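(* Let $1\le p\le\infty$, and let $w=\exp(-Q)$ be a weight in the class $\mathcal{F}(C^2+)$ such that, for some constant $c>0$, $T(a_n)\le c\,(n/a_n)^{2/3}$ for all $n\in\mathbb{N}$. Then there exists a constant $C=C(w,p)>0$ such that for every $n\in\mathbb{N}$ and every $f$ with $wf\in L^p(\mathbb{R})$, $$\left\|(f-v_n(f))\frac{w}{T^{1/4}}\right\|_{L^p(\mathbb{R})}\le C\,E_{p,n}(w,f),$$ $$\|(f-v_n(f))w\|_{L^p(\mathbb{R})}\le C\,T^{1/4}(a_n)\,E_{p,n}(w,f),$$ and, when $T^{1/4}wf\in L^p(\mathbb{R})$, $$\|(f-v_n(f))w\|_{L^p(\mathbb{R})}\le C\,E_{p,n}(T^{1/4}w,f).$$ Moreover, if $f$ is absolutely continuous and $f'w\in L^p(\mathbb{R})$, then $$\left\|(f-v_n(f))\frac{w}{T^{1/4}}\right\|_{L^p(\mathbb{R})}\le C\,\frac{a_n}{n}\,\|f'w\|_{L^p(\mathbb{R})}.$$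
   Context: Class $\mathcal{F}(C^2+)$: an exponential weight $w(x)=\exp(-Q(x))$ on $\mathbb{R}$ belongs to $\mathcal{F}(C^2+)$ when $Q:\mathbb{R}\to[0,\infty)$ is continuous and even and: (a) $Q'$ is continuous on $\mathbb{R}$ and $Q(0)=0$; (b) $Q''$ exists and is positive on $\mathbb{R}\setminus\{0\}$; (c) $\lim_{x\to\infty}Q(x)=\infty$; (d) the function $T(x):=xQ'(x)/Q(x)$, $x\ne0$, is quasi-increasing on $(0,\infty)$ (there is $C>0$ with $T(x)\le CT(y)$ whenever $0<x<y$), and there is $\Lambda\in\mathbb{R}$ with $T(x)\ge\Lambda>1$ for all $x\in\mathbb{R}\setminus\{0\}$; (e) there is $C>0$ with $\frac{Q''(x)}{|Q'(x)|}\le C\frac{|Q'(x)|}{Q(x)}$ for a.e. $x\in\mathbb{R}$, and there are a compact interval $J\ni0$ and $C>0$ with $\frac{Q''(x)}{|Q'(x)|}\ge C\frac{|Q'(x)|}{Q(x)}$ for a.e. $x\in\mathbb{R}\setminus J$. $\mathbb{N}=\{1,2,\dots\}$. The Mhaskar-Rakhmanov-Saff number $a_n>0$ of $w$ is defined by $n=\frac{2}{\pi}\int_0^1\frac{a_nu\,Q'(a_nu)}{(1-u^2)^{1/2}}\,du$, $n\in\mathbb{N}$. $\{p_k\}_{k\ge0}$ are the orthonormal polynomials for $w^2$: $p_k$ has degree $k$ and $\int_{\mathbb{R}}p_k(x)p_m(x)w^2(x)\,dx=\delta_{km}$. For $f$ with $fw\in L^p(\mathbb{R})$, put $c_k(f)=\int_{\mathbb{R}}f(t)p_k(t)w^2(t)\,dt$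 and $s_n(f)(x)=\sum_{k=0}^{n-1}c_k(f)p_k(x)$. The de la Vallée Poussin mean is $v_n(f)(x)=\frac1n\sum_{j=n+1}^{2n}s_j(f)(x)$. $\mathcal{P}_n$ is the set of polynomials of degree at most $n$. For a weight function $u$ ($u=w$ or $u=T^{1/4}w$) and $uf\in L^p(\mathbb{R})$, $E_{p,n}(u,f):=\inf_{P\in\mathcal{P}_n}\|u(f-P)\|_{L^p(\mathbb{R})}$. $T^{1/4}(a_n)$ means $(T(a_n))^{1/4}$. *)

(* Defs.v *)
From HB Require Import structures.
From mathcomp Require Import all_boot all_order all_algebra.
From mathcomp Require Import all_classical all_reals all_analysis.

Set Implicit Arguments.
Unset Strict Implicit.
Unset Printing Implicit Defensive.

Import Order.TTheory GRing.Theory Num.Theory.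
Import numFieldNormedType.Exports.

Local Open Scope classical_set_scope.
Local Open Scope ring_scope.

Section Weights.
Context {R : realType}.
Local Notation mu := (@lebesgue_measure R).
Implicit Types (Q u f : R -> R) (p : \bar R).

Definition weight Q : R -> R := fun x => expR (- Q x).

(* T is only meaningful off 0; the library's division gives T(0) = 0.  Every
   norm below is taken with respect to Lebesgue measure, so this value is
   irrelevant. *)
Definition growthT Q : R -> R := fun x => x * derive1 Q x / Q x.

Definition growthT4 Q : R -> R := fun x => growthT Q x `^ (1 / 4).

Definition quasi_increasing_pos (g : R -> R) : Prop :=
  exists2 C : R, 0 < C & forall x y, 0 < x -> x < y -> g x <= C * g y.

(* exp(-Q) belongs to F(C^2+) *)
Record classFC2plus Q : Prop := {
  FC2_ge0 : forall x, 0 <= Q x ;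
  FC2_continuous : continuous Q ;
  FC2_even : forall x, Q (- x) = Q x ;
  FC2_derivable : forall x : R, derivable Q x 1 ;
  FC2_C1 : continuous (derive1 Q) ;
  FC2_at0 : Q 0 = 0 ;
  FC2_derivable2 : forall x : R, x != 0 -> derivable (derive1 Q) x 1 ;
  FC2_convex : forall x : R, x != 0 -> 0 < derive1 (derive1 Q) x ;
  FC2_infty : Q x @[x --> +oo] --> +oo ;
  FC2_quasi : quasi_increasing_pos (growthT Q) ;
  FC2_Lambda : exists2 L : R, 1 < L & forall x : R, x != 0 -> L <= growthT Q x ;
  FC2_upper : exists2 C : R, 0 < C &
    {ae mu, forall x : R,
       derive1 (derive1 Q) x / `|derive1 Q x| <= C * (`|derive1 Q x| / Q x)} ;
  FC2_lower : exists a b C : R, [/\ a <= 0, 0 <= b, 0 < C &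
    {ae mu, forall x, ~ `[a, b]%classic x ->
       C * (`|derive1 Q x| / Q x) <= derive1 (derive1 Q) x / `|derive1 Q x|}]
}.

(* a is the Mhaskar-Rakhmanov-Saff number a_n of exp(-Q) *)
Definition is_MRS Q (n : nat) (a : R) : Prop :=
  0 < a /\
  n%:R = 2 / pi * \int[mu]_(u in `[0, 1])
                    (a * u * derive1 Q (a * u) / Num.sqrt (1 - u ^+ 2)).

(* The degree condition determines each P k up to sign; the partial sums
   below do not depend on these signs. *)
Definition orthonormal_polys (w : R -> R) (P : nat -> {poly R}) : Prop :=
  (forall k, size (P k) = k.+1) /\
  (forall k m, \int[mu]_x ((P k).[x] * (P m).[x] * w x ^+ 2) = (k == m)%:R).

Definition fourier_coef (w : R -> R) (P : nat -> {poly R}) f (k : nat) : R :=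
  \int[mu]_x (f x * (P k).[x] * w x ^+ 2).

Definition fourier_sum (w : R -> R) (P : nat -> {poly R}) f (n : nat) :
    {poly R} :=
  \sum_(0 <= k < n) fourier_coef w P f k *: P k.

Definition vallee_poussin (w : R -> R) (P : nat -> {poly R}) f (n : nat) :
    {poly R} :=
  n%:R^-1 *: \sum_(n.+1 <= j < n.*2.+1) fourier_sum w P f j.

Definition memLp p f : Prop := (f : measurableTypeR R -> R) \in Lfun mu p.

Definition normLp p f : \bar R := ('N[mu]_p [EFin \o f])%E.

(* size P <= n + 1 means deg P <= n *)
Definition best_approx p (n : nat) u f : \bar R :=
  ereal_inf [set normLp p (fun x => u x * (f x - P.[x]))
            | P in [set P : {poly R} | (size P <= n.+1)%N]].

(* Absolute continuity on every compact interval: the usual meaning for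
   functions on the whole line. *)
Definition abs_continuous f : Prop :=
  forall a b e : R, a < b -> 0 < e -> exists2 d : R, 0 < d &
    forall (m : nat) (s t : 'I_m -> R),
      (forall i, [/\ a <= s i, s i <= t i & t i <= b]) ->
      trivIset setT (fun i => `]s i, t i[%classic) ->
      \sum_(i < m) (t i - s i) < d ->
      \sum_(i < m) `|f (t i) - f (s i)| < e.

End Weights.

(* Main.v *)
(* The operator v_n is integration against the kernel
     V(x, t) = n^-1 * sum_(n < j <= 2 n) sum_(k < j) p_k(x) p_k(t),
   it reproduces polynomials of degree n, and the first three estimates follow
   from Schur's test once the weighted L^1 norms of V in either variable are
   bounded.  These reduce to an L^2 bound: (x - t) V(x, t) telescopes by the
   three-term recurrence, whose coefficients are O(a_n), so with h = a_n / n the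
   integral of V^2 w^2 (1 + ((x - t) / h)^2) is controlled by the Christoffel
   kernel K_(2n)(x, x), and the inequality of arithmetic and geometric means does
   the rest.

   The Christoffel kernel is bounded by
     w(x)^2 K_n(x, x) <= C (n / a_n) sqrt(T(min(|x|, a_n)))
   through explicit polynomials imitating w(t) / w(x), built from iterates of
   the logistic map y |-> 4 y (1 - y), and the unweighted Nikolskii inequality.
   The growth hypothesis on T(a_n) enters where the points t with T(t) much
   smaller than T(x) have to stay at a distance from x.

   The last estimate is the first one combined with a Favard inequality, for
   which a polynomial r_x of degree n is constructed such that the step function
   at x satisfies |1_(x <= t) - r_x(t)| w(t) <= C w(x) / (1 + ((t - x) / h)^2);
   integrating it against f' and applying Schur's test again gives the claim. *)

Require Import Defs.
From HB Require Import structures.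
From mathcomp Require Import all_boot all_order all_algebra.
From mathcomp Require Import all_classical all_reals all_analysis.
From mathcomp Require Import measurable_realfun ess_sup_inf.
From mathcomp Require Import ring lra zify.

Set Implicit Arguments.
Unset Strict Implicit.
Unset Printing Implicit Defensive.

Import Order.TTheory GRing.Theory Num.Theory.
Import numFieldNormedType.Exports.

Local Open Scope classical_set_scope.
Local Open Scope ring_scope.

(** * Monotonicity from the sign of the derivative almost everywhere *)

(** Condition (e) bounds [Q''] only almost everywhere, and [Q''] need not be continuous. It is
    therefore first turned into a pointwise statement free of second derivatives: [Q' / Q^K] is
    nonincreasing on the positive half-line. Together with convexity this supplies every
    second-order Taylor bound. Potential theory is avoided. From the integral defining [a_n] only
    one fact is kept: [Q sqrt T] at [a_n] is comparable with [n]. The obstacle in the Christoffel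
    bound is uniformity up to [a_n]. Far inside, [x] can be the centre of an interval and no power
    of [T] is lost; towards [a_n] the weight changes on the scale [x / T x], so the interval must
    end just beyond [x], which costs [sqrt T]. The power 1/4 is the square root of this loss: the
    [L^2] mass of the kernel is of order [(n / a_n) sqrt tau], and balancing it against a Cauchy
    kernel of width [a_n / n] gives [tau^(1/4)]. With the weight [T^(-1/4)] on the variable of
    integration the loss disappears, provided that a small [T t] forces [t] away from [x]. *)

Section GoldowskyTonelli.
Context {R : realType}.
Local Notation mu := (@lebesgue_measure R).

Lemma null_set_covers (A : set R) (e : R) : measurable A -> mu A = 0%E -> 0 < e ->
  exists U : nat -> set R, [/\ forall k, open (U k), forall k, A `<=` U k &
    (\sum_(0 <= k <oo) mu (U k) <= e%:E)%E].
Proof.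
move=> mA A0 e0.
have H k : exists U : set R, [/\ open U, A `<=` U &
    (mu U <= (e / (2 ^ k.+1)%:R)%:E)%E].
  have [||U [oU AU mU]] := @lebesgue_regularity_outer R A (e / (2 ^ k.+1)%:R) mA.
  - by rewrite [X in (X < _)%E](_ : _ = 0%E).
  - by rewrite divr_gt0// ltr0n expn_gt0.
  exists U; split => //.
  have mUA : measurable (U `\` A) by apply: measurableD => //; exact: open_measurable.
  rewrite -(setDUK AU) measureU//; last by rewrite setDE setICA setICr setI0.
  apply: le_trans (ltW mU); rewrite -[leRHS]add0e; apply: leeD => //.
  by rewrite [leLHS](_ : _ = 0%E).
have [U HU] := choice H.
exists U; split=> [k|k|]; [by case: (HU k)|by case: (HU k)|].
have := @epsilon_trick R (fun=> 0%E) e xpredT (fun=> lexx _) (ltW e0).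
rewrite (eseries0 (fun _ _ _ => erefl)) add0e; apply: le_trans.
by apply: lee_nneseries => // k _; rewrite add0e; have [] := HU k.
Qed.

(* The increments of [cover_len U a] dominate [N] times the length of any
   interval contained in [N] of the sets, which beats every finite derivative. *)
Definition cover_len (U : nat -> set R) (a x : R) : R :=
  fine (\sum_(0 <= k <oo) mu (U k `&` `]a, x]))%E.

Section cover_len.
Variables (U : nat -> set R) (e a : R).
Hypothesis oU : forall k, open (U k).
Hypothesis Ue : (\sum_(0 <= k <oo) mu (U k) <= e%:E)%E.

Let mUI k (B : set R) : measurable B -> measurable (U k `&` B).
Proof. by move=> mB; apply: measurableI => //; exact: open_measurable. Qed.

Let series_le (B : set R) : measurable B ->
  (\sum_(0 <= k <oo) mu (U k `&` B) <= e%:E)%E.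
Proof.
move=> mB; apply: le_trans Ue; apply: lee_nneseries => // k _.
by apply: le_measure; rewrite ?inE//; [exact: mUI|exact: open_measurable].
Qed.

Let series_fin (B : set R) : measurable B ->
  (\sum_(0 <= k <oo) mu (U k `&` B))%E \is a fin_num.
Proof.
move=> mB; rewrite ge0_fin_numE; last exact: nneseries_ge0.
by rewrite (le_lt_trans (series_le mB))// ltry.
Qed.

Lemma cover_len_le x : cover_len U a x <= e.
Proof. by rewrite -lee_fin fineK ?series_le// series_fin. Qed.

Lemma cover_len_incr (N : nat) x y : a <= x -> x <= y ->
  (forall k, (k < N)%N -> `]x, y] `<=` U k) ->
  cover_len U a x + N%:R * (y - x) <= cover_len U a y.
Proof.
move=> ax xy HN; rewrite -lee_fin EFinD /cover_len !fineK ?series_fin//.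
have -> : (\sum_(0 <= k <oo) mu (U k `&` `]a, y]) =
    \sum_(0 <= k <oo) mu (U k `&` `]a, x]) + \sum_(0 <= k <oo) mu (U k `&` `]x, y]))%E.
  rewrite -nneseriesD//; apply: eq_eseriesr => k _.
  rewrite -measureU//; [|exact: mUI|exact: mUI|].
    congr (mu _); rewrite -setIUr; congr (_ `&` _).
    by rewrite -itv_bndbnd_setU// bnd_simp.
  apply/seteqP; split=> z //= -[[_ +] [_ +]].
  by rewrite !in_itv/= => /andP[_ zx] /andP[]; rewrite ltNge zx.
apply: leeD => //.
apply: le_trans (nneseries_lim_ge N _) => //.
rewrite (@eq_big_nat _ _ _ _ _ _ (fun=> (y - x)%:E)); last first.
  move=> k /andP[_ kN]; rewrite (_ : U k `&` _ = `]x, y]%classic).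
    rewrite lebesgue_measure_itv/= lte_fin; case: ltP => //.
    by move=> yx; rewrite (_ : y = x) ?subrr//; apply/eqP; rewrite eq_le yx xy.
  by apply/seteqP; split=> [z []//|z zxy]; split=> //; exact: HN zxy.
by rewrite big_const_nat subn0 iter_addr addr0 mulr_natl EFin_natmul.
Qed.

End cover_len.

(** Goldowsky-Tonelli. If [f b < f a], add to [f] small multiples of [x - a] and of [cover_len], and
    take the last point [c] where the sum [phi] is at least [phi a]. To the right of [c] the sum
    drops, so the derivative of [f] at [c] is at most [-e] when [c] is not exceptional, and at most
    [-e (1 + N)] for every [N] when it is. Both are impossible. *)
Lemma ae_ge0_derive1_le (f : R -> R) (a b : R) : a <= b ->
  (forall x, a <= x <= b -> derivable f x 1) ->
  {ae mu, forall x, a <= x <= b -> 0 <= f^`()%classic x} -> f a <= f b.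
Proof.
rewrite le_eqVlt => /predU1P[->//|ab] df [A [mA A0 HA]].
have H0 x : a <= x <= b -> ~ A x -> 0 <= f^`()%classic x.
  by move=> xab nAx; apply: contrapT => Hx; apply/nAx/HA => /= /(_ xab).
rewrite leNgt; apply/negP => fba.
pose d := f a - f b; have d0 : 0 < d by rewrite subr_gt0.
have [U [oU AU Ud]] := @null_set_covers A 1 mA A0 ltr01.
(* As [cover_len] is at most 1, both perturbations together stay below [d / 2] at [b]. *)
pose e := d / (2 * (b - a + 1)).
have ba1 : 0 < b - a + 1 by rewrite addr_gt0// subr_gt0.
have e0 : 0 < e by rewrite divr_gt0// mulr_gt0.
pose s := cover_len U a.
pose phi x := f x + e * (x - a) + e * s x.
have sa : s a = 0.
  rewrite /s /cover_len eseries0// => k _ _.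
  by rewrite set_itvE setI0 measure0.
have phib : phi b < phi a.
  rewrite /phi subrr mulr0 sa mulr0 !addr0.
  have := cover_len_le a oU Ud b; rewrite -/(s b) => sb.
  have : e * s b <= e * 1 by rewrite ler_pM2l.
  have : e * (b - a) + e * 1 = d / 2 by rewrite /e; field; rewrite gt_eqF.
  by move: d0; rewrite /d; lra.
pose E := [set x | a <= x <= b /\ phi a <= phi x].
have Ea : E a by split; rewrite ?lexx ?(ltW ab).
have supE : has_sup E by split; [exists a|exists b => x [/andP[]]].
pose c := sup E.
have cb : c <= b by apply: sup_le_ub; [exists a|move=> x [/andP[]]].
have ac : a <= c by apply: ub_le_sup Ea; case: supE.
have cab : a <= c <= b by rewrite ac cb.
have fc : {for c, continuous f}.
  by apply: differentiable_continuous; apply/derivable1_diffP; exact: df.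
have smono x y : a <= x -> x <= y -> s x <= s y.
  move=> ax xy; have := @cover_len_incr U 1 a oU Ud 0 x y ax xy.
  by rewrite mul0r addr0; apply.
(* [cover_len] may jump, but it is nondecreasing, so approaching [c] from the left only continuity
   of [f] is needed. *)
have phic : phi a <= phi c.
  rewrite leNgt; apply/negP => hc.
  pose g := phi a - phi c; have g0 : 0 < g by rewrite subr_gt0.
  have /cvgrPdist_lt/(_ (g / 2)) := fc; rewrite divr_gt0// => /(_ isT).
  move=> /nbhs_ballP[r /= r0 Hr].
  have [x Ex xc] := sup_adherent (r0 : 0 < r) supE; rewrite -/c in xc.
  have [/andP[ax xb] px] := Ex.
  have xlc : x <= c by apply: ub_le_sup Ex; case: supE.
  have /= := Hr x; rewrite /ball/= ger0_norm ?subr_ge0//.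
  have -> : c - x < r by move: xc; clear; lra.
  move=> /(_ isT) /ltr_normlP[h1 h2].
  have := smono _ _ ax xlc; rewrite -(ler_pM2l e0) => h3.
  have : e * (x - a) <= e * (c - a) by rewrite ler_pM2l// lerB.
  by move: px hc g0 h1 h2 h3; rewrite /g /phi; clear; lra.
have cltb : c < b.
  by rewrite lt_neqAle cb andbT; apply/eqP => cbE; move: phib; rewrite -cbE ltNge phic.
have after x : c < x -> x <= b -> phi x < phi c.
  move=> cx xb; rewrite ltNge; apply/negP => h.
  have Ex : E x by split; [rewrite xb (le_trans ac (ltW cx))|exact: le_trans h].
  have : x <= c by apply: ub_le_sup Ex; case: supE.
  by rewrite leNgt cx.
have slope (N : nat) : (exists2 r, 0 < r & forall x, c < x -> x < c + r ->
    N%:R * (x - c) <= s x - s c) -> f^`()%classic c <= - e * (1 + N%:R).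
  move=> [r r0 Hr]; rewrite leNgt; apply/negP => h.
  have dfc := df _ cab.
  pose g := f^`()%classic c + e * (1 + N%:R).
  have g0 : 0 < g by move: h; rewrite /g; lra.
  have /cvgrPdist_lt/(_ g g0) : h^-1 *: (f (h *: 1 + c) - f c) @[h --> 0^'] --> f^`()%classic c.
    by rewrite derive1E; exact: dfc.
  move=> /nbhs_ballP[r2 /= r20 H2].
  pose h1 := Num.min (Num.min (r / 2) (r2 / 2)) (b - c).
  have h10 : 0 < h1 by rewrite !lt_min !divr_gt0//= subr_gt0.
  have h1r : h1 <= r / 2 by rewrite /h1 !ge_min lexx.
  have h1r2 : h1 <= r2 / 2 by rewrite /h1 !ge_min lexx orbT.
  have h1b : h1 <= b - c by rewrite /h1 !ge_min lexx !orbT.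
  have := H2 h1; rewrite /ball/= sub0r normrN gtr0_norm// gt_eqF//.
  have -> : h1 < r2 by move: h1r2 r20; clear; lra.
  move=> /(_ isT isT) /ltr_normlP[_ hh].
  have ph : phi (h1 + c) < phi c by apply: after; move: h10 h1b; clear; lra.
  have sh : N%:R * h1 <= s (h1 + c) - s c.
    by have := Hr (h1 + c); rewrite addrK; apply; move: h10 h1r r0; clear; lra.
  have : (f (h1 + c) - f c) < h1 * (- e * (1 + N%:R)).
    rewrite -(ler_pM2l e0) in sh.
    by move: ph sh; rewrite /phi; clear; lra.
  rewrite -ltr_pdivrMl//.
  by move: hh; rewrite /g scaler1 /GRing.scale/=; clear; lra.
have [Ac|nAc] := pselect (A c); last first.
  have := slope 0; rewrite addr0 mulr1 => /(_ _)/le_lt_trans -/(_ 0).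
  have : 0 <= f^`()%classic c by exact: H0.
  rewrite leNgt => /negP h /(_ _ _)/h; apply; last by rewrite oppr_lt0.
  by exists 1 => // x cx _; rewrite mul0r subr_ge0 smono// ltW.
have {}slope N : f^`()%classic c <= - e * (1 + N%:R).
  apply: slope.
  have : \forall x \near c, forall k, (k < N)%N -> U k x.
    elim: N => [|N ih]; first by near=> x => k; rewrite ltn0.
    near=> x => k; rewrite ltnS leq_eqVlt => /orP[/eqP ->|kN].
      by near: x; apply: open_nbhs_nbhs; split; [exact: oU|exact: AU].
    by have /(_ k kN) : forall k, (k < N)%N -> U k x by near: x.
  move=> /nbhs_ballP[r /= r0 Hr]; exists r => // x cx xcr.
  have := @cover_len_incr U 1 a oU Ud N c x ac (ltW cx); rewrite -/s lerBrDl; apply.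
  move=> k kN z /=; rewrite in_itv/= => /andP[cz zx]; apply: Hr => //.
  by rewrite /ball/= ltr0_norm ?subr_lt0//; lra.
pose M := - f^`()%classic c / e.
have := slope (Num.bound M); apply/negP; rewrite -ltNge.
have := archi_boundP (_ : 0 <= M).
have M1 : 1 <= M.
  rewrite ler_pdivlMr// mul1r; have := slope 0; rewrite addr0 mulr1; lra.
move=> /(_ (le_trans ler01 M1)); rewrite {1}/M ltr_pdivrMr//.
have := e0; lra.
Unshelve. all: by end_near. Qed.

End GoldowskyTonelli.

(** * Regularity of the exponent *)

Section Regular.
Context {R : realType}.
Implicit Types (Q : R -> R) (x y t d r : R).

(* What is used of the class: with [q = Q'] and [T = x q / Q], the exponent [K]
   comes from the upper bound on [Q''], [A] from quasi-monotonicity, and [l] is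
   [Lambda - 1]. *)
Record regular Q (K : nat) (A l : R) : Prop := {
  reg_der : forall x, is_derive x 1 Q (derive1 Q x) ;
  reg_cont : continuous (derive1 Q) ;
  reg_even : forall x, Q (- x) = Q x ;
  reg_0 : Q 0 = 0 ;
  reg_gt0 : forall x, 0 < x -> 0 < Q x ;
  reg_dgt0 : forall x, 0 < x -> 0 < derive1 Q x ;
  reg_homo : forall x y, x <= y -> derive1 Q x <= derive1 Q y ;
  reg_K : (0 < K)%N ;
  reg_pow : forall x y, 0 < x -> x <= y ->
    derive1 Q y * Q x ^+ K <= derive1 Q x * Q y ^+ K ;
  reg_A : 1 <= A ;
  reg_quasi : forall x y, 0 < x -> x <= y -> growthT Q x <= A * growthT Q y ;
  reg_l : 0 < l ;
  reg_L : forall x, 0 < x -> (1 + l) * Q x <= x * derive1 Q x }.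

(** Off a null set the upper bound in (e) reads [Q'' Q <= C Q'^2]. For an integer [K >= C] this is
    the sign of the derivative of [Q' / Q^K], which exists at every positive point, so the almost
    everywhere criterion gives monotonicity. *)
Lemma regularP Q : classFC2plus Q -> exists K A l, regular Q K A l.
Proof.
move=> hQ; have [L L1 HL] := FC2_Lambda hQ; have [C C0 HC] := FC2_upper hQ.
have [A0 A00 HA] := FC2_quasi hQ.
pose q : R -> R := derive1 Q.
have dQ x : is_derive x 1 Q (q x).
  by rewrite /q derive1E; apply: derivableP; exact: FC2_derivable hQ x.
have Qneq0 x : 0 < x -> Q x != 0.
  move=> x0; apply/negP => /eqP Q0; have := HL x (lt0r_neq0 x0).
  by rewrite /growthT Q0 invr0 mulr0 leNgt (lt_trans ltr01 L1).
have Qp x : 0 < x -> 0 < Q x.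
  by move=> x0; rewrite lt0r Qneq0//; exact: FC2_ge0 hQ x.
have HL' x : 0 < x -> L * Q x <= x * q x.
  by move=> x0; rewrite -ler_pdivlMr ?Qp//; exact: HL (lt0r_neq0 x0).
have qp x : 0 < x -> 0 < q x.
  move=> x0; rewrite -(pmulr_rgt0 _ x0); apply: lt_le_trans (HL' x x0).
  by rewrite mulr_gt0 ?Qp// (lt_trans ltr01 L1).
have cq : continuous q := FC2_C1 hQ.
have dq x : x != 0 -> is_derive x 1 q (derive1 q x).
  by move=> x0; rewrite derive1E; apply: derivableP; exact: FC2_derivable2 hQ x x0.
have mono x y : (0 <= x \/ y <= 0) -> x <= y -> q x <= q y.
  rewrite [x <= y]le_eqVlt => h /predU1P[->//|xy].
  have [||c] := @MVT R q (derive1 q) x y xy.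
  - move=> z; rewrite in_itv/= => /andP[xz zy]; apply: dq.
    by case: h => h; [rewrite gt_eqF// (le_lt_trans h)|rewrite lt_eqF// (lt_le_trans zy)].
  - exact/continuous_subspaceT.
  rewrite in_itv/= => /andP[xc cy] E; rewrite -subr_ge0 E mulr_ge0// ?subr_ge0 ltW//.
  apply: (FC2_convex hQ).
  by case: h => h; [rewrite gt_eqF// (le_lt_trans h)|rewrite lt_eqF// (lt_le_trans cy)].
pose K := (Num.bound C).+1.
have CK : C <= K%:R.
  by rewrite ltW// (lt_trans (archi_boundP (ltW C0)))// ltr_nat.
exists K, (Num.max 1 A0), (L - 1).
split => //=.
- exact: FC2_even hQ.
- exact: FC2_at0 hQ.
- move=> x y xy; have [x0|x0] := leP 0 x; first by apply: mono => //; left.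
  have [y0|y0] := leP y 0; first by apply: mono => //; right.
  apply: (le_trans (mono x 0 _ _)) => //; [by right|exact: ltW|].
  by apply: mono; [left|exact: ltW].
- move=> x y x0 xy.
  pose f (z : R) : R := - (q z / Q z ^+ K).
  have Hf (z : R) : 0 < z -> is_derive z 1 f
     (- (derive1 q z * (Q z ^+ K)^-1 + q z * (- (K%:R * Q z ^+ K.-1 * q z) / (Q z ^+ K) ^+ 2))).
    move=> z0; have dz := dq z (lt0r_neq0 z0); have dQz := dQ z.
    have QK0 : Q z ^+ K != 0 by rewrite expf_neq0// Qneq0.
    have dX : is_derive z 1 (fun u => Q u ^+ K) (K%:R * Q z ^+ K.-1 * q z).
      rewrite (_ : (fun u => Q u ^+ K) = Q ^+ K); last by apply/funext=> u; rewrite fctE.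
      exact: is_deriveX.
    have dV : is_derive z 1 (fun u => (Q u ^+ K)^-1) (- (K%:R * Q z ^+ K.-1 * q z) / (Q z ^+ K) ^+ 2).
      have := @is_deriveV R (fun u => Q u ^+ K) z _ _ QK0 dX.
      by move=> H; apply: (is_derive_eq H); rewrite /GRing.scale/= !mulNr mulrC.
    rewrite /f; apply: is_derive_eq.
    by rewrite /GRing.scale/=; congr (- _); rewrite addrC; congr (_ + _); rewrite mulrC.
  have fxy : f x <= f y.
    apply: ae_ge0_derive1_le xy _ _.
      by move=> z /andP[xz _]; have [] := Hf z (lt_le_trans x0 xz).
    case: HC => N [mN N0 HN]; exists N; split=> // z /= nz; apply: HN => /= Hz.
    apply: nz => /andP[xz zy].
    have z0 := lt_le_trans x0 xz; have Hfz := Hf z z0.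
    rewrite derive1E derive_val oppr_ge0.
    have qz := qp z z0; have Qz := Qp z z0.
    have : derive1 q z * Q z <= K%:R * q z ^+ 2.
      move: Hz; rewrite -/q gtr0_norm// ler_pdivrMr//.
      rewrite (_ : C * (q z / Q z) * q z = C * q z ^+ 2 / Q z); last by rewrite expr2 !mulrA [RHS]mulrAC.
      rewrite ler_pdivlMr// => /le_trans; apply.
      by rewrite ler_pM2r// exprn_gt0.
    have -> : derive1 q z / Q z ^+ K +
       q z * (- (K%:R * Q z ^+ K.-1 * q z) / (Q z ^+ K) ^+ 2) =
       (derive1 q z * Q z - K%:R * q z ^+ 2) / Q z ^+ K.+1.
      rewrite /K /= !exprS; field.
      by rewrite expf_neq0 gt_eqF.
    move=> h; rewrite pmulr_lle0 ?subr_le0// invr_gt0 exprn_gt0//.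
  move: fxy; rewrite /f lerN2 ler_pdivrMr ?exprn_gt0 ?Qp ?(lt_le_trans x0)//.
  by rewrite mulrAC ler_pdivlMr// exprn_gt0// Qp.
- by rewrite le_max lexx.
- move=> x y x0; rewrite le_eqVlt => /predU1P[<-|xy].
    rewrite ler_peMl ?le_max ?lexx//.
    by rewrite /growthT divr_ge0 ?mulr_ge0// ltW// ?qp// Qp.
  apply: (le_trans (HA x y x0 xy)); rewrite ler_wpM2r ?le_max ?lexx ?orbT//.
  have y0 := lt_trans x0 xy.
  by rewrite /growthT divr_ge0 ?mulr_ge0// ltW// ?qp// Qp.
- by rewrite subr_gt0.
- by move=> x x0; rewrite addrC subrK; exact: HL'.
Qed.

End Regular.

(** * Doubling and second-order Taylor estimates for the exponent *)

Section Growth.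
Context {R : realType} (Q : R -> R) (K : nat) (A l : R).
Hypothesis hQ : regular Q K A l.
Local Notation q := (derive1 Q : R -> R).
Local Notation T := (growthT Q).
Implicit Types (x y t d r : R).

Lemma growthTE x : 0 < x -> T x * Q x = x * q x.
Proof. by move=> x0; rewrite /growthT divfK// gt_eqF// (reg_gt0 hQ). Qed.

Lemma cont_Q : continuous Q.
Proof.
move=> x; apply: differentiable_continuous; apply/derivable1_diffP.
by have [] := reg_der hQ x.
Qed.

Lemma tangent_le x t : Q x + q x * (t - x) <= Q t.
Proof.
have [tx|xt|->] := ltgtP t x; last by rewrite subrr mulr0 addr0.
- have [||c] := @MVT R Q q t x tx.
  + by move=> z _; exact: reg_der hQ z.
  + by apply: continuous_subspaceT; exact: cont_Q.
  rewrite in_itv/= => /andP[tc cx] E.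
  have : q c * (x - t) <= q x * (x - t).
    by rewrite ler_wpM2r ?subr_ge0 ?(ltW tx)// (reg_homo hQ)// ltW.
  by move: E; clear -hQ; lra.
- have [||c] := @MVT R Q q x t xt.
  + by move=> z _; exact: reg_der hQ z.
  + by apply: continuous_subspaceT; exact: cont_Q.
  rewrite in_itv/= => /andP[xc ct] E.
  have : q x * (t - x) <= q c * (t - x).
    by rewrite ler_wpM2r ?subr_ge0 ?(ltW xt)// (reg_homo hQ)// ltW.
  by move: E; clear -hQ; lra.
Qed.

Lemma incr_le x t : Q t - Q x <= q t * (t - x).
Proof. by have := tangent_le t x; lra. Qed.

Lemma dQ0 : q 0 = 0.
Proof.
have H : is_derive (0 : R) 1 Q 0.
  apply: (@derive1_at_min R Q (-1) 1).
  - by rewrite (@le_trans _ _ 0)// oppr_le0.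
  - by move=> t _; have [] := reg_der hQ t.
  - by rewrite in_itv/= ltr01 andbT oppr_lt0.
  - move=> t _; rewrite (reg_0 hQ); have [t0|t0|->] := ltgtP t 0; last by rewrite (reg_0 hQ).
      by rewrite -(reg_even hQ) ltW// (reg_gt0 hQ)// oppr_gt0.
    by rewrite ltW// (reg_gt0 hQ).
by rewrite derive1E derive_val.
Qed.

Lemma dQ_ge0 x : 0 <= x -> 0 <= q x.
Proof. by rewrite -{2}dQ0; exact: reg_homo hQ _ _. Qed.

Lemma Q_ge0 x : 0 <= Q x.
Proof. by have := tangent_le 0 x; rewrite dQ0 (reg_0 hQ) mul0r addr0. Qed.

Lemma Q_homo x y : 0 <= x -> x <= y -> Q x <= Q y.
Proof.
move=> x0 xy; apply: le_trans (tangent_le x y).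
by rewrite lerDl mulr_ge0// ?subr_ge0// dQ_ge0.
Qed.

Lemma Q_norm x : Q `|x| = Q x.
Proof. by case: (ler0P x) => // _; rewrite (reg_even hQ). Qed.

Lemma Q_homo_norm x y : `|x| <= y -> Q x <= Q y.
Proof. by move=> h; rewrite -Q_norm Q_homo. Qed.

Lemma T_ge1 x : 0 < x -> 1 <= T x.
Proof.
move=> x0; rewrite /growthT ler_pdivlMr ?(reg_gt0 hQ)// mul1r.
apply: le_trans (reg_L hQ x0); rewrite ler_peMl ?Q_ge0//.
by rewrite lerDl ltW// (reg_l hQ).
Qed.

Lemma Q_le_xdQ x : 0 <= x -> Q x <= x * q x.
Proof. by move=> x0; have := incr_le 0 x; rewrite (reg_0 hQ) !subr0 mulrC. Qed.

Lemma xdQ_le_Q2 x : 0 <= x -> x * q x <= Q (2 * x).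
Proof.
move=> x0; apply: le_trans (tangent_le x (2 * x)).
by have := Q_ge0 x; nra.
Qed.

(** Capping [l] at 4 keeps the value at least 1/2. Then [halving / 2] dominates 1/4, and the square
    of a dyadic ratio can be absorbed in powers of [halving / 2]. *)
Definition halving : R := (1 + Num.min l 4 / 4)^-1.

Lemma halvingP : 1 / 2 <= halving < 1.
Proof.
have l0 := reg_l hQ; have m0 : 0 < Num.min l 4 by rewrite lt_min l0/= ltr0n.
have m4 : Num.min l 4 <= 4 by rewrite ge_min lexx orbT.
rewrite /halving -[X in _ <= X < _]div1r ler_pdivlMr; last by move: m0; clear -hQ; lra.
rewrite ltr_pdivrMr; last by move: m0; clear -hQ; lra.
by move: m0 m4; set m := Num.min _ _; clear -hQ; lra.
Qed.

(** The derivative of [Q z / z] is at least [l Q z / z^2]; the mean value theorem on [[x/2, x]]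
    turns this into a gain over the factor 2 of a linear function. *)
Lemma Q_halve x : 0 < x -> Q (x / 2) <= halving / 2 * Q x.
Proof.
move=> x0; have x20 : 0 < x / 2 by rewrite divr_gt0.
have l0 := reg_l hQ; have m0 : 0 < Num.min l 4 by rewrite lt_min l0/= ltr0n.
have ml : Num.min l 4 <= l by rewrite ge_min lexx.
rewrite mulrAC ler_pdivlMr// /halving mulrC ler_pdivlMl; last by move: m0; clear -hQ; lra.
have xx : x / 2 < x by move: x0; clear -hQ; lra.
have [||c] := @MVT R (fun z => Q z / z) (fun z => (q z * z - Q z) / z ^+ 2) _ _ xx.
- move=> z; rewrite in_itv/= => /andP[xz _].
  have z0 : z != 0 by rewrite gt_eqF// (lt_trans x20).
  have dz := reg_der hQ z.
  have dV : is_derive z 1 (fun u : R => u^-1) (- z ^- 2).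
    have := @is_deriveV R id z 1 1 z0 (is_derive_id _ _).
    by move=> H; apply: (is_derive_eq H); rewrite /GRing.scale/= mulr1.
  apply: is_derive_eq; rewrite /GRing.scale/=; field.
  by rewrite z0.
- apply: continuous_in_subspaceT => z; rewrite inE/= in_itv/= => /andP[xz _].
  apply: cvgM; first exact: cont_Q.
  by apply: cvgV => //; rewrite gt_eqF// (lt_le_trans x20).
rewrite in_itv/= => /andP[xc cx] E.
have c0 : 0 < c := lt_trans x20 xc.
have Qc : Q (x / 2) <= Q c by rewrite Q_homo// ltW.
have Q2 := Q_ge0 (x / 2).
have h1 : (Num.min l 4 / 4) * (Q (x / 2) * 2) <= (q c * c - Q c) / c ^+ 2 * (x - x / 2) * x.
  have -> : (q c * c - Q c) / c ^+ 2 * (x - x / 2) * x =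
     (q c * c - Q c) * (x ^+ 2 / c ^+ 2) / 2 by field; rewrite gt_eqF.
  have h2 : l * Q c <= q c * c - Q c by have := reg_L hQ c0; rewrite mulrC; lra.
  have h3 : 1 <= x ^+ 2 / c ^+ 2.
    by rewrite ler_pdivlMr ?exprn_gt0// mul1r ler_pXn2r// ?nnegrE ltW.
  have h4 : Num.min l 4 * Q (x / 2) <= l * Q c by rewrite ler_pM// ltW.
  have h5 : l * Q c * 1 <= (q c * c - Q c) * (x ^+ 2 / c ^+ 2).
    by rewrite ler_pM// mulr_ge0 ?Q_ge0// ltW.
  by move: h4 h5; set a := x ^+ 2 / _; clear -hQ; lra.
rewrite -E in h1; move: h1.
have -> : (Q x / x - Q (x / 2) / (x / 2)) * x = Q x - Q (x / 2) * 2.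
  by field; rewrite gt_eqF.
by set m := Num.min _ _; clear -hQ; lra.
Qed.

Lemma Q_halve_iter j x : 0 < x -> Q (x / 2 ^+ j) <= (halving / 2) ^+ j * Q x.
Proof.
move=> x0; elim: j => [|j ih]; first by rewrite expr0 divr1 mul1r.
have /andP[h1 _] := halvingP.
rewrite exprSr invfM mulrA; apply: le_trans (Q_halve _) _; first by rewrite divr_gt0// exprn_gt0.
rewrite exprS -[leRHS]mulrA ler_wpM2l//; move: h1; clear -hQ; lra.
Qed.

(* [x / T x = Q x / q x] is the scale on which [Q], [q] and [T] are essentially
   constant. *)
Lemma down_scale x t : 0 < t -> t <= x -> 2 * ((x - t) * q x) <= Q x ->
  Q x <= 2 * Q t /\ q x <= 2 ^+ K * q t.
Proof.
move=> t0 tx h; have x0 := lt_le_trans t0 tx.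
have Qt : Q x <= 2 * Q t by have := tangent_le x t; move: h; clear -hQ; lra.
split=> //; have Qx := reg_gt0 hQ x0; have Qt0 := reg_gt0 hQ t0.
have := reg_pow hQ t0 tx; rewrite -ler_pdivlMr ?exprn_gt0//; move=> /le_trans; apply.
rewrite -mulrA -expr_div_n mulrC ler_wpM2r//; first exact: dQ_ge0 (ltW t0).
rewrite lerXn2r ?nnegrE ?divr_ge0 ?Q_ge0//.
by rewrite ler_pdivrMr.
Qed.

Lemma down_T x t : 0 < t -> t <= x -> 2 * ((x - t) * q x) <= Q x ->
  T x <= 2 ^+ K * 2 * T t.
Proof.
move=> t0 tx h; have x0 := lt_le_trans t0 tx; have [_ q2] := down_scale t0 tx h.
have Qx := reg_gt0 hQ x0; have Qt0 := reg_gt0 hQ t0.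
have x2t : x <= 2 * t.
  have : Q x <= x * q x by exact: Q_le_xdQ (ltW x0).
  have := reg_dgt0 hQ x0.
  by move: h; clear -x0 tx; nra.
rewrite /growthT ler_pdivrMr//.
apply: (@le_trans _ _ (2 * t * (2 ^+ K * q t))).
  by apply: ler_pM => //; [exact: ltW|exact: dQ_ge0 (ltW x0)].
rewrite (_ : 2 * t * _ = 2 ^+ K * 2 * (t * q t)); last by clear -hQ; ring.
rewrite -[leRHS]mulrA ler_wpM2l//.
rewrite mulrAC ler_pdivlMr// ler_wpM2l ?Q_homo// ?ltW//.
by rewrite mulr_gt0// (reg_dgt0 hQ).
Qed.

(** If [Q] more than doubled, it would equal [2 Q x] at some [z] of the interval. There
    [q z <= 2^K q x] by [reg_pow], so the increment [Q z - Q x] would be at most [Q x / 2] instead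
    of [Q x]. *)
Lemma up_scale x y : 0 < x -> x <= y -> 2 ^+ K.+1 * ((y - x) * q x) <= Q x ->
  Q y <= 2 * Q x /\ q y <= 2 ^+ K * q x.
Proof.
move=> x0 xy h; have Qx := reg_gt0 hQ x0; have qx := reg_dgt0 hQ x0.
have main z : x <= z -> Q z <= 2 * Q x -> q z <= 2 ^+ K * q x.
  move=> xz Qz; have z0 := lt_le_trans x0 xz.
  have := reg_pow hQ x0 xz; rewrite -ler_pdivlMr ?exprn_gt0//; move=> /le_trans; apply.
  rewrite -mulrA -expr_div_n mulrC ler_wpM2r//; first exact: ltW.
  rewrite lerXn2r ?nnegrE ?divr_ge0 ?Q_ge0//.
  by rewrite ler_pdivrMr.
have Qy : Q y <= 2 * Q x; last by split=> //; exact: main.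
rewrite leNgt; apply/negP => h2.
have [||z zxy Qz] := @IVT R Q x y (2 * Q x) xy.
- by apply: continuous_subspaceT; exact: cont_Q.
- have Qxy := Q_homo (ltW x0) xy; rewrite (min_idPl Qxy) (max_idPr Qxy) (ltW h2) andbT.
  by move: Qx; clear -hQ; lra.
move: zxy; rewrite in_itv/= => /andP[xz zy].
have := main z xz; rewrite Qz lexx => /(_ isT) qz.
have := incr_le x z; rewrite Qz.
have : q z * (z - x) <= 2 ^+ K * q x * (y - x).
  by apply: ler_pM => //; rewrite ?subr_ge0 ?dQ_ge0 ?lerB// (le_trans (ltW x0)).
by move: h Qx; rewrite exprS; set b := _ ^+ K; clear -hQ; nra.
Qed.


Lemma expr_sub1_le (u : R) n : 1 <= u -> u <= 2 -> u ^+ n - 1 <= n%:R * (u - 1) * 2 ^+ n.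
Proof.
move=> u1 u2; elim: n => [|n ih]; first by rewrite !expr0 subrr !mul0r.
have p2 : 1 <= (2 : R) ^+ n by rewrite exprn_ege1// ler1n.
have n0 : (0 : R) <= n%:R by rewrite ler0n.
have up : 0 <= u ^+ n - 1 by rewrite subr_ge0 exprn_ege1.
rewrite !exprS -natr1; move: ih p2 up n0; set a := u ^+ n; set b := 2 ^+ n.
move: (n%:R) => m ih p2 up n0.
have h1 : u * (a - 1) <= 2 * (m * (u - 1) * b) by rewrite ler_pM//; move: u1; clear -hQ; lra.
have h2 : (u - 1) * 1 <= (u - 1) * (2 * b).
  by rewrite ler_wpM2l//; move: u1 p2; clear -hQ; lra.
move: h1 h2; clear -hQ; nra.
Qed.

Lemma sub1_expr_le (u : R) n : 0 <= u -> u <= 1 -> 1 - u ^+ n <= n%:R * (1 - u).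
Proof.
move=> u0 u1; elim: n => [|n ih]; first by rewrite expr0 subrr mul0r.
have up : u ^+ n <= 1 by rewrite exprn_ile1.
rewrite exprS -natr1; move: ih up; set a := u ^+ n; move: (n%:R) => m ih up.
have : u * (1 - a) <= 1 * (1 - a) by rewrite ler_wpM2r// subr_ge0.
by move: ih; clear -hQ; lra.
Qed.

Definition curv : R := K%:R * 4 ^+ K.

Lemma curv_ge1 : 1 <= curv.
Proof.
have K1 : 1 <= (K%:R : R) by rewrite ler1n (reg_K hQ).
by apply: mulr_ege1 => //; rewrite exprn_ege1// ler1n.
Qed.

(** [reg_pow] compares [q t / q x] with [(Q t / Q x)^K] on either side of [x]. On this scale
    [Q t / Q x] stays in [[0, 2]] and differs from 1 by a quantity of first order in [t - x]. Hence
    [q t - q x] is of first order and the Taylor remainder of second order. *)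
Lemma curv_local x t : 0 < x -> 0 < t -> 2 ^+ K.+1 * (`|t - x| * q x) <= Q x ->
  Q t - Q x - q x * (t - x) <= curv * (q x ^+ 2 / Q x) * (t - x) ^+ 2.
Proof.
move=> x0 t0 h; have Qx := reg_gt0 hQ x0; have qx := reg_dgt0 hQ x0.
have Qt := reg_gt0 hQ t0; have qt := reg_dgt0 hQ t0.
have p2 : 1 <= (2 : R) ^+ K by rewrite exprn_ege1// ler1n.
have E4 : (4 : R) ^+ K = 2 ^+ K * 2 ^+ K by rewrite -exprMn; congr (_ ^+ _); clear -hQ; lra.
have K0 : (0 : R) <= K%:R by rewrite ler0n.
rewrite /curv E4.
have uE : Q t / Q x - 1 = (Q t - Q x) / Q x by rewrite mulrBl divff ?gt_eqF.
have pow := reg_pow hQ.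
have [xt|tx] := leP x t.
- move: h; rewrite ger0_norm ?subr_ge0// => h.
  have [Q2 q2] := up_scale x0 xt h.
  have u1 : 1 <= Q t / Q x by rewrite ler_pdivlMr// mul1r Q_homo// ltW.
  have u2 : Q t / Q x <= 2 by rewrite ler_pdivrMr.
  have e := expr_sub1_le K u1 u2.
  have qtx : q t <= q x * (Q t / Q x) ^+ K.
    by rewrite expr_div_n mulrA ler_pdivlMr ?exprn_gt0// pow.
  have i1 := incr_le x t.
  have d0 : 0 <= t - x by rewrite subr_ge0.
  have u3 : Q t / Q x - 1 <= 2 ^+ K * q x * (t - x) / Q x.
    rewrite uE ler_wpM2r ?invr_ge0 ?(ltW Qx)//; apply: le_trans i1 _.
    by rewrite ler_wpM2r.
  have : q t - q x <= q x * (K%:R * (2 ^+ K * q x * (t - x) / Q x) * 2 ^+ K).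
    apply: (@le_trans _ _ (q x * ((Q t / Q x) ^+ K - 1))); first by move: qtx; clear -hQ; lra.
    rewrite ler_wpM2l ?(ltW qx)//; apply: le_trans e _.
    by rewrite ler_wpM2r ?ler_wpM2l// (le_trans ler01).
  move=> /(fun H => ler_wpM2r d0 H) H.
  have -> : K%:R * (2 ^+ K * 2 ^+ K) * (q x ^+ 2 / Q x) * (t - x) ^+ 2 =
    q x * (K%:R * (2 ^+ K * q x * (t - x) / Q x) * 2 ^+ K) * (t - x) by clear -hQ; ring.
  by apply: le_trans H; move: i1; clear -hQ; lra.
- move: h; rewrite ltr0_norm ?subr_lt0// opprB => h.
  have d0 : 0 <= x - t by rewrite subr_ge0 ltW.
  have u0 : 0 <= Q t / Q x by rewrite divr_ge0// ltW.
  have u1 : Q t / Q x <= 1 by rewrite ler_pdivrMr// mul1r Q_homo// ltW.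
  have e := sub1_expr_le K u0 u1.
  have qtx : q x * (Q t / Q x) ^+ K <= q t.
    by rewrite expr_div_n mulrA ler_pdivrMr ?exprn_gt0// pow// ltW.
  have i1 := incr_le t x.
  have u3 : 1 - Q t / Q x <= q x * (x - t) / Q x.
    rewrite -(opprB _ 1) uE -mulNr opprB ler_wpM2r ?invr_ge0 ?(ltW Qx)//.
  have H0 : q x - q t <= q x * (K%:R * (q x * (x - t) / Q x)).
    apply: (@le_trans _ _ (q x * (1 - (Q t / Q x) ^+ K))); first by move: qtx; clear -hQ; lra.
    rewrite ler_wpM2l ?(ltW qx)//; apply: le_trans e _.
    by rewrite ler_wpM2l.
  have H := ler_wpM2r d0 H0.
  apply: (@le_trans _ _ (q x * (K%:R * (q x * (x - t) / Q x)) * (x - t))).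
    by apply: le_trans H; have := incr_le x t; clear -hQ; lra.
  rewrite (_ : q x * _ * _ = K%:R * 1 * (q x ^+ 2 / Q x) * (t - x) ^+ 2); last by clear -hQ; ring.
  rewrite ler_wpM2r ?sqr_ge0// ler_wpM2r//; first by rewrite divr_ge0 ?sqr_ge0// ltW.
  by rewrite ler_wpM2l// mulr_ege1.
Qed.

Lemma dyadic_pos x r : 0 < x -> x <= r -> exists i, r / 2 ^+ i.+1 < x /\ x <= r / 2 ^+ i.
Proof.
move=> x0 xr; have r0 := lt_le_trans x0 xr.
have ex : exists i, r / 2 ^+ i.+1 < x.
  exists (Num.bound (r / x)); rewrite ltr_pdivrMr ?exprn_gt0// -ltr_pdivrMl// mulrC.
  apply: lt_trans (archi_boundP _) _; first by rewrite divr_ge0// ltW.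
  by rewrite -natrX ltr_nat (ltn_trans _ (ltn_expl _ _)).
case: (ex_minnP ex) => -[|i] Hi mi; [by exists 0; rewrite expr0 divr1|].
exists i.+1; split=> //; rewrite leNgt; apply/negP => h.
by have := mi i h; rewrite ltnn.
Qed.

(** Two regimes. Below the scale [x / T x], [curv_local] applies and its factor [q^2 / Q = T q / x]
    is absorbed by [T y Q(c y) <= A Q(2 c y)], at the price of doubling the argument. Above it,
    [(d / x) T x] is bounded below, so a first-order bound may be multiplied by it before the same
    absorption. *)
Lemma curv_wide x d t : 0 < x -> d <= x -> `|t - x| <= d ->
  Q t - Q x - q x * (t - x) <= A * curv * (d / x) ^+ 2 * Q (8 * x).
Proof.
move=> x0 dx td; have Qx := reg_gt0 hQ x0; have qx := reg_dgt0 hQ x0.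
have d0 : 0 <= d := le_trans (normr_ge0 _) td.
have [d00|dn0] := eqVneq d 0.
  move: td; rewrite d00 normr_le0 subr_eq0 => /eqP ->.
  by rewrite !subrr !mulr0 subr0 mul0r expr0n/= mulr0 mul0r.
have dp : 0 < d by rewrite lt0r dn0.
have A1 := reg_A hQ; have C1 := curv_ge1.
have A0 : 0 <= A := le_trans ler01 A1.
have C0 : 0 <= curv := le_trans ler01 C1.
have T2 c y : 1 <= c -> 0 < y -> T y * Q (c * y) <= A * Q (2 * (c * y)).
  move=> c1 y0; have cy : y <= c * y by rewrite ler_peMl// ltW.
  have cy0 : 0 < c * y := lt_le_trans y0 cy.
  apply: (@le_trans _ _ (A * T (c * y) * Q (c * y))).
    by rewrite ler_wpM2r ?Q_ge0// (reg_quasi hQ).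
  by rewrite -mulrA growthTE// ler_wpM2l// xdQ_le_Q2// ltW.
have [h|h] := leP (2 ^+ K.+1 * (d * q x)) (Q x).
- have t0 : 0 < t.
    have /ler_normlP[+ _] := td; rewrite opprB lerBlDl => /le_lt_trans/(_ _) xt.
    have : d < x.
      rewrite -(ltr_pM2r qx); apply: lt_le_trans (Q_le_xdQ (ltW x0)); apply: lt_le_trans h.
      by rewrite ltr_pMl ?mulr_gt0// exprn_egt1// ltr1n.
    by have /ler_normlP[+ _] := td; clear -hQ; lra.
  apply: le_trans (curv_local x0 t0 _) _.
    by apply: le_trans h; rewrite ler_wpM2l ?exprn_ge0// ler_wpM2r// ltW.
  apply: (@le_trans _ _ (curv * (q x ^+ 2 / Q x) * d ^+ 2)).
    rewrite ler_wpM2l//; first by rewrite mulr_ge0// divr_ge0 ?sqr_ge0// ltW.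
    by rewrite -real_normK ?num_real// lerXn2r ?nnegrE.
  have -> : curv * (q x ^+ 2 / Q x) * d ^+ 2 = curv * (d / x) ^+ 2 * (T x * (x * q x)).
    by rewrite /growthT; field; rewrite !gt_eqF.
  rewrite (_ : A * curv * _ * _ = curv * (d / x) ^+ 2 * (A * Q (8 * x))); last by clear -hQ; ring.
  rewrite ler_wpM2l//; first by rewrite mulr_ge0 ?sqr_ge0.
  apply: (@le_trans _ _ (T x * Q (2 * x))).
    by rewrite ler_wpM2l ?xdQ_le_Q2 ?(ltW x0)// (le_trans ler01)// T_ge1.
  apply: le_trans (T2 2 x _ x0) _; first by rewrite ler1n.
  by rewrite ler_wpM2l// Q_homo//; move: x0; clear -hQ; lra.
- have D1 : Q t - Q x - q x * (t - x) <= d / x * Q (4 * x).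
    have q2 : q x <= q (2 * x) by rewrite (reg_homo hQ)//; move: x0; clear -hQ; lra.
    have x2 : 0 <= 2 * x by rewrite mulr_ge0// ltW.
    have : q (2 * x) * d <= d / x * Q (4 * x).
      have := xdQ_le_Q2 x2; rewrite (_ : 2 * (2 * x) = 4 * x); last by clear -hQ; ring.
      move=> H; rewrite [leRHS]mulrAC ler_pdivlMr//.
      have : d * (2 * x * q (2 * x)) <= d * Q (4 * x) by rewrite ler_wpM2l.
      have : 0 <= d * (x * q (2 * x)).
        by rewrite !mulr_ge0// ?(ltW x0)// dQ_ge0.
      by clear -hQ; nra.
    apply: le_trans.
    have /ler_normlP[td1 td2] := td.
    have [xt|tx] := leP x t.
      have i1 := incr_le x t.
      have : q t * (t - x) <= q (2 * x) * d.
        apply: ler_pM => //; rewrite ?subr_ge0 ?dQ_ge0 ?(le_trans (ltW x0))//.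
        by apply: (reg_homo hQ); move: td2 dx; clear -hQ; lra.
      have : 0 <= q x * (t - x) by rewrite mulr_ge0 ?subr_ge0// ltW.
      by move: i1; clear -hQ; lra.
    have Qtx : Q t <= Q x.
      apply: Q_homo_norm; apply/ler_normlP.
      by move: tx td1 dx x0; clear -hQ; split; lra.
    have : q x * (x - t) <= q (2 * x) * d.
      by apply: ler_pM => //; rewrite ?subr_ge0 ?(ltW qx) ?(ltW tx)//; move: td1; clear -hQ; lra.
    by move: Qtx; clear -hQ; lra.
  apply: (le_trans D1).
  have hT : 1 <= 2 ^+ K.+1 * (d / x) * T x.
    rewrite /growthT (_ : _ * T x = 2 ^+ K.+1 * (d * q x) / Q x); last first.
      by rewrite /growthT; field; rewrite !gt_eqF.
    by rewrite ler_pdivlMr// mul1r ltW.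
  have dx0 : 0 <= d / x by rewrite divr_ge0// ltW.
  have hT4 := T2 4 x (_ : _) x0; have {}hT4 : T x * Q (4 * x) <= A * Q (8 * x).
    by have := hT4 (ler1n _ 4); rewrite (_ : 2 * (4 * x) = 8 * x)//; clear -hQ; ring.
  have : Q (4 * x) <= 2 ^+ K.+1 * (d / x) * (A * Q (8 * x)).
    apply: (@le_trans _ _ (2 ^+ K.+1 * (d / x) * T x * Q (4 * x))).
      by rewrite ler_peMl ?Q_ge0.
    by rewrite -mulrA ler_wpM2l// mulr_ge0// exprn_ge0.
  move=> /(fun H => ler_wpM2l dx0 H) /le_trans; apply.
  rewrite (_ : d / x * _ = 2 ^+ K.+1 * (A * (d / x) ^+ 2 * Q (8 * x))); last by clear -hQ; ring.
  rewrite (_ : A * curv * _ * _ = curv * (A * (d / x) ^+ 2 * Q (8 * x))); last by clear -hQ; ring.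
  rewrite ler_wpM2r//; first by rewrite mulr_ge0 ?Q_ge0// mulr_ge0 ?sqr_ge0.
  rewrite /curv exprS; have K1 : 1 <= (K%:R : R) by rewrite ler1n (reg_K hQ).
  have -> : (4 : R) ^+ K = 2 ^+ K * 2 ^+ K by rewrite -exprMn; congr (_ ^+ _); clear -hQ; lra.
  have p2 : (2 : R) <= 2 ^+ K by rewrite -[leLHS]expr1 ler_eXn2l ?ltr1n// (reg_K hQ).
  have : 2 * 2 ^+ K <= 2 ^+ K * (2 : R) ^+ K by rewrite ler_wpM2r// exprn_ge0.
  move=> /le_trans; apply; rewrite ler_peMl// mulr_ge0// exprn_ge0//.
Qed.

(** The bound has the shape required by [interior_bump]: one power of [halving / 2] per dyadic
    scale. For [x <= d] every term is at most a multiple of [Q(2 d)]. For [x] in the dyadic shell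
    [i < j] the factor [(d / x)^2] supplies [j - i] powers and [Q(8 x)] the other [i]. *)
Lemma curv_interior x t r j : 0 <= x -> x <= r -> `|t - x| <= r / 2 ^+ j ->
  Q t - Q x - q x * (t - x) <= 4 * (A * curv) * (halving / 2) ^+ j * Q (8 * r).
Proof.
move=> x0 xr; set d := r / 2 ^+ j => td.
have A1 := reg_A hQ; have C1 := curv_ge1.
have AC1 : 1 <= A * curv by rewrite mulr_ege1.
have /andP[h1 h2] := halvingP.
have h0 : 0 <= halving / 2 by move: h1; clear -hQ; lra.
have d0 : 0 <= d := le_trans (normr_ge0 _) td.
have r0 : 0 <= r := le_trans x0 xr.
have [xd|dx] := leP x d.
  have [/eqP dd|dn0] := boolP (d == 0).
    have x00 : x = 0 by apply/eqP; rewrite eq_le x0 andbT -dd.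
    move: td; rewrite dd x00 normr_le0 subr_eq0 => /eqP ->.
    rewrite !subrr !mulr0 subr0 mulr_ge0 ?Q_ge0// mulr_ge0 ?exprn_ge0//.
    by rewrite mulr_ge0// (le_trans ler01).
  have dp : 0 < d by rewrite lt0r dn0.
  have rp : 0 < r by move: dp; rewrite /d pmulr_lgt0// invr_gt0 exprn_gt0.
  have /ler_normlP[td1 td2] := td.
  have Qt : Q t <= Q (2 * d).
    by apply: Q_homo_norm; apply/ler_normlP; move: td1 td2 xd x0; clear -hQ; split; lra.
  have qd : - (q x * (t - x)) <= Q (2 * d).
    apply: (@le_trans _ _ (d * q d)); last exact: xdQ_le_Q2.
    rewrite -mulrN opprB mulrC; apply: (@le_trans _ _ (d * q x)).
      by rewrite ler_wpM2r ?dQ_ge0//; move: td1; clear -hQ; lra.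
    by rewrite ler_wpM2l// (reg_homo hQ).
  have Q2 : Q (2 * d) <= (halving / 2) ^+ j * Q (2 * r).
    by rewrite /d mulrA; apply: Q_halve_iter; rewrite mulr_gt0.
  have Q8 : (halving / 2) ^+ j * Q (2 * r) <= (halving / 2) ^+ j * Q (8 * r).
    by rewrite ler_wpM2l ?exprn_ge0// Q_homo//; move: r0; clear -hQ; lra.
  have := Q_ge0 x; have : 0 <= (halving / 2) ^+ j * Q (8 * r) by rewrite mulr_ge0 ?Q_ge0 ?exprn_ge0.
  rewrite -[4 * _ * _ * _]mulrA; move: Qt qd Q2 Q8 AC1.
  set E := _ ^+ j * Q (8 * r); set a := A * curv; move: (q x * _) => z; clear -hQ; nra.
have xp : 0 < x := le_lt_trans d0 dx.
have [i [ri xi]] := dyadic_pos xp xr.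
have rp : 0 < r := lt_le_trans xp xr.
have ij : (i < j)%N.
  rewrite -(@ltr_eXn2l R 2) ?ltr1n//.
  have := lt_le_trans dx xi; rewrite /d ltr_pM2l// ltf_pV2 ?posrE ?exprn_gt0//.
apply: le_trans (curv_wide xp (ltW dx) td) _.
have dxx : (d / x) ^+ 2 <= 4 * (halving / 2) ^+ (j - i).
  apply: (@le_trans _ _ (4 * (1 / 4) ^+ (j - i))); last first.
    have a1 : (0 : R) <= 1 / 4 by clear -hQ; lra.
    have a2 : 1 / 4 <= halving / 2 by move: h1; clear -hQ; lra.
    by rewrite ler_wpM2l// lerXn2r// nnegrE.
  have -> : (4 : R) * (1 / 4) ^+ (j - i) = (2 * (1 / 2) ^+ (j - i)) ^+ 2.
    rewrite [RHS]exprMn -exprM mulnC exprM (_ : (1 / 2) ^+ 2 = 1 / 4); last by clear -hQ; field.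
    by congr (_ * _); clear -hQ; lra.
  rewrite lerXn2r ?nnegrE ?divr_ge0// ?mulr_ge0 ?exprn_ge0//.
  rewrite ler_pdivrMr// /d -{1}(subnKC (ltnW ij)) exprD invfM.
  have : r / 2 ^+ i.+1 * 2 <= x * 2 by rewrite ler_wpM2r// ltW.
  rewrite exprS invfM => H.
  have E : r * ((2 ^+ i)^-1 * (2 ^+ (j - i))^-1) = (1 / 2) ^+ (j - i) * (r * (2^-1 / 2 ^+ i) * 2).
    by rewrite div1r exprVn; field; rewrite !expf_neq0.
  rewrite E (_ : 2 * _ * x = (1 / 2) ^+ (j - i) * (x * 2)); last by clear -hQ; ring.
  by rewrite ler_wpM2l ?exprn_ge0.
have Q8 : Q (8 * x) <= (halving / 2) ^+ i * Q (8 * r).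
  apply: le_trans (Q_halve_iter i (_ : 0 < 8 * r)); last by rewrite mulr_gt0.
  by rewrite Q_homo ?mulr_ge0// -mulrA ler_wpM2l.
rewrite -(subnK (ltnW ij)) exprD.
apply: (@le_trans _ _ (A * curv * (4 * (halving / 2) ^+ (j - i)) * ((halving / 2) ^+ i * Q (8 * r)))).
  have AC0 := le_trans ler01 AC1.
  apply: ler_pM => //; [by rewrite mulr_ge0 ?sqr_ge0|exact: Q_ge0|].
  by rewrite ler_wpM2l.
by rewrite le_eqVlt; apply/orP; left; apply/eqP; clear -hQ; ring.
Qed.

End Growth.

(** * The Mhaskar-Rakhmanov-Saff number *)

Section MRS.
Context {R : realType}.
Local Notation mu := (@lebesgue_measure R).
Implicit Types (a b s u x : R).

Lemma measurable_invr : measurable_fun setT (fun x : R => x^-1).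
Proof.
rewrite (_ : setT = [set 0] `|` ~` [set (0 : R)]); last by rewrite setUCr.
apply/measurable_funU; [exact: measurable_set1|exact: measurableC|split].
  exact: measurable_fun_set1.
apply: open_continuous_measurable_fun.
  by rewrite openC; apply: accessible_closed_set1; apply: hausdorff_accessible; exact: norm_hausdorff.
by move=> x /[!inE]/= /eqP x0; exact: inv_continuous.
Qed.

(** The primitive [-2 sqrt(1 - u)] is not differentiable at 1, so the integral is computed on
    [[1 - s, 1 - s / (k + 2)]] and monotone convergence gives the limit. *)
Lemma integral_inv_sqrt_le s : 0 < s ->
  (\int[mu]_(u in `[(1 - s)%R, 1%R[) ((Num.sqrt (1 - u))^-1)%:E <= (2 * Num.sqrt s)%:E)%E.
Proof.
move=> s0.
pose F (k : nat) : set R := `[1 - s, 1 - s / k.+2%:R]%classic.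
have sk k : 0 < s / k.+2%:R by rewrite divr_gt0.
have sks k : s / k.+2%:R < s by rewrite ltr_pdivrMr// ltr_pMr// ltr1n.
have UF : \bigcup_k F k = `[1 - s, 1[%classic.
  apply/seteqP; split=> [x [k _]|x]; rewrite /F/= !in_itv/=.
    move=> /andP[-> h]/=; by apply: le_lt_trans h _; rewrite ltrBlDr ltrDl sk.
  move=> /andP[h x1].
  exists (Num.bound (s / (1 - x))) => //; rewrite /F/= in_itv/= h/=.
  have x1' : 0 < 1 - x by rewrite subr_gt0.
  have sx : 0 <= s / (1 - x) by apply: divr_ge0; apply: ltW.
  have := archi_boundP sx.
  rewrite ltr_pdivrMr// => H.
  rewrite lerBrDl -lerBrDr ler_pdivrMr//; apply: le_trans (ltW H) _.
  by rewrite mulrC ler_pM2l// ler_nat; apply: leqW.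
rewrite -UF.
have mf k : measurable_fun (F k) (fun u => ((Num.sqrt (1 - u))^-1)%:E).
  apply/measurable_EFinP; apply: measurable_funTS; apply: measurableT_comp; first exact: measurable_invr.
  apply: continuous_measurable_fun => x.
  apply: (@continuous_comp _ _ _ (fun u : R => 1 - u) Num.sqrt); last exact: sqrt_continuous.
  by apply: cvgB; [exact: cvg_cst|exact: cvg_id].
have ndF : {homo F : n m / (n <= m)%N >-> (n <= m)%O}.
  apply/nondecreasing_seqP => k; rewrite subsetEset => x; rewrite /F/= !in_itv/= => /andP[-> h]/=.
  apply: le_trans h _; rewrite lerD2l lerN2 ler_pM2l// lef_pV2 ?posrE// ler_nat; exact: leqnSn.
have mFk k : measurable (F k) by exact: measurable_itv.
have f0 k (x : measurableTypeR R) : F k x -> (0%:E <= ((Num.sqrt (1 - x))^-1)%:E)%E.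
  by move=> _; rewrite lee_fin invr_ge0 sqrtr_ge0.
have cv := @ge0_nondecreasing_set_cvg_integral _ (measurableTypeR R) R F (fun u => ((Num.sqrt (1 - u))^-1)%:E) lebesgue_measure ndF mFk mf f0.
rewrite -(cvg_lim _ cv)//; apply: lime_le; first by apply/cvg_ex; eexists; exact: cv.
apply: nearW => k.
have lt1 : 1 - s < 1 - s / k.+2%:R by rewrite ltrD2l ltrN2.
have cS : continuous (fun u : R => Num.sqrt (1 - u)).
  move=> x; apply: (@continuous_comp _ _ _ (fun u : R => 1 - u) Num.sqrt); last exact: sqrt_continuous.
  by apply: cvgB; [exact: cvg_cst|exact: cvg_id].
have dF (x : R) : x < 1 -> is_derive x 1 (fun u : R => - 2 * Num.sqrt (1 - u)) (Num.sqrt (1 - x))^-1.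
  move=> x1; have x10 : 0 < 1 - x by rewrite subr_gt0.
  have d1 : is_derive x 1 (fun u : R => 1 - u) (-1).
    by have := is_deriveB (is_derive_cst (1 : R) x (1 : R)) (is_derive_id x (1 : R)); rewrite sub0r.
  have ds := is_derive1_sqrt x10.
  have dc := @is_derive1_comp _ _ _ x _ _ ds d1.
  have dc' : is_derive x 1 (fun u : R => Num.sqrt (1 - u)) ((2 * Num.sqrt (1 - x))^-1 * -1) by exact: dc.
  apply: is_derive_eq; rewrite /GRing.scale/=; field.
  by rewrite gt_eqF// sqrtr_gt0.
rewrite (@continuous_FTC2 R _ (fun u : R => - 2 * Num.sqrt (1 - u)))//.
- rewrite -EFinB lee_fin !subKr.
  have : 0 <= Num.sqrt (s / k.+2%:R) by rewrite sqrtr_ge0.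
  by clear; lra.
- apply: continuous_in_subspaceT => x; rewrite inE/= in_itv/= => /andP[_ xk].
  have x10 : 0 < 1 - x by move: (sk k) xk; move: (s / _) => z; clear; lra.
  by apply: cvgV; [rewrite gt_eqF// sqrtr_gt0|exact: cS].
- split.
  + move=> x; rewrite in_itv/= => /andP[_ xk].
    by have [] := dF x (_ : x < 1) => //; move: (sk k) xk; move: (s / _) => z; clear; lra.
  + by apply: cvg_at_right_filter; apply: cvgM; [exact: cvg_cst|exact: cS].
  + by apply: cvg_at_left_filter; apply: cvgM; [exact: cvg_cst|exact: cS].
- move=> x; rewrite in_itv/= => /andP[_ xk].
  have x1 : x < 1 by move: (sk k) xk; move: (s / _) => z; clear; lra.
  by have := dF x x1; rewrite derive1E => -[_ ->].
Qed.

End MRS.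

Section MRStheta.
Context {R : realType} (Q : R -> R) (K : nat) (A l : R).
Hypothesis hQ : regular Q K A l.
Local Notation q := (derive1 Q : R -> R).
Local Notation mu := (@lebesgue_measure R).

(* The square of [Q sqrt T]; the equation defining [a_n] says
   that [theta2 a_n] is comparable with [n ^ 2]. *)
Definition theta2 (x : R) : R := x * q x * Q x.

(** Let [s = 1 / T a]. Lower bound: on [[1 - s/2, 1)] the value [q (a u)] is comparable with [q a]
    by [down_scale], and [sqrt(1 - u^2) <= sqrt s]. Upper bound: below [1 - s] the singular factor
    is at most [1 / sqrt s] and the rest integrates to at most [Q a]; above it [q (a u) <= q a], and
    the singular factor integrates to at most [2 sqrt s]. *)
Lemma MRS_theta2_le n a : (0 < n)%N -> is_MRS Q n a ->
  theta2 a <= (2 ^+ K.+3 * n%:R) ^+ 2 /\ n%:R ^+ 2 <= 9 * theta2 a.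
Proof.
move=> n0 [a0].
set F := fun u => a * u * q (a * u) / Num.sqrt (1 - u ^+ 2) => nE.
have Qa := reg_gt0 hQ a0; have qa := reg_dgt0 hQ a0.
have th0 : 0 < theta2 a by rewrite /theta2 !mulr_gt0.
have F0 u : 0 <= u -> 0 <= F u.
  move=> u0; rewrite /F divr_ge0 ?sqrtr_ge0// !mulr_ge0 ?(ltW a0)//.
  by apply: (dQ_ge0 hQ); rewrite mulr_ge0// ltW.
have mF (D : set R) : measurable_fun D (fun u => (F u)%:E).
  apply/measurable_EFinP; apply: measurable_funTS; apply: measurable_funM.
    apply: continuous_measurable_fun => x; apply: cvgM.
      by apply: cvgM; [exact: cvg_cst|exact: cvg_id].
    apply: (@continuous_comp _ _ _ (fun u : R => a * u) q); last exact: reg_cont hQ _.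
    by apply: cvgM; [exact: cvg_cst|exact: cvg_id].
  apply: measurableT_comp; first exact: measurable_invr.
  apply: continuous_measurable_fun => x.
  apply: (@continuous_comp _ _ _ (fun u : R => 1 - u ^+ 2) Num.sqrt); last exact: sqrt_continuous.
  by apply: cvgB; [exact: cvg_cst|exact: exprn_continuous].
set I := (\int[mu]_(u in `[0%R, 1%R]) (F u)%:E)%E.
have pi0 := @pi_gt0 R; have [/andP[_ pi2] _] := @pihalf_02_cos_pihalf R.
have I0 : (0 <= I)%E.
  by apply: integral_ge0 => u /=; rewrite in_itv/= => /andP[u0 _]; rewrite lee_fin F0.
have n1 : (1 : R) <= n%:R by rewrite ler1n.
have fI : fine I = pi / 2 * n%:R.
  have : n%:R = 2 / pi * fine I by exact: nE.
  by move: (fine I) pi0 => z; move: (pi : R) => y y0 ->; field; exact: lt0r_neq0.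
(* The real-valued integral in [is_MRS] reads an infinite value as 0, which [n >= 1] excludes; so
   [I] is finite. *)
have IE : I = (pi / 2 * n%:R)%:E.
  rewrite -fI fineK// ge0_fin_numE//; rewrite ltey; apply/eqP => Iy.
  by move: fI; rewrite Iy/= => /esym/eqP; rewrite gt_eqF// mulr_gt0 ?divr_gt0// (lt_le_trans ltr01).
pose s := Q a / (a * q a).
have aq0 : 0 < a * q a by rewrite mulr_gt0.
have s0 : 0 < s by rewrite divr_gt0.
have s1 : s <= 1 by rewrite ler_pdivrMr// mul1r (Q_le_xdQ hQ)// ltW.
have rs0 : 0 < Num.sqrt s by rewrite sqrtr_gt0.
have rs2 : Num.sqrt s * Num.sqrt s = s by rewrite -expr2 sqr_sqrtr// ltW.
have thE : theta2 a = (a * q a * Num.sqrt s) ^+ 2.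
  by rewrite exprMn sqr_sqrtr ?ltW// /theta2 /s; field; rewrite !gt_eqF.
have w0 : 0 <= a * q a * Num.sqrt s by rewrite mulr_ge0 ?ltW.
split.
- have w1 : 0 <= 2 ^+ K.+3 * n%:R :> R by rewrite mulr_ge0// exprn_ge0.
  rewrite thE lerXn2r ?nnegrE//.
  pose c := a * q a / (2 ^+ K.+1 * Num.sqrt s).
  have p0 : (0 : R) < 2 ^+ K by rewrite exprn_gt0.
  have p1 : (0 : R) < 2 ^+ K.+1 by rewrite exprn_gt0.
  have : ((c * (s / 2))%:E <= I)%E.
    have -> : (c * (s / 2))%:E = (\int[mu]_(u in `[(1 - s / 2)%R, 1%R[) (cst c%:E u))%E.
      rewrite integral_cst//= lebesgue_measure_itv/= lte_fin ltrBlDr ltrDl divr_gt0//.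
      by rewrite -EFinM; congr (_ * _)%:E; clear -hQ; lra.
    apply: (@le_trans _ _ (\int[mu]_(u in `[(1 - s / 2)%R, 1%R[) (F u)%:E)%E).
      apply: ge0_le_integral => //.
      - by move=> u _; rewrite lee_fin /c divr_ge0 ?ltW// mulr_gt0.
      - exact: mF.
      - move=> u; rewrite /= in_itv/= => /andP[su u1].
        have u12 : 1 / 2 <= u by move: su s1; clear -hQ; lra.
        have u0 : 0 < u by move: u12; clear -hQ; lra.
        have au0 : 0 < a * u by rewrite mulr_gt0.
        have aua : a * u <= a by rewrite ger_pMr// ltW.
        have hcl : 2 * ((a - a * u) * q a) <= Q a.
          have : Q a = s * (a * q a) by rewrite /s divfK// gt_eqF.
          have : (1 - u) * (a * q a) <= s / 2 * (a * q a).
            by rewrite ler_pM2r//; move: su; clear -hQ; lra.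
          by clear -hQ; lra.
        have [_ qq] := down_scale hQ au0 aua hcl.
        rewrite lee_fin /c /F ler_pdivrMr; last by rewrite mulr_gt0.
        have u2 : 0 < 1 - u ^+ 2 by rewrite subr_gt0 exprn_ilt1// ltW.
        rewrite mulrAC ler_pdivlMr ?sqrtr_gt0//.
        rewrite (exprS _ K).
        have h1 : a * q a <= 2 * 2 ^+ K * (a * u * q (a * u)).
          apply: (@le_trans _ _ (2 * (a * u) * (2 ^+ K * q (a * u)))).
            apply: ler_pM => //; [exact: ltW|exact: ltW|].
            have : a * (1 / 2) <= a * u by rewrite ler_pM2l.
            by clear -hQ; lra.
          by rewrite le_eqVlt; apply/orP; left; apply/eqP; clear -hQ; ring.
        have h2 : Num.sqrt (1 - u ^+ 2) <= Num.sqrt s.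
          rewrite ler_wsqrtr//; have : (1 - u) * (1 + u) <= (1 - u) * 2.
            by rewrite ler_wpM2l ?subr_ge0 ?(ltW u1)//; move: u1; clear -hQ; lra.
          by move: su; clear -hQ; nra.
        rewrite [leRHS](_ : _ = 2 * 2 ^+ K * (a * u * q (a * u)) * Num.sqrt s); last by clear -hQ; ring.
        by apply: ler_pM => //; exact: ltW.
    apply: ge0_subset_integral => //; first exact: mF.
      by move=> u /=; rewrite in_itv/= => /andP[u0 _]; rewrite lee_fin F0.
    move=> u /=; rewrite !in_itv/= => /andP[su u1]; rewrite (ltW u1) andbT.
    by move: su s1; clear -hQ; lra.
  rewrite IE lee_fin /c => H.
  have H2 : a * q a * Num.sqrt s <= 2 ^+ K.+2 * (pi / 2 * n%:R).
    apply: le_trans (ler_wpM2l _ H); last by rewrite exprn_ge0.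
    rewrite -[X in _ * (X / 2)]rs2 (exprS _ K.+1) le_eqVlt; apply/orP; left; apply/eqP; field.
    by rewrite !gt_eqF.
  apply: le_trans H2 _; rewrite !exprS.
  have : pi / 2 * n%:R <= 2 * n%:R :> R by rewrite ler_wpM2r.
  move: p0; set b := 2 ^+ K; move: (pi / 2 * _) => z; clear -hQ => b0 /(ler_wpM2l (ltW b0)).
  by lra.
- suff : (I <= (3 * (a * q a * Num.sqrt s))%:E)%E.
    rewrite IE lee_fin => H; rewrite thE.
    have : n%:R <= 3 * (a * q a * Num.sqrt s).
      apply: le_trans H; rewrite ler_peMl//; have := pi_ge2 R; clear -hQ; lra.
    move=> h; have -> : 9 = 3 ^+ 2 :> R by clear -hQ; ring.
    by rewrite -exprMn lerXn2r ?nnegrE// mulr_ge0.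
  have s1' : 0 <= 1 - s by rewrite subr_ge0.
  rewrite /I (@itv_bndbnd_setU _ _ _ (BRight (1 - s)))//; last by rewrite bnd_simp; move: s0; clear -hQ; lra.
  rewrite ge0_integral_setU//; last 3 first.
  - exact: mF.
  - move=> u []; rewrite /= in_itv/= => /andP[h _]; rewrite lee_fin F0//.
    by move: h s1'; clear -hQ; lra.
  - apply/disj_setPS => u [] /=; rewrite !in_itv/= => /andP[_ h1] /andP[h2 _].
    by move: h1; rewrite leNgt h2.
  rewrite (_ : 3 * _ = a * q a * Num.sqrt s + a * q a * (2 * Num.sqrt s)); last by clear -hQ; ring.
  rewrite EFinD; apply: leeD.
  + have -> : a * q a * Num.sqrt s = (Num.sqrt s)^-1 * (Q (a * 1) - Q (a * 0)).
      rewrite mulr1 mulr0 (reg_0 hQ) subr0 -[Q a](divfK (_ : a * q a != 0)) ?gt_eqF// -/s -[X in _ * (X * _)]rs2.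
      by field; rewrite gt_eqF.
    have cf : continuous (fun u : R => a * q (a * u)).
      move=> x; apply: cvgM; first exact: cvg_cst.
      apply: (@continuous_comp _ _ _ (fun u : R => a * u) q); last exact: reg_cont hQ _.
      by apply: cvgM; [exact: cvg_cst|exact: cvg_id].
    have dG (x : R) : is_derive x 1 (fun u : R => Q (a * u)) (a * q (a * x)).
      have d1 : is_derive x 1 (fun u : R => a * u) a.
        by apply: is_derive_eq; rewrite /GRing.scale/= mulr1.
      have := @is_derive1_comp _ _ _ x _ _ (reg_der hQ (a * x)) d1.
      by move=> H; apply: (is_derive_eq H); rewrite mulrC.
    have cG : continuous (fun u : R => Q (a * u)).
      move=> x; apply: (@continuous_comp _ _ _ (fun u : R => a * u) Q); last exact: cont_Q hQ _.
      by apply: cvgM; [exact: cvg_cst|exact: cvg_id].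
    rewrite EFinM EFinB -(@continuous_FTC2 R (fun u : R => a * q (a * u)) (fun u => Q (a * u)))//; last 3 first.
    - exact: continuous_subspaceT.
    - split; [by move=> x _; have [] := dG x| |].
        by apply: cvg_at_right_filter; exact: cG.
      by apply: cvg_at_left_filter; exact: cG.
    - by move=> x _; rewrite derive1E; have [_ ->] := dG x.
    have mG (D : set R) : measurable_fun D (fun u => (a * q (a * u))%:E).
      by apply/measurable_EFinP; apply: measurable_funTS; exact: continuous_measurable_fun.
    have G0 u : 0 <= u -> 0 <= a * q (a * u).
      by move=> u0; rewrite mulr_ge0 ?(ltW a0)//; apply: (dQ_ge0 hQ); rewrite mulr_ge0// ltW.
    rewrite -ge0_integralZl//; last 2 first.
    - exact: mG.
    - by move=> u /=; rewrite in_itv/= => /andP[u0 _]; rewrite lee_fin G0.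
    apply: (@le_trans _ _ (\int[mu]_(u in `[0%R, (1 - s)%R]) ((Num.sqrt s)^-1%:E * (a * q (a * u))%:E))%E).
      apply: ge0_le_integral => //.
      - by move=> u /=; rewrite in_itv/= => /andP[u0 _]; rewrite lee_fin F0.
      - exact: mF.
      - by apply: emeasurable_funM; [exact: measurable_cst|exact: mG].
      - move=> u /=; rewrite in_itv/= => /andP[u0 us]; rewrite -EFinM lee_fin /F.
        have u1 : u <= 1 by move: us s0; clear -hQ; lra.
        rewrite mulrC; apply: ler_pM.
        + by rewrite invr_ge0 sqrtr_ge0.
        + by rewrite -mulrA mulrCA mulr_ge0// G0.
        + have h : Num.sqrt s <= Num.sqrt (1 - u ^+ 2).
            rewrite ler_wsqrtr//; have : u ^+ 2 <= u by rewrite expr2 ler_piMr.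
            by move: us; clear -hQ; lra.
          by rewrite lef_pV2 ?posrE// (lt_le_trans rs0).
        + rewrite (_ : a * u * _ = u * (a * q (a * u))); last by clear -hQ; ring.
          by rewrite ler_piMl// G0.
    apply: ge0_subset_integral => //.
    - by apply: emeasurable_funM; [exact: measurable_cst|exact: mG].
    - by move=> u /=; rewrite in_itv/= => /andP[u0 _]; rewrite -EFinM lee_fin mulr_ge0 ?G0// invr_ge0 ltW.
    - move=> u /=; rewrite !in_itv/= => /andP[-> us]/=; move: us s0; clear -hQ; lra.
  + rewrite EFinM; apply: le_trans (lee_wpmul2l _ (integral_inv_sqrt_le s0)); last by rewrite lee_fin ltW.
    have mS (D : set R) : measurable_fun D (fun u => ((Num.sqrt (1 - u))^-1)%:E).
      apply/measurable_EFinP; apply: measurable_funTS; apply: measurableT_comp; first exact: measurable_invr.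
      apply: continuous_measurable_fun => x.
      apply: (@continuous_comp _ _ _ (fun u : R => 1 - u) Num.sqrt); last exact: sqrt_continuous.
      by apply: cvgB; [exact: cvg_cst|exact: cvg_id].
    rewrite -ge0_integralZl//; last by rewrite lee_fin ltW.
    rewrite -integral_itv_bndo_bndc; last exact: mF.
    apply: (@le_trans _ _ (\int[mu]_(u in `[(1 - s)%R, 1%R[) (F u)%:E)%E).
      apply: ge0_subset_integral => //; first exact: mF.
        by move=> u /=; rewrite in_itv/= => /andP[u0 _]; rewrite lee_fin F0// (le_trans s1').
      by move=> u /=; rewrite !in_itv/= => /andP[/ltW -> ->].
    apply: ge0_le_integral => //.
    - by move=> u /=; rewrite in_itv/= => /andP[u0 _]; rewrite lee_fin F0// (le_trans s1').
    - exact: mF.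
    - by apply: emeasurable_funM; [exact: measurable_cst|exact: mS].
    - move=> u /=; rewrite in_itv/= => /andP[us u1]; rewrite -EFinM lee_fin /F.
      have u0 : 0 <= u := le_trans s1' us.
      apply: ler_pM.
      * by rewrite -mulrA mulr_ge0 ?(ltW a0)// mulr_ge0//; apply: (dQ_ge0 hQ); rewrite mulr_ge0// ltW.
      * by rewrite invr_ge0 sqrtr_ge0.
      * apply: ler_pM.
        - by rewrite mulr_ge0// ltW.
        - by apply: (dQ_ge0 hQ); rewrite mulr_ge0// ltW.
        - by rewrite ger_pMr// ltW.
        - by apply: (reg_homo hQ); rewrite ger_pMr// ltW.
      * have h : Num.sqrt (1 - u) <= Num.sqrt (1 - u ^+ 2).
          by rewrite ler_wsqrtr// lerD2l lerN2 expr2 ler_piMr// ltW.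
        by rewrite lef_pV2 ?posrE// ?(lt_le_trans _ h)// sqrtr_gt0 subr_gt0.
exact: mS.
Qed.

End MRStheta.

(** * Polynomial inequalities on an interval *)

Section OrthogonalPolynomials.
Context {R : realType}.
Local Notation mu := (@lebesgue_measure R).
Implicit Types (p r : {poly R}) (x y z : R) (W : R -> R).

Lemma cauchy_schwarz_sum n (a b : nat -> R) :
  (\sum_(0 <= k < n) a k * b k) ^+ 2 <=
  (\sum_(0 <= k < n) a k ^+ 2) * (\sum_(0 <= k < n) b k ^+ 2).
Proof.
set S := \sum_(_ <= _ < _) _ * _; set A := \sum_(_ <= _ < _) a _ ^+ 2.
set B := \sum_(_ <= _ < _) b _ ^+ 2.
have B0 : 0 <= B by apply: sumr_ge0 => k _; exact: sqr_ge0.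
have H : 0 <= B * (B * A - S ^+ 2).
  have -> : B * (B * A - S ^+ 2) = \sum_(0 <= k < n) (a k * B - b k * S) ^+ 2.
    rewrite (eq_bigr (fun k => B ^+ 2 * a k ^+ 2 - 2 * B * S * (a k * b k) + S ^+ 2 * b k ^+ 2)); last first.
      by move=> k _; ring.
    rewrite big_split/= sumrB -!mulr_sumr -/S -/A -/B; ring.
  by apply: sumr_ge0 => k _; exact: sqr_ge0.
have [B00|Bn0] := eqVneq B 0; last first.
  by rewrite mulrC -subr_ge0 -(pmulr_rge0 _ (_ : 0 < B))// lt0r Bn0.
have b0 k : (k < n)%N -> b k = 0.
  move=> kn; have : b k ^+ 2 = 0.
    apply/eqP; rewrite eq_le sqr_ge0 andbT -B00 /B.
    rewrite (bigD1_seq k)/= ?mem_index_iota ?iota_uniq//.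
    by rewrite lerDl sumr_ge0// => i _; exact: sqr_ge0.
  by move/eqP; rewrite sqrf_eq0 => /eqP.
rewrite B00 mulr0 /S big_nat_cond big1 ?expr0n//=.
by move=> k; rewrite andbT => kn; rewrite b0// mulr0.
Qed.

Lemma poly_basis (P : nat -> {poly R}) : (forall k, size (P k) = k.+1) ->
  forall n p, (size p <= n)%N -> exists c : nat -> R, p = \sum_(0 <= k < n) c k *: P k.
Proof.
move=> hP; elim=> [|n ih] p sp.
  exists (fun=> 0); rewrite big_geq//; apply/eqP; rewrite -size_poly_eq0; lia.
pose a := p`_n / lead_coef (P n).
have lP : lead_coef (P n) != 0 by rewrite lead_coef_eq0 -size_poly_eq0 hP.
have [|c Hc] := ih (p - a *: P n).
  apply/leq_sizeP => j nj; rewrite coefB coefZ.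
  have [->|jn] := eqVneq j n.
    by rewrite /a -[(P n)`_n](_ : lead_coef (P n) = _) ?divfK ?subrr// lead_coefE hP.
  have jn' : (n < j)%N by rewrite ltn_neqAle eq_sym jn.
  rewrite !nth_default ?mulr0 ?subrr// ?hP// (leq_trans sp)//.
exists (fun k => if (k == n)%N then a else c k).
rewrite big_nat_recr//= eqxx -[LHS](subrK (a *: P n)) Hc; congr (_ + _).
by apply: eq_big_nat => k /andP[_ kn]; rewrite ltn_eqF.
Qed.

Definition has_moments W := forall p, mu.-integrable setT (EFin \o (fun x => p.[x] * W x)).

Definition moment W p : R := \int[mu]_x (p.[x] * W x).

Lemma momentD W p r : has_moments W -> moment W (p + r) = moment W p + moment W r.
Proof.
move=> hW; rewrite /moment -RintegralD//; apply: eq_Rintegral => x _.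
by rewrite hornerD mulrDl.
Qed.

Lemma momentZ W a p : has_moments W -> moment W (a *: p) = a * moment W p.
Proof.
move=> hW; rewrite /moment -RintegralZl//; apply: eq_Rintegral => x _.
by rewrite hornerZ mulrA.
Qed.

Lemma moment_sum W n (c : nat -> R) (P : nat -> {poly R}) : has_moments W ->
  moment W (\sum_(0 <= k < n) c k *: P k) = \sum_(0 <= k < n) c k * moment W (P k).
Proof.
move=> hW; elim: n => [|n ih].
  rewrite !big_geq// /moment; under eq_Rintegral do rewrite horner0 mul0r.
  by rewrite Rintegral_cst//= mul0r.
by rewrite !big_nat_recr//= momentD// ih momentZ.
Qed.

Lemma moment_ge0 W p : (forall x, 0 <= W x) -> (forall x, 0 <= p.[x]) -> 0 <= moment W p.
Proof. by move=> W0 p0; apply: Rintegral_ge0 => x _; rewrite mulr_ge0. Qed.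

(** The common squared norm [d] lets the same lemmas serve the Chebyshev polynomials, with
    [d = pi / 2], and the orthonormal polynomials of the weight, with [d = 1]. *)
Definition orthogonal_polys W (d : R) (P : nat -> {poly R}) :=
  [/\ has_moments W, forall k, size (P k) = k.+1 &
      forall j k, moment W (P j * P k) = d * (j == k)%:R].

Lemma orthogonal_moment W d P n (a b : nat -> R) : orthogonal_polys W d P ->
  moment W ((\sum_(0 <= k < n) a k *: P k) * (\sum_(0 <= k < n) b k *: P k)) =
  d * \sum_(0 <= k < n) a k * b k.
Proof.
move=> [hW hP hO].
rewrite mulr_suml; under eq_bigr do rewrite -scalerAl.
rewrite moment_sum// mulr_sumr; apply: eq_big_nat => k /andP[_ kn].
rewrite mulr_sumr; under eq_bigr do rewrite -scalerAr.
rewrite moment_sum// (bigD1_seq k)/= ?mem_index_iota ?iota_uniq//.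
rewrite hO eqxx mulr1 big1 ?addr0; first by ring.
by move=> i; rewrite eq_sym => /negPf ik; rewrite hO ik !mulr0.
Qed.

(** Cauchy-Schwarz on the expansion of [p]: the coefficients contribute the moment of [p^2], the
    values at [x] the Christoffel kernel. *)
Lemma reproducing_bound W d P n p x : orthogonal_polys W d P -> 0 < d ->
  (size p <= n)%N ->
  p.[x] ^+ 2 <= d^-1 * (\sum_(0 <= k < n) (P k).[x] ^+ 2) * moment W (p ^+ 2).
Proof.
move=> hO d0 sp; have [_ hP _] := hO; have [c ->] := poly_basis hP sp.
rewrite expr2 [in leRHS]expr2 (orthogonal_moment n c c hO) horner_sum.
under eq_bigr do rewrite hornerZ.
have := cauchy_schwarz_sum n c (fun k => (P k).[x]).
rewrite -expr2 => /le_trans; apply.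
rewrite le_eqVlt; apply/orP; left; apply/eqP.
under [in LHS]eq_bigr do rewrite expr2; field; exact: lt0r_neq0.
Qed.

End OrthogonalPolynomials.

(** * Chebyshev polynomials, Nikolskii and Bernstein-Walsh inequalities *)

Section Chebyshev.
Context {R : realType}.
Local Notation mu := (@lebesgue_measure R).
Implicit Types (p r : {poly R}) (x y z t : R).

(** Carrying two consecutive polynomials makes the three-term recurrence structural. *)
Fixpoint chebU (k : nat) : {poly R} * {poly R} :=
  if k is k'.+1 then let: (u, v) := chebU k' in (v, 2 *: 'X * v - u)
  else (1, 2 *: 'X).

(* The Chebyshev polynomial of the second kind, usually written U_k. *)
Definition cheb k := (chebU k).1.

Lemma chebUE k : chebU k = (cheb k, cheb k.+1).
Proof. by rewrite /cheb/=; case: (chebU k). Qed.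

Lemma chebSS k : cheb k.+2 = 2 *: 'X * cheb k.+1 - cheb k.
Proof. by rewrite {1}/cheb/= chebUE. Qed.

Lemma cheb0 : cheb 0 = 1. Proof. by []. Qed.
Lemma cheb1 : cheb 1 = 2 *: 'X. Proof. by []. Qed.

Lemma size_2X p : p != 0 -> size (2 *: 'X * p) = (size p).+1.
Proof.
by move=> p0; rewrite -scalerAl size_scale ?pnatr_eq0// mulrC size_mulX.
Qed.

Lemma size_cheb k : size (cheb k) = k.+1.
Proof.
suff : size (cheb k) = k.+1 /\ size (cheb k.+1) = k.+2 by case.
elim: k => [|k [ih1 ih2]]; first by rewrite cheb0 cheb1 size_poly1 size_scale ?pnatr_eq0// size_polyX.
split=> //; rewrite chebSS size_polyDl.
  by rewrite size_2X ?ih2// -size_poly_eq0 ih2.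
by rewrite size_polyN size_2X ?ih2 ?ih1// -size_poly_eq0 ih2.
Qed.

Lemma cheb_cos k t : (cheb k).[cos t] * sin t = sin (k.+1%:R * t).
Proof.
suff : (cheb k).[cos t] * sin t = sin (k.+1%:R * t) /\
       (cheb k.+1).[cos t] * sin t = sin (k.+2%:R * t) by case.
elim: k => [|k [ih1 ih2]].
  rewrite cheb0 cheb1 hornerC mul1r mul1r hornerZ hornerX; split=> //.
  by rewrite [X in _ = sin X](_ : _ = t + t) ?sinD; ring.
split=> //; rewrite chebSS hornerD hornerN hornerM hornerZ hornerX mulrBl ih1.
rewrite -[2 * _ * _ * _]mulrA ih2.
have -> : k.+3%:R * t = k.+2%:R * t + t by rewrite -natr1 mulrDl mul1r.
have -> : k.+1%:R * t = k.+2%:R * t - t by rewrite -(natr1 k.+1) mulrDl mul1r addrK.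
rewrite !sinD sinN cosN; ring.
Qed.

(** The square root of a negative number is 0, so this weight vanishes off [[-1, 1]] and its moments
    are integrals over the whole line. *)
Definition semicircle x : R := Num.sqrt (1 - x ^+ 2).

Lemma continuous_semicircle : continuous semicircle.
Proof.
move=> x; apply: (@continuous_comp _ _ _ (fun u : R => 1 - u ^+ 2) Num.sqrt); last exact: sqrt_continuous.
by apply: cvgB; [exact: cvg_cst|exact: exprn_continuous].
Qed.

Lemma semicircle_out x : x \notin `[-1, 1] -> semicircle x = 0.
Proof.
rewrite in_itv/= -ler_norml => h; apply: ler0_sqrtr; rewrite subr_le0 ltW//.
by rewrite -real_normK ?num_real// exprn_egt1// ltNge.
Qed.

Lemma continuous_poly_semicircle p : continuous (fun x => p.[x] * semicircle x).
Proof.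
by move=> x; apply: cvgM; [exact: continuous_horner|exact: continuous_semicircle].
Qed.

Lemma moments_semicircle : has_moments semicircle.
Proof.
move=> p; set f := EFin \o _.
have -> : f = f \_ `[-1, 1].
  apply/funext => x; rewrite patchE; case: ifPn => //.
  by rewrite mem_setE => h; rewrite /f/= semicircle_out// mulr0.
apply/integrable_restrict => //; rewrite setTI.
apply: continuous_compact_integrable; first exact: segment_compact.
by apply: continuous_subspaceT; exact: continuous_poly_semicircle.
Qed.

Lemma sin_natpi k : sin (k%:R * pi) = 0 :> R.
Proof.
elim: k => [|k ih]; first by rewrite mul0r sin0.
by rewrite -natr1 mulrDl mul1r sinDpi ih oppr0.
Qed.

Lemma integral_cos_nat (k : nat) :
  (\int[mu]_(t in `[0%R, pi]) (cos (k%:R * t))%:E = (pi * (k == 0)%:R)%:E :> \bar R)%E.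
Proof.
have pi0 := @pi_gt0 R; case: k => [|k].
  rewrite (eq_integral (cst 1%E)); last by move=> t _; rewrite mul0r cos0.
  by rewrite integral_cst//= lebesgue_measure_itv/= lte_fin pi0 mul1e sube0 mulr1.
have kn0 : (k.+1%:R : R) != 0 by rewrite pnatr_eq0.
have dF (t : R) : is_derive t 1 (fun u => k.+1%:R^-1 * sin (k.+1%:R * u)) (cos (k.+1%:R * t)).
  have d1 : is_derive t (1 : R) (fun u : R => k.+1%:R * u) (k.+1%:R).
    by apply: is_derive_eq; rewrite /GRing.scale/= mulr1.
  have d2 := @is_derive1_comp _ sin _ t _ _ (is_derive_sin (k.+1%:R * t)) d1.
  have d3 : is_derive t (1 : R) (fun u : R => sin (k.+1%:R * u)) (cos (k.+1%:R * t) * k.+1%:R) by exact: d2.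
  apply: is_derive_eq; rewrite /GRing.scale/=.
  by rewrite mulrC -mulrA divff// mulr1.
have cl (f : R -> R) : continuous f -> continuous (fun u : R => f (k.+1%:R * u)).
  move=> cf x; apply: (@continuous_comp _ _ _ (fun u : R => k.+1%:R * u) f); last exact: cf.
  by apply: cvgM; [exact: cvg_cst|exact: cvg_id].
have cF : continuous (fun u : R => k.+1%:R^-1 * sin (k.+1%:R * u)).
  by move=> x; apply: cvgM; [exact: cvg_cst|apply: cl; exact: continuous_sin].
rewrite (@continuous_FTC2 R _ (fun u : R => k.+1%:R^-1 * sin (k.+1%:R * u)))//.
- by rewrite sin_natpi !mulr0 sin0 mulr0 -EFinB subrr.
- by apply: continuous_subspaceT; apply: cl; exact: continuous_cos.
- split; [by move=> x _; have [] := dF x|by apply: cvg_at_right_filter; exact: cF|].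
  by apply: cvg_at_left_filter; exact: cF.
- by move=> x _; rewrite derive1E; have [_ ->] := dF x.
Qed.

Lemma integral_semicircle p :
  (\int[mu]_x (p.[x] * semicircle x)%:E =
   \int[mu]_(t in `[0%R, pi]) (p.[cos t] * sin t ^+ 2)%:E :> \bar R)%E.
Proof.
have pi0 := @pi_gt0 R.
transitivity (\int[mu]_(x in `[cos pi, cos 0]) (p.[x] * semicircle x)%:E)%E.
  rewrite cospi cos0 [RHS]integral_mkcond; apply: eq_integral => x _.
  rewrite patchE; case: ifPn => //.
  by rewrite mem_setE => h; rewrite semicircle_out// mulr0.
have dcos : (cos : R -> R)^`()%classic = (fun x => - sin x).
  by apply/funext => x; rewrite derive1E derive_val.
have csin : continuous (fun x : R => - sin x).
  by move=> x; apply: cvgN; exact: continuous_sin.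
rewrite (@integration_by_substitution_decreasing R cos).
- apply: eq_integral => t; rewrite inE/= in_itv/= => /andP[t0 tpi].
  congr (_%:E); rewrite dcos !fctE /= /semicircle -sin2cos2 sqrtr_sqr ger0_norm.
    by rewrite opprK -mulrA expr2.
  by rewrite sin_ge0_pi// t0.
- exact: ltW.
- move=> x y; rewrite !in_itv/= => hx hy xy.
  by rewrite ltr_cos// in_itv.
- by move=> x _; rewrite dcos; exact: csin.
- by rewrite dcos; apply/cvg_ex; eexists; apply: cvg_at_right_filter; exact: csin.
- by rewrite dcos; apply/cvg_ex; eexists; apply: cvg_at_left_filter; exact: csin.
- split; [by move=> x _; exact: derivable_cos|by apply: cvg_at_right_filter; exact: continuous_cos|].
  by apply: cvg_at_left_filter; exact: continuous_cos.
- by apply: continuous_subspaceT; exact: continuous_poly_semicircle.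
Qed.

Lemma cheb_orthogonal : orthogonal_polys semicircle (pi / 2) cheb.
Proof.
split; [exact: moments_semicircle|exact: size_cheb|move=> j k].
rewrite /moment /Rintegral integral_semicircle.
wlog kj : j k / (k <= j)%N.
  move=> H; have [|/ltnW] := leqP k j; first exact: H.
  by move=> /H; rewrite eq_sym mulrC.
have E (t : R) : ((cheb j * cheb k).[cos t] * sin t ^+ 2) =
   2^-1 * cos ((j - k)%:R * t) + - 2^-1 * cos ((j + k).+2%:R * t).
  rewrite hornerM expr2 mulrACA !cheb_cos.
  have -> : (j - k)%:R * t = j.+1%:R * t - k.+1%:R * t.
    by rewrite -mulrBl -natrB// subSS.
  have -> : (j + k).+2%:R * t = j.+1%:R * t + k.+1%:R * t.
    by rewrite -mulrDl -natrD addSn addnS.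
  by rewrite cosB cosD; field.
have ci c m : mu.-integrable `[0%R, pi] (EFin \o (fun t : R => c * cos (m%:R * t))).
  apply: continuous_compact_integrable; first exact: segment_compact.
  apply: continuous_subspaceT => x; apply: cvgM; first exact: cvg_cst.
  apply: (@continuous_comp _ _ _ (fun u : R => m%:R * u) cos); last exact: continuous_cos.
  by apply: cvgM; [exact: cvg_cst|exact: cvg_id].
have ci1 m : mu.-integrable `[0%R, pi] (EFin \o (fun t : R => cos (m%:R * t))).
  by apply: eq_integrable (ci 1 m) => // t _ /=; rewrite mul1r.
transitivity (\int[mu]_(t in `[0, pi]) (2^-1 * cos ((j - k)%:R * t) + - 2^-1 * cos ((j + k).+2%:R * t))).
  by apply: eq_Rintegral => t _; exact: E.
rewrite RintegralD// !RintegralZl// /Rintegral !integral_cos_nat/= !mulr0 addr0 subn_eq0.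
have -> : (j <= k)%N = (j == k) by rewrite eqn_leq kj andbT.
by rewrite mulrA [2^-1 * _]mulrC.
Qed.

Lemma cheb_sqr_le k z : -1 <= z <= 1 -> (cheb k).[z] ^+ 2 * (1 - z ^+ 2) <= 1.
Proof.
move=> z1; have zE : cos (acos z) = z by rewrite acosK// in_itv.
rewrite -zE -sin2cos2 -exprMn cheb_cos.
by have := sin2cos2 (k.+1%:R * acos z); have := sqr_ge0 (cos (k.+1%:R * acos z)); lra.
Qed.

(** Each term of the kernel sum is at most 1 after multiplication by [1 - z^2], because
    [U_k(cos t) sin t] is a sine. The factor [2 / pi] is at most 1 and is dropped. *)
Lemma nikolskii n p z : (size p <= n)%N -> -1 <= z <= 1 ->
  p.[z] ^+ 2 * (1 - z ^+ 2) <= n%:R * moment semicircle (p ^+ 2).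
Proof.
move=> sp z1; have pi2 : 0 < pi / 2 :> R by rewrite divr_gt0// pi_gt0.
have h := reproducing_bound z cheb_orthogonal pi2 sp.
have z20 : 0 <= 1 - z ^+ 2.
  by move: z1 => /andP[? ?]; nra.
have m0 : 0 <= moment semicircle (p ^+ 2).
  by apply: moment_ge0 => x; [exact: sqrtr_ge0|rewrite horner_exp sqr_ge0].
apply: le_trans (ler_wpM2r z20 h) _; rewrite mulrAC ler_wpM2r//.
rewrite -mulrA mulr_suml.
have : \sum_(0 <= k < n) (cheb k).[z] ^+ 2 * (1 - z ^+ 2) <= n%:R.
  apply: (@le_trans _ _ (\sum_(0 <= k < n) 1)); last by rewrite sumr_const_nat subn0.
  by apply: ler_sum => k _; exact: cheb_sqr_le.
have s0 : 0 <= \sum_(0 <= k < n) (cheb k).[z] ^+ 2 * (1 - z ^+ 2).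
  by apply: sumr_ge0 => k _; rewrite mulr_ge0// sqr_ge0.
apply: le_trans; rewrite ler_piMl// invf_le1//; exact: pihalf_ge1.
Qed.

(** Here [z] is the Joukowski image of [rho], and [e = 1 / rho]. The invariant
    [U_(k+1) = rho^(k+1) + e U_k] replaces the alternating recurrence by one with positive terms. *)
Lemma cheb_out k z (rho e : R) : 0 < e -> e <= 1 -> rho * e = 1 -> rho + e = 2 * z ->
  0 <= (cheb k).[z] <= k.+1%:R * rho ^+ k.
Proof.
move=> e0 e1 re rz.
have r1 : 1 <= rho.
  by have : rho = e^-1; [apply: (mulIf (lt0r_neq0 e0)); rewrite re mulVf// lt0r_neq0|move=> ->; rewrite invf_ge1].
suff : [/\ 0 <= (cheb k).[z], (cheb k).[z] <= k.+1%:R * rho ^+ k &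
    (cheb k.+1).[z] = rho ^+ k.+1 + e * (cheb k).[z]] by case=> -> ->.
elim: k => [|k [ih0 ih1 ih2]].
  rewrite cheb0 cheb1 hornerC hornerZ hornerX; split; [exact: ler01|by rewrite mul1r expr0|].
  by rewrite mulr1 expr1 rz.
have rp : 0 < rho := lt_le_trans ltr01 r1.
split.
- by rewrite ih2 addr_ge0// ?exprn_ge0 ?mulr_ge0// ltW.
- rewrite ih2 -natr1 mulrDl mul1r addrC lerD2r.
  apply: (@le_trans _ _ (1 * (cheb k).[z])); first by rewrite ler_wpM2r.
  rewrite mul1r (le_trans ih1)// ler_wpM2l// exprS ler_peMl// exprn_ge0// ltW//.
- rewrite chebSS hornerD hornerN hornerM hornerZ hornerX ih2 -rz !exprS.
  have : rho * e * (cheb k).[z] = (cheb k).[z] by rewrite re mul1r.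
  move: (rho ^+ k) (cheb k).[z] => a b H.
  apply/eqP; rewrite -subr_eq0; apply/eqP; transitivity (rho * e * b - b); first by ring.
  by rewrite H subrr.
Qed.

(** If [r = 1 + d] with [d > 0], Bernoulli gives [r^(4 m) >= (m d)^4], which is incompatible with a
    bound cubic in [m]. *)
Lemma exp_poly_le1 (r : R) (N : nat) : 0 <= r ->
  (forall m : nat, (0 < m)%N -> r ^+ m <= (m * N).+1%:R ^+ 3) -> r <= 1.
Proof.
move=> r0 H; rewrite leNgt; apply/negP => r1.
pose d := r - 1; have d0 : 0 < d by rewrite subr_gt0.
have bern m : m%:R * d <= r ^+ m.
  elim: m => [|m ih]; first by rewrite mul0r expr0.
  rewrite exprS -natr1.
  have : 1 <= r ^+ m by rewrite exprn_ege1// ltW.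
  by move: ih; rewrite /d; set x := r ^+ m; nra.
pose M := (4 * N).+1%:R ^+ 3 / d ^+ 4 : R.
have M0 : 0 <= M by rewrite divr_ge0 ?exprn_ge0// ltW.
have := archi_boundP M0; set m := Num.bound M => Mm.
have m0 : (0 < m)%N by rewrite -(ltr_nat R) (le_lt_trans M0).
have mp : 0 < (m%:R : R) by rewrite ltr0n.
have h1 : (m%:R * d) ^+ 4 <= (m%:R * (4 * N).+1%:R) ^+ 3.
  apply: (@le_trans _ _ (r ^+ (m * 4))).
    by rewrite exprM lerXn2r ?nnegrE ?mulr_ge0 ?exprn_ge0 ?(ltW d0).
  apply: le_trans (H _ _) _; first by rewrite muln_gt0 m0.
  rewrite lerXn2r ?nnegrE ?mulr_ge0// -natrM ler_nat; lia.
move: Mm; rewrite /M ltr_pdivrMr ?exprn_gt0// ltNge; apply/negP/negPn.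
move: h1; rewrite !exprMn => h1; rewrite -(ler_pM2l (exprn_gt0 3 mp)).
by apply: le_trans h1; rewrite mulrA -exprSr.
Qed.

(** A power trick replaces the maximum principle. The reproducing bound for [p^m] gives [|p(z)|^(2
    m) <= (m N + 1)^3 (M rho^N)^(2 m)], and the polynomial factor is removed by letting [m] grow. *)
Lemma bernstein_walsh N p M z (rho e : R) : (size p <= N.+1)%N -> 0 < M ->
  (forall t, -1 <= t <= 1 -> `|p.[t]| <= M) ->
  0 < e -> e <= 1 -> rho * e = 1 -> rho + e = 2 * z ->
  `|p.[z]| <= M * rho ^+ N.
Proof.
move=> sp M0 pM e0 e1 re rz.
have r1 : 1 <= rho.
  by have : rho = e^-1; [apply: (mulIf (lt0r_neq0 e0)); rewrite re mulVf// lt0r_neq0|move=> ->; rewrite invf_ge1].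
have rp : 0 < rho := lt_le_trans ltr01 r1.
have pi2 : 0 < pi / 2 :> R by rewrite divr_gt0// pi_gt0.
have D0 : 0 < M * rho ^+ N by rewrite mulr_gt0// exprn_gt0.
suff : (`|p.[z]| / (M * rho ^+ N)) ^+ 2 <= 1.
  by rewrite expr_le1 ?divr_ge0 ?(ltW D0)// ler_pdivrMr// mul1r.
apply: (@exp_poly_le1 _ N); first exact: sqr_ge0.
move=> m m0.
have spm : (size (p ^+ m) <= (m * N).+1)%N.
  apply: leq_trans (size_poly_exp_leq _ _) _; rewrite ltnS mulnC leq_mul2l; apply/orP; right.
  by move: sp; case: (size p).
have h := reproducing_bound z cheb_orthogonal pi2 spm.
have hm : moment semicircle ((p ^+ m) ^+ 2) <= M ^+ (2 * m) * (pi / 2).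
  have -> : M ^+ (2 * m) * (pi / 2) = moment semicircle ((M ^+ (2 * m))%:P).
    have [_ _ o] := cheb_orthogonal; have := o 0%N 0%N.
    rewrite cheb0 mulr1 eqxx mulr1 => <-; rewrite -momentZ; last exact: moments_semicircle.
    by rewrite -mul_polyC mulr1.
  apply: le_Rintegral => //; [exact: moments_semicircle|exact: moments_semicircle|].
  move=> x _; have [x1|x1] := boolP (x \in `[-1, 1]); last by rewrite semicircle_out// !mulr0.
  rewrite ler_wpM2r ?sqrtr_ge0// hornerC !horner_exp -exprM mulnC.
  rewrite exprM [leRHS]exprM lerXn2r ?nnegrE ?sqr_ge0//.
  rewrite -real_normK ?num_real// lerXn2r ?nnegrE ?(ltW M0)//.
  by apply: pM; move: x1; rewrite in_itv.
have hs : \sum_(0 <= k < (m * N).+1) (cheb k).[z] ^+ 2 <= (m * N).+1%:R ^+ 3 * rho ^+ (2 * (m * N)).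
  apply: (@le_trans _ _ (\sum_(0 <= k < (m * N).+1) (m * N).+1%:R ^+ 2 * rho ^+ (2 * (m * N)))); last first.
    by rewrite sumr_const_nat subn0 -[leLHS]mulr_natl mulrA -exprS.
  rewrite big_nat_cond [leRHS]big_nat_cond; apply: ler_sum => k /andP[/andP[_ kn] _].
  have /andP[c0 c1] := cheb_out k e0 e1 re rz.
  rewrite [X in rho ^+ X]mulnC exprM -exprMn lerXn2r ?nnegrE ?mulr_ge0 ?exprn_ge0 ?(ltW rp)//.
  apply: le_trans c1 _; apply: ler_pM => //; first by rewrite exprn_ge0// ltW.
    by rewrite ler_nat.
  by rewrite ler_weXn2l.
have s0 : 0 <= \sum_(0 <= k < (m * N).+1) (cheb k).[z] ^+ 2.
  by apply: sumr_ge0 => i _; exact: sqr_ge0.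
have m0' : 0 <= moment semicircle ((p ^+ m) ^+ 2).
  by apply: moment_ge0 => x; [exact: sqrtr_ge0|rewrite horner_exp sqr_ge0].
rewrite -exprM expr_div_n ler_pdivrMr ?exprn_gt0//.
rewrite (_ : `|p.[z]| ^+ (2 * m) = (p ^+ m).[z] ^+ 2); last first.
  by rewrite horner_exp -[RHS]real_normK ?num_real// normrX -exprM mulnC.
apply: le_trans h _; have ip : 0 <= (pi / 2)^-1 :> R by rewrite invr_ge0 ltW.
apply: (@le_trans _ _ ((pi / 2)^-1 * ((m * N).+1%:R ^+ 3 * rho ^+ (2 * (m * N))) * (M ^+ (2 * m) * (pi / 2)))).
  by apply: ler_pM => //; [exact: mulr_ge0|rewrite ler_wpM2l].
rewrite exprMn -exprM (_ : (N * (2 * m))%N = (2 * (m * N))%N); last by rewrite mulnCA [(N * m)%N]mulnC.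
rewrite le_eqVlt; apply/orP; left; apply/eqP; move: (rho ^+ _) (M ^+ _) (pi / 2) pi2 => u v w w0; field.
exact: lt0r_neq0.

Qed.

End Chebyshev.

(** * Peaking polynomials from the logistic map *)

Section Logistic.
Context {R : realType}.
Local Notation mu := (@lebesgue_measure R).
Implicit Types (p : {poly R}) (c r t u x y z : R).

(* [logP j] at [sin^2 a] is [sin^2 (2^j a)]. *)
Fixpoint logP (j : nat) : {poly R} :=
  if j is i.+1 then 4 *: (logP i * (1 - logP i)) else 'X.

(** The quotient of [logP j] by its argument: at [sin^2 a] it is the Fejer kernel
    [sin^2(2^j a) / sin^2 a], with peak value [4^j] at 0. *)
Fixpoint logQ (j : nat) : {poly R} :=
  if j is i.+1 then 4 *: (logQ i * (1 - logP i)) else 1.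

Lemma logPS j y : (logP j.+1).[y] = 4 * ((logP j).[y] * (1 - (logP j).[y])).
Proof. by rewrite /= hornerZ hornerM hornerD hornerN hornerC. Qed.

Lemma logQS j y : (logQ j.+1).[y] = 4 * ((logQ j).[y] * (1 - (logP j).[y])).
Proof. by rewrite /= hornerZ hornerM hornerD hornerN hornerC. Qed.

Lemma logPQ j y : (logP j).[y] = y * (logQ j).[y].
Proof.
elim: j => [|j ih]; first by rewrite /= hornerX hornerC mulr1.
by rewrite logPS logQS {1}ih; ring.
Qed.

Lemma size_logP j : (size (logP j) <= (2 ^ j).+1)%N.
Proof.
elim: j => [|j ih]; first by rewrite size_polyX.
rewrite /= (leq_trans (size_scale_leq _ _))// (leq_trans (size_polyMleq _ _))//.
have : (size (1 - logP j)%R <= (2 ^ j).+1)%N.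
  by rewrite (leq_trans (size_polyD _ _))// geq_max size_polyN ih size_poly1 ltnS.
by move: ih; rewrite expnS; move: (size (logP j)) (size (1 - logP j)%R) (2 ^ j)%N => a b e; lia.
Qed.

Lemma size_logQ j : (size (logQ j) <= 2 ^ j)%N.
Proof.
elim: j => [|j ih]; first by rewrite size_poly1.
rewrite /= (leq_trans (size_scale_leq _ _))// (leq_trans (size_polyMleq _ _))//.
have : (size (1 - logP j)%R <= (2 ^ j).+1)%N.
  by rewrite (leq_trans (size_polyD _ _))// geq_max size_polyN size_logP size_poly1 ltnS.
by move: ih; rewrite expnS; move: (size (logQ j)) (size (1 - logP j)%R) (2 ^ j)%N => a b e; lia.
Qed.

Lemma logP01 j y : 0 <= y <= 1 -> 0 <= (logP j).[y] <= 1.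
Proof.
move=> hy; elim: j => [|j /andP[h0 h1]]; first by rewrite /= hornerX.
rewrite logPS; move: h0 h1; set a := (logP j).[y] => h0 h1.
apply/andP; split; first by rewrite !mulr_ge0// subr_ge0.
have := sqr_ge0 (2 * a - 1); nra.
Qed.

(** [logQ j / 4^j] is the product of the factors [1 - logP i] with [i < j], each at least
    [1 - 4^i y]; the 1/3 comes from [1 + 4 + ... + 4^(j-1) <= 4^j / 3]. *)
Lemma logQ_bounds j y : 0 <= y <= 1 ->
  [/\ 0 <= (logQ j).[y], (logQ j).[y] <= 4 ^+ j, y * (logQ j).[y] <= 1 &
      4 ^+ j * (1 - 4 ^+ j * y / 3) <= (logQ j).[y]].
Proof.
move=> hy; have /andP[y0 y1] := hy.
have h j' := logP01 j' hy.
have H3 i : y * (logQ i).[y] <= 1 by rewrite -logPQ; have /andP[] := h i.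
suff : [/\ 0 <= (logQ j).[y], (logQ j).[y] <= 4 ^+ j &
      4 ^+ j * (1 - 4 ^+ j * y / 3) <= (logQ j).[y]] by case.
elim: j => [|j [ih0 ih1 ih3]].
  by rewrite /= hornerC expr0; split=> //; lra.
have /andP[l0 l1] := h j.
rewrite logQS exprS; split.
- by rewrite !mulr_ge0// subr_ge0.
- rewrite ler_pM2l// (le_trans _ ih1)// ler_piMr//; lra.
- rewrite -[leLHS]mulrA ler_pM2l//.
  have ll : (logP j).[y] <= 4 ^+ j * y by rewrite logPQ mulrC ler_wpM2r.
  have e0 : (0 : R) < 4 ^+ j by rewrite exprn_gt0.
  set a := 4 ^+ j in ih1 ih3 ll e0 *; set L := (logP j).[y] in l0 l1 ll *.
  apply: (@le_trans _ _ ((logQ j).[y] - a * L)).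
    have : a * L <= a * (a * y) by rewrite ler_wpM2l// ltW.
    by move: ih3; lra.
  rewrite mulrBr mulr1 lerD2l lerN2 ler_wpM2r//.
Qed.

Lemma logP_large j y : 0 <= y <= 1 -> 1 / 4 <= 4 ^+ j * y -> 4 ^+ j * y <= 1 ->
  1 / 6 <= (logP j).[y].
Proof.
move=> hy h1 h2; have [_ _ _ h] := logQ_bounds j hy; have /andP[y0 _] := hy.
rewrite logPQ; apply: (@le_trans _ _ (y * (4 ^+ j * (1 - 4 ^+ j * y / 3)))).
  by rewrite mulrA [y * _]mulrC; set a := 4 ^+ j * y in h1 h2 *; nra.
by rewrite ler_wpM2l.
Qed.

Lemma quaternary_pos y : 0 < y -> y <= 1 -> exists i, 1 / 4 <= 4 ^+ i * y <= 1.
Proof.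
move=> y0 y1.
have ex : exists i, 1 < 4 ^+ i.+1 * y.
  exists (Num.bound y^-1); rewrite -ltr_pdivrMr// div1r.
  apply: lt_trans (archi_boundP _) _; first by rewrite invr_ge0 ltW.
  by rewrite -natrX ltr_nat (ltn_trans _ (ltn_expl _ _)).
case: (ex_minnP ex) => -[|i] Hi mi.
  exists 0%N; rewrite expr0 mul1r; apply/andP; split=> //; move: Hi; rewrite expr1; lra.
exists i.+1; apply/andP; split; first by move: Hi; rewrite exprS; lra.
by rewrite leNgt; apply/negP => /mi; rewrite ltnn.
Qed.

Definition affine c r p := p \Po (r *: 'X + c%:P).

Lemma affineE c r p u : (affine c r p).[u] = p.[c + r * u].
Proof. by rewrite horner_comp hornerD hornerZ hornerX hornerC addrC. Qed.

Lemma size_affine c r p : (size (affine c r p) <= size p)%N.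
Proof.
have [->|p0] := eqVneq p 0; first by rewrite /affine comp_poly0 size_poly0.
apply: leq_trans (size_comp_poly_leq _ _) _.
have : (size (r *: 'X + c%:P)%R <= 2)%N.
  rewrite (leq_trans (size_polyD _ _))// geq_max (leq_trans (size_scale_leq _ _)) ?size_polyX//=.
  by rewrite (leq_trans (size_polyC_leq1 _)).
move: p0; rewrite -size_poly_gt0; set a := size p; set b := size _ => a0 b2.
have : (a.-1 * b.-1 <= a.-1 * 1)%N by rewrite leq_mul2l; apply/orP; right; lia.
lia.
Qed.

Lemma nikolskii_scaled n p c r z (f : R -> R) : 0 < r -> (size p <= n)%N -> -1 <= z <= 1 ->
  (forall u, -1 <= u <= 1 -> p.[c + r * u] ^+ 2 * semicircle u <= f (c + r * u)) ->
  (forall t, 0 <= f t) -> continuous f -> mu.-integrable setT (EFin \o f) ->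
  p.[c + r * z] ^+ 2 * (1 - z ^+ 2) <= n%:R / r * \int[mu]_t f t.
Proof.
move=> r0 sp hz hf f0 cf intf.
have spa := leq_trans (size_affine c r p) sp.
have := nikolskii spa hz; rewrite affineE => /le_trans; apply.
rewrite -mulrA ler_wpM2l// mulrC ler_pdivlMr//.
rewrite -lee_fin EFinM.
have -> : (\int[mu]_t f t)%:E = (\int[mu]_t (f t)%:E)%E.
  by rewrite /Rintegral fineK// integrable_fin_num.
have -> : (moment semicircle (affine c r p ^+ 2))%:E = (\int[mu]_t ((affine c r p ^+ 2).[t] * semicircle t)%:E)%E.
  by rewrite /moment /Rintegral fineK// integrable_fin_num//; exact: moments_semicircle.
pose F (u : R) := c + r * u.
have dF (x : R) : is_derive x 1 F r.
  have := is_deriveD (is_derive_cst c x (1 : R)) (is_deriveZ r (is_derive_id x (1 : R))).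
  by rewrite add0r /GRing.scale/= mulr1 (_ : F = cst c + (r \*: id)).
have dFE : F^`()%classic = cst r by apply/funext => x; rewrite derive1E; have [_ ->] := dF x.
have cF : continuous F.
  move=> x; apply: cvgD; [exact: cvg_cst|apply: cvgM; [exact: cvg_cst|exact: cvg_id]].
have mf (D : set R) : measurable_fun D (fun t => (f t)%:E).
  by apply/measurable_EFinP; apply: measurable_funTS; exact: continuous_measurable_fun.
have cfF : continuous (f \o F).
  by move=> x; apply: (@continuous_comp _ _ _ F f); [exact: cF|exact: cf].
have mfF (D : set R) : measurable_fun D (fun t => ((f \o F) t)%:E).
  by apply/measurable_EFinP; apply: measurable_funTS; exact: continuous_measurable_fun.
have F1 : F (-1) <= F 1 by rewrite /F lerD2l ler_pM2l//; lra.
have sub : (\int[mu]_(u in `[(-1)%R, 1%R]) ((f \o F) u)%:E * r%:E <= \int[mu]_t (f t)%:E)%E.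
  rewrite muleC -ge0_integralZl//; last 3 first.
  - exact: mfF.
  - by move=> u _; rewrite lee_fin f0.
  - by rewrite lee_fin ltW.
  have -> : (\int[mu]_(x in `[(-1)%R, 1%R]) (r%:E * ((f \o F) x)%:E) = \int[mu]_(x in `[F (-1)%R, F 1%R]) (f x)%:E)%E.
    rewrite (@integration_by_substitution_increasing R F f)//.
    - by apply: eq_integral => u _; rewrite dFE -EFinM mulrC.
    - by move=> x y _ _ xy; rewrite /F ltrD2l ltr_pM2l.
    - by move=> x _; rewrite dFE; exact: cvg_cst.
    - by rewrite dFE; apply/cvg_ex; eexists; exact: cvg_cst.
    - by rewrite dFE; apply/cvg_ex; eexists; exact: cvg_cst.
    - split; [by move=> x _; have [] := dF x|by apply: cvg_at_right_filter; exact: cF|].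
      by apply: cvg_at_left_filter; exact: cF.
    - exact: continuous_subspaceT.
  by apply: ge0_subset_integral; [exact: measurable_itv|exact: measurableT|exact: mf|move=> x _; rewrite lee_fin f0|].
apply: le_trans sub; rewrite lee_wpmul2r//; first by rewrite lee_fin ltW.
rewrite [leRHS]integral_mkcond; apply: ge0_le_integral => //.
- by move=> u _; rewrite lee_fin mulr_ge0 ?sqrtr_ge0// horner_exp sqr_ge0.
- by apply/measurable_EFinP; apply: continuous_measurable_fun; exact: continuous_poly_semicircle.
- apply/(measurable_restrictT _ _).1 => //; exact: mfF.
move=> u _; rewrite patchE; case: ifPn; rewrite mem_setE => hu.
  by rewrite lee_fin horner_exp affineE hf//; move: hu; rewrite in_itv.
by rewrite semicircle_out// mulr0.
Qed.

(** Number of copies of the factor attached to the scale [2^-i]. Where [logP i] is at least 1/6, one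
    copy is at most [1 - 1/12 <= exp(-1/12)], so 12 copies are needed per unit of exponent; the
    successor turns the truncation into an upper bound. *)
Definition bump_mult (n : nat) (C th : R) (i : nat) : nat :=
  (Num.truncn (12 * C * n%:R * (th / 2) ^+ i)).+1.

Lemma size_prod_leq I (s : seq I) (F : I -> {poly R}) (d : I -> nat) :
  (forall i, (size (F i) <= (d i).+1)%N) ->
  (size (\prod_(i <- s) F i)%R <= (\sum_(i <- s) d i).+1)%N.
Proof.
move=> h; elim: s => [|i s ih]; first by rewrite !big_nil size_poly1.
rewrite !big_cons (leq_trans (size_polyMleq _ _))//.
by have := h i; move: ih; set a := size _; set b := size (F i); lia.
Qed.

Lemma size_exp_leq p d n : (size p <= d.+1)%N -> (size (p ^+ n) <= (d * n).+1)%N.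
Proof.
move=> h; apply: leq_trans (size_poly_exp_leq _ _) _; rewrite ltnS leq_mul2r.
by apply/orP; right; move: h; case: (size p).
Qed.

(* A polynomial of degree [O(n)] dominated by [exp (- C n |s|^(1+b))] with
   [2^-b = th]: one factor per dyadic scale down to [1 / n]. *)
Lemma interior_bump (C th : R) : 0 <= C -> 0 < th < 1 ->
  exists D : nat, forall n, (0 < n)%N -> exists S : {poly R},
    [/\ (size S <= (D * n).+1)%N, S.[0] = 1,
        forall s, -1 <= s <= 1 -> 0 <= S.[s] &
        forall s E, -1 <= s <= 1 ->
          (forall j, `|s| <= 1 / 2 ^+ j -> E <= C * n%:R * (th / 2) ^+ j) ->
          S.[s] <= expR (2 * C) * expR (- E)].
Proof.
move=> C0 /andP[th0 th1].
(* A copy at scale [i] has degree at most [2^(i+1)]. The multiplicities contribute the geometric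
   series [24 C n th^i]; their rounding contributes [2^(i+1)], which sums to [O(n)] since the scales
   stop at [2^J <= n]. *)
pose Dr := 24 * C / (1 - th) + 8; pose D := Num.bound Dr.
have th1' : 0 < 1 - th by rewrite subr_gt0.
have Dr0 : 0 <= Dr by rewrite addr_ge0// divr_ge0 ?(ltW th1')// mulr_ge0.
have DD : Dr <= D%:R by rewrite ltW// archi_boundP.
exists D => n n0.
have n1 : 1 <= (n%:R : R) by rewrite ler1n.
pose J := trunc_log 2 n.
have /andP[Jn nJ] : (2 ^ J <= n < 2 ^ J.+1)%N by apply: trunc_log_bounds.
pose N := bump_mult n C th.
have th20 : 0 <= th / 2 by rewrite divr_ge0// ltW.
have NZ i : 0 <= 12 * C * n%:R * (th / 2) ^+ i by rewrite !mulr_ge0 ?exprn_ge0.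
have NB i : 12 * C * n%:R * (th / 2) ^+ i < (N i)%:R.
  by have /andP[] := truncn_itv (NZ i).
have NU i : (N i)%:R <= 12 * C * n%:R * (th / 2) ^+ i + 1.
  by have /andP[h _] := truncn_itv (NZ i); rewrite /N /bump_mult -natr1 lerD2r.
pose F (i : nat) : {poly R} := (1 - 2^-1 *: (logP i \Po 'X^2)) ^+ N i.
pose S := \prod_(0 <= i < J.+1) F i.
have FE i s : (F i).[s] = (1 - 2^-1 * (logP i).[s ^+ 2]) ^+ N i.
  by rewrite /F horner_exp hornerD hornerN hornerC hornerZ horner_comp hornerXn.
have SE s : S.[s] = \prod_(0 <= i < J.+1) (F i).[s] by rewrite /S horner_prod.
have F01 i s : -1 <= s <= 1 -> 0 <= (F i).[s] <= 1.
  move=> hs; have s2 : 0 <= s ^+ 2 <= 1.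
    by rewrite sqr_ge0/=; move: hs => /andP[? ?]; nra.
  have /andP[l0 l1] := logP01 i s2.
  by rewrite FE exprn_ge0 ?exprn_ile1//; lra.
exists S; split.
- have sF i : (size (F i) <= (2 ^ i.+1 * N i).+1)%N.
    apply: size_exp_leq; rewrite (leq_trans (size_polyD _ _))// geq_max size_poly1 size_polyN ltnS leq0n/=.
    rewrite (leq_trans (size_scale_leq _ _))//.
    apply: leq_trans (size_comp_poly_leq _ _) _; rewrite size_polyXn/= ltnS expnS mulnC leq_mul2l/=.
    by have := size_logP i; case: (size _).
  apply: leq_trans (size_prod_leq _ sF) _; rewrite ltnS -(ler_nat R) natr_sum natrM.
  apply: (@le_trans _ _ (Dr * n%:R)); last by rewrite ler_wpM2r.
  have geo K : \sum_(0 <= i < K) th ^+ i <= (1 - th)^-1.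
    rewrite -[leRHS]mul1r ler_pdivlMr// mulrC.
    have -> : (1 - th) * \sum_(0 <= i < K) th ^+ i = 1 - th ^+ K.
      elim: K => [|K ih]; first by rewrite big_geq// mulr0 expr0 subrr.
      by rewrite big_nat_recr//= mulrDr ih exprS; ring.
    by rewrite gerBl exprn_ge0// ltW.
  have geo2 K : \sum_(0 <= i < K) (2 : R) ^+ i.+1 <= 2 * 2 ^+ K.
    elim: K => [|K ih]; first by rewrite big_geq// expr0 mulr1.
    by rewrite big_nat_recr//= !exprS; move: ih; lra.
  apply: (@le_trans _ _ (\sum_(0 <= i < J.+1) (24 * C * n%:R * th ^+ i + 2 ^+ i.+1))).
    apply: ler_sum => i _; rewrite natrM natrX.
    apply: (@le_trans _ _ (2 ^+ i.+1 * (12 * C * n%:R * (th / 2) ^+ i + 1))).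
      by rewrite ler_wpM2l// exprn_ge0.
    rewrite mulrDr mulr1 lerD2r expr_div_n exprS le_eqVlt; apply/orP; left; apply/eqP.
    by field; rewrite expf_neq0.
  rewrite big_split/= -mulr_sumr.
  have h1 : 24 * C * n%:R * \sum_(0 <= i < J.+1) th ^+ i <= 24 * C * n%:R * (1 - th)^-1.
    by rewrite ler_wpM2l// !mulr_ge0.
  have h2 := geo2 J.+1.
  have h3 : (2 : R) ^+ J.+1 <= 2 * n%:R by rewrite exprS ler_pM2l// -natrX ler_nat.
  have -> : Dr * n%:R = 24 * C * n%:R * (1 - th)^-1 + 8 * n%:R by rewrite /Dr; ring.
  apply: lerD; first exact: h1.
  by move: h2 h3; set a := \sum_(_ <= _ < _) _; set b := _ ^+ _; lra.
- rewrite SE big1// => i _; rewrite FE expr0n/= logPQ mul0r mulr0 subr0 expr1n//.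
- by move=> s hs; rewrite SE; apply: prodr_ge0 => i _; have /andP[] := F01 i s hs.
- move=> s E hs hE.
  have s2 : 0 <= s ^+ 2 <= 1.
    by rewrite sqr_ge0/=; move: hs => /andP[? ?]; nra.
  have S1 : S.[s] <= 1.
    rewrite SE; have : forall K, 0 <= \prod_(0 <= i < K) (F i).[s] <= 1.
      elim=> [|K /andP[ih0 ih1]]; first by rewrite big_geq// ler01 lexx.
      by have /andP[f0 f1] := F01 K s hs; rewrite big_nat_recr//= mulr_ge0// mulr_ile1.
    by move=> /(_ J.+1)/andP[].
  have e2C : E <= 2 * C -> S.[s] <= expR (2 * C) * expR (- E).
    move=> h; apply: (le_trans S1); rewrite -expRD -[leLHS]expR0 ler_expR; lra.
  (* Either [s] belongs to a scale [i <= J], whose factor alone gives the decay, or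
     [|s| <= 2^-(J+1) < 1 / n], where [E <= 2 C] and the trivial bound [S <= 1] is enough. *)
  have [i [hi Hi]] : exists i, (i <= J.+1)%N /\ (`|s| <= 1 / 2 ^+ i /\ ((i <= J)%N -> 1 / 6 <= (logP i).[s ^+ 2])).
    have [s00|sn0] := eqVneq s 0.
      exists J.+1; split=> //; split; last by rewrite ltnn.
      by rewrite s00 normr0 divr_ge0 ?ler01 ?exprn_ge0.
    have sp : 0 < s ^+ 2 by rewrite exprn_even_gt0.
    have [i /andP[i1 i2]] := quaternary_pos sp (proj2 (andP s2)).
    have si : `|s| <= 1 / 2 ^+ i.
      rewrite -(@ler_pXn2r _ 2) ?nnegrE ?divr_ge0 ?exprn_ge0//.
      rewrite real_normK ?num_real// expr_div_n expr1n ler_pdivlMr ?exprn_gt0//.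
      rewrite -exprM mulnC exprM (_ : 2 ^+ 2 = 4 :> R) 1?mulrC//; ring.
    have [iJ|Ji] := leqP i J.
      by exists i; split; [exact: leqW|split=> // _; exact: logP_large].
    exists J.+1; split=> //; split; last by rewrite ltnn.
    apply: (le_trans si); rewrite !div1r lef_pV2 ?posrE ?exprn_gt0//.
    by rewrite ler_weXn2l// ler1n.
  have [si Li] := Hi.
  have [iJ|Ji] := leqP i J; last first.
    apply: e2C; have := hE i si => /le_trans; apply.
    have -> : i = J.+1 by apply/eqP; rewrite eqn_leq hi Ji.
    apply: (@le_trans _ _ (C * n%:R * (1 / 2) ^+ J.+1)).
      rewrite ler_wpM2l// ?mulr_ge0//.
      have hh : (0 : R) <= 1 / 2 by lra.
      by rewrite lerXn2r ?nnegrE//; lra.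
    rewrite -mulrA [leRHS]mulrC ler_wpM2l// expr_div_n expr1n.
    rewrite mulrA ler_pdivrMr ?exprn_gt0// mulr1.
    apply: (@le_trans _ _ (2 ^+ J.+1)); first by rewrite -natrX ler_nat ltnW.
    by rewrite ler_peMl ?exprn_ge0//; lra.
  have l6 := Li iJ; have /andP[l0 l1] := logP01 i s2.
  apply: (@le_trans _ _ (expR (- E))); last first.
    rewrite ler_peMl ?expR_ge0// -[leLHS]expR0 ler_expR; lra.
  apply: (@le_trans _ _ (F i).[s]).
    rewrite SE (bigD1_seq i) ?mem_index_iota ?iota_uniq//.
    rewrite ler_piMr//; first by have /andP[] := F01 i s hs.
    by apply: prodr_ile1 => k _; exact: F01.
  rewrite FE; apply: (@le_trans _ _ (expR (- (1 / 12)) ^+ N i)).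
    rewrite lerXn2r ?nnegrE ?expR_ge0//; first by lra.
    apply: le_trans (expR_ge1Dx _); lra.
  rewrite -expRM_natl ler_expR mulrN lerN2.
  apply: (le_trans (hE i si)); have := NB i; lra.
Qed.

End Logistic.

Section LogisticOutside.
Context {R : realType}.
Implicit Types (X Y : R) (j : nat).

(* The logistic polynomial continued to arguments below [0], where it grows
   geometrically in [j]; [ms j] is its derivative. *)
Definition ml j X : R := - (logP j).[- X].

Fixpoint ms j X : R := if j is i.+1 then 4 * ms i X * (1 + 2 * ml i X) else 1.

Lemma ml0 X : ml 0 X = X. Proof. by rewrite /ml /= hornerX opprK. Qed.

Lemma mlS j X : ml j.+1 X = 4 * ml j X * (1 + ml j X).
Proof. by rewrite /ml logPS; ring. Qed.

Lemma ml_ge j X : 0 <= X -> 4 ^+ j * X <= ml j X.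
Proof.
move=> X0; elim: j => [|j ih]; first by rewrite ml0 expr0 mul1r.
have h : 0 <= 4 ^+ j * X by rewrite mulr_ge0 ?exprn_ge0.
rewrite mlS exprS -mulrA; move: ih h; set z := _ * X; nra.
Qed.

Lemma ml_ge0 j X : 0 <= X -> 0 <= ml j X.
Proof. by move=> X0; rewrite (le_trans _ (ml_ge j X0))// mulr_ge0 ?exprn_ge0. Qed.

Lemma ml_le j X : 0 <= X -> 1 + ml j X <= expR (4 ^+ j * X).
Proof.
move=> X0; elim: j => [|j ih]; first by rewrite ml0 expr0 mul1r expR_ge1Dx.
have m0 := ml_ge0 j X0.
rewrite mlS exprS -[4 * 4 ^+ j * X]mulrA expRM_natl.
apply: (@le_trans _ _ ((1 + ml j X) ^+ 4)).
  by move: m0; set m := ml j X => m0; rewrite !exprS expr0; nra.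
by rewrite lerXn2r ?nnegrE ?expR_ge0// addr_ge0.
Qed.

Lemma ms_ge j X : 0 <= X -> 4 ^+ j <= ms j X.
Proof.
move=> X0; elim: j => [|j ih]; first by rewrite expr0.
rewrite exprS /= -mulrA ler_pM2l//; have m0 := ml_ge0 j X0.
have h : (0 : R) <= 4 ^+ j by rewrite exprn_ge0.
by move: ih h m0; set s := ms j X; set z := 4 ^+ j; nra.
Qed.

Lemma ms_le j X : 0 <= X -> ms j X <= 4 ^+ j * expR (4 ^+ j * X).
Proof.
move=> X0; elim: j => [|j ih]; first by rewrite expr0 /= !mul1r -[leLHS]expR0 ler_expR.
have m0 := ml_ge0 j X0; have := ml_le j X0; rewrite /= !exprS.
set e := expR (4 ^+ j * X) in ih * => me.
have -> : expR (4 * 4 ^+ j * X) = e ^+ 4 by rewrite -mulrA expRM_natl.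
have e1 : 1 <= e by move: me m0; lra.
rewrite -mulrA -[leRHS]mulrA ler_pM2l//.
have h : 1 + 2 * ml j X <= e ^+ 2.
  apply: (@le_trans _ _ ((1 + ml j X) ^+ 2)); first by rewrite !expr2; nra.
  by rewrite lerXn2r ?nnegrE ?addr_ge0// (le_trans ler01).
apply: (@le_trans _ _ (4 ^+ j * e * e ^+ 2)).
  apply: ler_pM => //; first by rewrite (le_trans _ (ms_ge j X0))// exprn_ge0.
  by rewrite addr_ge0// mulr_ge0.
rewrite -mulrA ler_wpM2l ?exprn_ge0// -exprS ler_weXn2l//.
Qed.

Lemma ml_sep j X Y : 0 <= X -> 0 <= Y ->
  16 ^+ j * (Y - X) ^+ 2 <= (ml j Y - ml j X) ^+ 2.
Proof.
move=> X0 Y0; elim: j => [|j ih]; first by rewrite !ml0 expr0 mul1r.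
have m0 := ml_ge0 j X0; have n0 := ml_ge0 j Y0; rewrite !mlS exprS -mulrA.
move: ih m0 n0; set m := ml j X; set n := ml j Y; set z := _ * _ => ih m0 n0.
have -> : 4 * n * (1 + n) - 4 * m * (1 + m) = 4 * ((n - m) * (1 + m + n)) by ring.
rewrite exprMn (_ : 4 ^+ 2 = 16) ?ler_pM2l//; last by ring.
rewrite exprMn; apply: (le_trans ih); rewrite ler_peMr ?sqr_ge0// expr2; nra.
Qed.

(** One step maps [m] to [4 m (1 + m)], whose increment from [m] to [n] is its linear part plus
    exactly [4 (n - m)^2]. By [ml_sep] this square dominates [4 16^j (Y - X)^2]. *)
Lemma ml_convex j X Y : 0 <= X -> 0 <= Y ->
  ms j.+1 X * (Y - X) + 4 * 16 ^+ j * (Y - X) ^+ 2 <= ml j.+1 Y - ml j.+1 X.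
Proof.
move=> X0 Y0.
have step i : ms i X * (Y - X) <= ml i Y - ml i X ->
    ms i.+1 X * (Y - X) + 4 * 16 ^+ i * (Y - X) ^+ 2 <= ml i.+1 Y - ml i.+1 X.
  have m0 := ml_ge0 i X0; have sep := ml_sep i X0 Y0; rewrite !mlS /= => h.
  have -> : 4 * ml i Y * (1 + ml i Y) - 4 * ml i X * (1 + ml i X) =
    4 * (1 + 2 * ml i X) * (ml i Y - ml i X) + 4 * (ml i Y - ml i X) ^+ 2 by ring.
  apply: lerD; last by rewrite -mulrA ler_pM2l.
  rewrite (_ : _ * _ * _ * (Y - X) = 4 * (1 + 2 * ml i X) * (ms i X * (Y - X))); last by ring.
  by rewrite ler_wpM2l// mulr_ge0// addr_ge0// mulr_ge0.
apply: (step j); elim: j => [|j ih]; first by rewrite !ml0 /= mul1r.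
by apply: le_trans (step _ ih); rewrite lerDl mulr_ge0 ?sqr_ge0// mulr_ge0 ?exprn_ge0.
Qed.

(** The logarithmic derivative [X ms / ml] is at least 1 and is multiplied by
    [(1 + 2 m) / (1 + m) >= 3/2] at each step once [m = ml] is at least 1. Three steps give 27/8;
    [edge_far] needs a factor somewhat above 2. *)
Lemma ms_ratio j X : 1 <= 4 ^+ j * X -> 27 / 8 * ml j.+3 X <= X * ms j.+3 X.
Proof.
move=> X1; have X0 : 0 <= X by rewrite -(@pmulr_rge0 _ (4 ^+ j)) ?exprn_gt0// (le_trans ler01).
have base i : ml i X <= X * ms i X.
  elim: i => [|i ih]; first by rewrite ml0 /= mulr1.
  have m0 := ml_ge0 i X0; rewrite mlS /=; move: ih m0.
  set m := ml i X; set s := ms i X => ih m0.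
  have : m * (1 + 2 * m) <= (X * s) * (1 + 2 * m) by rewrite ler_wpM2r// addr_ge0// mulr_ge0.
  by nra.
have step i c : 0 <= c -> 1 <= ml i X -> c * ml i X <= X * ms i X -> (3 / 2 * c) * ml i.+1 X <= X * ms i.+1 X.
  move=> c0 m1 h; rewrite mlS /=; move: h m1.
  set m := ml i X; set s := ms i X => h m1.
  have m12 : 0 <= 1 + 2 * m by lra.
  have h1 : c * m * (1 + 2 * m) <= (X * s) * (1 + 2 * m) by rewrite ler_wpM2r.
  have h2 : c * m * (3 / 2 * (1 + m)) <= c * m * (1 + 2 * m) by rewrite ler_wpM2l ?mulr_ge0//; lra.
  by move: h1 h2; lra.
have big i : (j <= i)%N -> 1 <= ml i X.
  move=> ji; apply: le_trans (ml_ge _ X0); apply: (le_trans X1).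
  by rewrite ler_wpM2r// ler_weXn2l// ler1n.
have h1 := step j 1 ler01 (big _ (leqnn _)); rewrite mul1r in h1.
have {}h1 := h1 (base j).
have h2 := step j.+1 _ _ (big _ (leqnSn _)) h1.
have h3 := step j.+2 _ _ (big _ (leqW (leqnSn _))) (h2 _).
have E : 27 / 8 = 3 / 2 * (3 / 2 * (3 / 2 * 1)) :> R by field.
by rewrite E; apply: h3; lra.
Qed.

Lemma ml_geN1 j X : -1 <= X <= 0 -> -1 <= ml j X.
Proof. by move=> hX; rewrite /ml lerN2; have /andP[] := @logP01 R j (- X) ltac:(lra). Qed.

Lemma ml_le_max j X B : -1 <= X -> X <= B -> 0 <= B -> ml j X <= expR (4 ^+ j * B).
Proof.
move=> X1 XB B0; have [X0|/ltW X0] := leP 0 X.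
  have h := ml_le j X0; apply: (@le_trans _ _ (expR (4 ^+ j * X))); first by move: h; lra.
  by rewrite ler_expR ler_wpM2l// exprn_ge0.
apply: (@le_trans _ _ 0); last exact: expR_ge0.
by rewrite /ml oppr_le0; have /andP[] := @logP01 R j (- X) ltac:(lra).
Qed.

End LogisticOutside.

(** * Comparison of the exponent with a logistic polynomial near the edge *)

Section Edge.
Context {R : realType} (Q : R -> R) (K : nat) (A l : R).
Hypothesis hQ : regular Q K A l.
Local Notation q := (derive1 Q : R -> R).
Local Notation T := (growthT Q).
Local Notation curv := (curv K).
Implicit Types (x y t d r : R).

Let E0 : R := expR 64.

Section Compare.
Variables (x : R) (j : nat).
Hypothesis x0 : 0 < x.
Let d := j.+3.
Let u : R := (4 ^+ d)^-1.
(** The zero of the argument of [edgeV] lies at relative distance about [32 u] from [x]; [H1] keeps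
    this inside the range of [curv_local]. [H2] makes the quadratic gain of [ml_convex] exceed the
    Taylor remainder of [Q], where [E0 = exp 64] bounds [ms d (64 u) / 4^d]. *)
Hypothesis H1 : 2 ^+ (K + 6) * T x <= 4 ^+ d.
Hypothesis H2 : 8 * E0 * curv * T x <= 4 ^+ d.
Let L2 : R := 1 + 64 * u.
(* [edgeV] is convex to the right of the zero of its argument and stays in
   [[-1, 0]] to the left of it; [edgeA] makes [edgeA * edgeV] tangent to [Q] at
   [x], so that [(1 - edgeA (edgeV t - edgeV x) / N) ^ N] imitates
   [w t / w x] from below. *)
Definition edgeV t := ml d (L2 * (t / x) ^+ 2 - 1).
Definition edgeA := q x / (2 * L2 / x * ms d (64 * u)).

Lemma edge_u : 0 < u <= 1 / 64.
Proof.
rewrite /u invr_gt0 exprn_gt0//= -[leLHS]div1r ler_pdivrMr ?exprn_gt0//.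
rewrite /d !exprS; have : (1 : R) <= 4 ^+ j by rewrite exprn_ege1// ler1n.
move: (4 ^+ j) => z; clear -hQ H1 H2 x0; lra.
Qed.

Let ud : 4 ^+ d * u = 1. Proof. by rewrite /u divff// expf_neq0. Qed.
Let X64 : 4 ^+ d * (64 * u) = 64. Proof. by rewrite mulrCA ud mulr1. Qed.

Lemma edge_ms : 4 ^+ d <= ms d (64 * u) <= E0 * 4 ^+ d.
Proof.
have /andP[u0 u1] := edge_u; have X0 : 0 <= 64 * u by rewrite mulr_ge0// ltW.
rewrite ms_ge//= [E0 * _]mulrC; by have := ms_le d X0; rewrite X64.
Qed.

Lemma edgeV_x : edgeV x = ml d (64 * u).
Proof. by rewrite /edgeV divff ?gt_eqF// expr1n mulr1 /L2 addrC addKr. Qed.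

(** Inside the zero it is only known that [edgeV] is at least -1, so the right side may be as low as
    [- edgeA (edgeV x + 1)]. By then [Q] has dropped by [q x x de / 2], and [ms_ratio] shows that
    this is more. *)
Lemma edge_far t : `|t| <= x -> L2 * (t / x) ^+ 2 < 1 -> Q t - Q x <= edgeA * (edgeV t - edgeV x).
Proof.
move=> tx h; have /andP[u0 u1] := edge_u; have /andP[s1 s2] := edge_ms.
have X0 : 0 <= 64 * u by rewrite mulr_ge0// ltW.
have Qx := reg_gt0 hQ x0; have qx := reg_dgt0 hQ x0; have TE := growthTE hQ x0.
have L1 : 1 <= L2 by rewrite /L2; move: u0; clear -hQ H1 H2 x0 ud X64; lra.
have L22 : L2 <= 2 by rewrite /L2; move: u1; clear -hQ H1 H2 x0 ud X64; lra.
have m64 : 64 <= ml d (64 * u) by rewrite -[leLHS]X64 ml_ge.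
have c1 := curv_ge1 hQ.
pose de := 32 * u / L2; have de0 : 0 < de by rewrite divr_gt0// ?mulr_gt0// (lt_le_trans ltr01).
have deL : de * L2 = 32 * u by rewrite divfK// gt_eqF// (lt_le_trans ltr01).
have du : de <= 32 * u by rewrite -deL ler_peMr// ltW.
have de1 : de <= 1 / 2 by move: du u1; clear -hQ H1 H2 x0 ud X64; lra.
have tl : `|t| <= x * (1 - de).
  rewrite -ler_pdivrMl//; rewrite -(@ler_pXn2r _ 2) ?nnegrE ?mulr_ge0 ?invr_ge0 ?(ltW x0)//; last by move: de1; clear -hQ H1 H2 x0 ud X64; lra.
  rewrite exprMn real_normK ?num_real// -exprMn mulrC.
  rewrite -(@ler_pM2l _ L2) ?(lt_le_trans ltr01)//; apply: (le_trans (ltW h)).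
  have -> : L2 * (1 - de) ^+ 2 = L2 - 2 * (de * L2) + de * (de * L2) by ring.
  rewrite deL /L2; have : 0 <= de * (32 * u) by rewrite mulr_ge0 ?(ltW de0)// mulr_ge0// ltW.
  by clear -hQ H1 H2 x0 ud X64; lra.
have Qt : Q t <= Q (x * (1 - de)) := Q_homo_norm hQ tl.
have xd0 : 0 < x * (1 - de) by rewrite mulr_gt0//; move: de1; clear -hQ H1 H2 x0 ud X64; lra.
have TQ0 : 0 < T x * Q x by rewrite TE mulr_gt0.
have dT : 2 ^+ K.+1 * (de * T x) <= 1.
  apply: (@le_trans _ _ (2 ^+ (K + 6) * T x * u)).
    rewrite exprD exprS; have T1 := T_ge1 hQ x0.
    have k0 : 0 <= 2 ^+ K * T x by rewrite mulr_ge0 ?exprn_ge0 ?(le_trans ler01 T1).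
    have : 2 ^+ K * T x * de <= 2 ^+ K * T x * (32 * u) by rewrite ler_wpM2l.
    by rewrite (_ : 2 ^+ 6 = 64); [clear -hQ H1 H2 x0 ud X64; lra|clear -hQ H1 H2 x0 ud X64; ring].
  by rewrite -[leRHS]ud ler_wpM2r// ltW.
have loc := curv_local hQ x0 xd0.
have xE : x * (1 - de) - x = - (x * de) by ring.
have hloc : 2 ^+ K.+1 * (`|x * (1 - de) - x| * q x) <= Q x.
  rewrite xE normrN (gtr0_norm (mulr_gt0 x0 de0)).
  have -> : 2 ^+ K.+1 * (x * de * q x) = 2 ^+ K.+1 * (de * T x) * Q x.
    by rewrite -[RHS]mulrA -[de * T x * _]mulrA TE; ring.
  by rewrite ler_piMl ?(ltW Qx).
have {hloc}loc := loc hloc.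
have c2 : curv * (q x ^+ 2 / Q x) * (x * de) ^+ 2 = q x * x * de * (curv * T x * de).
  have -> : q x ^+ 2 / Q x = q x * T x / x.
    by rewrite /growthT; field; rewrite !gt_eqF.
  by field; rewrite gt_eqF.
have cT : curv * T x * de <= 1 / 2.
  have T1 := T_ge1 hQ x0; have cT0 : 0 <= curv * T x by rewrite mulr_ge0// (le_trans ler01).
  have h8 : curv * T x * (8 * E0) * u <= 1.
    rewrite -[leRHS]ud ler_wpM2r ?(ltW u0)//; move: H2; clear -hQ H1 H2 x0 ud X64; lra.
  have E64 : 64 <= E0 by rewrite (le_trans _ (expR_ge1Dx _))//; clear -hQ H1 H2 x0 ud X64; lra.
  have h3 : curv * T x * de <= curv * T x * (32 * u) by rewrite ler_wpM2l.
  have h4 : curv * T x * (64 * u) <= curv * T x * (E0 * u) by rewrite ler_wpM2l// ler_wpM2r// ltW.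
  by move: h8 h3 h4; clear -hQ H1 H2 x0 ud X64; lra.
have main : Q t - Q x <= - (q x * x * de / 2).
  move: loc; rewrite xE sqrrN c2.
  have : q x * x * de * (curv * T x * de) <= q x * x * de * (1 / 2) by rewrite ler_wpM2l// mulr_ge0 ?(ltW de0)// mulr_ge0// ltW.
  by move: Qt; clear -hQ H1 H2 x0 ud X64; lra.
apply: (le_trans main); rewrite edgeV_x -[leRHS]opprK lerN2 -mulrN opprB.
have V1 : -1 <= edgeV t.
  apply: ml_geN1; rewrite lerBrDr addNr mulr_ge0 ?sqr_ge0 ?(le_trans ler01 L1)//=.
  by rewrite subr_le0 ltW.
have hr := @ms_ratio R j (64 * u).
have {}hr := hr ltac:(move: X64; rewrite /d !exprS; clear -hQ H1 H2 x0 ud X64; lra).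
have s0 : 0 < ms d (64 * u) by rewrite (lt_le_trans _ s1)// exprn_gt0.
rewrite /edgeA; set m := ml d _ in m64 V1 hr *; set s := ms d _ in hr s0 *.
have L0 : 0 < L2 by rewrite (lt_le_trans ltr01).
have -> : q x / (2 * L2 / x * s) * (m - edgeV t) = q x * x * ((m - edgeV t) / (2 * L2 * s)).
  by field; rewrite !gt_eqF.
rewrite -[leRHS]mulrA ler_wpM2l ?(mulr_ge0 (ltW qx) (ltW x0))//.
rewrite ler_pdivrMr; last by rewrite mulr_gt0// mulr_gt0.
have -> : de / 2 * (2 * L2 * s) = (de * L2) * s by field.
rewrite deL; move: hr V1 m64; clear -hQ H1 H2 x0 ud X64; lra.
Qed.

(** The choice of [edgeA] makes the first-order terms in [t - x] agree. What is compared is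
    quadratic in [w = t / x - 1]: the remainder [curv T w^2] of [Q] against the gain of
    [ml_convex]. *)
Lemma edge_near t : 0 <= t -> t <= x * (1 + u) -> 1 <= L2 * (t / x) ^+ 2 ->
  Q t - Q x <= edgeA * (edgeV t - edgeV x).
Proof.
move=> t00 tx h; have /andP[u0 u1] := edge_u; have /andP[s1 s2] := edge_ms.
have X0 : 0 <= 64 * u by rewrite mulr_ge0// ltW.
have Qx := reg_gt0 hQ x0; have qx := reg_dgt0 hQ x0; have TE := growthTE hQ x0.
have L1 : 1 <= L2 by rewrite /L2; move: u0; clear -hQ H1 H2 x0 ud X64; lra.
pose w := t / x - 1; have tE : t = x * (1 + w) by rewrite /w; field; rewrite gt_eqF.
have wu : w <= u by move: tx; rewrite tE ler_pM2l// lerD2l.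
have w1 : -1 <= w by rewrite /w lerBrDr addNr divr_ge0// ltW.
have txw : t / x = 1 + w by rewrite /w; ring.
have wl : - (32 * u) <= w.
  rewrite leNgt; apply/negP => wl; move: h; rewrite txw leNgt => /negP; apply.
  have h1 : (1 + w) ^+ 2 < (1 - 32 * u) ^+ 2.
    by rewrite ltrXn2r ?nnegrE//; move: wl w1 u1; clear -hQ H1 H2 x0 ud X64; lra.
  have : L2 * (1 + w) ^+ 2 < L2 * (1 - 32 * u) ^+ 2 by rewrite ltr_pM2l// (lt_le_trans ltr01).
  move=> /lt_le_trans; apply; rewrite /L2.
  have -> : (1 + 64 * u) * (1 - 32 * u) ^+ 2 = 1 + (32 * u) ^+ 2 * (64 * u - 3) by ring.
  by rewrite gerDl mulr_ge0_le0 ?sqr_ge0//; move: u1; clear -hQ H1 H2 x0 ud X64; lra.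
have wn : `|w| <= 32 * u by rewrite ler_norml wl/=; move: wu u0; clear -hQ H1 H2 x0 ud X64; lra.
have t0 : 0 < t by rewrite tE mulr_gt0//; move: wl u1; clear -hQ H1 H2 x0 ud X64; lra.
have xE : t - x = x * w by rewrite tE; ring.
have T1 := T_ge1 hQ x0.
have dT : 2 ^+ K.+1 * (`|w| * T x) <= 1.
  apply: (@le_trans _ _ (2 ^+ (K + 6) * T x * u)).
    rewrite exprD exprS.
    have k0 : 0 <= 2 ^+ K * T x by rewrite mulr_ge0 ?exprn_ge0 ?(le_trans ler01 T1).
    have : 2 ^+ K * T x * `|w| <= 2 ^+ K * T x * (32 * u) by rewrite ler_wpM2l.
    by rewrite (_ : 2 ^+ 6 = 64); [clear -hQ H1 H2 x0 ud X64; lra|clear -hQ H1 H2 x0 ud X64; ring].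
  by rewrite -[leRHS]ud ler_wpM2r// ltW.
have loc := curv_local hQ x0 t0.
have hloc : 2 ^+ K.+1 * (`|t - x| * q x) <= Q x.
  rewrite xE normrM (gtr0_norm x0).
  have -> : 2 ^+ K.+1 * (x * `|w| * q x) = 2 ^+ K.+1 * (`|w| * T x) * Q x.
    by rewrite -[RHS]mulrA -[`|w| * T x * _]mulrA TE; ring.
  by rewrite ler_piMl ?(ltW Qx).
have {hloc}loc := loc hloc.
have c2 : curv * (q x ^+ 2 / Q x) * (x * w) ^+ 2 = q x * x * (curv * T x * w ^+ 2).
  have -> : q x ^+ 2 / Q x = q x * T x / x.
    by rewrite /growthT; field; rewrite !gt_eqF.
  by field; rewrite gt_eqF.
have Y0 : 0 <= L2 * (t / x) ^+ 2 - 1 by rewrite subr_ge0.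
have := @ml_convex R j.+2 (64 * u) _ X0 Y0; rewrite -/d -/(edgeV t) -edgeV_x.
have -> : L2 * (t / x) ^+ 2 - 1 - 64 * u = L2 * (2 * w + w ^+ 2) by rewrite txw /L2; ring.
have s0 : 0 < ms d (64 * u) by rewrite (lt_le_trans _ s1)// exprn_gt0.
have L0 : 0 < L2 by rewrite (lt_le_trans ltr01).
have A0 : 0 < edgeA by rewrite /edgeA divr_gt0// mulr_gt0// divr_gt0// mulr_gt0.
rewrite -(@ler_pM2l _ edgeA)// => /(le_trans _); apply.
rewrite mulrDr [edgeA * (ms _ _ * _)]mulrA.
have -> : edgeA * ms d (64 * u) = q x * x / (2 * L2).
  by rewrite /edgeA; field; rewrite !gt_eqF.
have -> : q x * x / (2 * L2) * (L2 * (2 * w + w ^+ 2)) = q x * x * (w + w ^+ 2 / 2).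
  by field; rewrite gt_eqF.
have -> : edgeA * (4 * 16 ^+ j.+2 * (L2 * (2 * w + w ^+ 2)) ^+ 2) =
   q x * x * (w ^+ 2 * (2 + w) ^+ 2 * (L2 * (2 * 16 ^+ j.+2 / ms d (64 * u)))).
  by rewrite /edgeA; field; rewrite !gt_eqF.
have key : curv * T x * w ^+ 2 <= w ^+ 2 * (2 + w) ^+ 2 * (L2 * (2 * 16 ^+ j.+2 / ms d (64 * u))).
  rewrite -[leRHS]mulrA mulrC ler_wpM2l ?sqr_ge0//.
  have w2 : 1 <= (2 + w) ^+ 2 by rewrite expr2; move: w1; clear -hQ H1 H2 x0 ud X64; nra.
  apply: (@le_trans _ _ (1 * (1 * (2 * 16 ^+ j.+2 / ms d (64 * u))))); last first.
    have z0 : 0 <= 2 * 16 ^+ j.+2 / ms d (64 * u) by rewrite divr_ge0 ?(ltW s0)// mulr_ge0// exprn_ge0.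
    by apply: ler_pM => //; [rewrite mul1r|rewrite ler_wpM2r].
  rewrite !mul1r ler_pdivlMr//.
  apply: (@le_trans _ _ (curv * T x * (E0 * 4 ^+ d))).
    by rewrite ler_wpM2l// mulr_ge0 ?(le_trans ler01 (curv_ge1 hQ))// (le_trans ler01).
  have -> : 16 ^+ j.+2 = 4 ^+ d * 4 ^+ d / 16 :> R.
    by rewrite /d !exprS (_ : 16 = 4 * 4 :> R) 1?exprMn; [field|ring].
  have p4 : 0 < (4 : R) ^+ d by rewrite exprn_gt0.
  have := ler_wpM2r (ltW p4) H2; clear -hQ H1 H2 x0 ud X64; lra.
move: loc; rewrite xE c2.
have qx0 : 0 <= q x * x by rewrite mulr_ge0// ltW.
have h1 := ler_wpM2l qx0 key.
have h2 : 0 <= q x * x * w ^+ 2 by rewrite mulr_ge0// sqr_ge0.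
by move: h1 h2; clear -hQ H1 H2 x0 ud X64; lra.
Qed.

Lemma edge_compare t : `|t| <= x * (1 + u) -> Q t - Q x <= edgeA * (edgeV t - edgeV x).
Proof.
move=> tx.
have VE : edgeV t = edgeV `|t| by rewrite /edgeV !expr_div_n real_normK ?num_real.
have NE : L2 * (t / x) ^+ 2 = L2 * (`|t| / x) ^+ 2 by rewrite !expr_div_n real_normK ?num_real.
have /andP[u0 _] := edge_u.
have [h|h] := ltP (L2 * (t / x) ^+ 2) 1.
  apply: edge_far => //; rewrite leNgt; apply/negP => xt.
  move: h; rewrite ltNge => /negP; apply; rewrite NE.
  have L1 : 1 <= L2 by rewrite /L2; move: u0; clear -hQ H1 H2 x0 ud X64; lra.
  by rewrite -[leLHS]mul1r ler_pM// exprn_ege1// ler_pdivlMr// mul1r ltW.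
by rewrite -(Q_norm hQ) VE; apply: edge_near => //; rewrite -NE.
Qed.

Lemma edgeV_le t : `|t| <= x * (1 + u) -> edgeV t <= expR 128.
Proof.
move=> tx; have /andP[u0 u1] := edge_u.
have L0 : 0 <= L2 by rewrite /L2 addr_ge0// mulr_ge0// ltW.
have h : (t / x) ^+ 2 <= (1 + u) ^+ 2.
  rewrite -[(t / x) ^+ 2]real_normK ?num_real// lerXn2r ?nnegrE//; first by rewrite addr_ge0// ltW.
  by rewrite normrM normfV (gtr0_norm x0) ler_pdivrMr// mulrC.
apply: (@le_trans _ _ (expR (4 ^+ d * (128 * u)))).
  apply: ml_le_max; last by rewrite mulr_ge0// ltW.
  - by rewrite lerBrDr addNr mulr_ge0// sqr_ge0.
  - have := ler_wpM2l L0 h; rewrite /L2; have : u * (64 * u * (2 + u)) <= u * (3 : R).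
      by rewrite ler_wpM2l ?(ltW u0)//; move: u0 u1; clear -hQ H1 H2 x0 ud X64; nra.
    move: u0 u1; clear -hQ H1 H2 x0 ud X64 => u0 u1 a b; move: b; rewrite expr2.
    have : u * u <= u by rewrite ler_piMr ?(ltW u0)//; lra.
    by move: a; rewrite -!expr2; nra.
by rewrite ler_expR mulrCA ud mulr1.
Qed.

Lemma edgeA_bounds : 0 < edgeA <= T x * Q x / 4 ^+ d.
Proof.
have /andP[u0 u1] := edge_u; have /andP[s1 s2] := edge_ms.
have qx := reg_dgt0 hQ x0; have TE := growthTE hQ x0.
have s0 : 0 < ms d (64 * u) by rewrite (lt_le_trans _ s1)// exprn_gt0.
have L1 : 1 <= L2 by rewrite /L2; move: u0; clear -hQ H1 H2 x0 ud X64; lra.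
have L0 : 0 < L2 by rewrite (lt_le_trans ltr01).
have A0 : 0 < edgeA by rewrite /edgeA divr_gt0// mulr_gt0// divr_gt0// mulr_gt0.
rewrite A0/= /edgeA.
rewrite TE (_ : q x / _ = x * q x / (2 * L2 * ms d (64 * u))); last by field; rewrite !gt_eqF.
have D0 : 0 < 2 * L2 * ms d (64 * u) by rewrite mulr_gt0// mulr_gt0.
have p0 : 0 < (4 : R) ^+ d by rewrite exprn_gt0.
rewrite ler_wpM2l ?(mulr_ge0 (ltW x0) (ltW qx))// lef_pV2 ?posrE//.
apply: (le_trans s1); rewrite ler_peMl ?(ltW s0)//; move: L1; clear -hQ H1 H2 x0 ud X64; lra.
Qed.

End Compare.
End Edge.

(** * Christoffel functions *)

Section CauchyKernel.
Context {R : realType}.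
Local Notation mu := (@lebesgue_measure R).
Implicit Types (c h x t : R) (G : R -> R).

Lemma integral_affine c h G : 0 < h -> continuous G -> (forall x, 0 <= G x) ->
  (\int[mu]_x (G x)%:E = \int[mu]_u (G (c + h * u) * h)%:E)%E.
Proof.
move=> h0 cG G0; pose F (u : R) := c + h * u.
have dF (x : R) : is_derive x 1 F h.
  have := is_deriveD (is_derive_cst c x (1 : R)) (is_deriveZ h (is_derive_id x (1 : R))).
  by rewrite add0r /GRing.scale/= mulr1 (_ : F = cst c + (h \*: id)).
have dFE : F^`()%classic = cst h by apply/funext => x; rewrite derive1E; have [_ ->] := dF x.
rewrite (@increasing_ge0_integration_by_substitutionT R F G)//.
- by apply: eq_integral => u _; rewrite dFE.
- by move=> x y xy; rewrite /F ltrD2l ltr_pM2l.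
- by rewrite dFE => x; exact: cvg_cst.
- by rewrite dFE; exact: is_cvg_cst.
- by rewrite dFE; exact: is_cvg_cst.
- rewrite /F; apply/cvgrNyPle => B; near=> u.
  by rewrite -lerBrDl -ler_pdivlMl//; near: u; exact: nbhs_ninfty_le.
- rewrite /F; apply/cvgryPge => B; near=> u.
  by rewrite -lerBlDl -ler_pdivrMl//; near: u; exact: nbhs_pinfty_ge.
Unshelve. all: by end_near. Qed.

Lemma integral_reflect G : continuous G -> (forall x, 0 <= G x) ->
  (\int[mu]_x (G x)%:E = \int[mu]_x (G (- x))%:E)%E.
Proof.
move=> cG G0.
have cGN : continuous (G \o -%R).
  by move=> x; apply: continuous_comp; [exact: opp_continuous|exact: cG].
have split (F : R -> R) : continuous F -> (forall x, 0 <= F x) -> (\int[mu]_x (F x)%:E =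
    \int[mu]_(x in `]-oo, (- 0)%R]) (F x)%:E + \int[mu]_(x in `[0%R, +oo[) (F x)%:E)%E.
  move=> cF F0.
  have mF (D : set R) : measurable_fun D (EFin \o F).
    by apply/measurable_EFinP; apply: measurable_funTS; exact: continuous_measurable_fun.
  rewrite -(integral_itv_obnd_cbnd (mF _)) -ge0_integral_setU//; last 3 first.
  - exact: mF.
  - by move=> x _; rewrite lee_fin.
  - rewrite oppr0; apply/disj_setPLR => x; rewrite /= !in_itv/= andbT => x0.
    by apply/negP; rewrite -leNgt.
  congr integral; apply/seteqP; split=> x _ //=; rewrite oppr0 !in_itv/= andbT.
  by case: (leP x 0); [left|right].
rewrite (split G)// (split (G \o -%R))// => [|x]; last exact: G0.
have R1 := @ge0_integration_by_substitutionNy R G 0 (continuous_subspaceT cG) (fun x _ => G0 x).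
have R2 := @ge0_integration_by_substitutionNy R (G \o -%R) 0 (continuous_subspaceT cGN) (fun x _ => G0 (- x)).
rewrite R1 R2.
rewrite [RHS]addeC; congr (_ + _)%E.
by apply: eq_integral => x _ /=; rewrite opprK.
Qed.

Definition cauchy c h t : R := (1 + ((t - c) / h) ^+ 2)^-1.

Lemma cauchy_gt0 c h t : 0 < cauchy c h t.
Proof. by rewrite invr_gt0 ltr_pwDl// sqr_ge0. Qed.

Lemma cauchyC c h t : cauchy c h t = cauchy t h c.
Proof. by rewrite /cauchy -(opprB c t) mulNr sqrrN. Qed.

Lemma continuous_cauchy c h : continuous (cauchy c h).
Proof.
move=> x; apply: cvgV; first by rewrite gt_eqF// ltr_pwDl// sqr_ge0.
apply: cvgD; first exact: cvg_cst.
have H : (t - c) / h @[t --> x] --> (x - c) / h.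
  by apply: cvgM; [apply: cvgB; [exact: cvg_id|exact: cvg_cst]|exact: cvg_cst].
exact: (continuous_comp H (@exprn_continuous _ 2 _)).
Qed.

Lemma integral_cauchy c h : 0 < h -> (\int[mu]_t (cauchy c h t)%:E = (h * pi)%:E)%E.
Proof.
move=> h0; rewrite (integral_affine c h0 (@continuous_cauchy c h)); last first.
  by move=> x; rewrite ltW// cauchy_gt0.
have E (u : R) : cauchy c h (c + h * u) = (oneDsqr u)^-1.
  by rewrite /cauchy/oneDsqr; congr (1 + _ ^+ 2)^-1; field; rewrite gt_eqF.
under eq_integral do rewrite E mulrC EFinM.
rewrite ge0_integralZl//; last 2 first.
- by apply/measurable_EFinP; apply: continuous_measurable_fun; exact: continuous_oneDsqrV.
- by rewrite lee_fin ltW.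
rewrite EFinM; congr *%E.
rewrite (@ge0_symfun_integralT R (fun u => (oneDsqr u)^-1)).
- rewrite -set_itvcy integral0y_oneDsqr -EFinM; congr EFin; by rewrite mulrC divfK.
- by move=> u; rewrite invr_ge0 (le_trans ler01 (oneDsqr_ge1 _)).
- exact: continuous_oneDsqrV.
- by move=> u; rewrite /= /oneDsqr sqrrN.
Qed.

Lemma integrable_cauchy c h : 0 < h -> mu.-integrable setT (EFin \o cauchy c h).
Proof.
move=> h0; apply/integrableP; split.
  by apply/measurable_EFinP; apply: continuous_measurable_fun; exact: continuous_cauchy.
rewrite (_ : (\int[_]_(_ in _) _ = (h * pi)%:E)%E) ?ltry// -(integral_cauchy c h0).
by apply: eq_integral => x _ /=; rewrite ger0_norm// ltW// cauchy_gt0.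
Qed.

Lemma cauchy_dominated (f : R -> R) C : continuous f ->
  (forall x, `|f x| <= C * (1 + x ^+ 2)^-1) -> mu.-integrable setT (EFin \o f).
Proof.
move=> cf hf.
apply: (@le_integrable _ _ _ mu setT measurableT _ (EFin \o (fun x => C * cauchy 0 1 x))).
- by apply/measurable_EFinP; apply: continuous_measurable_fun.
- by move=> x _ /=; rewrite lee_fin /cauchy subr0 divr1 (le_trans (hf x))// ler_norm.
- by apply: eq_integrable (integrableZl measurableT C (@integrable_cauchy 0 1 ltr01)).
Qed.

End CauchyKernel.

Section WeightMoments.
Context {R : realType} (Q : R -> R) (K : nat) (A l : R).
Hypothesis hQ : regular Q K A l.
Local Notation mu := (@lebesgue_measure R).
Local Notation q := (derive1 Q : R -> R).
Local Notation T := (growthT Q).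
Local Notation w := (weight Q).
Implicit Types (x y t d r : R) (P : {poly R}).

Lemma poly_exp_le P c : 0 < c -> exists2 C, 0 <= C & forall x, `|P.[x]| <= C * expR (c * `|x|).
Proof.
elim/poly_ind: P c => [|P a ih] c c0.
  by exists 0 => // x; rewrite horner0 normr0 mul0r.
have c20 : 0 < c / 2 by rewrite divr_gt0.
have [C C0 hC] := ih _ c20.
exists (C * (2 / c) + `|a|); first by rewrite addr_ge0// mulr_ge0// divr_ge0// ltW.
move=> x; rewrite hornerMXaddC (le_trans (ler_normD _ _))// mulrDl lerD//; last first.
  by rewrite ler_peMr// -[leLHS]expR0 ler_expR mulr_ge0// ltW.
rewrite normrM.
have -> : c * `|x| = c / 2 * `|x| + c / 2 * `|x| by field.
rewrite expRD mulrACA; apply: ler_pM => //; rewrite -[2 / c]invf_div ler_pdivlMl ?divr_gt0//.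
by apply: le_trans (expR_ge1Dx _); rewrite mulrC lerDr.
Qed.

Lemma weight_gt0 x : 0 < w x. Proof. exact: expR_gt0. Qed.
Lemma weight_ge0 x : 0 <= w x. Proof. exact: expR_ge0. Qed.
Lemma weight_le1 x : w x <= 1.
Proof. by rewrite /weight -[leRHS]expR0 ler_expR oppr_le0 (Q_ge0 hQ). Qed.
Lemma weightN x : w (- x) = w x. Proof. by rewrite /weight (reg_even hQ). Qed.

Lemma continuous_weight : continuous w.
Proof.
move=> x; apply: (@continuous_comp _ _ _ (fun u => - Q u) expR); last exact: continuous_expR.
by apply: cvgN; exact: (cont_Q hQ).
Qed.

Lemma continuous_poly_weight P : continuous (fun x => P.[x] * w x).
Proof. by move=> x; apply: cvgM; [exact: continuous_horner|exact: continuous_weight]. Qed.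

Lemma weight_tail x : w x <= expR (q 1) * expR (- (q 1 * `|x|)).
Proof.
rewrite -expRD ler_expR -(Q_norm hQ); have := tangent_le hQ 1 `|x|; have := Q_ge0 hQ 1.
by clear -hQ; lra.
Qed.

Lemma poly_weight_le P : exists2 C, 0 <= C & forall x, `|P.[x]| * w x <= C * (1 + x ^+ 2)^-1.
Proof.
have q1 := reg_dgt0 hQ ltr01.
have [C C0 hC] := poly_exp_le (P * (1 + 'X^2)) q1.
exists (C * expR (q 1)); first by rewrite mulr_ge0// expR_ge0.
move=> x; have x2 : 0 < 1 + x ^+ 2 by rewrite ltr_pwDl// sqr_ge0.
rewrite ler_pdivlMr// mulrAC.
have := hC x; rewrite hornerM hornerD hornerC hornerXn normrM (gtr0_norm x2) => h.
apply: (le_trans (ler_pM _ _ h (weight_tail x))) => //; first by rewrite mulr_ge0// ltW.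
  exact: weight_ge0.
rewrite mulrACA -expRD subrr expR0 mulr1//.
Qed.

Lemma poly_weight_integrable P : mu.-integrable setT (EFin \o (fun x => P.[x] * w x)).
Proof.
have [C C0 hC] := poly_weight_le P.
apply: (@cauchy_dominated _ _ C); first exact: continuous_poly_weight.
by move=> x; rewrite normrM (ger0_norm (weight_ge0 _)).
Qed.

Lemma weight_moments : has_moments (fun x => w x ^+ 2).
Proof.
move=> P; have [C C0 hC] := poly_weight_le P.
apply: (@cauchy_dominated _ _ C).
  move=> x; rewrite /=; under eq_fun do rewrite expr2 mulrA.
  by apply: cvgM; [exact: continuous_poly_weight|exact: continuous_weight].
move=> x; rewrite normrM (ger0_norm (sqr_ge0 _)); apply: le_trans (hC x).
by rewrite ler_wpM2l// expr2 ler_piMl ?weight_ge0// weight_le1.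
Qed.

Lemma Rintegral_sqr_weight P : \int[mu]_t (P.[t] * w t) ^+ 2 = moment (fun x => w x ^+ 2) (P ^+ 2).
Proof. by apply: eq_Rintegral => t _; rewrite horner_exp exprMn. Qed.

End WeightMoments.

(** * Pointwise bounds for weighted polynomials, near the edge and in the interior *)

Section Christoffel.
Context {R : realType} (Q : R -> R) (K : nat) (A l : R).
Hypothesis hQ : regular Q K A l.
Local Notation mu := (@lebesgue_measure R).
Local Notation q := (derive1 Q : R -> R).
Local Notation T := (growthT Q).
Local Notation w := (weight Q).
Local Notation W := (fun x => w x ^+ 2).
Implicit Types (x y t d r : R) (P : {poly R}).

Lemma size_comp_quadratic P (S : {poly R}) n : (size P <= n.+1)%N -> (size S <= 3)%N ->
  (size (P \Po S) <= (n * 2).+1)%N.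
Proof.
move=> hP hS; apply: leq_trans (size_comp_poly_leq _ _) _; rewrite ltnS leq_mul//.
  by move: hP; case: (size P).
by move: hS; case: (size S).
Qed.

(* If [S] is [1] at [x] and below [B w(t)/w(x)] near [x], then [P S] obeys the
   unweighted Nikolskii inequality. *)
Lemma christoffel_of_majorant P (S : {poly R}) (M : nat) B c r x z : 0 < r -> -1 <= z <= 1 ->
  x = c + r * z -> (size (P * S)%R <= M)%N ->
  (forall u, -1 <= u <= 1 ->
     S.[c + r * u] ^+ 2 * semicircle u <= B * (w (c + r * u) / w x) ^+ 2) ->
  (P.[x] * w x) ^+ 2 * (S.[x] ^+ 2 * (1 - z ^+ 2)) <= M%:R / r * (B * moment W (P ^+ 2)).
Proof.
move=> r0 hz xE sPS hS.
have wx := weight_gt0 Q x.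
pose f t := B / w x ^+ 2 * (P.[t] * w t) ^+ 2.
have B0 : 0 <= B.
  have := hS 0 ltac:(lra); rewrite mulr0 addr0 => h.
  have hh : 0 < (w c / w x) ^+ 2 by rewrite exprn_gt0// divr_gt0// weight_gt0.
  by rewrite -(pmulr_lge0 _ hh); apply: le_trans h; rewrite mulr_ge0 ?sqr_ge0 ?sqrtr_ge0.
have intPw : mu.-integrable setT (EFin \o (fun t => (P.[t] * w t) ^+ 2)).
  apply: eq_integrable (weight_moments hQ (P ^+ 2)) => //= t _.
  by rewrite horner_exp exprMn.
have h := @nikolskii_scaled R M (P * S) c r z f r0 sPS hz.
have hf : (forall u, -1 <= u <= 1 -> (P * S).[c + r * u] ^+ 2 * semicircle u <= f (c + r * u)).
  move=> u hu; rewrite /f hornerM exprMn -[leLHS]mulrA.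
  apply: (@le_trans _ _ (P.[c + r * u] ^+ 2 * (B * (w (c + r * u) / w x) ^+ 2))).
    by rewrite ler_wpM2l ?sqr_ge0// hS.
  rewrite expr_div_n exprMn le_eqVlt; apply/orP; left; apply/eqP.
  by field; rewrite gt_eqF.
have f0 t : 0 <= f t by rewrite mulr_ge0 ?sqr_ge0// divr_ge0 ?sqr_ge0.
have cf : continuous f.
  move=> t; apply: cvgM; first exact: cvg_cst.
  apply: (@continuous_comp _ _ _ (fun t => P.[t] * w t) (fun u : R => u ^+ 2)).
    exact: (continuous_poly_weight hQ).
  exact: exprn_continuous.
have intf : mu.-integrable setT (EFin \o f).
  by apply: eq_integrable (integrableZl measurableT (B / w x ^+ 2) intPw).
have {}h := h hf f0 cf intf.
have fE : \int[mu]_t f t = B / w x ^+ 2 * moment W (P ^+ 2).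
  by rewrite -Rintegral_sqr_weight -RintegralZl.
move: h; rewrite fE -xE hornerM exprMn => h.
have := ler_wpM2r (sqr_ge0 (w x)) h.
rewrite [leRHS](_ : _ = M%:R / r * (B * moment W (P ^+ 2))); last first.
  by field; rewrite !gt_eqF.
by apply: le_trans; rewrite exprMn le_eqVlt; apply/orP; left; apply/eqP; ring.
Qed.

(** The interval is [[-b, b]] with [b = x (1 + u)] and [u = 4^-d] of order [1 / T x]. Such a short
    margin costs [1 / (1 - z^2)], about [4^d], in the Nikolskii inequality. The factor [Sp] imitates
    [w t / w x]; the factor [Hp], peaking at both ends, wins back [2^e]. A loss of order [2^d],
    hence [sqrt(T x)], remains. *)
Lemma edge_bound : exists2 C : R, 0 < C & forall N P x, (size P <= N)%N -> 0 < x ->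
  (P.[x] * w x) ^+ 2 <=
  C * (N%:R + Num.sqrt (T x) * (1 + Q x)) * (Num.sqrt (T x) / x) * moment W (P ^+ 2).
Proof.
pose E1 : R := expR 128.
have E11 : 1 <= E1 by rewrite /E1 -[leLHS]expR0 ler_expR.
pose A0 : R := 64 + 8 * expR 64 * curv K + 2 ^+ (K + 6).
have c1 := curv_ge1 hQ.
have e640 : 0 < expR (64 : R) by rewrite expR_gt0.
have ec0 : 0 <= 8 * expR 64 * curv K :> R by rewrite mulr_ge0 ?(le_trans ler01 c1)// mulr_ge0// ltW.
have p20 : 0 <= 2 ^+ (K + 6) :> R by rewrite exprn_ge0.
have A064 : 64 <= A0 by rewrite /A0 -addrA lerDl addr_ge0.
have A00 : 0 < A0 by rewrite (lt_le_trans _ A064).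
pose sA := Num.sqrt A0.
have sA0 : 0 < sA by rewrite sqrtr_gt0.
exists (4 * (1 + 6 * sA * E1) * (2 * sA)).
  by rewrite !mulr_gt0// ltr_pwDl// !mulr_ge0// ltW// (lt_le_trans ltr01).
move=> N P x sP x0.
have Qx := reg_gt0 hQ x0; have T1 := T_ge1 hQ x0.
have AT : 64 <= A0 * T x by rewrite (le_trans A064)// ler_peMr// ltW.
(* The least such exponent makes [2^d] comparable with [sqrt(T x)]. The three summands of [A0] give
   [3 <= d] and the two hypotheses of [edge_compare]. *)
have ex : exists i, A0 * T x <= 4 ^+ i.
  exists (Num.bound (A0 * T x)); apply: ltW.
  apply: lt_le_trans (archi_boundP _) _; first by rewrite (le_trans _ AT).
  by rewrite -natrX ler_nat ltnW// ltn_expl.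
case: (ex_minnP ex) => d Hd md.
have d3 : (3 <= d)%N.
  rewrite leqNgt; apply/negP => d2; have := le_trans AT Hd; apply/negP; rewrite -ltNge.
  apply: (@le_lt_trans _ _ (4 ^+ 2)); first by rewrite ler_weXn2l// ler1n.
  by rewrite -natrX ltr_nat.
case: d d3 Hd md => [|[|[|j]]]// _; set d := j.+3; set e := j.+2 => Hd md.
have He : 4 ^+ e < A0 * T x.
  by rewrite ltNge; apply/negP => /md; rewrite ltnn.
have H1 : 2 ^+ (K + 6) * T x <= 4 ^+ d.
  apply: le_trans Hd; rewrite ler_wpM2r ?(le_trans ler01)// /A0 lerDr addr_ge0//.
have H2 : 8 * expR 64 * curv K * T x <= 4 ^+ d.
  apply: le_trans Hd; rewrite ler_wpM2r ?(le_trans ler01)// /A0; move: p20; clear -hQ; lra.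
pose u : R := (4 ^+ d)^-1.
have /andP[u0 u1] : 0 < u <= 1 / 64 := @edge_u R j.
have du : 4 ^+ d * u = 1 by rewrite divff// gt_eqF// exprn_gt0.
have cmp t : `|t| <= x * (1 + u) -> _ := edge_compare hQ x0 H1 H2 (t := t).
have Vle t : `|t| <= x * (1 + u) -> _ := edgeV_le x0 (t := t) (j := j).
have /andP[Ap Ale] := edgeA_bounds hQ j x0.
set A1 := edgeA Q x j in cmp Ap Ale *; set V := edgeV x j in cmp Vle *.
have Vx0 : 0 <= V x by rewrite /V edgeV_x// ml_ge0// mulr_ge0// ltW.
(* Enough factors to keep the base [1 - A1 / Ns (V t - V x)] nonnegative, since [V <= E1] on the
   interval. The bound on [A1] makes [Ns] of order [1 + Q x]. *)
pose Ns := (Num.truncn (A1 * E1)).+1.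
have AE0 : 0 <= A1 * E1 by rewrite mulr_ge0 ?(ltW Ap)// (le_trans ler01 E11).
have /andP[Nl Nu] := truncn_itv AE0.
have Ns0 : 0 < (Ns%:R : R) by rewrite ltr0n.
pose Vp : {poly R} := - (logP d \Po (1 - ((1 + 64 * u) / x ^+ 2) *: 'X^2)).
have VpE t : Vp.[t] = V t.
  have E (cc : R) : (1 - cc *: 'X^2).[t] = 1 - cc * t ^+ 2 by rewrite !hornerE.
  rewrite hornerN horner_comp E /V /edgeV /ml.
  congr (- _.[_]); rewrite -/d -/u; field; exact: lt0r_neq0.
pose Sp : {poly R} := (1 - (A1 / Ns%:R) *: (Vp - (V x)%:P)) ^+ Ns.
have SpE t : Sp.[t] = (1 - A1 / Ns%:R * (V t - V x)) ^+ Ns.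
  have E (U : {poly R}) cc v : (1 - cc *: (U - v%:P)).[t] = 1 - cc * (U.[t] - v) by rewrite !hornerE.
  by rewrite /Sp horner_exp E VpE.
pose b := x * (1 + u); have b0 : 0 < b by rewrite mulr_gt0// addr_gt0.
have Sle t : `|t| <= b -> 0 <= Sp.[t] <= w t / w x.
  move=> tb; have y1 : A1 / Ns%:R * (V t - V x) <= 1.
    rewrite mulrAC ler_pdivrMr// mul1r; apply: le_trans (ltW Nu); rewrite ler_pM2l//.
    by have := Vle t tb; rewrite -/E1; move: Vx0; clear -hQ; lra.
  rewrite SpE exprn_ge0 ?subr_ge0//=.
  rewrite /weight -expRN -expRD (opprK (Q x)).
  apply: (@le_trans _ _ (expR (- (A1 / Ns%:R * (V t - V x))) ^+ Ns)).
    by rewrite lerXn2r ?nnegrE ?expR_ge0 ?subr_ge0//; exact: expR_ge1Dx.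
  rewrite -expRM_natl ler_expR mulrN mulrA [Ns%:R * _]mulrC divfK ?gt_eqF//.
  by have := cmp t tb; clear -hQ; lra.
have Sx : Sp.[x] = 1 by rewrite SpE subrr mulr0 subr0 expr1n.
(* A Fejer kernel in [1 - (t / b)^2], normalised to 1 at the end points. Since [4^e u = 1/4], the
   point [x] lies within the peak, where [Hp >= 5/6]. *)
pose Hp : {poly R} := (4 ^+ e)^-1 *: (logQ e \Po (1 - (b ^+ 2)^-1 *: 'X^2)).
have HpE s : Hp.[b * s] = (4 ^+ e)^-1 * (logQ e).[1 - s ^+ 2].
  have E cc t : (1 - cc *: 'X^2 : {poly R}).[t] = 1 - cc * t ^+ 2 by rewrite !hornerE.
  by rewrite /Hp hornerZ horner_comp E [(b * s) ^+ 2]exprMn mulKf// gt_eqF// exprn_gt0.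
pose z := x / b; have xE : x = 0 + b * z by rewrite add0r /z mulrC divfK// gt_eqF.
have zE : z = (1 + u)^-1 by rewrite /z /b; field; rewrite !gt_eqF// addr_gt0.
have z01 : 0 < z <= 1.
  by rewrite zE invr_gt0 addr_gt0//= invf_le1 ?addr_gt0// lerDl ltW.
have hz : -1 <= z <= 1 by case/andP: z01 => *; apply/andP; split=> //; lra.
have z2 : u <= 1 - z ^+ 2 <= 2 * u.
  have E : 1 - z ^+ 2 = (2 * u + u ^+ 2) * (z * z).
    by rewrite zE; field; rewrite gt_eqF// addr_gt0.
  have zu : z * (1 + u) = 1 by rewrite zE mulVf// gt_eqF// addr_gt0.
  case/andP: z01 => za zb.
  have hzz : z * z <= 1 by rewrite mulr_ile1 ?(ltW za).
  have zz2 : z * z * ((1 + u) * (1 + u)) = 1 by rewrite mulrACA zu mulr1.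
  have zz0 : 0 < z * z by rewrite mulr_gt0.
  rewrite E; apply/andP; split.
    rewrite -[leLHS]mulr1 -zz2 mulrCA [leRHS]mulrC ler_pM2l// !expr2; nra.
  have : (2 * u + u ^+ 2) * (z * z) = 1 - z * z by rewrite -E expr2.
  have : z * (1 - u) <= 1 * (1 - u) by rewrite ler_wpM2r//; move: u1; clear -hQ; lra.
  have : z * z >= (1 - u) * (1 - u).
    have : (1 - u) <= z by rewrite zE -[leRHS]div1r ler_pdivlMr ?addr_gt0//; have := sqr_ge0 u; rewrite expr2; clear -hQ; lra.
    by move=> hzu; apply: ler_pM => //; move: u1; clear -hQ; lra.
  by have := sqr_ge0 u; rewrite expr2; clear -hQ; lra.
have [_ _ _] := @logQ_bounds R e (1 - z ^+ 2) ltac:(move: z2 u0 u1; clear -hQ; lra).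
have e4 : 0 < (4 : R) ^+ e by rewrite exprn_gt0.
have eu : 4 ^+ e * u = 1 / 4 by move: du; rewrite /d exprS -/e; clear -hQ; lra.
move=> Hlow; have Hx : 5 / 6 <= Hp.[x].
  rewrite {1}xE add0r HpE [leRHS]mulrC ler_pdivlMr//; apply: le_trans Hlow; rewrite [leLHS]mulrC ler_pM2l//.
  have : 4 ^+ e * (1 - z ^+ 2) <= 4 ^+ e * (2 * u) by rewrite ler_pM2l//; case/andP: z2.
  by move: eu; clear -hQ; lra.
have e2 : 0 < (2 : R) ^+ e by rewrite exprn_gt0.
(* From [H <= 1] and [H v^2 <= 4^-e] follows [(H v)^2 = H (H v^2) <= 4^-e], hence
   [H^2 v <= H v <= 2^-e]. *)
have Hu s : -1 <= s <= 1 -> Hp.[b * s] ^+ 2 * semicircle s <= (2 ^+ e)^-1.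
  move=> hs; have y01 : 0 <= 1 - s ^+ 2 <= 1.
    by have := sqr_ge0 s; move: hs; rewrite expr2 => /andP[? ?] ?; nra.
  have [l0 l1 l2 _] := logQ_bounds e y01.
  rewrite HpE /semicircle; move: y01 l0 l1 l2; set y := 1 - s ^+ 2; set L := (logQ e).[y].
  move=> /andP[y0 y1] l0 l1 l2; set v := Num.sqrt y.
  have v0 : 0 <= v by rewrite sqrtr_ge0.
  have v2 : v ^+ 2 = y by rewrite sqr_sqrtr.
  set H := (4 ^+ e)^-1 * L.
  have h0 : 0 <= H by rewrite mulr_ge0// invr_ge0 ltW.
  have h1 : H <= 1 by rewrite /H mulrC ler_pdivrMr// mul1r.
  have hv : H * v ^+ 2 <= (4 ^+ e)^-1.
    by rewrite v2 /H -mulrA ler_piMr ?invr_ge0 ?(ltW e4)// mulrC.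
  apply: (@le_trans _ _ (H * v)).
    by rewrite expr2 -mulrA ler_piMl// mulr_ge0.
  rewrite -(@ler_pXn2r _ 2) ?nnegrE ?mulr_ge0 ?invr_ge0 ?(ltW e2)//.
  rewrite exprMn exprVn -exprM mulnC exprM (_ : 2 ^+ 2 = 4); last by ring.
  apply: le_trans hv; rewrite ler_wpM2r ?sqr_ge0// expr2 ler_piMl//.
pose M := (N + 2 ^ d * 2 * Ns + 2 ^ e * 2)%N.
have sPS : (size (P * (Sp * Hp))%R <= M)%N.
  have q3 (cc : R) : (size (1 - cc *: 'X^2)%R <= 3)%N.
    rewrite (leq_trans (size_polyD _ _))// geq_max size_poly1 size_polyN.
    by rewrite (leq_trans (size_scale_leq _ _))// size_polyXn.
  have sV : (size Vp <= (2 ^ d * 2).+1)%N.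
    by rewrite size_polyN; apply: size_comp_quadratic; [exact: size_logP|exact: q3].
  have sS : (size Sp <= (2 ^ d * 2 * Ns).+1)%N.
    apply: size_exp_leq; rewrite (leq_trans (size_polyD _ _))// geq_max size_poly1 size_polyN/=.
    rewrite (leq_trans (size_scale_leq _ _))// (leq_trans (size_polyD _ _))// geq_max sV size_polyN.
    by rewrite (leq_trans (size_polyC_leq1 _)).
  have sH : (size Hp <= (2 ^ e * 2).+1)%N.
    rewrite (leq_trans (size_scale_leq _ _))//; apply: size_comp_quadratic; last exact: q3.
    by rewrite (leq_trans (size_logQ _)).
  apply: leq_trans (size_polyMleq _ _) _; have := size_polyMleq Sp Hp.
  move: sP sS sH; rewrite /M; move: (size P) (size Sp) (size Hp) (size (Sp * Hp)) => a1 a2 a3 a4.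
  by clear; lia.
have maj s : -1 <= s <= 1 ->
    (Sp * Hp).[0 + b * s] ^+ 2 * semicircle s <= (2 ^+ e)^-1 * (w (0 + b * s) / w x) ^+ 2.
  move=> hs; rewrite add0r hornerM exprMn -mulrA mulrC; apply: ler_pM.
  - by rewrite mulr_ge0 ?sqr_ge0 ?sqrtr_ge0.
  - exact: sqr_ge0.
  - exact: Hu.
  have bs : `|b * s| <= b by rewrite normrM (gtr0_norm b0) ler_piMr ?(ltW b0)// ler_norml.
  have /andP[S0 S1] := Sle _ bs.
  by rewrite lerXn2r ?nnegrE// (le_trans S0).
have := christoffel_of_majorant b0 hz xE sPS maj.
rewrite hornerM Sx mul1r; set I := moment W _; set LHS := (_ * w x) ^+ 2.
have I0 : 0 <= I by apply: moment_ge0 => t; rewrite ?horner_exp sqr_ge0.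
have L0 : 0 <= LHS by exact: sqr_ge0.
have hl : LHS * (u / 2) <= LHS * (Hp.[x] ^+ 2 * (1 - z ^+ 2)).
  rewrite ler_wpM2l// mulrC; apply: ler_pM; rewrite ?(ltW u0)//; last by case/andP: z2.
  by rewrite expr2; move: Hx; clear -hQ; nra.
move=> /(le_trans hl) main.
have d2 : (2 : R) ^+ d = 2 * 2 ^+ e by rewrite exprS.
have sT0 : 0 < Num.sqrt (T x) by rewrite sqrtr_gt0 (lt_le_trans ltr01).
have d2le : (2 : R) ^+ d <= 2 * sA * Num.sqrt (T x).
  rewrite d2 -[leRHS]mulrA ler_pM2l//; rewrite -(@ler_pXn2r _ 2) ?nnegrE ?(ltW e2) ?(mulr_ge0 (ltW sA0) (ltW sT0))//.
  rewrite [leRHS]exprMn /sA !sqr_sqrtr ?(le_trans ler01 T1) ?(ltW A00)//.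
  rewrite -exprM mulnC exprM (_ : 2 ^+ 2 = 4 :> R); last by ring.
  exact: ltW.
have main2 : LHS <= 4 * (M%:R / x) * 2 ^+ d * I.
  have ui : u^-1 = 2 ^+ d * 2 ^+ d by rewrite invrK -exprMn; congr (_ ^+ _); ring.
  have u20 : 0 < u / 2 by rewrite divr_gt0.
  have bx : b^-1 <= x^-1 by rewrite lef_pV2 ?posrE// ler_peMr ?(ltW x0)// lerDl ltW.
  rewrite -(ler_pM2r u20); apply: (le_trans main).
  apply: (@le_trans _ _ (M%:R / x * ((2 ^+ e)^-1 * I))).
    by rewrite ler_wpM2r ?mulr_ge0 ?invr_ge0 ?(ltW e2)// ler_wpM2l.
  have -> : (2 ^+ e)^-1 = u * 2 ^+ d * 2 :> R.
    apply: (mulIf (lt0r_neq0 e2)); rewrite mulVf ?gt_eqF//.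
    by rewrite -[RHS]mulrA -d2 -mulrA -ui mulfV// gt_eqF.
  rewrite le_eqVlt; apply/orP; left; apply/eqP; field; exact: lt0r_neq0.
apply: (le_trans main2).
have NsU : Ns%:R <= E1 * Q x + 1.
  rewrite -natr1 lerD2r; apply: (le_trans Nl); rewrite mulrC ler_pM2l ?(lt_le_trans ltr01)//.
  apply: (le_trans Ale); rewrite ler_pdivrMr ?exprn_gt0// mulrC ler_pM2l//.
  by apply: le_trans Hd; rewrite ler_peMl ?(le_trans ler01)// (le_trans _ A064)// ler1n.
have MU : M%:R <= (1 + 6 * sA * E1) * (N%:R + Num.sqrt (T x) * (1 + Q x)).
  have -> : M%:R = N%:R + 2 ^+ d * 2 * Ns%:R + 2 ^+ e * 2 :> R by rewrite -!natrX -!natrM -!natrD.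
  have h1 : 2 ^+ d * (2 * Ns%:R + 1) <= 2 * sA * Num.sqrt (T x) * (3 * (E1 * (1 + Q x))).
    apply: ler_pM => //; rewrite ?exprn_ge0// ?addr_ge0//.
    by move: NsU E11 Qx; clear -hQ; nra.
  have h2 : 0 <= 6 * sA * E1 * N%:R by rewrite !mulr_ge0// ?(ltW sA0)// (le_trans ler01).
  have h3 : 0 <= Num.sqrt (T x) * (1 + Q x) by rewrite mulr_ge0 ?(ltW sT0)// addr_ge0// ltW.
  by move: h1 h2 h3; rewrite d2; clear -hQ; lra.
rewrite (_ : 4 * _ * _ * I = 4 * M%:R * 2 ^+ d * (I / x)); last by ring.
rewrite (_ : _ * _ * (_ / x) * I = 4 * ((1 + 6 * sA * E1) * (N%:R + Num.sqrt (T x) * (1 + Q x))) * (2 * sA * Num.sqrt (T x)) * (I / x)); last by ring.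
rewrite ler_wpM2r ?divr_ge0 ?(ltW x0)//; apply: ler_pM => //; rewrite ?mulr_ge0 ?exprn_ge0//.
by rewrite ler_pM2l.
Qed.

(** With [x] at the centre of the interval the Nikolskii inequality loses nothing. A power of a
    linear polynomial imitates the tangent part of [Q], and the bump handles the excess over the
    tangent, which [curv_interior] controls at each dyadic scale. *)
Lemma interior_bound : exists2 C : R, 0 < C & forall N P r x, (size P <= N)%N -> 0 < r -> `|x| <= r ->
  (P.[x] * w x) ^+ 2 <= C * (N%:R + 1 + Q (8 * r)) / r * moment W (P ^+ 2).
Proof.
pose C := 4 * (A * curv K).
have c1 := curv_ge1 hQ; have A1 := reg_A hQ.
have C0 : 0 <= C by rewrite mulr_ge0// mulr_ge0 ?(le_trans ler01 A1) ?(le_trans ler01 c1).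
have /andP[h1 h2] := halvingP hQ.
have th01 : 0 < halving l < 1 by rewrite h2 andbT (lt_le_trans _ h1)// divr_gt0.
have [D HD] := interior_bump C0 th01.
pose B := expR (2 * C) ^+ 2.
have B0 : 0 < B by rewrite exprn_gt0// expR_gt0.
exists (B * (D%:R + 2)); first by rewrite mulr_gt0// ltr_wpDl.
move=> N P r x sP r0.
wlog x0 : P sP x / 0 <= x.
  move=> H xr; have [|/ltW x0] := leP 0 x; first by move=> x0; apply: H.
  have := H (P \Po (- 'X)) _ (- x); rewrite normrN horner_comp hornerN hornerX opprK (weightN hQ).
  have -> : moment W ((P \Po (- 'X)) ^+ 2) = moment W (P ^+ 2).
    rewrite -!Rintegral_sqr_weight /Rintegral [in RHS]integral_reflect//.
    - by congr fine; apply: eq_integral => t _; rewrite horner_comp hornerN hornerX (weightN hQ).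
    - move=> t; apply: (@continuous_comp _ _ _ (fun t => P.[t] * w t) (fun u : R => u ^+ 2)).
        exact: (continuous_poly_weight hQ).
      exact: exprn_continuous.
    - by move=> t; exact: sqr_ge0.
  by apply=> //; rewrite ?oppr_ge0// size_comp_poly2// size_polyN size_polyX.
move=> xr; rewrite ger0_norm// in xr.
(* At least [Q(8 r)], so that [curv_interior] yields the hypothesis of the bump and
   [q x r <= Q(2 r) <= n] keeps the linear base nonnegative. *)
pose n := (Num.truncn (Q (8 * r))).+1.
have /andP[nl nu] := @truncn_itv _ (Q (8 * r)) (Q_ge0 hQ _).
have n0 : 0 < (n%:R : R) by rewrite ltr0n.
have [S [sS S0 S1 S2]] := HD n (ltn0Sn _).
have qx0 : 0 <= q x by apply: (dQ_ge0 hQ).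
pose S1p := affine (- x / r) r^-1 S.
pose S2p := (1 - (q x / n%:R) *: ('X - x%:P)) ^+ n.
pose S' := S1p * S2p.
have S'E u : S'.[x + r * u] = S.[u] * (1 - q x / n%:R * (r * u)) ^+ n.
  rewrite hornerM affineE horner_exp hornerD hornerN hornerC hornerZ hornerXsubC.
  rewrite (_ : - x / r + r^-1 * (x + r * u) = u); last by field; rewrite gt_eqF.
  by rewrite [x + r * u - x]addrAC subrr add0r.
have sPS : (size (P * S')%R <= N + (D * n + n))%N.
  have s1 : (size S1p <= (D * n).+1)%N := leq_trans (size_affine _ _ _) sS.
  have s2 : (size S2p <= (1 * n).+1)%N.
    apply: size_exp_leq; rewrite (leq_trans (size_polyD _ _))// geq_max size_poly1 size_polyN/=.
    by rewrite (leq_trans (size_scale_leq _ _))// size_XsubC.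
  apply: leq_trans (size_polyMleq _ _) _; have := size_polyMleq S1p S2p.
  rewrite -/S'; move: sP s1 s2; rewrite mul1n.
  move: (size P) (size S1p) (size S2p) (size S') (D * n)%N => a1 a2 a3 a4 a5.
  by clear; lia.
have hz : -1 <= (0 : R) <= 1 by rewrite oppr_le0 ler01.
have xE : x = x + r * 0 by rewrite mulr0 addr0.
have maj u : -1 <= u <= 1 -> S'.[x + r * u] ^+ 2 * semicircle u <= B * (w (x + r * u) / w x) ^+ 2.
  move=> hu; have sc : semicircle u <= 1.
    by rewrite /semicircle -[leRHS]sqrtr1 ler_wsqrtr// gerBl sqr_ge0.
  have qr : q x * r <= n%:R.
    apply: le_trans (ltW nu); apply: (@le_trans _ _ (Q (2 * r))); last by apply: (Q_homo hQ); lra.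
    apply: le_trans (xdQ_le_Q2 hQ (ltW r0)); rewrite mulrC ler_pM2l//; exact: reg_homo hQ _ _ xr.
  have un : `|u| <= 1 by rewrite ler_norml.
  have y1 : q x / n%:R * (r * u) <= 1.
    rewrite mulrAC ler_pdivrMr// mul1r (le_trans _ qr)// mulrA ler_piMr ?mulr_ge0 ?(ltW r0)//.
    by case/andP: hu.
  have F0 : 0 <= (1 - q x / n%:R * (r * u)) ^+ n by rewrite exprn_ge0// subr_ge0.
  have F1 : (1 - q x / n%:R * (r * u)) ^+ n <= expR (- (q x * (r * u))).
    apply: (@le_trans _ _ (expR (- (q x / n%:R * (r * u))) ^+ n)).
      by rewrite lerXn2r ?nnegrE ?expR_ge0 ?subr_ge0//; exact: expR_ge1Dx.
    rewrite -expRM_natl ler_expR mulrN (_ : n%:R * _ = q x * (r * u))//.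
    by field; rewrite gt_eqF.
  have Sb : S.[u] <= expR (2 * C) * expR (- (Q (x + r * u) - Q x - q x * (r * u))).
    apply: S2 => // i ui.
    have := @curv_interior _ _ _ _ _ hQ x (x + r * u) r i x0 xr.
    rewrite addrC addKr normrM (gtr0_norm r0) => /(_ _)/le_trans; apply.
      rewrite -[r / _]mulr1 -mulrA ler_pM2l// mulr1 -[leRHS]div1r; exact: ui.
    rewrite -/C mulrAC; apply: ler_wpM2r; last by rewrite ler_wpM2l// ltW.
    by case/andP: th01 => *; rewrite exprn_ge0// divr_ge0// ltW.
  have SS : 0 <= S'.[x + r * u] <= expR (2 * C) * (w (x + r * u) / w x).
    rewrite S'E mulr_ge0 ?S1//=.
    apply: (@le_trans _ _ (expR (2 * C) * expR (- (Q (x + r * u) - Q x - q x * (r * u))) * expR (- (q x * (r * u))))).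
      by apply: ler_pM; rewrite ?S1.
    rewrite -mulrA ler_pM2l ?expR_gt0// -expRD /weight -expRN -expRD opprK ler_expR.
    by clear -hQ; lra.
  case/andP: SS => SS0 SS1.
  apply: (@le_trans _ _ (S'.[x + r * u] ^+ 2)); first by rewrite ler_piMr// sqr_ge0.
  by rewrite -exprMn lerXn2r ?nnegrE// (le_trans SS0).
have := christoffel_of_majorant r0 hz xE sPS maj.
have -> : S'.[x] = 1.
  by rewrite xE S'E S0 !mulr0 subr0 expr1n mulr1.
rewrite expr1n expr0n/= subr0 !mulr1 => /le_trans; apply.
have I0 : 0 <= moment W (P ^+ 2) by apply: moment_ge0 => t; rewrite ?horner_exp sqr_ge0.
rewrite mulrA ler_wpM2r// mulrAC ler_wpM2r ?invr_ge0 ?(ltW r0)//.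
rewrite !natrD natrM mulrC -mulrA ler_pM2l//.
have n1 : n%:R <= 1 + Q (8 * r) by rewrite /n -natr1 addrC lerD2l.
have D0 : 0 <= (D%:R : R) by [].
have N0 : 0 <= (N%:R : R) by [].
have Q0 := Q_ge0 hQ (8 * r).
have : (D%:R + 1) * n%:R <= (D%:R + 1) * (1 + Q (8 * r)) by rewrite ler_wpM2l// addr_ge0.
have : 0 <= D%:R * (N%:R : R) by rewrite mulr_ge0.
by move: n1 N0 Q0; clear -hQ; lra.
Qed.

End Christoffel.

(** * Christoffel bound on the whole line and growth beyond [a_n] *)

Section Range.
Context {R : realType} (Q : R -> R) (K : nat) (A l : R).
Hypothesis hQ : regular Q K A l.
Local Notation mu := (@lebesgue_measure R).
Local Notation q := (derive1 Q : R -> R).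
Local Notation T := (growthT Q).
Local Notation w := (weight Q).
Local Notation W := (fun x => w x ^+ 2).
Implicit Types (x y t d r a B : R) (P : {poly R}).

(* All that is used of the Mhaskar-Rakhmanov-Saff number; the last two fields
   come from the growth condition on [T (a_n)]. *)
Record mrs B (n : nat) a : Prop := {
  mrs_n : (0 < n)%N ;
  mrs_a : 0 < a ;
  mrs_lo : n%:R <= B * (Q a * Num.sqrt (T a)) ;
  mrs_hi : Q a * Num.sqrt (T a) <= B * n%:R ;
  mrs_T : T a * Num.sqrt (T a) <= B * (n%:R / a) ;
  mrs_sT : Num.sqrt (T a) <= B * n%:R }.

(** [MRS_theta2_le] gives the two bounds on [Q a sqrt(T a)]. The growth condition raised to the
    power 3/2 gives [mrs_T], and [mrs_sT] follows because the numbers [a_n] stay away from 0. *)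
Lemma mrsP (a_ : nat -> R) : (forall n, (0 < n)%N -> is_MRS Q n (a_ n)) ->
  (exists2 c : R, 0 < c &
     forall n, (0 < n)%N -> T (a_ n) <= c * (n%:R / a_ n) `^ (2 / 3)) ->
  exists2 B : R, 1 <= B & forall n, (0 < n)%N -> mrs B n (a_ n).
Proof.
move=> ha [c c0 hT].
(* [a0] is a lower bound for every [a_n]: if [a < 1], then
   [1 <= n^2 <= 9 theta2 a <= 9 a q(1) Q(1)]. Having [c1 >= 1] allows [c1^3] to be replaced by the
   square [c1^4]. *)
pose c1 : R := 1 + c; pose a0 := Num.min 1 ((9 * (q 1 * Q 1))^-1).
have q1 := reg_dgt0 hQ ltr01; have Q1 := reg_gt0 hQ ltr01.
have a00 : 0 < a0 by rewrite lt_min ltr01 invr_gt0 mulr_gt0// mulr_gt0.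
have c10 : 0 < c1 by rewrite addr_gt0.
have c12 : 0 < c1 ^+ 2 by rewrite exprn_gt0.
have p2 : 0 < (2 : R) ^+ K.+3 by rewrite exprn_gt0.
have c12a : 0 < c1 ^+ 2 / a0 by rewrite divr_gt0.
exists (4 + 2 ^+ K.+3 + c1 ^+ 2 + c1 ^+ 2 / a0).
  by move: c12 c12a p2; set u := c1 ^+ 2; set v := _ / a0; set z := _ ^+ _; clear -hQ; lra.
move=> n n0; have mr := ha n n0; have [an0 _] := mr; set a := a_ n in mr an0 *.
have [h1 h2] := MRS_theta2_le hQ n0 mr.
have nR : 1 <= (n%:R : R) by rewrite ler1n.
have T1 := T_ge1 hQ an0; have Qa := reg_gt0 hQ an0.
set s := Num.sqrt (T a); have s0 : 0 < s by rewrite sqrtr_gt0 (lt_le_trans ltr01).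
have s2 : s ^+ 2 = T a by rewrite sqr_sqrtr// (le_trans ler01).
have thE : theta2 Q a = (Q a * s) ^+ 2 by rewrite exprMn s2 /theta2 -(growthTE hQ an0); ring.
have Qs0 : 0 < Q a * s by rewrite mulr_gt0.
have hi : Q a * s <= 2 ^+ K.+3 * n%:R.
  by move: h1; rewrite thE ler_pXn2r// nnegrE ?(ltW Qs0)// mulr_ge0// ltW.
have lo : n%:R <= 3 * (Q a * s).
  rewrite -(@ler_pXn2r _ 2) ?nnegrE ?mulr_ge0 ?(ltW Qa) ?(ltW s0)// [leRHS]exprMn -thE.
  by apply: (le_trans h2); rewrite (_ : 3 ^+ 2 = 9 :> R)//; ring.
have aa0 : a0 <= a.
  rewrite ge_min; have [//|a1] := leP 1 a; apply/orP; right.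
  have : 1 <= 9 * theta2 Q a by apply: le_trans h2; rewrite exprn_ege1.
  have : theta2 Q a <= a * (q 1 * Q 1).
    rewrite /theta2 -mulrA ler_pM2l//; apply: ler_pM.
    - exact: (dQ_ge0 hQ (ltW an0)).
    - exact: ltW.
    - exact: reg_homo hQ _ _ (ltW a1).
    - exact: (Q_homo hQ (ltW an0) (ltW a1)).
  rewrite -[_^-1]div1r ler_pdivrMr ?mulr_gt0//; clear -hQ; lra.
have y0 : 0 < n%:R / a by rewrite divr_gt0// (lt_le_trans ltr01).
have TT : T a * s <= c1 ^+ 2 * (n%:R / a).
  have hTn := hT n n0; rewrite -/a in hTn.
  have T0 : 0 <= T a by rewrite (le_trans ler01).
  rewrite -(@ler_pXn2r _ 2) ?nnegrE ?(mulr_ge0 T0 (ltW s0)) ?(mulr_ge0 (ltW c12) (ltW y0))//.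
  rewrite exprMn s2 -exprSr.
  have hp : T a <= c1 * (n%:R / a) `^ (2 / 3).
    apply: (le_trans hTn); rewrite ler_wpM2r ?powR_ge0//; rewrite /c1; clear -hQ; lra.
  apply: (@le_trans _ _ ((c1 * (n%:R / a) `^ (2 / 3)) ^+ 3)).
    by rewrite lerXn2r ?nnegrE// mulr_ge0 ?powR_ge0 ?(ltW c10).
  have -> : (c1 * (n%:R / a) `^ (2 / 3)) ^+ 3 = c1 ^+ 3 * (n%:R / a) ^+ 2.
    rewrite exprMn; congr (_ * _); rewrite -(powR_mulrn 3) ?powR_ge0// -powRrM.
    by rewrite (_ : 2 / 3 * 3%:R = 2%:R) ?powR_mulrn ?(ltW y0)//; field.
  rewrite [leRHS]exprMn ler_wpM2r ?sqr_ge0// -exprM ler_weXn2l//.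
  by rewrite /c1; move: c0; clear -hQ; lra.
have sT : s <= c1 ^+ 2 / a0 * n%:R.
  apply: (@le_trans _ _ (T a * s)); first by rewrite ler_peMl// ltW.
  apply: (le_trans TT); rewrite mulrA mulrAC ler_wpM2r// ler_wpM2l ?(ltW c12)//.
  by rewrite lef_pV2 ?posrE.
have n0' : 0 <= (n%:R : R) by [].
split=> //; rewrite -/s.
- by move: lo Qs0 c12 c12a p2; set z1 := _ * s; set z2 := c1 ^+ 2; set z3 := _ / a0; set z4 := _ ^+ _; clear -hQ; nra.
- by move: hi n0' c12 c12a p2; set z1 := _ * s; set z2 := c1 ^+ 2; set z3 := _ / a0; set z4 := _ ^+ _; clear -hQ; nra.
- by move: TT y0 c12 c12a p2; set z1 := _ * s; set z2 := c1 ^+ 2; set z3 := _ / a0; set z4 := _ ^+ _; set z5 := _ / a; clear -hQ; nra.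
- by move: sT n0' c12 c12a p2; set z2 := c1 ^+ 2; set z3 := _ / a0; set z4 := _ ^+ _; clear -hQ; nra.
Qed.

Lemma Q_ratio x y : 0 < x -> x <= y -> y * Q x <= x * Q y.
Proof.
move=> x0 xy; have h1 := tangent_le hQ x y; have h2 := Q_le_xdQ hQ (ltW x0).
have : Q x * (y - x) <= x * q x * (y - x) by rewrite ler_wpM2r// subr_ge0.
by have := ler_wpM2l (ltW x0) h1; clear -hQ; lra.
Qed.

(** Quasi-monotonicity prevents [sqrt T] from decreasing by more than a constant factor, so the
    hypothesis bounds [Q y / Q x]. Then [reg_pow] bounds [q y / q x] and the monotonicity of
    [Q z / z] bounds [y / x], which together bound [T]. *)
Lemma theta_ratio D x y : 1 <= D -> 0 < x -> x <= y ->
  Q y * Num.sqrt (T y) <= D * (Q x * Num.sqrt (T x)) ->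
  Q y <= D * A * Q x /\ T y <= (D * A) ^+ K.+1 * T x.
Proof.
move=> D1 x0 xy h; have y0 := lt_le_trans x0 xy; have A1 := reg_A hQ.
have Qx := reg_gt0 hQ x0; have Qy := reg_gt0 hQ y0.
have Tx := T_ge1 hQ x0; have Ty := T_ge1 hQ y0.
have sx0 : 0 < Num.sqrt (T x) by rewrite sqrtr_gt0 (lt_le_trans ltr01).
have sxy : Num.sqrt (T x) <= A * Num.sqrt (T y).
  apply: (@le_trans _ _ (Num.sqrt (A * T y))); first by rewrite ler_wsqrtr// (reg_quasi hQ).
  rewrite sqrtrM ?(le_trans ler01)// ler_wpM2r ?sqrtr_ge0//.
  rewrite -(@ler_pXn2r _ 2) ?nnegrE ?sqrtr_ge0 ?(le_trans ler01)// sqr_sqrtr ?(le_trans ler01)//.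
  by rewrite expr2 ler_peMr// (le_trans ler01).
have QQ : Q y <= D * A * Q x.
  rewrite -(ler_pM2r sx0); apply: (@le_trans _ _ (A * (Q y * Num.sqrt (T y)))).
    by rewrite mulrCA ler_wpM2l// ltW.
  have := ler_wpM2l (le_trans ler01 A1) h; set z1 := A * _; set z2 := Num.sqrt _.
  by clear -hQ; lra.
split=> //; rewrite /growthT ler_pdivrMr//.
have DA1 : 1 <= D * A by rewrite mulr_ege1.
have DA0 : 0 <= D * A := le_trans ler01 DA1.
have yx : y <= D * A * x.
  rewrite -(ler_pM2r Qx); apply: (le_trans (Q_ratio x0 xy)).
  by have := ler_wpM2l (ltW x0) QQ; clear -hQ; lra.
have qq : q y <= (D * A) ^+ K * q x.
  have := reg_pow hQ x0 xy; rewrite -ler_pdivlMr ?exprn_gt0// => /le_trans; apply.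
  rewrite -mulrA -expr_div_n mulrC ler_wpM2r ?(ltW (reg_dgt0 hQ x0))//.
  by rewrite lerXn2r ?nnegrE ?divr_ge0 ?(ltW Qy) ?(ltW Qx)// ler_pdivrMr.
apply: (@le_trans _ _ (D * A * x * ((D * A) ^+ K * q x))).
  by apply: ler_pM; rewrite ?(ltW y0) ?(ltW (reg_dgt0 hQ y0)).
rewrite exprS (_ : D * A * x * _ = D * A * (D * A) ^+ K * (x * q x / Q x) * Q x); last by field; rewrite gt_eqF.
apply: ler_wpM2l; last exact: (Q_homo hQ (ltW x0) xy).
by rewrite !mulr_ge0 ?exprn_ge0 ?invr_ge0 ?(ltW x0) ?(ltW Qx) ?(ltW (reg_dgt0 hQ x0)) ?(le_trans ler01 D1) ?(le_trans ler01 A1).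
Qed.

Lemma growth_scaled N P r t M (rho e : R) : 0 < r -> (size P <= N.+1)%N -> 0 < M ->
  (forall u, `|u| <= r -> `|P.[u]| <= M) ->
  0 < e -> e <= 1 -> rho * e = 1 -> rho + e = 2 * (t / r) -> `|P.[t]| <= M * rho ^+ N.
Proof.
move=> r0 sP M0 PM e0 e1 re rz.
have := @bernstein_walsh R N (affine 0 r P) M (t / r) rho e (leq_trans (size_affine _ _ _) sP) M0.
have tE : r * (t / r) = t by rewrite mulrC divfK ?gt_eqF.
rewrite affineE add0r tE; apply=> // u hu.
by rewrite affineE add0r PM// normrM (gtr0_norm r0) ler_piMr ?(ltW r0)// ler_norml.
Qed.

Lemma joukowski (z : R) : 1 <= z -> exists rho e : R,
  [/\ 0 < e, e <= 1, rho * e = 1, rho + e = 2 * z & rho = z + Num.sqrt (z ^+ 2 - 1)].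
Proof.
move=> z1; set s := Num.sqrt (z ^+ 2 - 1).
have s2 : s ^+ 2 = z ^+ 2 - 1 by rewrite sqr_sqrtr// subr_ge0 exprn_ege1.
have s0 : 0 <= s by rewrite sqrtr_ge0.
have re : (z + s) * (z - s) = 1 by rewrite (_ : _ * _ = z ^+ 2 - s ^+ 2); [rewrite s2|]; ring.
have zs : 0 < z + s by rewrite ltr_wpDr// (lt_le_trans ltr01).
have e0 : 0 < z - s by rewrite -(pmulr_rgt0 _ zs) re.
exists (z + s), (z - s); split=> //; last by ring.
have : (z - s) * 1 <= (z - s) * (z + s) by rewrite ler_pM2l//; move: z1 s0; lra.
by rewrite mulr1 [_ * (z + s)]mulrC re.
Qed.

(** In the Bernstein-Walsh inequality [rho + 1 / rho = 2 |t| / r], so [rho <= exp(2 |t| / r)]. The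
    slack [eps] covers [M = 0], where that inequality does not apply directly. *)
Lemma poly_far N P r t M : 0 < r -> (size P <= N.+1)%N -> 0 <= M ->
  (forall u, `|u| <= r -> `|P.[u]| <= M) -> r <= `|t| ->
  `|P.[t]| <= M * expR (2 * N%:R * (`|t| / r)).
Proof.
move=> r0 sP M0 PM rt.
wlog t0 : P sP PM t rt / 0 <= t.
  move=> H; have [|/ltW t0] := leP 0 t; first by move=> t0; apply: H.
  have := H (P \Po (- 'X)) _ _ (- t); rewrite normrN horner_comp hornerN hornerX opprK; apply=> //.
  - by rewrite size_comp_poly2// size_polyN size_polyX.
  - by move=> u ur; rewrite horner_comp hornerN hornerX PM// normrN.
  - by rewrite oppr_ge0.
rewrite ger0_norm// in rt *.
have z1 : 1 <= t / r by rewrite ler_pdivlMr// mul1r.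
have [rho [e [e0 e1 re rz rhoE]]] := joukowski z1.
have key M' : 0 < M' -> M <= M' -> `|P.[t]| <= M' * expR (2 * N%:R * (t / r)).
  move=> M'0 MM; apply: le_trans (growth_scaled r0 sP M'0 _ e0 e1 re rz) _.
    by move=> u ur; apply: le_trans MM; exact: PM.
  rewrite ler_pM2l// -mulrA mulrCA expRM_natl lerXn2r ?nnegrE ?expR_ge0//.
    by rewrite -(pmulr_lge0 _ e0) re ler01.
  apply: le_trans (expR_ge1Dx _); move: rz e0; lra.
apply/ler_addgt0Pr => eps eps0.
have ex0 : 0 < expR (2 * N%:R * (t / r)) by rewrite expR_gt0.
apply: le_trans (key (M + eps / expR (2 * N%:R * (t / r))) _ _) _.
- by rewrite ltr_wpDl// divr_gt0.
- by rewrite lerDl divr_ge0// ltW.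
- by rewrite mulrDl divfK ?gt_eqF.
Qed.

(* Beyond [Q sqrt T ~ N] the weight decays faster than polynomials of degree [N] grow. *)
Lemma max_theta N P x : (size P <= N.+1)%N -> 0 < x -> P.[x] != 0 ->
  (forall t, `|t| <= x -> `|P.[t]| * w t <= `|P.[x]| * w x) ->
  Q x * Num.sqrt (T x) <= 2 ^+ K.+3 * N%:R.
Proof.
move=> sP x0 Px hmax.
have Tx := T_ge1 hQ x0; have Qx := reg_gt0 hQ x0; have qx := reg_dgt0 hQ x0.
have T0 : 0 < T x := lt_le_trans ltr01 Tx.
set s := Num.sqrt (T x); have s0 : 0 < s by rewrite sqrtr_gt0.
have s2 : s ^+ 2 = T x by rewrite sqr_sqrtr// ltW.
have s1 : 1 <= s by rewrite -[leLHS]sqrtr1 ler_wsqrtr.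
(* Half of the scale [x / T x], in units of [x]. One such step back, [Q] is lower by a fixed
   proportion, while the Joukowski parameter of [x / y] is only [1 + 4 / sqrt(T x)]. Maximality at
   [x] then bounds [Q x] by a multiple of [N / sqrt(T x)]. *)
pose v := (2 * T x)^-1; have v0 : 0 < v by rewrite invr_gt0 mulr_gt0.
have vT : v * T x = 1 / 2 by rewrite /v; field; rewrite gt_eqF.
have v2 : v <= 1 / 2 by rewrite -vT ler_peMr// ltW.
pose y := x * (1 - v); have y0 : 0 < y by rewrite mulr_gt0//; move: v2; clear -hQ; lra.
have yx : y <= x by rewrite ler_piMr ?(ltW x0)//; move: v0; clear -hQ; lra.
have xqv : (x - y) * q x = Q x / 2.
  have -> : (x - y) * q x = v * (x * q x) by rewrite /y; ring.
  by rewrite -(growthTE hQ x0) mulrA vT; field.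
have [_ q2] := @down_scale _ _ _ _ _ hQ x y y0 yx ltac:(rewrite xqv; move: Qx; clear -hQ; lra).
have drop : Q x <= 2 ^+ K.+1 * (Q x - Q y).
  have : q y * (x - y) <= Q x - Q y by have := tangent_le hQ y x; clear -hQ; lra.
  have : (x - y) * q x <= 2 ^+ K * (q y * (x - y)).
    by rewrite [q y * _]mulrC mulrCA ler_wpM2l// subr_ge0.
  have k0 : 0 < (2 : R) ^+ K by rewrite exprn_gt0.
  by rewrite xqv exprS => h1 h2; have := ler_wpM2l (ltW k0) h2; move: h1; clear -hQ; lra.
have z1 : 1 <= x / y by rewrite ler_pdivlMr// mul1r.
have [rho [e [e0 e1 re rz rhoE]]] := joukowski z1.
have zE : x / y = (1 - v)^-1 by rewrite /y invfM mulrA divff ?mul1r// gt_eqF.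
have zv : x / y <= 1 + 2 * v.
  rewrite zE -[leLHS]div1r ler_pdivrMr; last by move: v2; clear -hQ; lra.
  by have : v * v <= v * (1 / 2); [rewrite ler_pM2l|clear -hQ; lra].
have rho1 : rho <= 1 + 4 / s.
  rewrite rhoE.
  have vs : v = (1 / 2) * (s^-1 * s^-1) by rewrite /v -s2; field; rewrite gt_eqF.
  have si0 : 0 < s^-1 by rewrite invr_gt0.
  have si1 : s^-1 <= 1 by rewrite invf_le1.
  have : Num.sqrt ((x / y) ^+ 2 - 1) <= 3 / s.
    rewrite -(@ler_pXn2r _ 2) ?nnegrE ?sqrtr_ge0 ?divr_ge0 ?(ltW s0)// sqr_sqrtr ?subr_ge0 ?exprn_ege1//.
    have : (x / y) ^+ 2 <= (1 + 2 * v) ^+ 2 by rewrite lerXn2r ?nnegrE// ?(le_trans ler01 z1)//; move: v0; clear -hQ; lra.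
    rewrite [(3 / s) ^+ 2](_ : _ = 18 * v); last by rewrite vs; field; rewrite gt_eqF.
    have : v * v <= v * (1 / 2) by rewrite ler_pM2l.
    have -> : (1 + 2 * v) ^+ 2 = 1 + 4 * v + 4 * (v * v) by ring.
    by move: v0; set zz := _ ^+ 2; set vv := v * v; clear -hQ; lra.
  have : s^-1 * s^-1 <= s^-1 by rewrite ler_piMl// ltW.
  by move: zv; rewrite vs; clear -hQ; lra.
have M0 : 0 < `|P.[x]| * w x * expR (Q y).
  by apply: mulr_gt0; [apply: mulr_gt0; [rewrite normr_gt0|exact: weight_gt0]|exact: expR_gt0].
have Mu u : `|u| <= y -> `|P.[u]| <= `|P.[x]| * w x * expR (Q y).
  move=> uy; have := hmax u (le_trans uy yx) => h.
  apply: (@le_trans _ _ (`|P.[u]| * w u * expR (Q u))).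
    by rewrite -mulrA /weight -expRD addNr expR0 mulr1.
  by apply: ler_pM => //; rewrite ?mulr_ge0 ?expR_ge0 ?weight_ge0// ler_expR (Q_homo_norm hQ).
have h : 1 <= expR (- Q x + Q y) * rho ^+ N.
  rewrite -(@ler_pM2l _ `|P.[x]|) ?normr_gt0// mulr1 expRD !mulrA.
  exact: growth_scaled y0 sP M0 Mu e0 e1 re rz.
have rhoe : rho ^+ N <= expR (N%:R * (4 / s)).
  rewrite expRM_natl lerXn2r ?nnegrE ?expR_ge0//; first by rewrite -(pmulr_lge0 _ e0) re ler01.
  exact: le_trans rho1 (expR_ge1Dx _).
have : expR 0 <= expR (- Q x + Q y + N%:R * (4 / s)).
  by rewrite expR0 expRD (le_trans h)// ler_wpM2l ?expR_ge0.
rewrite ler_expR => h2.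
have k0 : 0 < (2 : R) ^+ K.+1 by rewrite exprn_gt0.
have h3 : Q x <= 2 ^+ K.+1 * (N%:R * (4 / s)).
  by apply: (le_trans drop); rewrite ler_pM2l//; move: h2; clear -hQ; lra.
have kE : 2 ^+ K.+3 * N%:R = 2 ^+ K.+1 * (N%:R * (4 / s)) * s.
  have -> : (2 : R) ^+ K.+3 = 4 * 2 ^+ K.+1.
    by rewrite -[K.+3]/(2 + K.+1)%N exprD (_ : 2 ^+ 2 = 4 :> R)//; ring.
  by move: (2 ^+ K.+1) => z; field; rewrite gt_eqF.
by rewrite kE; exact: (ler_wpM2r (ltW s0) h3).
Qed.

Definition reflect P := P \Po (- 'X).

Lemma reflectE P x : (reflect P).[x] = P.[- x].
Proof. by rewrite horner_comp hornerN hornerX. Qed.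

Lemma size_reflect P : size (reflect P) = size P.
Proof. by rewrite size_comp_poly2// size_polyN size_polyX. Qed.

Lemma moment_reflect P : moment W (reflect P ^+ 2) = moment W (P ^+ 2).
Proof.
rewrite -!Rintegral_sqr_weight /Rintegral [in RHS]integral_reflect//.
- by congr fine; apply: eq_integral => t _; rewrite reflectE (weightN hQ).
- move=> t; apply: (@continuous_comp _ _ _ (fun t => P.[t] * w t) (fun u : R => u ^+ 2)).
    exact: (continuous_poly_weight hQ).
  exact: exprn_continuous.
- by move=> t; exact: sqr_ge0.
Qed.

Lemma moment_sqr_ge0 P : 0 <= moment W (P ^+ 2).
Proof. by apply: moment_ge0 => t; rewrite ?horner_exp sqr_ge0. Qed.

(* [T] frozen beyond [a], which makes the Christoffel bound valid on the whole
   line. *)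
Definition tau a x := Num.max 1 (T (Num.min `|x| a)).

Lemma tau_ge1 a x : 1 <= tau a x. Proof. by rewrite le_max lexx. Qed.

Lemma tau_le B n a x : mrs B n a -> tau a x <= A * T a.
Proof.
move=> h; have a0 := mrs_a h; have A1 := reg_A hQ; have T1 := T_ge1 hQ a0.
rewrite ge_max; apply/andP; split; first by rewrite mulr_ege1.
have [x0|xa] := eqVneq x 0.
  rewrite x0 normr0 min_l ?(ltW a0)// /growthT mul0r mul0r mulr_ge0// (le_trans ler01)//.
by apply: (reg_quasi hQ); rewrite ?lt_min ?normr_gt0 ?xa// ge_min lexx orbT.
Qed.

Lemma edge_bound_norm : exists2 C : R, 0 < C & forall N P x, (size P <= N)%N -> x != 0 ->
  (P.[x] * w x) ^+ 2 <=
  C * (N%:R + Num.sqrt (T `|x|) * (1 + Q x)) * (Num.sqrt (T `|x|) / `|x|) * moment W (P ^+ 2).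
Proof.
have [C C0 H] := edge_bound hQ; exists C => // N P x sP x0.
have [xp|xn] := leP 0 x.
  by rewrite ger0_norm//; apply: H => //; rewrite lt_def x0.
rewrite ltr0_norm// -moment_reflect -(weightN hQ) -(reg_even hQ).
have -> : P.[x] = (reflect P).[- x] by rewrite reflectE opprK.
by apply: H; rewrite ?size_reflect// oppr_gt0.
Qed.

Lemma sqrt_ge1 x : 1 <= x -> 1 <= Num.sqrt x.
Proof. by move=> x1; rewrite -[leLHS]sqrtr1 ler_wsqrtr. Qed.

Lemma sqrt_le_mul D x : 1 <= D -> 0 <= x -> Num.sqrt (D * x) <= D * Num.sqrt x.
Proof.
move=> D1 x0; rewrite sqrtrM ?(le_trans ler01)// ler_wpM2r ?sqrtr_ge0//.
rewrite -(@ler_pXn2r _ 2) ?nnegrE ?sqrtr_ge0 ?(le_trans ler01)// sqr_sqrtr ?(le_trans ler01)//.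
by rewrite expr2 ler_peMr// (le_trans ler01).
Qed.

Lemma sup_attained P x : P.[x] != 0 -> exists c,
  P.[c] != 0 /\ forall t, `|P.[t]| * w t <= `|P.[c]| * w c.
Proof.
move=> Px; pose f t := `|P.[t]| * w t.
have f0 : 0 < f x by rewrite mulr_gt0 ?normr_gt0 ?weight_gt0.
have [C C0 hC] := poly_weight_le hQ P.
pose L := `|x| + (C / f x + 1).
have Cf0 : 0 <= C / f x by rewrite divr_ge0// ltW.
have L0 : 0 <= L by rewrite !addr_ge0.
have cf : continuous f.
  move=> t; apply: cvgM; last exact: (continuous_weight hQ).
  by apply: cvg_norm; exact: continuous_horner.
have [c cL cmax] := @EVT_max R f (- L) L ltac:(by rewrite lerNl; move: L0; clear -hQ; lra) (continuous_subspaceT cf).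
have xL : x \in `[- L, L]%R by rewrite in_itv/= -ler_norml lerDl addr_ge0.
have fc : 0 < f c := lt_le_trans f0 (cmax x xL).
exists c; split; first by move: fc; rewrite /f pmulr_lgt0 ?weight_gt0// normr_gt0.
move=> t; have [tL|tL] := leP `|t| L; first by apply: cmax; rewrite in_itv/= -ler_norml.
apply: le_trans (cmax x xL); apply: (le_trans (hC t)).
have t2 : 0 < 1 + t ^+ 2 by rewrite ltr_pwDl// sqr_ge0.
rewrite ler_pdivrMr// -ler_pdivrMl// mulrC.
have Lt : C / f x + 1 <= `|t| by apply: le_trans (ltW tL); rewrite lerDr.
rewrite -real_normK ?num_real// expr2.
by move: Lt Cf0; set u := C / f x; set v := `|t|; clear -hQ; nra.
Qed.

(** Up to [a / 16] the interior bound applies, with [8 r = a / 2]; up to [a], the edge bound. Beyond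
    [a] the value is at most the maximum of [|P| w]. If this is attained at some [c] beyond [a],
    [max_theta] and [theta_ratio] bound [Q] and [T] at [c] by multiples of their values at [a], and
    the edge bound applies at [c]. The size [5 n] leaves room for all later uses. *)
Lemma christoffel_bound B : 1 <= B -> exists2 C : R, 0 < C & forall n a, mrs B n a ->
  forall P x, (size P <= 5 * n)%N ->
  (P.[x] * w x) ^+ 2 <= C * (n%:R / a) * Num.sqrt (tau a x) * moment W (P ^+ 2).
Proof.
move=> B1; have [Ci Ci0 Hi] := interior_bound hQ; have [Ce Ce0 He] := edge_bound_norm.
have A1 := reg_A hQ; have A0 : 0 < A := lt_le_trans ltr01 A1.
have B0 : 0 < B := lt_le_trans ltr01 B1.
pose D := Num.max 1 (2 ^+ K.+3 * 5 * B) : R.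
have D1 : 1 <= D by rewrite le_max lexx.
have D0 : 0 < D := lt_le_trans ltr01 D1.
pose E := (D * A) ^+ K.+1.
have DA : 1 <= D * A by rewrite mulr_ege1.
have E1 : 1 <= E by rewrite exprn_ege1.
have E0 : 0 < E := lt_le_trans ltr01 E1.
pose c12 := 16 * Ci * (6 + B) + 16 * Ce * (5 + 2 * A * B).
pose c3 := Ce * (5 + 2 * E * (D * A) * B) * E.
have c120 : 0 < c12.
  by apply: addr_gt0; apply: mulr_gt0; rewrite ?mulr_gt0// addr_gt0// !mulr_gt0.
have c30 : 0 < c3 by apply: mulr_gt0 => //; apply: mulr_gt0 => //; rewrite addr_gt0// !mulr_gt0.
exists (c12 * (1 + A) + c3); first by rewrite addr_gt0// mulr_gt0// addr_gt0.
move=> n a h; have a0 := mrs_a h; have n0 := mrs_n h.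
have nR : 1 <= (n%:R : R) by rewrite ler1n.
have n0R : 0 < (n%:R : R) := lt_le_trans ltr01 nR.
have T1 := T_ge1 hQ a0; have T0 : 0 <= T a := le_trans ler01 T1.
have Qa := reg_gt0 hQ a0.
have hi := mrs_hi h; have sT := mrs_sT h; set s := Num.sqrt (T a) in hi sT.
have s1 : 1 <= s := sqrt_ge1 T1.
have s0 : 0 < s := lt_le_trans ltr01 s1.
have QaB : Q a <= B * n%:R by apply: le_trans hi; rewrite ler_peMr// ltW.
have inner P x : (size P <= 5 * n)%N -> `|x| <= a ->
    (P.[x] * w x) ^+ 2 <= c12 * (n%:R / a) * Num.sqrt (tau a x) * moment W (P ^+ 2).
  move=> sP xa; have I0 := moment_sqr_ge0 P.
  have st1 := sqrt_ge1 (tau_ge1 a x).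
  have [x16|x16] := leP `|x| (a / 16).
    have a16 : 0 < a / 16 by rewrite divr_gt0.
    have := Hi _ _ _ _ sP a16 x16 => /le_trans; apply; rewrite ler_wpM2r//.
    have Q8 : Q (8 * (a / 16)) <= B * n%:R.
      by apply: le_trans QaB; apply: (Q_homo hQ); move: a0; clear -hQ; lra.
    apply: (@le_trans _ _ (16 * Ci * (6 + B) * (n%:R / a))).
      rewrite natrM invf_div (_ : 16 * Ci * _ * _ = Ci * ((6 + B) * n%:R) * (16 / a)); last by ring.
      rewrite ler_wpM2r ?divr_ge0 ?(ltW a0)// ler_pM2l//.
      by move: Q8 nR; clear -hQ; lra.
    have y0 : 0 <= n%:R / a by rewrite divr_ge0// ltW.
    apply: (@le_trans _ _ (c12 * (n%:R / a))); last by rewrite ler_peMr// mulr_ge0// ltW.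
    rewrite ler_wpM2r// /c12 lerDl.
    by rewrite !mulr_ge0 ?addr_ge0 ?mulr_ge0 ?invr_ge0 ?(ltW Ce0) ?(ltW A0) ?(ltW B0).
  have xp : 0 < `|x| by apply: lt_trans x16; rewrite divr_gt0.
  have x0 : x != 0 by rewrite -normr_gt0.
  have tE : tau a x = T `|x| by rewrite /tau min_l// max_r// (T_ge1 hQ).
  have tA := tau_le x h.
  apply: le_trans (He _ _ _ sP x0) _; rewrite -tE ler_wpM2r//.
  set st := Num.sqrt (tau a x) in st1 *.
  have stA : st <= A * s by apply: le_trans (sqrt_le_mul A1 T0); rewrite ler_wsqrtr.
  have st0 : 0 <= st := le_trans ler01 st1.
  have Qxa : Q x <= Q a := Q_homo_norm hQ xa.
  have sQ : st * (1 + Q x) <= 2 * A * B * n%:R.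
    apply: (@le_trans _ _ (A * s * (1 + Q a))).
      by apply: ler_pM => //; [rewrite addr_ge0// (Q_ge0 hQ)|rewrite lerD2l].
    have := ler_wpM2l (ltW A0) hi; have := ler_wpM2l (ltW A0) sT; clear -hQ; lra.
  have ix : `|x|^-1 <= 16 / a by rewrite -[16 / a]invf_div lef_pV2 ?posrE ?divr_gt0// ltW.
  apply: (@le_trans _ _ (Ce * ((5 + 2 * A * B) * n%:R) * (st * (16 / a)))).
    apply: ler_pM; rewrite ?mulr_ge0 ?addr_ge0 ?invr_ge0 ?(ltW Ce0) ?(Q_ge0 hQ)//.
    - by rewrite mulr_ge0// addr_ge0// (Q_ge0 hQ).
    - by rewrite ler_pM2l// natrM; move: sQ; clear -hQ; lra.
    - by rewrite ler_wpM2l.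
  rewrite (_ : Ce * _ * _ = 16 * Ce * (5 + 2 * A * B) * (n%:R / a) * st); last by ring.
  rewrite ler_wpM2r// ler_wpM2r ?divr_ge0 ?(ltW a0)// /c12 lerDr.
  by rewrite !mulr_ge0 ?addr_ge0 ?(ltW Ci0) ?(ltW B0).
move=> P x sP; have I0 := moment_sqr_ge0 P.
have st1 := sqrt_ge1 (tau_ge1 a x).
have y0 : 0 <= n%:R / a by rewrite divr_ge0// ltW.
have st0 : 0 <= Num.sqrt (tau a x) by rewrite sqrtr_ge0.
have C0 := ltW (addr_gt0 (mulr_gt0 c120 (addr_gt0 ltr01 A0)) c30).
have [xa|xa] := leP `|x| a.
  apply: (le_trans (inner P x sP xa)); rewrite ler_wpM2r// ler_wpM2r// ler_wpM2r//.
  rewrite mulrDr mulr1 -addrA lerDl addr_ge0 ?(ltW c30)// mulr_ge0 ?(ltW c120) ?(ltW A0)//.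
have tE : tau a x = T a by rewrite /tau min_r ?(ltW xa)// max_r.
rewrite tE -/s.
have [Px0|Px] := eqVneq P.[x] 0.
  rewrite Px0 mul0r expr0n/=; apply: mulr_ge0 => //.
  by apply: (mulr_ge0 _ (ltW s0)); exact: mulr_ge0.
have [c [Pc cmax]] := sup_attained Px.
apply: (@le_trans _ _ ((P.[c] * w c) ^+ 2)).
  rewrite -[leLHS]real_normK ?num_real// -[leRHS]real_normK ?num_real//.
  rewrite lerXn2r ?nnegrE// !normrM (ger0_norm (weight_ge0 Q x)) (ger0_norm (weight_ge0 Q c)).
  exact: cmax.
have [ca|ca] := leP `|c| a.
  apply: (le_trans (inner P c sP ca)); rewrite ler_wpM2r//.
  have stA : Num.sqrt (tau a c) <= A * s.
    by apply: le_trans (sqrt_le_mul A1 T0); rewrite ler_wsqrtr// (tau_le c h).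
  apply: (@le_trans _ _ (c12 * (n%:R / a) * (A * s))).
    by rewrite ler_wpM2l// mulr_ge0// ltW.
  have := mulr_ge0 (mulr_ge0 (ltW c120) y0) (ltW s0).
  have := mulr_ge0 (mulr_ge0 (ltW c30) y0) (ltW s0).
  by clear -hQ; lra.
have cp : 0 < `|c| := lt_trans a0 ca.
have c0 : c != 0 by rewrite -normr_gt0.
have Qc : Q `|c| * Num.sqrt (T `|c|) <= D * (Q a * s).
  have [P' [sP' P'c P'm]] : exists P', [/\ (size P' <= (5 * n).+1)%N, P'.[`|c|] != 0 &
      forall t, `|P'.[t]| * w t <= `|P'.[`|c|]| * w `|c| ].
    have [c0'|c0'] := leP 0 c.
      by exists P; rewrite ger0_norm//; split=> //; exact: leqW.
    exists (reflect P); rewrite ltr0_norm// !reflectE opprK size_reflect; split=> //; first exact: leqW.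
    by move=> t; rewrite reflectE -(weightN hQ t) (weightN hQ c); exact: cmax.
  apply: le_trans (max_theta sP' cp P'c (fun t _ => P'm t)) _.
  rewrite natrM mulrA; apply: (@le_trans _ _ (2 ^+ K.+3 * 5 * (B * (Q a * s)))).
    by apply: ler_wpM2l; [rewrite mulr_ge0// exprn_ge0|exact: (mrs_lo h)].
  rewrite mulrA ler_wpM2r ?mulr_ge0 ?(ltW Qa) ?(ltW s0)// le_max lexx orbT//.
have [Qca Tca] := theta_ratio D1 a0 (ltW ca) Qc.
apply: le_trans (He _ _ _ sP c0) _; rewrite ler_wpM2r//.
have sc : Num.sqrt (T `|c|) <= E * s.
  by apply: le_trans (sqrt_le_mul E1 T0); rewrite ler_wsqrtr.
have sc0 : 0 <= Num.sqrt (T `|c|) by rewrite sqrtr_ge0.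
rewrite -(Q_norm hQ c).
apply: (@le_trans _ _ (Ce * ((5 + 2 * E * (D * A) * B) * n%:R) * (E * s / a))); last first.
  have := mulr_ge0 (mulr_ge0 (mulr_ge0 (ltW c120) (addr_ge0 ler01 (ltW A0))) y0) (ltW s0).
  by rewrite /c3; set z := c12 * _; rewrite (_ : Ce * _ * _ = Ce * (5 + 2 * E * (D * A) * B) * E * (n%:R / a) * s); [clear -hQ; lra|ring].
apply: ler_pM; rewrite ?mulr_ge0 ?addr_ge0 ?invr_ge0 ?(ltW Ce0) ?(Q_ge0 hQ)//.
- by rewrite mulr_ge0// addr_ge0// (Q_ge0 hQ).
- have -> : (5 + 2 * E * (D * A) * B) * n%:R = 5 * n%:R + 2 * E * (D * A) * B * n%:R by ring.
  rewrite ler_pM2l// natrM lerD2l.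
  apply: (@le_trans _ _ (E * s * (D * A * (1 + Q a)))).
    apply: ler_pM => //; first by rewrite addr_ge0// (Q_ge0 hQ).
    by rewrite mulrDr mulr1 lerD.
  have := ler_wpM2l (mulr_ge0 (ltW E0) (le_trans ler01 DA)) hi.
  have := ler_wpM2l (mulr_ge0 (ltW E0) (le_trans ler01 DA)) sT.
  by clear -hQ; lra.
- by apply: ler_pM; rewrite ?invr_ge0// lef_pV2 ?posrE//; exact: ltW.
Qed.

(** Doubling the argument multiplies [Q t / t] by at least [1 / halving]. After a number of
    doublings depending only on [B] and [D] the quotient exceeds [D n / a], and it stays above since
    [Q t / t] is nondecreasing. *)
Lemma Q_far B D : 1 <= B -> 0 < D -> exists2 L : R, 1 <= L & forall n a, mrs B n a ->
  forall t, L * a <= `|t| -> D * n%:R * (`|t| / a) <= Q t.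
Proof.
move=> B1 D0; have B0 : 0 < B := lt_le_trans ltr01 B1.
have /andP[h1 h2] := halvingP hQ; have l0 : 0 < halving l by rewrite (lt_le_trans _ h1)// divr_gt0.
have [j Hj] : exists j, halving l ^+ j <= (2 * B * D)^-1.
  have := @cvg_expr R (halving l) ltac:(by rewrite gtr0_norm).
  move=> /cvgrPdist_lt/(_ (2 * B * D)^-1) []; first by rewrite invr_gt0 !mulr_gt0.
  move=> j _ /(_ j (leqnn _)); rewrite /= sub0r normrN gtr0_norm ?exprn_gt0// => hh.
  by exists j; exact: ltW.
exists (2 ^+ j.+1); first by rewrite exprn_ege1// ler1n.
move=> n a h t tL; have a0 := mrs_a h; have Qa := reg_gt0 hQ a0; have T1 := T_ge1 hQ a0.
have p0 : 0 < 2 ^+ j.+1 * a by rewrite mulr_gt0// exprn_gt0.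
rewrite -(Q_norm hQ t); set u := `|t| in tL *; have u0 : 0 < u := lt_le_trans p0 tL.
have Q2a : n%:R / B <= Q (2 * a).
  rewrite ler_pdivrMr// mulrC; apply: le_trans (mrs_lo h) _; rewrite ler_pM2l//.
  apply: le_trans (xdQ_le_Q2 hQ (ltW a0)); rewrite -(growthTE hQ a0) mulrC ler_wpM2r ?(ltW Qa)//.
  rewrite -{2}(@sqr_sqrtr _ (T a)) ?(le_trans ler01)// expr2 ler_peMr ?sqrtr_ge0//; exact: sqrt_ge1.
have Qj : 2 ^+ j * Q (2 * a) <= halving l ^+ j * Q (2 ^+ j.+1 * a).
  have E : 2 ^+ j.+1 * a / 2 ^+ j = 2 * a by rewrite exprS; field; rewrite expf_neq0.
  have := Q_halve_iter hQ j p0; rewrite E => /(ler_wpM2l (exprn_ge0 j (ler0n R 2))).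
  by rewrite expr_div_n mulrA [2 ^+ j * (_ / _)]mulrC divfK ?expf_neq0.
have main : 2 ^+ j.+1 * (D * n%:R) <= Q (2 ^+ j.+1 * a).
  have Qp : 0 <= Q (2 ^+ j.+1 * a) by exact: Q_ge0 hQ _.
  have h3 : 2 ^+ j * (n%:R / B) <= (2 * B * D)^-1 * Q (2 ^+ j.+1 * a).
    apply: (@le_trans _ _ (2 ^+ j * Q (2 * a))); first by rewrite ler_wpM2l// exprn_ge0.
    by apply: (le_trans Qj); rewrite ler_wpM2r.
  have c0 : 0 < 2 * B * D by rewrite !mulr_gt0.
  have := ler_wpM2l (ltW c0) h3; rewrite (mulVKf (lt0r_neq0 c0)).
  rewrite exprS (_ : 2 * B * D * _ = 2 * 2 ^+ j * (D * n%:R))//; field; exact: lt0r_neq0.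
have := Q_ratio p0 tL; rewrite mulrC => hr.
have := le_trans (ler_wpM2r (ltW u0) main) hr.
rewrite -(ler_pM2l p0 (D * n%:R * (u / a))); apply: le_trans; rewrite le_eqVlt; apply/orP; left; apply/eqP.
by field; rewrite gt_eqF.
Qed.

End Range.

(** * The de la Vallee Poussin kernel *)

Section SecondMoment.
Context {R : realType} (Q : R -> R) (K : nat) (A l : R).
Hypothesis hQ : regular Q K A l.
Local Notation mu := (@lebesgue_measure R).
Local Notation q := (derive1 Q : R -> R).
Local Notation T := (growthT Q).
Local Notation w := (weight Q).
Local Notation W := (fun x => w x ^+ 2).
Implicit Types (x y t d r a B : R) (P : {poly R}).

Lemma sqr_norm x : `|x| ^+ 2 = x ^+ 2.
Proof. by rewrite real_normK ?num_real. Qed.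

(** Within [L a] the factor [t^2] is trivially bounded. Beyond, [poly_far] allows growth
    [exp(B n + 6 n |t| / a)], the 6 being twice the 3 of the degree, while the weight is at most
    [exp(-(B + 10) n |t| / a)]. The surplus absorbs the powers of [n] and [t] and leaves an
    integrable Cauchy kernel. *)
Lemma second_moment B : 1 <= B -> exists2 C : R, 0 < C & forall n a, mrs Q B n a ->
  forall P, (size P <= 3 * n)%N ->
  moment W ('X^2 * P ^+ 2) <= C * a ^+ 2 * moment W (P ^+ 2).
Proof.
move=> B1; have [C0 C00 HC] := christoffel_bound hQ B1.
have B0 : 0 < B := lt_le_trans ltr01 B1.
have A1 := reg_A hQ; have A0 : 0 < A := lt_le_trans ltr01 A1.
have D0 : 0 < B + 10 by rewrite addr_gt0.
have [L L1 HL] := Q_far hQ B1 D0.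
have L0 : 0 < L := lt_le_trans ltr01 L1.
pose c := 2 * (C0 * A * B); have c0 : 0 < c by rewrite !mulr_gt0.
exists (L ^+ 2 + c * pi); first by rewrite addr_gt0 ?mulr_gt0 ?exprn_gt0 ?pi_gt0.
move=> n a h P sP; have a0 := mrs_a h; have n0 := mrs_n h.
have nR : 1 <= (n%:R : R) by rewrite ler1n.
set I := moment W (P ^+ 2); have I0 : 0 <= I := moment_sqr_ge0 Q P.
have T1 := T_ge1 hQ a0; have T0 : 0 <= T a := le_trans ler01 T1.
pose G := C0 * (n%:R / a) * (A * (B * n%:R)) * I.
have na0 : 0 <= n%:R / a by rewrite divr_ge0 ?(ltW a0).
have G0 : 0 <= G.
  by rewrite /G !mulr_ge0 ?(ltW C00) ?(ltW A0) ?(ltW B0) ?invr_ge0 ?(ltW a0).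
have sP5 : (size P <= 5 * n)%N by rewrite (leq_trans sP)// leq_mul2r orbT.
have Pw u : (P.[u] * w u) ^+ 2 <= G.
  have tA : Num.sqrt (tau Q a u) <= A * (B * n%:R).
    have t1 : Num.sqrt (tau Q a u) <= Num.sqrt (A * T a) by rewrite ler_wsqrtr// (tau_le hQ u h).
    apply: (le_trans t1); apply: (le_trans (sqrt_le_mul A1 T0)).
    by rewrite ler_pM2l//; exact: mrs_sT h.
  apply: (le_trans (HC _ _ h P u sP5)); apply: ler_wpM2r => //; apply: ler_wpM2l => //.
  by rewrite mulr_ge0// ltW.
have Qa : Q a <= B * n%:R.
  apply: le_trans (mrs_hi h); rewrite ler_peMr ?(Q_ge0 hQ)//; exact: sqrt_ge1.
have far t : L * a <= `|t| -> t ^+ 2 * (P.[t] * w t) ^+ 2 <= c * a * I * cauchy 0 a t.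
  move=> Lt; set s := `|t| / a.
  have at0 : a <= `|t| by apply: le_trans Lt; rewrite ler_peMl// ltW.
  have s1 : 1 <= s by rewrite ler_pdivlMr// mul1r.
  pose M := Num.sqrt G * expR (B * n%:R).
  have M0 : 0 <= M by rewrite mulr_ge0 ?sqrtr_ge0 ?expR_ge0.
  have Pu u : `|u| <= a -> `|P.[u]| <= M.
    move=> ua; rewrite -[`|_|]mulr1 -(expR0) -(subrr (Q u)) expRD [expR _ * _]mulrC mulrA.
    apply: ler_pM; rewrite ?expR_ge0//; last by rewrite ler_expR (le_trans _ Qa)// (Q_homo_norm hQ).
    have := Pw u; rewrite -sqr_norm normrM (ger0_norm (weight_ge0 Q u)) => hh.
    by rewrite -[leLHS]ger0_norm// -sqrtr_sqr ler_wsqrtr.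
  have sP1 : (size P <= (3 * n).+1)%N := leqW sP.
  have hP := poly_far a0 sP1 M0 Pu at0.
  have hw : w t <= expR (- ((B + 10) * n%:R * s)) by rewrite ler_expR lerN2 (HL _ _ h).
  have hPw : (P.[t] * w t) ^+ 2 <= G * expR (- (8 * (n%:R * s))).
    have hh : `|P.[t]| * w t <= Num.sqrt G * expR (- (4 * (n%:R * s))).
      apply: (le_trans (ler_pM _ (weight_ge0 Q t) hP hw)); first exact: normr_ge0.
      rewrite /M -!mulrA ler_wpM2l ?sqrtr_ge0// -!expRD ler_expR natrM -/s.
      have : B * n%:R * 1 <= B * n%:R * s by rewrite ler_wpM2l// mulr_ge0// ltW.
      by clear -hQ; lra.
    rewrite -sqr_norm normrM (ger0_norm (weight_ge0 Q t)).
    rewrite (_ : G * _ = (Num.sqrt G * expR (- (4 * (n%:R * s)))) ^+ 2).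
      by rewrite lerXn2r ?nnegrE ?mulr_ge0 ?weight_ge0 ?sqrtr_ge0 ?expR_ge0.
    by rewrite exprMn sqr_sqrtr// -expRM_natl; congr (_ * expR _); ring.
  have y1 : 1 <= n%:R * s by rewrite mulr_ege1.
  have ey : (n%:R * s) ^+ 4 * expR (- (8 * (n%:R * s))) <= 1.
    rewrite expRN -ler_pdivlMr ?invr_gt0 ?expR_gt0// invrK mul1r.
    apply: (@le_trans _ _ (expR (n%:R * s) ^+ 4)).
      rewrite lerXn2r ?nnegrE ?expR_ge0 ?(le_trans ler01 y1)//.
      by apply: le_trans (expR_ge1Dx _); rewrite lerDr.
    by rewrite -expRM_natl ler_expR; move: y1; clear -hQ; lra.
  apply: (le_trans (ler_wpM2l (sqr_ge0 t) hPw)).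
  have t2 : t ^+ 2 = a ^+ 2 * s ^+ 2 by rewrite /s expr_div_n real_normK ?num_real//; field; rewrite gt_eqF.
  rewrite /cauchy subr0 -ler_pdivrMr ?invr_gt0 ?ltr_pwDl ?sqr_ge0// invrK.
  have -> : (t / a) ^+ 2 = s ^+ 2 by rewrite expr_div_n t2; field; rewrite gt_eqF.
  rewrite t2 /G /c; set e := expR _ in ey *; set y := n%:R * s in y1 ey *.
  have e0 : 0 <= e by exact: expR_ge0.
  have k0 : 0 <= C0 * A * B * a * I by rewrite !mulr_ge0 ?(ltW C00) ?(ltW A0) ?(ltW B0) ?(ltW a0).
  have s2 : 1 + s ^+ 2 <= 2 * y ^+ 2.
    have : s <= y by rewrite /y ler_peMl// (le_trans ler01 s1).
    by move: s1 y1; rewrite !expr2; clear -hQ; nra.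
  have := ler_wpM2l k0 (ler_wpM2r e0 (ler_wpM2l (sqr_ge0 y) s2)).
  have := ler_wpM2l k0 ey.
  rewrite (_ : a ^+ 2 * s ^+ 2 * _ * _ = C0 * A * B * a * I * (y ^+ 2 * (1 + s ^+ 2) * e)); last first.
    by rewrite /y; field; rewrite gt_eqF.
  by rewrite (_ : y ^+ 4 = y ^+ 2 * y ^+ 2) ?exprD//; [clear -hQ; lra|ring].
have main t : ('X^2 * P ^+ 2).[t] * W t <= L ^+ 2 * a ^+ 2 * ((P ^+ 2).[t] * W t) + c * a * I * cauchy 0 a t.
  have -> : ('X^2 * P ^+ 2).[t] * W t = t ^+ 2 * (P.[t] * w t) ^+ 2.
    by rewrite hornerM hornerXn horner_exp -mulrA -exprMn.
  have -> : (P ^+ 2).[t] * W t = (P.[t] * w t) ^+ 2 by rewrite horner_exp exprMn.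
  have k1 := mulr_ge0 (mulr_ge0 (mulr_ge0 (ltW c0) (ltW a0)) I0) (ltW (cauchy_gt0 0 a t)).
  have [Lt|/ltW Lt] := leP `|t| (L * a); last first.
    by apply: (le_trans (far t Lt)); rewrite lerDr mulr_ge0 ?sqr_ge0// mulr_ge0 ?sqr_ge0.
  apply: (@le_trans _ _ (L ^+ 2 * a ^+ 2 * (P.[t] * w t) ^+ 2)); last by rewrite lerDl.
  rewrite ler_wpM2r ?sqr_ge0// -sqr_norm -exprMn lerXn2r ?nnegrE//.
  by rewrite mulr_ge0 ?(ltW L0) ?(ltW a0).
have int1 := weight_moments hQ (P ^+ 2).
have int2 := integrable_cauchy 0 a0.
have i1 := integrableZl measurableT (L ^+ 2 * a ^+ 2) int1.
have i2 := integrableZl measurableT (c * a * I) int2.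
apply: (@le_trans _ _ (\int[mu]_t (L ^+ 2 * a ^+ 2 * ((P ^+ 2).[t] * W t) + c * a * I * cauchy 0 a t))).
  apply: le_Rintegral => //; first exact: (weight_moments hQ).
  by apply: eq_integrable (integrableD measurableT i1 i2).
rewrite RintegralD//.
rewrite !RintegralZl// -/(moment W (P ^+ 2)) -/I.
have -> : \int[mu]_t cauchy 0 a t = a * pi by rewrite /Rintegral integral_cauchy.
by rewrite le_eqVlt; apply/orP; left; apply/eqP; ring.
Qed.

End SecondMoment.

(** * Three-term recurrence, Christoffel-Darboux formula and [L^2] estimates for the kernel *)

Section Recurrence.
Context {R : realType} (W : R -> R) (P : nat -> {poly R}).
Hypothesis hP : orthogonal_polys W 1 P.
Implicit Types (p r : {poly R}) (x t : R).

Let hW : has_moments W := let: And3 h _ _ := hP in h.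
Let sP k : size (P k) = k.+1. Proof. by case: hP. Qed.
Let oP j k : moment W (P j * P k) = (j == k)%:R. Proof. by case: hP => _ _ ->; rewrite mul1r. Qed.

Lemma momentB p r : moment W (p - r) = moment W p - moment W r.
Proof. by rewrite -scaleN1r momentD// momentZ// mulN1r. Qed.

Lemma moment_basis n (c : nat -> R) i : (i < n)%N ->
  moment W (P i * \sum_(0 <= k < n) c k *: P k) = c i.
Proof.
move=> i_n; rewrite mulr_sumr; under eq_bigr do rewrite -scalerAr.
rewrite (moment_sum n c (fun k => P i * P k))// (bigD1_seq i) ?mem_index_iota ?iota_uniq//=.
rewrite oP eqxx mulr1 big1 ?addr0// => k ki; by rewrite oP eq_sym (negbTE ki) mulr0.
Qed.

Lemma moment_low k p : (size p <= k)%N -> moment W (P k * p) = 0.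
Proof.
move=> /(poly_basis sP)[c ->]; rewrite mulr_sumr; under eq_bigr do rewrite -scalerAr.
rewrite (moment_sum k c (fun j => P k * P j))// big1_seq// => j; rewrite mem_index_iota => /andP[_ jk].
by rewrite oP gtn_eqF ?mulr0.
Qed.

Lemma moment_total n p : (size p <= n)%N -> (forall i, (i < n)%N -> moment W (P i * p) = 0) -> p = 0.
Proof.
move=> /(poly_basis sP)[c ->] H; rewrite big_nat big1// => i /= i_n.
by rewrite -(moment_basis c i_n) H// scale0r.
Qed.

Let sXP k : (size ('X * P k)%R <= k.+2)%N.
Proof. by rewrite (leq_trans (size_polyMleq _ _))// size_polyX sP. Qed.

Definition recur k : R := moment W (P k.+1 * ('X * P k)).

Lemma three_terms0 : exists b, 'X * P 0 = recur 0 *: P 1 + b *: P 0.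
Proof.
exists (moment W (P 0 * ('X * P 0))); apply/eqP; rewrite -subr_eq0; apply/eqP.
apply: (@moment_total 2).
  rewrite (leq_trans (size_polyD _ _))// geq_max size_polyN; apply/andP; split.
    exact: sXP.
  by rewrite (leq_trans (size_polyD _ _))// geq_max !(leq_trans (size_scale_leq _ _)) ?sP.
move=> i i2; rewrite mulrBr momentB mulrDr momentD// -!scalerAr !momentZ// !oP.
case: i i2 => [|[|//]] _ /=; rewrite ?mulr0 ?mulr1 ?addr0 ?add0r ?subrr//.
Qed.

Lemma three_terms k : exists b,
  'X * P k.+1 = recur k.+1 *: P k.+2 + b *: P k.+1 + recur k *: P k.
Proof.
exists (moment W (P k.+1 * ('X * P k.+1))); apply/eqP; rewrite -subr_eq0; apply/eqP.
apply: (@moment_total k.+3).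
  rewrite (leq_trans (size_polyD _ _))// geq_max size_polyN; apply/andP; split.
    exact: sXP.
  rewrite (leq_trans (size_polyD _ _))// geq_max; apply/andP; split.
    by rewrite (leq_trans (size_polyD _ _))// geq_max !(leq_trans (size_scale_leq _ _)) ?sP.
  by rewrite (leq_trans (size_scale_leq _ _))// sP leqW.
move=> i ik; rewrite mulrBr momentB !mulrDr !momentD// -!scalerAr !momentZ// !oP.
have [->|i2] := eqVneq i k.+2.
  have -> : (k.+2 == k.+1) = false by lia.
  have -> : (k.+2 == k) = false by lia.
  by rewrite /recur mulr1 !mulr0 !addr0 subrr.
have [->|i1] := eqVneq i k.+1; first by rewrite (_ : (k.+1 == k) = false); [rewrite /=; ring|lia].
have [->|i0] := eqVneq i k.
  have -> : P k * ('X * P k.+1) = P k.+1 * ('X * P k) by rewrite mulrCA [P k * _]mulrC mulrCA.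
  by rewrite /recur mulr1 !mulr0 !add0r subrr.
have -> : P i * ('X * P k.+1) = P k.+1 * ('X * P i) by rewrite mulrCA [P i * _]mulrC mulrCA.
rewrite (@moment_low k.+1 ('X * P i)) ?(mulr0, addr0, subrr)//.
apply: (leq_trans (sXP i)); by move: ik i2 i1 i0; lia.
Qed.

Definition CDker n x t : R := \sum_(0 <= k < n) (P k).[x] * (P k).[t].

(** Written without division, it also holds on the diagonal and can be summed over [n] as it
    stands. *)
Lemma christoffel_darboux n x t : (x - t) * CDker n.+1 x t =
  recur n * ((P n.+1).[x] * (P n).[t] - (P n).[x] * (P n.+1).[t]).
Proof.
elim: n => [|n ih].
  have [b hb] := three_terms0.
  have E u : u * (P 0).[u] = recur 0 * (P 1).[u] + b * (P 0).[u].
    by have := congr1 (fun p => p.[u]) hb; rewrite !hornerE.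
  rewrite /CDker big_nat1; have := E x; have := E t; move: (_.[x]) (_.[t]) => u v.
  by move=> h1 h2; ring: h1 h2.
rewrite /CDker big_nat_recr//= -/(CDker n.+1 x t) mulrDr ih.
have [b hb] := three_terms n.
have E u : u * (P n.+1).[u] = recur n.+1 * (P n.+2).[u] + b * (P n.+1).[u] + recur n * (P n).[u].
  by have := congr1 (fun p => p.[u]) hb; rewrite !hornerE.
have -> : (x - t) * ((P n.+1).[x] * (P n.+1).[t]) =
  (x * (P n.+1).[x]) * (P n.+1).[t] - (P n.+1).[x] * (t * (P n.+1).[t]) by ring.
by rewrite !E; ring.
Qed.

Lemma CDkerE n x t : CDker n x t = (\sum_(0 <= k < n) (P k).[x] *: P k).[t].
Proof. by rewrite horner_sum; apply: eq_bigr => k _; rewrite hornerZ. Qed.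

Lemma moment_CDker n x :
  moment W ((\sum_(0 <= k < n) (P k).[x] *: P k) ^+ 2) = CDker n x x.
Proof. by rewrite expr2 (orthogonal_moment n _ _ hP) mul1r. Qed.

Lemma CDker_ge0 n x : 0 <= CDker n x x.
Proof. by apply: sumr_ge0 => k _; rewrite -expr2 sqr_ge0. Qed.

Lemma CDker_homo m n x : (m <= n)%N -> CDker m x x <= CDker n x x.
Proof.
move=> mn; rewrite /CDker (@big_cat_nat _ _ _ m 0 n)//= lerDl.
by apply: sumr_ge0 => k _; rewrite -expr2 sqr_ge0.
Qed.

Lemma size_lin_comb n (c : nat -> R) : (size (\sum_(0 <= k < n) c k *: P k)%R <= n)%N.
Proof.
elim: n => [|n ih]; first by rewrite big_geq// size_poly0.
rewrite big_nat_recr//= (leq_trans (size_polyD _ _))// geq_max (leq_trans ih)//=.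
by rewrite (leq_trans (size_scale_leq _ _))// sP.
Qed.

Hypothesis W0 : forall x, 0 <= W x.

Lemma moment_le p r : (forall x, p.[x] <= r.[x]) -> moment W p <= moment W r.
Proof. by move=> h; apply: le_Rintegral => // x _; rewrite ler_wpM2r. Qed.

Definition vpker n x : {poly R} :=
  n%:R^-1 *: \sum_(n.+1 <= j < n.*2.+1) \sum_(0 <= k < j) (P k).[x] *: P k.

Lemma vpkerE n x t : (vpker n x).[t] = n%:R^-1 * \sum_(n.+1 <= j < n.*2.+1) CDker j x t.
Proof.
by rewrite hornerZ horner_sum; congr (_ * _); apply: eq_bigr => j _; rewrite CDkerE.
Qed.

Lemma vpkerC n x t : (vpker n x).[t] = (vpker n t).[x].
Proof.
rewrite !vpkerE; congr (_ * _); apply: eq_bigr => j _.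
by apply: eq_bigr => k _; rewrite mulrC.
Qed.

Lemma sum_window (V : nmodType) (F : nat -> V) n :
  \sum_(n.+1 <= j < n.*2.+1) F j = \sum_(0 <= j < n) F (j + n.+1)%N.
Proof. by rewrite -{1}(add0n n.+1) big_addn subSS -addnn addnK. Qed.

(** The kernel is a mean of the kernels [CDker j], so its square is at most the mean of their
    squares; the moments of these are the diagonal values [CDker j x x]. *)
Lemma vpker_sqr n x : (0 < n)%N -> moment W (vpker n x ^+ 2) <= CDker n.*2.+1 x x.
Proof.
move=> n0; have nR : 0 < (n%:R : R) by rewrite ltr0n.
pose S : {poly R} := n%:R^-1 *: \sum_(n.+1 <= j < n.*2.+1) (\sum_(0 <= k < j) (P k).[x] *: P k) ^+ 2.
apply: (@le_trans _ _ (moment W S)).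
  apply: moment_le => t; rewrite horner_exp vpkerE /S hornerZ horner_sum.
  under [in leRHS]eq_bigr do rewrite horner_exp -CDkerE.
  have := cauchy_schwarz_sum n (fun=> 1) (fun j => CDker (j + n.+1) x t).
  rewrite !sum_window.
  under eq_bigr do rewrite mul1r.
  under [X in _ <= X * _ -> _]eq_bigr do rewrite expr1n.
  rewrite sumr_const_nat subn0 => h; rewrite exprMn.
  have := ler_wpM2l (sqr_ge0 n%:R^-1) h; rewrite mulrA => /le_trans; apply.
  rewrite mulrA ler_wpM2r//; first by apply: sumr_ge0 => j _; exact: sqr_ge0.
  by rewrite expr2 -mulrA mulVf ?mulr1// gt_eqF.
rewrite /S momentZ//.
have -> : moment W (\sum_(n.+1 <= j < n.*2.+1) (\sum_(0 <= k < j) (P k).[x] *: P k) ^+ 2) =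
   \sum_(n.+1 <= j < n.*2.+1) CDker j x x.
  rewrite !sum_window.
  have := moment_sum n (fun=> 1) (fun j => (\sum_(0 <= k < j + n.+1) (P k).[x] *: P k) ^+ 2) hW.
  under eq_bigr do rewrite scale1r.
  move=> ->.
  by apply: eq_bigr => j _; rewrite mul1r moment_CDker.
rewrite ler_pdivrMl//; apply: (@le_trans _ _ (\sum_(n.+1 <= j < n.*2.+1) CDker n.*2.+1 x x)).
  by rewrite !big_nat; apply: ler_sum => j /andP[_ jn]; apply: CDker_homo; exact: ltnW.
rewrite sumr_const_nat mulr_natl (_ : n.*2.+1 - n.+1 = n)%N//; by rewrite subSS -addnn addnK.
Qed.

(** By Christoffel-Darboux, [(x - t) V] is [1 / n] times the difference of two expansions in the
    orthonormal basis, in which each degree occurs at most once. Their moments are sums of squares,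
    so the full factor [n^-2] survives although [n] kernels have been added. *)
Lemma vpker_shift n x rho : (0 < n)%N -> (forall j, (j < n.*2)%N -> recur j ^+ 2 <= rho) ->
  moment W ((x%:P - 'X) ^+ 2 * vpker n x ^+ 2) <= 4 * rho / n%:R ^+ 2 * CDker n.*2.+1 x x.
Proof.
move=> n0 hrho; have nR : 0 < (n%:R : R) by rewrite ltr0n.
(* [SA] collects the products of [P (i + 1)] at [x] with [P i] at [t], and [SB] those of [P (i - 1)]
   with [P i]; the cut-offs encode the window [n < j <= 2 n]. The index [i + 1] reaches [2 n],
   whence the diagonal kernel with [2 n + 1] terms. *)
pose a i : R := if (n <= i)%N then recur i * (P i.+1).[x] else 0.
pose b i : R := if (n < i)%N then recur i.-1 * (P i.-1).[x] else 0.
pose SA : {poly R} := \sum_(0 <= i < n.*2) a i *: P i.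
pose SB : {poly R} := \sum_(0 <= i < n.*2.+1) b i *: P i.
have rho0 : 0 <= rho by apply: le_trans (hrho 0%N _); rewrite ?sqr_ge0// double_gt0.
have VE t : (x - t) * (vpker n x).[t] = n%:R^-1 * (SA.[t] - SB.[t]).
  rewrite vpkerE mulrCA; congr (_ * _); rewrite mulr_sumr.
  rewrite big_add1 /=.
  under eq_bigr do rewrite christoffel_darboux.
  rewrite /SA /SB !horner_sum [in X in _ - X]big_nat_recl// {1}/b /= scale0r horner0 add0r.
  rewrite (@big_cat_nat _ _ _ n 0 n.*2)//=; last by rewrite -addnn leq_addr.
  rewrite [in X in _ - X](@big_cat_nat _ _ _ n 0 n.*2)//=; last by rewrite -addnn leq_addr.
  have -> : \sum_(0 <= i < n) (a i *: P i).[t] = 0.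
    by rewrite big_nat big1// => i /andP[_ i_n]; rewrite /a leqNgt i_n/= scale0r horner0.
  have -> : \sum_(0 <= i < n) (b i.+1 *: P i.+1).[t] = 0.
    by rewrite big_nat big1// => i /andP[_ i_n]; rewrite /b ltnS leqNgt i_n/= scale0r horner0.
  rewrite !add0r -sumrB !big_nat; apply: eq_bigr => i /andP[ni _].
  by rewrite !hornerZ /a /b ltnS ni/=; ring.
apply: (@le_trans _ _ (moment W ((2 / n%:R ^+ 2) *: (SA ^+ 2) + (2 / n%:R ^+ 2) *: (SB ^+ 2)))).
  apply: moment_le => t; rewrite -exprMn horner_exp hornerM hornerD hornerN hornerC hornerX VE.
  rewrite hornerD !hornerZ !horner_exp exprMn -mulrDr exprVn [2 / _]mulrC -mulrA.
  rewrite ler_wpM2l ?invr_ge0 ?sqr_ge0//; have := sqr_ge0 (SA.[t] + SB.[t]); lra.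
rewrite momentD// !momentZ//.
have -> : moment W (SA ^+ 2) = \sum_(0 <= k < n.*2) a k * a k.
  by rewrite expr2 (orthogonal_moment _ _ _ hP) mul1r.
have -> : moment W (SB ^+ 2) = \sum_(0 <= k < n.*2.+1) b k * b k.
  by rewrite expr2 (orthogonal_moment _ _ _ hP) mul1r.
have hA : \sum_(0 <= k < n.*2) a k * a k <= rho * CDker n.*2.+1 x x.
  rewrite /CDker big_nat_recl// mulrDr mulr_sumr; apply: ler_wpDl.
    by rewrite mulr_ge0// -expr2 sqr_ge0.
  rewrite !big_nat; apply: ler_sum => i /andP[_ i_n]; rewrite /a; case: ifP => _; last first.
    by rewrite mul0r mulr_ge0// -expr2 sqr_ge0.
  by rewrite -!expr2 exprMn ler_wpM2r ?sqr_ge0// hrho.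
have hB : \sum_(0 <= k < n.*2.+1) b k * b k <= rho * CDker n.*2.+1 x x.
  rewrite big_nat_recl// {1 2}/b/= mul0r add0r /CDker mulr_sumr big_nat_recr//=.
  apply: ler_wpDr; first by rewrite mulr_ge0// -expr2 sqr_ge0.
  rewrite !big_nat; apply: ler_sum => i /andP[_ i_n]; rewrite /b; case: ifP => _; last first.
    by rewrite mul0r mulr_ge0// -expr2 sqr_ge0.
  by rewrite -!expr2 exprMn ler_wpM2r ?sqr_ge0// hrho.
have k0 : 0 <= 2 / n%:R ^+ 2 :> R by rewrite divr_ge0 ?sqr_ge0.
have := ler_wpM2l k0 hA; have := ler_wpM2l k0 hB; set u := CDker _ _ _; set v := 2 / _.
rewrite (_ : 4 * rho / n%:R ^+ 2 * u = v * (rho * u) + v * (rho * u)); first by lra.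
by rewrite /v; field; rewrite gt_eqF.
Qed.

End Recurrence.

Section IntegralEFin.
Context {R : realType}.
Local Notation mu := (@lebesgue_measure R).

Lemma le_integral_EFin (f g : R -> R) : measurable_fun setT f -> measurable_fun setT g ->
  (forall t, 0 <= f t) -> (forall t, f t <= g t) ->
  (\int[mu]_t (f t)%:E <= \int[mu]_t (g t)%:E)%E.
Proof.
move=> mf mg f0 fg; apply: ge0_le_integral; first exact: measurableT.
- by move=> t _; rewrite lee_fin.
- exact/measurable_EFinP.
- exact/measurable_EFinP.
- by move=> t _; rewrite lee_fin.
Qed.

End IntegralEFin.

(** * Weighted [L^1] bounds for the kernel *)

Section KernelBounds.
Context {R : realType} (Q : R -> R) (K : nat) (A l : R).
Hypothesis hQ : regular Q K A l.
Local Notation mu := (@lebesgue_measure R).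
Local Notation q := (derive1 Q : R -> R).
Local Notation T := (growthT Q).
Local Notation w := (weight Q).
Local Notation W := (fun x => w x ^+ 2).
Implicit Types (x y t d r a B : R).

Lemma orthonormal_orthogonal (P : nat -> {poly R}) :
  orthonormal_polys w P -> orthogonal_polys W 1 P.
Proof.
move=> [sP oP]; split=> //; first exact: (weight_moments hQ).
move=> j k; rewrite mul1r -oP; apply: eq_Rintegral => x _; by rewrite hornerM.
Qed.

Lemma dQN x : q (- x) = - q x.
Proof.
have h : is_derive x 1 (Q \o -%R) (- q (- x)).
  have d1 := is_deriveN (is_derive_id x (1 : R)).
  have d2 := reg_der hQ (- x).
  have := @is_derive1_comp R Q -%R x _ _ d2 d1.
  by rewrite mulrN1.
have E : Q \o -%R = Q by apply/funext => u /=; rewrite (reg_even hQ).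
rewrite E in h; have [_ h2] := h; have [_ h3] := reg_der hQ x.
by apply: oppr_inj; rewrite opprK -h2 h3.
Qed.

Lemma growthTN x : T (- x) = T x.
Proof. by rewrite /growthT dQN (reg_even hQ) mulrNN. Qed.

Lemma growthT_norm x : T `|x| = T x.
Proof. by case: (ler0P x) => // _; rewrite growthTN. Qed.

Lemma T_ge1_neq0 x : x != 0 -> 1 <= T x.
Proof. by move=> x0; rewrite -growthT_norm (T_ge1 hQ)// normr_gt0. Qed.

Lemma T_ge0 x : 0 <= T x.
Proof.
have [->|x0] := eqVneq x 0; first by rewrite /growthT mul0r mul0r.
exact: le_trans ler01 (T_ge1_neq0 x0).
Qed.

Lemma growthT4E x : growthT4 Q x = Num.sqrt (Num.sqrt (T x)).
Proof.
rewrite /growthT4 (_ : 1 / 4 = 2^-1 * 2^-1); last by field.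
by rewrite powRrM powR12_sqrt ?powR_ge0// powR12_sqrt// T_ge0.
Qed.

Lemma growthT4_ge0 x : 0 <= growthT4 Q x. Proof. by rewrite growthT4E sqrtr_ge0. Qed.

Lemma growthT4_ge1 x : x != 0 -> 1 <= growthT4 Q x.
Proof. by move=> x0; rewrite growthT4E sqrt_ge1// sqrt_ge1// T_ge1_neq0. Qed.

Lemma measurable_growthT : measurable_fun setT T.
Proof.
apply: measurable_funM.
  apply: measurable_funM; first exact: measurable_id.
  by apply: continuous_measurable_fun; exact: reg_cont hQ.
apply: (measurableT_comp measurable_invr).
by apply: continuous_measurable_fun; exact: cont_Q hQ.
Qed.

Lemma measurable_growthT4 : measurable_fun setT (growthT4 Q).
Proof.
rewrite (_ : growthT4 Q = Num.sqrt \o (Num.sqrt \o T)); last by apply/funext => x; rewrite growthT4E.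
by do 2 (apply: measurableT_comp; first by apply: continuous_measurable_fun; exact: sqrt_continuous); exact: measurable_growthT.
Qed.

Lemma tau_le_T a x : 0 < a -> x != 0 -> tau Q a x <= A * T x.
Proof.
move=> a0 x0; have A1 := reg_A hQ; rewrite ge_max mulr_ege1// ?T_ge1_neq0//= -(growthT_norm x).
by apply: (reg_quasi hQ); rewrite ?lt_min ?normr_gt0 ?x0// ge_min lexx.
Qed.

(* The points [t] where [T t] is much smaller than [tau a x] stay away from [x]. *)
Lemma tau_far B : 1 <= B -> exists2 C : R, 0 < C & forall n a, mrs Q B n a -> forall x,
  exists2 h' : R, 0 < h' & forall t,
    Num.sqrt (tau Q a x) / Num.sqrt (T t) * cauchy x (a / n%:R) t <=
    C * (cauchy x (a / n%:R) t + (a / n%:R) / h' * cauchy x h' t).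
Proof.
move=> B1; have A1 := reg_A hQ; have A0 : 0 < A := lt_le_trans ltr01 A1.
have B0 : 0 < B := lt_le_trans ltr01 B1.
pose C1 := 1 + A * T 1; have T11 := T_ge1 hQ ltr01.
have C11 : 1 <= C1 by rewrite lerDl mulr_ge0 ?(ltW A0)// (le_trans ler01).
(* Normalised so that [mrs_T] yields [h' T y <= 1/2]; this is where the growth condition on
   [T (a_n)] is used. *)
pose kap := (2 * (A ^+ 2 * B))^-1.
have kap0 : 0 < kap by rewrite invr_gt0 !mulr_gt0// exprn_gt0.
pose C := C1 + A + 2 ^+ K * 2 + 2 / kap.
have p2 : 0 <= (2 : R) ^+ K * 2 by rewrite mulr_ge0// exprn_ge0.
have k2 : 0 <= 2 / kap by rewrite divr_ge0// ltW.
have Cp : 0 < C by rewrite /C; move: C11 A0 p2 k2; clear -hQ; lra.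
exists C => // n a hm x; have a0 := mrs_a hm; have n0 := mrs_n hm.
have nR : 0 < (n%:R : R) by rewrite ltr0n.
set h := a / n%:R; have h0 : 0 < h by rewrite divr_gt0.
set st := Num.sqrt (tau Q a x); have st1 : 1 <= st := sqrt_ge1 (tau_ge1 Q a x).
have st0 : 0 < st := lt_le_trans ltr01 st1.
(* The kernel of width [h'] multiplied by [h / h'] has the same integral [h pi] as the kernel of
   width [h], and at distances beyond [h'] it exceeds that kernel by a factor of order [h' / h],
   that is, of order [st]. *)
pose h' := kap * h * st; have h'0 : 0 < h' := mulr_gt0 (mulr_gt0 kap0 h0) st0.
exists h' => // t.
have c0 := cauchy_gt0 x h t; have c0' := cauchy_gt0 x h' t.
have hh0 : 0 < h / h' by rewrite divr_gt0.
have small D : 0 <= D -> D <= C -> st / Num.sqrt (T t) <= D ->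
    st / Num.sqrt (T t) * cauchy x h t <= C * (cauchy x h t + h / h' * cauchy x h' t).
  move=> D0 DC hD; apply: (@le_trans _ _ (C * cauchy x h t)).
    by rewrite ler_wpM2r ?(ltW c0)// (le_trans hD).
  by rewrite ler_wpM2l ?(le_trans D0)// lerDl mulr_ge0 ?ltW.
have [t0|t0] := eqVneq t 0.
  have T0z : T t = 0 by rewrite t0 /growthT !mul0r.
  by apply: (small 0) => //; [exact: ltW|rewrite T0z sqrtr0 invr0 mulr0].
have Tt := T_ge1_neq0 t0; have sT := sqrt_ge1 Tt.
have sT0 : 0 < Num.sqrt (T t) := lt_le_trans ltr01 sT.
set y := Num.min `|x| a.
(* Near 0 quasi-monotonicity compares with [T 1], so [tau] is bounded by a constant. *)
have [y1|y1] := leP y 1.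
  apply: (small C1); rewrite ?(le_trans ler01)//; first by rewrite /C; move: A0 p2 k2; clear -hQ; lra.
  rewrite ler_pdivrMr//; apply: (@le_trans _ _ C1); last by rewrite ler_peMr ?(le_trans ler01).
  apply: (@le_trans _ _ (Num.sqrt (C1 ^+ 2))); last by rewrite sqrtr_sqr ger0_norm// (le_trans ler01).
  rewrite ler_wsqrtr//; apply: (@le_trans _ _ C1); last by rewrite expr2 ler_peMr ?(le_trans ler01).
  rewrite ge_max C11/= -/y.
  have y0 : 0 <= y by rewrite le_min normr_ge0 ltW.
  have [->|yn0] := eqVneq y 0; first by rewrite /growthT mul0r mul0r (le_trans ler01).
  apply: le_trans (_ : A * T 1 <= _); last by rewrite lerDr.
  by apply: (reg_quasi hQ) => //; rewrite lt_def yn0.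
have y0 : 0 < y := lt_trans ltr01 y1.
have Ty := T_ge1 hQ y0.
have tE : tau Q a x = T y by rewrite /tau max_r.
have stE : st = Num.sqrt (T y) by rewrite /st tE.
have Dbound D : 1 <= D -> D <= C -> T y <= D * T t ->
   st / Num.sqrt (T t) * cauchy x h t <= C * (cauchy x h t + h / h' * cauchy x h' t).
  move=> D1 DC hD; apply: (small D) => //; first exact: le_trans D1.
  rewrite ler_pdivrMr// stE; apply: le_trans (sqrt_le_mul D1 (T_ge0 t)); exact: ler_wsqrtr.
have [yt|ty] := leP y `|t|.
  apply: (Dbound A) => //; first by rewrite /C; move: C11 p2 k2; clear -hQ; lra.
  by rewrite -(growthT_norm t); apply: (reg_quasi hQ).
have tp : 0 < `|t| by rewrite normr_gt0.
(* Within the scale [y / T y] below [y], [down_T] keeps [T t] comparable with [T y]. Otherwise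
   [y - |t|] exceeds [y / (2 T y)], which for [y > 1] is at least [h']. *)
have [near|far] := leP (2 * ((y - `|t|) * q y)) (Q y).
  apply: (Dbound (2 ^+ K * 2)); last by rewrite -(growthT_norm t); exact: (down_T hQ tp (ltW ty) near).
    have : (1 : R) <= 2 ^+ K by rewrite exprn_ege1// ler1n.
    by clear -hQ; lra.
  by rewrite /C; move: C11 A0 k2; clear -hQ; lra.
have Qy := reg_gt0 hQ y0; have qy := reg_dgt0 hQ y0.
have xt : y - `|t| <= `|t - x|.
  have : y <= `|x| by rewrite ge_min lexx.
  have : `|x| <= `|t| + `|t - x| by rewrite -{1}(subKr t x) (le_trans (ler_normB _ _)).
  by clear -hQ; lra.
have Td : T y * (2 * (y - `|t|)) > y.
  rewrite /growthT mulrAC ltr_pdivlMr// -mulrA ltr_pM2l// mulrC.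
  by move: far; clear -hQ; lra.
have d0 : 0 < `|t - x|.
  by apply: lt_le_trans xt; rewrite subr_gt0.
have hd : h' <= `|t - x|.
  have h3 : h * (T y * st) <= A ^+ 2 * B.
    have TyA : T y <= A * T a by apply: (reg_quasi hQ) => //; rewrite ge_min lexx orbT.
    have stA : st <= A * Num.sqrt (T a).
      by rewrite stE; apply: le_trans (sqrt_le_mul A1 (T_ge0 a)); exact: ler_wsqrtr.
    apply: (@le_trans _ _ (h * (A * T a * (A * Num.sqrt (T a))))).
      by rewrite ler_pM2l//; apply: ler_pM; rewrite ?(ltW st0)// (le_trans ler01).
    have := mrs_T hm; rewrite -(ler_pM2l h0) => h4.
    have := ler_wpM2l (sqr_ge0 A) h4.
    rewrite (_ : h * (B * (n%:R / a)) = B); last by rewrite /h; field; rewrite !gt_eqF.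
    by apply: le_trans; rewrite le_eqVlt; apply/orP; left; apply/eqP; ring.
  apply: le_trans xt; have T0 : 0 < T y := lt_le_trans ltr01 Ty.
  rewrite -(ler_pM2l T0) -(@ler_pM2l _ 2)//; apply: (@le_trans _ _ 1); last first.
    by apply: le_trans (ltW y1) _; move: Td; clear -hQ; lra.
  have := ler_wpM2l (ltW kap0) h3; have kE : kap * (A ^+ 2 * B) = 1 / 2.
    by rewrite /kap; field; rewrite !gt_eqF.
  by rewrite kE /h'; clear -hQ; lra.
have dE : (t - x) ^+ 2 = `|t - x| ^+ 2 by rewrite sqr_norm.
have CE z : 0 < z -> cauchy x z t = z ^+ 2 / (z ^+ 2 + `|t - x| ^+ 2).
  move=> z0; rewrite /cauchy expr_div_n dE.
  have -> : 1 + `|t - x| ^+ 2 / z ^+ 2 = (z ^+ 2 + `|t - x| ^+ 2) / z ^+ 2.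
    by field; rewrite gt_eqF.
  by rewrite invf_div.
apply: (@le_trans _ _ (st * cauchy x h t)).
  by rewrite ler_wpM2r ?(ltW c0)// ler_pdivrMr// ler_peMr// ltW.
apply: (@le_trans _ _ (2 / kap * (h / h' * cauchy x h' t))); last first.
  apply: ler_pM; rewrite ?(mulr_ge0 (ltW hh0) (ltW c0'))//; last by rewrite lerDr ltW.
  by rewrite /C lerDr; move: C11 A0 p2; clear -hQ; lra.
rewrite !CE//; move: d0 hd; set d := `|t - x| => d0 hd.
have hd2 : h' ^+ 2 <= d ^+ 2 by rewrite lerXn2r ?nnegrE ?(ltW h'0) ?(ltW d0).
have d20 : 0 < d ^+ 2 by rewrite exprn_gt0.
apply: (@le_trans _ _ (st * (h ^+ 2 / d ^+ 2))).
  rewrite ler_pM2l// ler_pM2l ?exprn_gt0// lef_pV2 ?posrE ?addr_gt0 ?exprn_gt0//.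
  by rewrite lerDr sqr_ge0.
have -> : 2 / kap * (h / h' * (h' ^+ 2 / (h' ^+ 2 + d ^+ 2))) = st * (h ^+ 2 * (2 / (h' ^+ 2 + d ^+ 2))).
  have s0 : h' ^+ 2 + d ^+ 2 != 0 by rewrite gt_eqF// addr_gt0// exprn_gt0.
  move: s0; set S := h' ^+ 2 + d ^+ 2 => s0; rewrite /h'; field.
  by rewrite s0 !gt_eqF.
rewrite ler_pM2l// ler_pM2l ?exprn_gt0// ler_pdivlMr ?addr_gt0 ?exprn_gt0//.
by rewrite mulrC ler_pdivrMr//; move: hd2; clear -hQ; lra.
Qed.

Section Orthonormal.
Variable (P : nat -> {poly R}).
Hypothesis oP : orthonormal_polys w P.
Let hP : orthogonal_polys W 1 P := orthonormal_orthogonal oP.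
Let W0 x : 0 <= W x. Proof. exact: sqr_ge0. Qed.

Lemma moment_sqr_le (p : {poly R}) j : moment W (P j * p) ^+ 2 <= moment W (p ^+ 2).
Proof.
have hW := weight_moments hQ; set m := moment W (P j * p).
have : 0 <= moment W ((p - m *: P j) ^+ 2) by exact: moment_sqr_ge0.
have -> : (p - m *: P j) ^+ 2 = p ^+ 2 + ((- (2 * m)) *: (P j * p) + (m ^+ 2) *: (P j * P j)).
  by rewrite -!mul_polyC !(polyCM, polyCN, polyC_exp); ring.
case: hP => _ _ h; rewrite !momentD// !momentZ// h eqxx /= -/m.
by have : m * m = m ^+ 2 by []; clear -hQ; lra.
Qed.

End Orthonormal.

(** [recur j] is a single orthonormal coefficient of [x P_j], so its square is at most the second
    moment of [P_j]. *)
Lemma recur_bound B : 1 <= B -> exists2 C : R, 0 < C & forall n a, mrs Q B n a ->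
  forall P : nat -> {poly R}, orthonormal_polys w P -> forall j, (j < n.*2)%N ->
  recur W P j ^+ 2 <= C * a ^+ 2.
Proof.
move=> B1; have [C C0 H] := second_moment hQ B1; exists C => // n a hm P oP j j2.
apply: (le_trans (moment_sqr_le oP _ _)); have [sP _] := oP.
have [_ _ oPP] := orthonormal_orthogonal oP.
rewrite exprMn; apply: le_trans (H _ _ hm (P j) _) _.
  by rewrite sP; move: j2; rewrite -mul2n; lia.
by rewrite (_ : moment W (P j ^+ 2) = 1) ?mulr1// expr2 oPP eqxx mulr1.
Qed.

(** The Christoffel bound is applied to the kernel with one variable fixed at [x]: its value at [x]
    and the moment of its square are both the diagonal value, one power of which cancels. *)
Lemma CDker_bound B : 1 <= B -> exists2 C : R, 0 < C & forall n a, mrs Q B n a ->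
  forall P : nat -> {poly R}, orthonormal_polys w P -> forall x,
  w x ^+ 2 * CDker P n.*2.+1 x x <= C * (n%:R / a) * Num.sqrt (tau Q a x).
Proof.
move=> B1; have [C C0 H] := christoffel_bound hQ B1; exists C => // n a hm P oP x.
have hP := orthonormal_orthogonal oP; have n0 := mrs_n hm; have a0 := mrs_a hm.
have s5 : (size (\sum_(0 <= k < n.*2.+1) (P k).[x] *: P k)%R <= 5 * n)%N.
  by apply: leq_trans (size_lin_comb hP _ _) _; rewrite -mul2n; move: n0; lia.
have := H _ _ hm _ x s5; rewrite (moment_CDker hP) -CDkerE.
set k := CDker _ _ _ _; set c := C * _ * _ => h.
have k0 : 0 <= k by exact: CDker_ge0.
have c0 : 0 <= c by rewrite mulr_ge0 ?sqrtr_ge0// mulr_ge0 ?(ltW C0)// divr_ge0// ltW.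
have [->|kn0] := eqVneq k 0; first by rewrite mulr0.
have kp : 0 < k by rewrite lt_def kn0.
by rewrite -(ler_pM2r kp); apply: le_trans h; rewrite le_eqVlt; apply/orP; left; apply/eqP; ring.
Qed.

Definition vpmass n x (P : nat -> {poly R}) h : R :=
  moment W (vpker P n x ^+ 2 + h ^- 2 *: ((x%:P - 'X) ^+ 2 * vpker P n x ^+ 2)).

Lemma kernel_L2 B : 1 <= B -> exists2 C : R, 0 < C & forall n a, mrs Q B n a ->
  forall P : nat -> {poly R}, orthonormal_polys w P -> forall x,
  w x ^+ 2 * vpmass n x P (a / n%:R) <= C * (n%:R / a) * Num.sqrt (tau Q a x).
Proof.
move=> B1; have [C1 C10 H1] := recur_bound B1; have [C2 C20 H2] := CDker_bound B1.
exists ((1 + 4 * C1) * C2); first by rewrite mulr_gt0// addr_gt0// mulr_gt0.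
move=> n a hm P oP x; have n0 := mrs_n hm; have a0 := mrs_a hm.
have hP := orthonormal_orthogonal oP; have hW := weight_moments hQ.
have W0 u : 0 <= W u by exact: sqr_ge0.
have nR : 0 < (n%:R : R) by rewrite ltr0n.
rewrite /vpmass momentD// momentZ//.
have h1 := vpker_sqr hP W0 x n0.
have h2 := vpker_shift hP W0 x n0 (H1 _ _ hm P oP).
have h3 := H2 _ _ hm P oP x.
set k := CDker _ _ _ _ in h1 h2 h3.
have hh0 : 0 < (a / n%:R) ^- 2 by rewrite invr_gt0 exprn_gt0// divr_gt0.
have h4 : (a / n%:R) ^- 2 * moment W ((x%:P - 'X) ^+ 2 * vpker P n x ^+ 2) <= 4 * C1 * k.
  have := h2; rewrite -(ler_pM2l hh0) => /le_trans; apply.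
  by rewrite le_eqVlt; apply/orP; left; apply/eqP; field; rewrite !gt_eqF.
apply: (@le_trans _ _ ((1 + 4 * C1) * (w x ^+ 2 * k))).
  rewrite [leRHS]mulrCA ler_wpM2l ?sqr_ge0//; move: h1 h4; clear -hQ; lra.
have p4 : 0 <= 1 + 4 * C1 by rewrite addr_ge0// mulr_ge0// ltW.
apply: le_trans (ler_wpM2l p4 h3) _; rewrite le_eqVlt; apply/orP; left; apply/eqP; ring.
Qed.

(* The parameter [s] is chosen as [h / tau^(1/4)] for the first kernel bound and
   as [h / tau^(1/2)] for the second. *)
Lemma kernel_amgm n (P : nat -> {poly R}) x h s (v : R -> R) : 0 < h -> 0 < s ->
  measurable_fun setT v -> (forall t, 0 <= v t) ->
  (\int[mu]_t (w x * `|(vpker P n x).[t]| * w t * v t)%:E <=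
   (s / 2 * (w x ^+ 2 * vpmass n x P h))%:E +
   \int[mu]_t ((2 * s)^-1 * (v t ^+ 2 * cauchy x h t))%:E)%E.
Proof.
move=> h0 s0 mv v0; set V := vpker P n x.
pose U : {poly R} := V ^+ 2 + h ^- 2 *: ((x%:P - 'X) ^+ 2 * V ^+ 2).
have UE t : U.[t] * cauchy x h t = V.[t] ^+ 2.
  rewrite /U hornerD hornerZ horner_exp hornerM !horner_exp hornerD hornerN hornerC hornerX /cauchy expr_div_n.
  have c0 : 0 < h ^+ 2 + (t - x) ^+ 2 by rewrite ltr_pwDl ?exprn_gt0// sqr_ge0.
  rewrite -(opprB t x) sqrrN; field.
  by rewrite !gt_eqF.
have mw : measurable_fun setT w by apply: continuous_measurable_fun; exact: (continuous_weight hQ).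
have mV : measurable_fun setT (fun t => V.[t]) by apply: continuous_measurable_fun; exact: continuous_horner.
have mc : measurable_fun setT (cauchy x h) by apply: continuous_measurable_fun; exact: continuous_cauchy.
have intU : mu.-integrable setT (EFin \o (fun t => U.[t] * W t)) := weight_moments hQ U.
have U0 t : 0 <= U.[t].
  rewrite /U hornerD hornerZ horner_exp hornerM !horner_exp addr_ge0 ?sqr_ge0// mulr_ge0 ?invr_ge0 ?sqr_ge0//.
  by rewrite mulr_ge0 ?sqr_ge0.
have -> : (s / 2 * (w x ^+ 2 * vpmass n x P h))%:E =
   (\int[mu]_t (s / 2 * w x ^+ 2 * (U.[t] * W t))%:E)%E.
  rewrite mulrA EFinM /vpmass /moment /Rintegral fineK; last exact: integrable_fin_num.
  rewrite -ge0_integralZl//.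
  - by apply/measurable_EFinP; case/integrableP: intU => /measurable_EFinP.
  - by move=> t _; rewrite lee_fin mulr_ge0// sqr_ge0.
  - by rewrite lee_fin mulr_ge0 ?sqr_ge0// divr_ge0// ltW.
have mU : measurable_fun setT (fun t => U.[t] * W t).
  by case/integrableP: intU => /measurable_EFinP.
rewrite -ge0_integralD//; last 4 first.
- move=> t _; rewrite lee_fin.
  exact: mulr_ge0 (mulr_ge0 (divr_ge0 (ltW s0) (ler0n _ 2)) (sqr_ge0 _)) (mulr_ge0 (U0 t) (sqr_ge0 _)).
- by apply/measurable_EFinP; apply: measurable_funM.
- move=> t _; rewrite lee_fin mulr_ge0 ?invr_ge0 ?(mulr_ge0 (ler0n R 2) (ltW s0))//.
  by rewrite mulr_ge0 ?sqr_ge0// ltW// cauchy_gt0.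
- apply/measurable_EFinP; apply: measurable_funM => //; apply: measurable_funM => //.
  exact: measurable_funX.
under [leRHS]eq_integral do rewrite -EFinD.
apply: le_integral_EFin.
- apply: measurable_funM => //; apply: measurable_funM => //.
  apply: measurable_funM => //; apply: measurableT_comp => //.
- apply: measurable_funD; apply: measurable_funM => //.
  by apply: measurable_funM => //; exact: measurable_funX.
- by move=> t; rewrite !mulr_ge0 ?weight_ge0.
move=> t.
set c := cauchy x h t in UE *; have c0 : 0 < c by exact: cauchy_gt0.
pose g := Num.sqrt (U.[t]); pose e := Num.sqrt c.
have g2 : g ^+ 2 = U.[t] by rewrite sqr_sqrtr.
have e2 : e ^+ 2 = c by rewrite sqr_sqrtr// ltW.
have VE : `|V.[t]| = g * e.
  by rewrite -sqrtr_sqr -UE sqrtrM.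
rewrite VE -g2 -e2.
have := sqr_ge0 (s * (w x * g * w t) - v t * e).
have s20 : 0 < (2 * s)^-1 by rewrite invr_gt0 mulr_gt0.
move=> /(mulr_ge0 (ltW s20)) hh; rewrite -subr_ge0; apply: le_trans hh _.
by rewrite le_eqVlt; apply/orP; left; apply/eqP; field; rewrite gt_eqF.
Qed.

Lemma integral_cauchyZ x h (c : R) : 0 < h -> 0 <= c ->
  (\int[mu]_t (c * cauchy x h t)%:E = (c * (h * pi))%:E)%E.
Proof.
move=> h0 c0; under eq_integral do rewrite EFinM.
rewrite ge0_integralZl//; first by rewrite integral_cauchy// -EFinM.
- by apply/measurable_EFinP; apply: continuous_measurable_fun; exact: continuous_cauchy.
- by move=> t _; rewrite lee_fin ltW// cauchy_gt0.
Qed.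

Lemma kernel_V1 B : 1 <= B -> exists2 C : R, 0 < C & forall n a, mrs Q B n a ->
  forall P : nat -> {poly R}, orthonormal_polys w P -> forall x,
  (\int[mu]_t (w x * `|(vpker P n x).[t]| * w t)%:E <=
    (C * Num.sqrt (Num.sqrt (tau Q a x)))%:E)%E.
Proof.
move=> B1; have [C C0 H] := kernel_L2 B1; exists (C / 2 + pi / 2).
  by rewrite addr_gt0// divr_gt0// pi_gt0.
move=> n a hm P oP x; have n0 := mrs_n hm; have a0 := mrs_a hm.
have nR : 0 < (n%:R : R) by rewrite ltr0n.
set h := a / n%:R; have h0 : 0 < h by rewrite divr_gt0.
set st := Num.sqrt (tau Q a x); have st1 : 1 <= st := sqrt_ge1 (tau_ge1 Q a x).
set r := Num.sqrt st; have r1 : 1 <= r := sqrt_ge1 st1.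
have r0 : 0 < r := lt_le_trans ltr01 r1.
have r2 : r ^+ 2 = st by rewrite sqr_sqrtr// (le_trans ler01).
have s0 : 0 < h / r by rewrite divr_gt0.
have := @kernel_amgm n P x h (h / r) (cst 1) h0 s0 (@measurable_cst _ _ _ _ _ _) (fun=> ler01).
under eq_integral do rewrite mulr1.
move=> /le_trans; apply.
have -> : (\int[mu]_t ((2 * (h / r))^-1 * (cst 1 t ^+ 2 * cauchy x h t))%:E = (pi / 2 * r)%:E)%E.
  under eq_integral do rewrite expr1n mul1r.
  rewrite integral_cauchyZ//; last by rewrite invr_ge0 mulr_ge0// ltW.
  by congr EFin; move: (pi : R) => p; field; rewrite !gt_eqF.
rewrite -EFinD lee_fin (mulrDl (C / 2) (pi / 2) r) lerD2r.
have := H _ _ hm P oP x; rewrite -/st -/h => hh.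
have s20 : 0 <= h / r / 2 by rewrite divr_ge0// ltW.
apply: (le_trans (ler_wpM2l s20 hh)); rewrite le_eqVlt; apply/orP; left; apply/eqP.
rewrite -r2 /h; field; by rewrite !gt_eqF.
Qed.

(** With [s = h / sqrt tau] the mass term is bounded. In the other term [tau_far] replaces
    [sqrt(tau / T t)] times the Cauchy kernel by two kernels of integral [h pi], which cancels the
    [1 / h]. *)
Lemma kernel_V3 B : 1 <= B -> exists2 C : R, 0 < C & forall n a, mrs Q B n a ->
  forall P : nat -> {poly R}, orthonormal_polys w P -> forall x,
  (\int[mu]_t (w x * `|(vpker P n x).[t]| * w t / growthT4 Q t)%:E <= C%:E)%E.
Proof.
move=> B1; have [C C0 H] := kernel_L2 B1; have [C' C'0 H'] := tau_far B1.
exists (C / 2 + C' * pi).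
  by rewrite addr_gt0// ?divr_gt0// mulr_gt0// pi_gt0.
move=> n a hm P oP x; have n0 := mrs_n hm; have a0 := mrs_a hm.
have nR : 0 < (n%:R : R) by rewrite ltr0n.
have [h' h'0 Hh'] := H' _ _ hm x.
set h := a / n%:R in Hh' *; have h0 : 0 < h by rewrite divr_gt0.
set st := Num.sqrt (tau Q a x) in Hh' *; have st1 : 1 <= st := sqrt_ge1 (tau_ge1 Q a x).
have st0 : 0 < st := lt_le_trans ltr01 st1.
have s0 : 0 < h / st by rewrite divr_gt0.
have mv : measurable_fun setT (fun t => (growthT4 Q t)^-1).
  by apply: (measurableT_comp measurable_invr); exact: measurable_growthT4.
have v0 t : 0 <= (growthT4 Q t)^-1 by rewrite invr_ge0 growthT4_ge0.
have := @kernel_amgm n P x h (h / st) (fun t => (growthT4 Q t)^-1) h0 s0 mv v0.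
move=> /le_trans; apply; rewrite EFinD; apply: leeD.
  rewrite lee_fin; have := H _ _ hm P oP x; rewrite -/st -/h => hh.
  have s20 : 0 <= h / st / 2 by rewrite divr_ge0// ltW.
  apply: (le_trans (ler_wpM2l s20 hh)); rewrite le_eqVlt; apply/orP; left; apply/eqP.
  rewrite /h; field; by rewrite !gt_eqF.
have mc z : measurable_fun setT (fun t => (cauchy x z t)%:E).
  by apply/measurable_EFinP; apply: continuous_measurable_fun; exact: continuous_cauchy.
have hh0 : 0 < h / h' by rewrite divr_gt0.
have E2 : (\int[mu]_t (C' / (2 * h) * (cauchy x h t + h / h' * cauchy x h' t))%:E = (C' * pi)%:E)%E.
  have k0 : 0 <= C' / (2 * h) by rewrite divr_ge0 ?(ltW C'0)// mulr_ge0// ltW.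
  have k1 : 0 <= C' / (2 * h) * (h / h') by rewrite mulr_ge0// ltW.
  under eq_integral do rewrite mulrDr [_ * (h / h' * _)]mulrA EFinD.
  rewrite ge0_integralD//.
  - rewrite !integral_cauchyZ// -EFinD; congr EFin.
    by move: (pi : R) => p; field; rewrite !gt_eqF.
  - by move=> t _; rewrite lee_fin mulr_ge0// ltW// cauchy_gt0.
  - by apply/measurable_EFinP; apply: measurable_funM => //; apply/measurable_EFinP; exact: mc.
  - by move=> t _; rewrite lee_fin mulr_ge0// ltW// cauchy_gt0.
  - by apply/measurable_EFinP; apply: measurable_funM => //; apply/measurable_EFinP; exact: mc.
rewrite -E2; apply: le_integral_EFin.
- apply: measurable_funM => //; apply: measurable_funM => //.
    exact: measurable_funX.
  by apply: continuous_measurable_fun; exact: continuous_cauchy.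
- apply: measurable_funM => //; apply: measurable_funD.
    by apply: continuous_measurable_fun; exact: continuous_cauchy.
  by apply: measurable_funM => //; apply: continuous_measurable_fun; exact: continuous_cauchy.
- move=> t; rewrite mulr_ge0 ?invr_ge0 ?(mulr_ge0 (ler0n R 2) (ltW s0))//.
  by rewrite mulr_ge0 ?sqr_ge0// ltW// cauchy_gt0.
move=> t.
have E4 : (growthT4 Q t)^-1 ^+ 2 = (Num.sqrt (T t))^-1.
  by rewrite growthT4E exprVn sqr_sqrtr// sqrtr_ge0.
rewrite E4; have := Hh' t; have h20 : 0 < (2 * h)^-1 by rewrite invr_gt0 mulr_gt0.
move=> /(ler_wpM2l (ltW h20)); set c1 := _ + _; rewrite (_ : C' / (2 * h) * c1 = (2 * h)^-1 * (C' * c1)); last by ring.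
apply: le_trans; rewrite le_eqVlt; apply/orP; left; apply/eqP.
by move: (Num.sqrt (T t))^-1 => z; field; rewrite !gt_eqF.
Qed.

End KernelBounds.

(** * Operator bounds in Lp *)

Section Schur.
Context {R : realType}.
Local Notation mu := (@lebesgue_measure R).

(** The parameter [lam] stays free so that it can be chosen after integrating in [t]; at [r = 1] the
    second term vanishes. *)
Lemma young_unit (r a lam : R) : 1 <= r -> 0 <= a -> 0 < lam ->
  a <= lam `^ (1 - r) * a `^ r / r + lam * (1 - r^-1).
Proof.
move=> r1 a0 l0; have r0 : 0 < r := lt_le_trans ltr01 r1.
move: r1; rewrite le_eqVlt => /predU1P[<-|r1].
  by rewrite subrr powRr0 mul1r powRr1// invr1 subrr mulr0 addr0 mulr1.
have q0 : 0 < 1 - r^-1 by rewrite subr_gt0 invf_lt1.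
pose q := (1 - r^-1)^-1.
have qi : q^-1 = 1 - r^-1 by rewrite /q invrK.
have q0' : 0 < q by rewrite invr_gt0.
have := @conjugate_powR R (a / lam) 1 r q (divr_ge0 a0 (ltW l0)) ler01 r0 q0' ltac:(by rewrite qi addrC subrK).
rewrite mulr1 powR1 mul1r qi => h.
have := ler_wpM2l (ltW l0) h; rewrite mulrDr mulrC divfK ?gt_eqF// => /le_trans; apply.
rewrite lerD2r mulrA ler_wpM2r ?invr_ge0 ?(ltW r0)// powRM ?invr_ge0 ?(ltW l0)//.
rewrite mulrCA mulrC ler_wpM2r ?powR_ge0// -powR_inv1 ?(ltW l0)// -powRrM mulN1r.
rewrite -{1}(powRr1 (ltW l0)) -powRD ?(lt0r_neq0 l0) ?implybT//.
Qed.

(* Optimising over the Young parameter replaces Hoelder's inequality. *)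
Lemma young_opt (r u j C : R) : 1 <= r -> 0 <= u -> 0 <= j -> 0 < C ->
  (forall lam, 0 < lam -> u <= lam `^ (1 - r) / r * j + lam * (1 - r^-1) * C) ->
  u `^ r <= C `^ (r - 1) * j.
Proof.
move=> r1 u0 j0 C0 H; have r0 : 0 < r := lt_le_trans ltr01 r1.
have ri1 : r^-1 <= 1 by rewrite invf_le1.
have [j00|jn0] := eqVneq j 0.
  rewrite j00 mulr0; suff -> : u = 0 by rewrite powR0// gt_eqF.
  apply/eqP; rewrite eq_le u0 andbT; apply/ler_addgt0Pr => e e0; rewrite add0r.
  have := H (e / C) (divr_gt0 e0 C0); rewrite j00 mulr0 add0r => /le_trans; apply.
  rewrite mulrAC divfK ?gt_eqF// ler_piMr ?(ltW e0)// gerBl invr_ge0 ltW//.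
have jp : 0 < j by rewrite lt_def jn0.
have jC : 0 < j / C by rewrite divr_gt0.
pose lam := (j / C) `^ r^-1; have l0 : 0 < lam by rewrite powR_gt0.
have lr : lam `^ r = j / C by rewrite -powRrM mulVf ?gt_eqF// powRr1// ltW.
have l1 : lam `^ (1 - r) * j = lam * C.
  rewrite powRB ?(lt0r_neq0 l0) ?implybT// powRr1 ?(ltW l0)// lr.
  by field; rewrite !gt_eqF.
have h : u <= lam * C.
  apply: (le_trans (H lam l0)); rewrite mulrAC l1 le_eqVlt; apply/orP; left; apply/eqP.
  by field; rewrite gt_eqF.
apply: (@le_trans _ _ ((lam * C) `^ r)).
  by rewrite ge0_ler_powR ?nnegrE ?(ltW r0)// mulr_ge0 ?ltW.
rewrite powRM ?(ltW l0) ?(ltW C0)// lr powRB ?(lt0r_neq0 C0) ?implybT// powRr1 ?(ltW C0)//.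
by rewrite le_eqVlt; apply/orP; left; apply/eqP; field; rewrite gt_eqF.
Qed.

Variables (k : R -> R -> R) (C : R).
Hypothesis C0 : 0 < C.
Hypothesis mk : measurable_fun setT (fun z : measurableTypeR R * measurableTypeR R => k z.1 z.2).
Hypothesis k0 : forall x t, 0 <= k x t.
Hypothesis k1 : forall x, (\int[mu]_t (k x t)%:E <= C%:E)%E.
Hypothesis k2 : forall t, (\int[mu]_x (k x t)%:E <= C%:E)%E.

Let mk1 x : measurable_fun setT (k x).
Proof.
have : measurable_fun setT ((fun z : measurableTypeR R * measurableTypeR R => k z.1 z.2) \o (fun t : measurableTypeR R => (x, t))).
  by apply: measurableT_comp => //; exact: pair1_measurable.
by [].
Qed.

Let mk2 t : measurable_fun setT (k^~ t).
Proof.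
have : measurable_fun setT ((fun z : measurableTypeR R * measurableTypeR R => k z.1 z.2) \o (fun x : measurableTypeR R => (x, t))).
  by apply: measurableT_comp => //; exact: pair2_measurable.
by [].
Qed.

Lemma schur_fubini (g : R -> R) : measurable_fun setT g -> (forall t, 0 <= g t) ->
  (\int[mu]_x \int[mu]_t (k x t * g t)%:E <= C%:E * \int[mu]_t (g t)%:E)%E.
Proof.
move=> mg g0.
pose f (z : measurableTypeR R * measurableTypeR R) : \bar R := (k z.1 z.2 * g z.2)%:E.
have mf : measurable_fun setT f.
  apply/measurable_EFinP; apply: measurable_funM => //.
  apply: (measurableT_comp mg); exact: measurable_snd.
have f0 z : (0 <= f z)%E by rewrite lee_fin mulr_ge0.
rewrite (fubini_tonelli f mf f0).
apply: (@le_trans _ _ (\int[mu]_t (C%:E * (g t)%:E))%E).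
  apply: ge0_le_integral => //.
  - by move=> t _; apply: integral_ge0 => x _; exact: f0.
  - exact: (measurable_fun_fubini_tonelli_G f mf f0).
  - by apply/measurable_EFinP; apply: measurable_funM.
  - move=> t _; rewrite /f/=; under eq_integral do rewrite EFinM.
    rewrite ge0_integralZr//.
    + by apply: lee_wpmul2r; rewrite ?lee_fin.
    + by apply/measurable_EFinP; exact: mk2.
    + by move=> x _; rewrite lee_fin.
    + by rewrite lee_fin.
rewrite ge0_integralZl//; first by apply/measurable_EFinP.
- by move=> t _; rewrite lee_fin.
- by rewrite lee_fin ltW.
Qed.

(** The bound on the integrals in [t] gives, pointwise, [|F x|^r] at most [C^(r-1)] times the
    integral of [k |g|^r]. Integrating in [x] and exchanging the order uses the bound on the
    integrals in [x]. *)
Lemma schur_finite (r : R) (g F : R -> R) : 1 <= r -> measurable_fun setT g ->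
  measurable_fun setT F ->
  (forall x, (`|F x|%:E <= \int[mu]_t (k x t * `|g t|)%:E)%E) ->
  ('N[mu]_r%:E [EFin \o F] <= C%:E * 'N[mu]_r%:E [EFin \o g])%E.
Proof.
move=> r1 mg mF hF; have r0 : 0 < r := lt_le_trans ltr01 r1.
have ri1 : r^-1 <= 1 by rewrite invf_le1.
have mgr : measurable_fun setT (fun t => `|g t| `^ r).
  by apply: (measurableT_comp (measurable_powR r)); exact: measurableT_comp.
have cr0 x t : 0 <= k x t * `|g t| `^ r by rewrite mulr_ge0 ?powR_ge0.
have mkg x : measurable_fun setT (fun t => k x t * `|g t| `^ r) by exact: measurable_funM.
have pw x : ((`|F x| `^ r)%:E <= (C `^ (r - 1))%:E * \int[mu]_t (k x t * `|g t| `^ r)%:E)%E.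
  have J0 : (0 <= \int[mu]_t (k x t * `|g t| `^ r)%:E)%E.
    by apply: integral_ge0 => t _; rewrite lee_fin.
  case J : (\int[mu]_t (k x t * `|g t| `^ r)%:E)%E J0 => [j| |] //= J0; last first.
    by rewrite gt0_muley ?leey// lte_fin powR_gt0.
  rewrite -EFinM lee_fin; apply: (young_opt r1) => //.
  move=> lam l0; rewrite -lee_fin; apply: (le_trans (hF x)).
  apply: (@le_trans _ _ (\int[mu]_t ((lam `^ (1 - r) / r)%:E * (k x t * `|g t| `^ r)%:E
      + (lam * (1 - r^-1))%:E * (k x t)%:E))%E).
    under [leRHS]eq_integral do rewrite -!EFinM -EFinD.
    apply: le_integral_EFin.
    - by apply: measurable_funM => //; exact: measurableT_comp.
    - by apply: measurable_funD; apply: measurable_funM.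
    - by move=> t; rewrite mulr_ge0.
    - move=> t; apply: (le_trans (ler_wpM2l (k0 x t) (young_unit r1 (normr_ge0 (g t)) l0))).
      by rewrite le_eqVlt; apply/orP; left; apply/eqP; ring.
  have ri0 : 0 <= lam `^ (1 - r) / r by rewrite divr_ge0 ?powR_ge0 ?ltW.
  have rj0 : 0 <= lam * (1 - r^-1) by rewrite mulr_ge0 ?(ltW l0)// subr_ge0.
  rewrite ge0_integralD//; last 4 first.
  - by move=> t _; rewrite -EFinM lee_fin mulr_ge0.
  - by apply: measurable_funeM; apply/measurable_EFinP; exact: mkg.
  - by move=> t _; rewrite -EFinM lee_fin mulr_ge0.
  - by apply: measurable_funeM; apply/measurable_EFinP; exact: mk1.
  rewrite ge0_integralZl//; last 2 first.
  - by apply/measurable_EFinP; exact: mkg.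
  - by move=> t _; rewrite lee_fin.
  rewrite J EFinD; apply: leeD; first by rewrite -EFinM.
  rewrite ge0_integralZl//; last 2 first.
  - by apply/measurable_EFinP; exact: mk1.
  - by move=> t _; rewrite lee_fin.
  by rewrite [leRHS]EFinM; apply: lee_wpmul2l; rewrite ?lee_fin.
pose f (z : measurableTypeR R * measurableTypeR R) : \bar R := (k z.1 z.2 * `|g z.2| `^ r)%:E.
have mK : measurable_fun setT f.
  apply/measurable_EFinP; apply: measurable_funM => //.
  apply: (measurableT_comp mgr); exact: measurable_snd.
have f0 z : (0 <= f z)%E by rewrite lee_fin mulr_ge0 ?powR_ge0.
have mJ : measurable_fun setT (fun x => \int[mu]_t (k x t * `|g t| `^ r)%:E)%E.
  exact: (measurable_fun_fubini_tonelli_F f mK f0).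
have main : (\int[mu]_x (`|F x| `^ r)%:E <= (C `^ r)%:E * \int[mu]_t (`|g t| `^ r)%:E)%E.
  apply: (@le_trans _ _ (\int[mu]_x ((C `^ (r - 1))%:E * \int[mu]_t (k x t * `|g t| `^ r)%:E)%E)%E).
    apply: ge0_le_integral => //.
    - apply/measurable_EFinP; apply: (measurableT_comp (measurable_powR r)).
      exact: measurableT_comp.
    - exact: measurable_funeM.
  rewrite ge0_integralZl//; last 2 first.
  - by move=> x _; apply: integral_ge0 => t _; rewrite lee_fin.
  - by rewrite lee_fin powR_ge0.
  have -> : C `^ r = C `^ (r - 1) * C.
    by rewrite -{3}(powRr1 (ltW C0)) -powRD ?subrK// (lt0r_neq0 C0) implybT.
  rewrite EFinM -muleA; apply: lee_wpmul2l; first by rewrite lee_fin powR_ge0.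
  by apply: schur_fubini => // t; exact: powR_ge0.
have e0 (h : R -> R) : (0 <= \int[mu]_x (`|h x| `^ r)%:E)%E.
  by apply: integral_ge0 => x _; rewrite lee_fin powR_ge0.
rewrite unlock /=.
apply: (@le_trans _ _ (((C `^ r)%:E * \int[mu]_t (`|g t| `^ r)%:E) `^ r^-1)%E).
  apply: gt0_ler_poweR => //; rewrite ?invr_ge0 ?(ltW r0)// in_itv/= leey andbT//.
  by rewrite mule_ge0// lee_fin powR_ge0.
rewrite poweRM//; last by rewrite lee_fin powR_ge0.
by rewrite poweR_EFin -powRrM mulfV ?gt_eqF// powRr1// ltW.
Qed.

Lemma schur_infty (g F : R -> R) : measurable_fun setT g ->
  (forall x, (`|F x|%:E <= \int[mu]_t (k x t * `|g t|)%:E)%E) ->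
  ('N[mu]_+oo [EFin \o F] <= C%:E * 'N[mu]_+oo [EFin \o g])%E.
Proof.
move=> mg hF; rewrite unlock /=; case: ifP => [mu0|]; last by rewrite mule0.
have [M0|M0] := leP 0%E (ess_sup mu (abse \o (EFin \o g))); last first.
  suff : (0 <= ess_sup mu (abse \o (EFin \o g)))%E by rewrite leNgt M0.
  by apply: ess_sup_gee => //; apply: nearW => x; exact: abse_ge0.
have := ess_sup_ge mu (abse \o (EFin \o g)).
case: (ess_sup mu (abse \o (EFin \o g))) M0 => [M| |]//= M0 hM; last first.
  by rewrite gt0_muley ?leey// lte_fin.
apply/ess_supP; apply: nearW => x /=; apply: (le_trans (hF x)).
apply: (@le_trans _ _ (\int[mu]_t (M%:E * (k x t)%:E))%E).
  apply: ae_ge0_le_integral => //.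
  - by move=> t _; rewrite lee_fin mulr_ge0.
  - by apply/measurable_EFinP; apply: measurable_funM; [exact: mk1|exact: measurableT_comp].
  - by move=> t _; rewrite -EFinM lee_fin mulr_ge0.
  - by apply: measurable_funeM; apply/measurable_EFinP; exact: mk1.
  - apply: filterS hM => t; rewrite lee_fin => h _.
    by rewrite -EFinM lee_fin mulrC ler_wpM2r.
rewrite ge0_integralZl//; last 2 first.
- by apply/measurable_EFinP; exact: mk1.
- by move=> t _; rewrite lee_fin.
by rewrite muleC; apply: lee_wpmul2r.
Qed.

Lemma schur_test (p : \bar R) (g F : R -> R) : (1 <= p)%E -> measurable_fun setT g ->
  measurable_fun setT F ->
  (forall x, (`|F x|%:E <= \int[mu]_t (k x t * `|g t|)%:E)%E) ->
  ('N[mu]_p [EFin \o F] <= C%:E * 'N[mu]_p [EFin \o g])%E.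
Proof.
case: p => [r|_|]//; first by rewrite lee_fin => *; exact: schur_finite.
by move=> mg _; exact: schur_infty.
Qed.

End Schur.

Section LebesgueNorms.
Context {R : realType}.
Local Notation mu := (@lebesgue_measure R).
Implicit Types (f g F G u : R -> R) (p : \bar R).

Lemma lebesgue_setT_gt0 : (0 < mu [set: R])%E.
Proof.
apply: (@lt_le_trans _ _ (mu `[0, 1]%classic)).
  by rewrite lebesgue_measure_itv/= lte_fin ltr01 oppr0 adde0 lte_fin.
by apply: le_measure => //; rewrite inE.
Qed.

(** The point 0 is exempted because [growthT4] takes the conventional value 0 there, where
    [w <= T^(1/4) w] fails. *)
Lemma le_normLp p F G : (1 <= p)%E -> measurable_fun setT F -> measurable_fun setT G ->
  (forall x, x != 0 -> `|F x| <= `|G x|) -> (normLp p F <= normLp p G)%E.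
Proof.
case: p => [r r1 mF mG h|_ mF mG h|]//; rewrite /normLp unlock /=; last first.
  case: ifP => // _; apply: le_ess_sup.
  exists [set 0]; split; [exact: measurable_set1|exact: lebesgue_measure_set1|].
  move=> x /= nx; apply: contrapT => /eqP x0; apply: nx; rewrite lee_fin; exact: h.
rewrite lee_fin in r1; have r0 : 0 < r := lt_le_trans ltr01 r1.
have m (H : R -> R) : measurable_fun setT H -> measurable_fun setT (fun x => (`|H x| `^ r)%:E).
  move=> mH; apply/measurable_EFinP; apply: (measurableT_comp (measurable_powR r)).
  exact: measurableT_comp.
have i0 (H : R -> R) : (0 <= \int[mu]_x (`|H x| `^ r)%:E)%E.
  by apply: integral_ge0 => x _; rewrite lee_fin powR_ge0.
apply: gt0_ler_poweR; rewrite ?invr_ge0 ?(ltW r0)// ?in_itv/= ?leey ?andbT//; try exact: i0.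
apply: ae_ge0_le_integral => //.
- exact: m.
- exact: m.
- exists [set 0]; split; [exact: measurable_set1|exact: lebesgue_measure_set1|].
  move=> x /= nx; apply: contrapT => /eqP x0; apply: nx => _.
  by rewrite lee_fin ge0_ler_powR// ?nnegrE ?h// ltW.
Qed.

Lemma memLp_measurable p f : memLp p f -> measurable_fun setT f.
Proof. by move=> /sub_Lfun_mfun /set_mem. Qed.

(** For a finite exponent, [|g| <= 1 + |g|^r] reduces the claim to the integrability of [u] and of
    [|g|^r], in place of the Hoelder inequality. *)
Lemma memLp_integrable p g u (C : R) : (1 <= p)%E -> memLp p g -> measurable_fun setT u ->
  mu.-integrable setT (EFin \o u) -> (forall x, `|u x| <= C) ->
  mu.-integrable setT (EFin \o (fun x => g x * u x)).
Proof.
move=> p1 gp mU iu uC; have mg := memLp_measurable gp.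
have mgu : measurable_fun setT (fun x => g x * u x) by exact: measurable_funM.
case: p p1 gp => [r r1 gp|_ gp|]//; last first.
  have := set_mem (sub_Lfun_finLfun gp); rewrite /finLfun /= /finite_norm unlock /= lebesgue_setT_gt0.
  have := ess_sup_ge mu (abse \o (EFin \o g)).
  set M := ess_sup _ _ => hM Moo.
  have M0 : (0 <= M)%E.
    by apply: ess_sup_gee; [exact: lebesgue_setT_gt0|apply: nearW => x; exact: abse_ge0].
  have Mfin : M \is a fin_num by rewrite ge0_fin_numE.
  apply/integrableP; split; first exact/measurable_EFinP.
  have /integrableP[_ iu'] := iu.
  apply: (@le_lt_trans _ _ (\int[mu]_x ((fine M)%:E * `|(EFin \o u) x|))%E); last first.
    rewrite ge0_integralZl//; first by rewrite lte_mul_pinfty// lee_fin fine_ge0.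
    - by apply: measurableT_comp => //; exact/measurable_EFinP.
    - by rewrite lee_fin fine_ge0.
  apply: ae_ge0_le_integral => //.
  - by apply: measurableT_comp => //; exact/measurable_EFinP.
  - by move=> x _; rewrite mule_ge0// lee_fin fine_ge0.
  - by apply: measurable_funeM; apply: measurableT_comp => //; exact/measurable_EFinP.
  - apply: filterS hM => x /= h _; rewrite fineK// normrM EFinM.
    by apply: lee_wpmul2r => //; rewrite lee_fin.
rewrite lee_fin in r1; have ig := Lfun_integrable r1 gp.
apply: (@le_integrable _ _ _ mu setT measurableT _ (fun x => ((C%:E * (`|g x| `^ r)%:E) + `|(EFin \o u) x|)%E)) => //.
- exact/measurable_EFinP.
- move=> x _ /=; rewrite lee_fin normrM.
  have C0 : 0 <= C by apply: le_trans (uC 0).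
  rewrite [leRHS]ger0_norm; last by rewrite addr_ge0// mulr_ge0// powR_ge0.
  have h : `|g x| <= 1 + `|g x| `^ r.
    have [g1|g1] := leP `|g x| 1; first by rewrite (le_trans g1)// lerDl powR_ge0.
    by rewrite (le_trans (le1r_powR (ltW g1) r1))// lerDr.
  have h1 := ler_wpM2r (normr_ge0 (u x)) h.
  have h2 := ler_wpM2r (powR_ge0 `|g x| r) (uC x).
  by clear -h1 h2; lra.
- apply: integrableD => //; first exact: integrableZl.
  exact: integrable_abse.
Qed.

Lemma le_best_approx p n u f (e : \bar R) (C : R) : 0 < C ->
  (forall P : {poly R}, (size P <= n.+1)%N ->
    (e <= C%:E * normLp p (fun x => u x * (f x - P.[x]))%R)%E) ->
  (e <= C%:E * best_approx p n u f)%E.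
Proof.
move=> C0 h; rewrite -lee_pdivrMl// /best_approx; apply: le_ereal_inf_tmp => _ [P sP <-].
by rewrite lee_pdivrMl//; exact: h.
Qed.

End LebesgueNorms.

(** * The de la Vallee Poussin means as integral operators *)

Section ValleePoussin.
Context {R : realType} (Q : R -> R) (K : nat) (A l : R).
Hypothesis hQ : regular Q K A l.
Local Notation mu := (@lebesgue_measure R).
Local Notation T4 := (growthT4 Q).
Local Notation w := (weight Q).
Local Notation W := (fun x => w x ^+ 2).
Implicit Types (f g : R -> R) (r V : {poly R}).

(** What is needed to write [v_n(f)] as an integral against the kernel. It covers [w f] in [L^p] as
    well as the functions of the last estimate, known only through [f' w] in [L^p]. *)
Definition finite_moments f :=
  measurable_fun setT f /\ forall r, mu.-integrable setT (EFin \o (fun x => f x * r.[x] * W x)).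

Definition pairing f r : R := \int[mu]_x (f x * r.[x] * W x).

Lemma measurable_poly r : measurable_fun setT (fun x : R => r.[x]).
Proof. by apply: continuous_measurable_fun => x; exact: continuous_horner. Qed.

Lemma measurable_weight : measurable_fun setT w.
Proof. by apply: continuous_measurable_fun; exact: (continuous_weight hQ). Qed.

Lemma memLp_finite_moments p f : (1 <= p)%E -> memLp p (fun x => w x * f x) -> finite_moments f.
Proof.
move=> p1 fp; have mwf := memLp_measurable fp; split.
  rewrite (_ : f = (fun x => (w x * f x) * (w x)^-1)).
    apply: measurable_funM => //; apply: measurableT_comp; [exact: measurable_invr|exact: measurable_weight].
  by apply/funext => x; rewrite mulrAC divff ?mul1r// gt_eqF// weight_gt0.
move=> r; have [C C0 hC] := poly_weight_le hQ r.
have h : mu.-integrable setT (EFin \o (fun x => (w x * f x) * (r.[x] * w x))).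
  apply: (memLp_integrable (C := C) p1 fp) => //.
  - by apply: measurable_funM; [exact: measurable_poly|exact: measurable_weight].
  - exact: (poly_weight_integrable hQ).
  - move=> x; rewrite normrM (ger0_norm (weight_ge0 Q x)) (le_trans (hC x))// ler_piMr//.
    by rewrite invf_le1 ?ltr_pwDl ?sqr_ge0// lerDl sqr_ge0.
by apply: eq_integrable (h) => // x _ /=; congr EFin; ring.
Qed.

Lemma poly_finite_moments r : finite_moments (fun x => r.[x]).
Proof.
split; first exact: measurable_poly.
move=> s; have h := weight_moments hQ (r * s).
by apply: eq_integrable (h) => // x _ /=; rewrite hornerM.
Qed.

Lemma finite_momentsB f r : finite_moments f -> finite_moments (fun x => f x - r.[x]).
Proof.
move=> [mf If]; have [mr Ir] := poly_finite_moments r; split; first exact: measurable_funB.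
move=> s; have h := integrableB measurableT (If s) (Ir s).
by apply: eq_integrable (h) => // x _ /=; rewrite !mulrBl.
Qed.

Section Pairing.
Variable f : R -> R.
Hypothesis hf : finite_moments f.

Lemma pairingD r s : pairing f (r + s) = pairing f r + pairing f s.
Proof.
rewrite /pairing -RintegralD//; try exact: (hf.2).
by apply: eq_Rintegral => x _; rewrite hornerD; ring.
Qed.

Lemma pairingZ c r : pairing f (c *: r) = c * pairing f r.
Proof.
rewrite /pairing -RintegralZl//; last exact: (hf.2).
by apply: eq_Rintegral => x _; rewrite hornerZ; ring.
Qed.

Lemma pairing_sum (s : seq nat) (F : nat -> {poly R}) :
  pairing f (\sum_(i <- s) F i) = \sum_(i <- s) pairing f (F i).
Proof.
have p0 : pairing f 0 = 0 by rewrite -(scale0r (0 : {poly R})) pairingZ mul0r.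
by apply: (big_morph (pairing f) pairingD p0).
Qed.

Lemma vallee_poussinE P n x : (vallee_poussin w P f n).[x] = pairing f (vpker P n x).
Proof.
rewrite /vallee_poussin /vpker hornerZ pairingZ; congr (_ * _).
rewrite horner_sum pairing_sum; apply: eq_bigr => j _.
rewrite /fourier_sum horner_sum pairing_sum; apply: eq_bigr => k _.
by rewrite hornerZ pairingZ mulrC.
Qed.

End Pairing.

Lemma pairingB f r V : finite_moments f ->
  pairing (fun x => f x - r.[x]) V = pairing f V - pairing (fun x => r.[x]) V.
Proof.
move=> hf; rewrite /pairing -RintegralB//.
- by apply: eq_Rintegral => x _; rewrite !mulrBl.
- exact: hf.2.
- exact: (poly_finite_moments r).2.
Qed.

Lemma pairing_vpker P n r x : orthonormal_polys w P -> (0 < n)%N -> (size r <= n.+1)%N ->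
  pairing (fun x => r.[x]) (vpker P n x) = r.[x].
Proof.
move=> oP n0 sr; have hP := orthonormal_orthogonal hQ oP; have [hW sP _] := hP.
have hr := poly_finite_moments r.
rewrite /vpker (pairingZ hr) (pairing_sum hr).
rewrite (eq_big_nat _ _ (F2 := fun=> r.[x])); last first.
  move=> j /andP[nj _]; have [c rE] := poly_basis sP (leq_trans sr nj).
  transitivity (moment W (r * \sum_(0 <= k < j) (P k).[x] *: P k)).
    by apply: eq_Rintegral => t _; rewrite hornerM.
  rewrite {1}rE (orthogonal_moment j _ _ hP) mul1r rE horner_sum.
  by apply: eq_bigr => k _; rewrite hornerZ.
rewrite sum_window sumr_const_nat subn0 -(mulr_natl r.[x]) mulrA mulVf ?mul1r//.
by rewrite pnatr_eq0 -lt0n.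
Qed.

Lemma vallee_poussin_error P n f r x : orthonormal_polys w P -> (0 < n)%N -> (size r <= n.+1)%N ->
  finite_moments f ->
  f x - (vallee_poussin w P f n).[x] =
  (f x - r.[x]) - (vallee_poussin w P (fun x => f x - r.[x]) n).[x].
Proof.
move=> oP n0 sr hf; rewrite !vallee_poussinE//; last exact: finite_momentsB.
by rewrite pairingB// pairing_vpker//; ring.
Qed.

Lemma measurable_vpker P n :
  measurable_fun setT (fun z : measurableTypeR R * measurableTypeR R => (vpker P n z.1).[z.2]).
Proof.
rewrite (_ : (fun z : _ => _) = (fun z : measurableTypeR R * measurableTypeR R =>
  n%:R^-1 * \sum_(n.+1 <= j < n.*2.+1) CDker P j z.1 z.2)); last first.
  by apply/funext => z; rewrite vpkerE.
apply: measurable_funM => //; apply: measurable_sum => j; apply: measurable_sum => k.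
apply: measurable_funM; apply: (measurableT_comp (measurable_poly _)); [exact: measurable_fst|exact: measurable_snd].
Qed.

(** Schur's test for the kernel [u(x) |V(x, t)| w(t)^2 / v(t)] acting on [v g]. The weight [v] may
    vanish at 0, which is a null set. *)
Lemma vallee_poussin_schur p P n (u v : R -> R) (C : R) g : (1 <= p)%E -> 0 < C ->
  measurable_fun setT u -> measurable_fun setT v ->
  (forall x, 0 <= u x) -> (forall x, 0 <= v x) -> (forall x, x != 0 -> 0 < v x) ->
  (forall x, \int[mu]_t (u x * `|(vpker P n x).[t]| * (W t / v t))%:E <= C%:E)%E ->
  (forall t, \int[mu]_x (u x * `|(vpker P n x).[t]| * (W t / v t))%:E <= C%:E)%E ->
  finite_moments g ->
  (normLp p (fun x => u x * (vallee_poussin w P g n).[x])%R <= C%:E * normLp p (fun x => v x * g x)%R)%E.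
Proof.
move=> p1 C0 mU mv u0 v0 vp k1 k2 hg; have [mg Ig] := hg.
apply: (schur_test C0 _ _ k1 k2) => //.
- apply: measurable_funM; first apply: measurable_funM.
  + apply: (measurableT_comp mU); exact: measurable_fst.
  + by apply: measurableT_comp => //; exact: measurable_vpker.
  + have mq : measurable_fun setT (fun t => W t / v t).
      apply: measurable_funM; first by apply: measurable_funX; exact: measurable_weight.
      by apply: measurableT_comp => //; exact: measurable_invr.
    apply: (measurableT_comp mq); exact: measurable_snd.
- by move=> x t; apply: mulr_ge0; [exact: mulr_ge0|rewrite divr_ge0// sqr_ge0].
- exact: measurable_funM.
- by apply: measurable_funM => //; exact: measurable_poly.
- move=> x; rewrite vallee_poussinE// normrM (ger0_norm (u0 x)) EFinM.
  set V := vpker P n x.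
  apply: (@le_trans _ _ ((u x)%:E * \int[mu]_t (`|g t * V.[t] * W t|)%:E)%E).
    apply: lee_wpmul2l; first by rewrite lee_fin.
    have := le_normr_Rintegral measurableT (Ig V); rewrite -lee_fin => /le_trans; apply.
    rewrite /Rintegral fineK//.
    by have := integrable_fin_num measurableT (integrable_abse (Ig V)).
  have mgV : measurable_fun setT (fun t => g t * V.[t] * W t).
    apply: measurable_funM; first by apply: measurable_funM => //; exact: measurable_poly.
    by apply: measurable_funX; exact: measurable_weight.
  rewrite -ge0_integralZl//; last 2 first.
  - by apply/measurable_EFinP; exact: measurableT_comp.
  - by rewrite lee_fin.
  apply: ae_ge0_le_integral => //.
  + by move=> t _; rewrite -EFinM lee_fin mulr_ge0.
  + by apply: measurable_funeM; apply/measurable_EFinP; exact: measurableT_comp.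
  + move=> t _; rewrite lee_fin; apply: mulr_ge0 => //; apply: mulr_ge0; first exact: mulr_ge0.
    by rewrite divr_ge0// sqr_ge0.
  + apply/measurable_EFinP; apply: measurable_funM.
      apply: measurable_funM.
        by apply: measurable_funM => //; apply: measurableT_comp => //; exact: measurable_poly.
      apply: measurable_funM; first by apply: measurable_funX; exact: measurable_weight.
      by apply: measurableT_comp => //; exact: measurable_invr.
    by apply: measurableT_comp => //; exact: measurable_funM.
  + exists [set 0]; split; [exact: measurable_set1|exact: lebesgue_measure_set1|].
    move=> t /= nt; apply: contrapT => /eqP t0; apply: nt => _; rewrite -EFinM lee_fin !normrM.
    rewrite (ger0_norm (v0 t)) (ger0_norm (weight_ge0 Q t)) le_eqVlt; apply/orP; left; apply/eqP.
    by field; rewrite gt_eqF// vp.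
Qed.

(** Since [v_n] fixes [r], the error for [f] equals [(f - r) - v_n(f - r)]. The first term is
    bounded through [u <= v], the second by Schur's test. *)
Lemma vallee_poussin_best p P n (u v : R -> R) (C : R) f : (1 <= p)%E -> 0 < C ->
  orthonormal_polys w P -> (0 < n)%N ->
  measurable_fun setT u -> measurable_fun setT v ->
  (forall x, 0 <= u x) -> (forall x, 0 <= v x) -> (forall x, x != 0 -> 0 < v x) ->
  (forall x, x != 0 -> u x <= v x) ->
  (forall x, \int[mu]_t (u x * `|(vpker P n x).[t]| * (W t / v t))%:E <= C%:E)%E ->
  (forall t, \int[mu]_x (u x * `|(vpker P n x).[t]| * (W t / v t))%:E <= C%:E)%E ->
  finite_moments f ->
  (normLp p (fun x => ((f x - (vallee_poussin w P f n).[x]) * u x)%R) <=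
    (1 + C)%:E * best_approx p n v f)%E.
Proof.
move=> p1 C0 oP n0 mU mv u0 v0 vp uv k1 k2 hf; apply: le_best_approx; first by rewrite addr_gt0.
move=> r sr; have hg := finite_momentsB r hf; set g := fun x => f x - r.[x] in hg *.
have mvp (h : R -> R) : measurable_fun setT (fun x => u x * (vallee_poussin w P h n).[x]).
  by apply: measurable_funM => //; exact: measurable_poly.
have mg : measurable_fun setT g := hg.1.
have -> : (fun x => (f x - (vallee_poussin w P f n).[x]) * u x) =
    (fun x => u x * g x) \+ (fun x => - (u x * (vallee_poussin w P g n).[x])).
  by apply/funext => x /=; rewrite /g (vallee_poussin_error x oP n0 sr hf); ring.
have m1 : measurable_fun setT (fun x => u x * g x) by exact: measurable_funM.
have m2 : measurable_fun setT (fun x => - (u x * (vallee_poussin w P g n).[x])) by exact: measurableT_comp.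
apply: (le_trans (@eminkowski _ _ _ mu _ _ p m1 m2 p1)).
rewrite EFinD ge0_muleDl ?lee_fin ?(ltW C0)// mul1e; apply: leeD.
  apply: le_normLp => //; try exact: measurable_funM.
  by move=> x x0; rewrite !normrM ler_wpM2r// !ger0_norm// uv.
apply: le_trans (vallee_poussin_schur p1 C0 mU mv u0 v0 vp k1 k2 hg).
by apply: le_normLp => //; move=> x _; rewrite normrN.
Qed.

End ValleePoussin.

Section ValleePoussinBounds.
Context {R : realType} (Q : R -> R) (K : nat) (A l : R).
Hypothesis hQ : regular Q K A l.
Local Notation mu := (@lebesgue_measure R).
Local Notation T := (growthT Q).
Local Notation T4 := (growthT4 Q).
Local Notation w := (weight Q).

Lemma best_approx_ge0 p n (u f : R -> R) : (0 <= best_approx p n u f)%E.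
Proof. by apply: le_ereal_inf_tmp => _ [P _ <-]; exact: Lnorm_ge0. Qed.

Lemma sqrt_sqrt_le (D x : R) : 1 <= D -> 0 <= x ->
  Num.sqrt (Num.sqrt (D * x)) <= D * Num.sqrt (Num.sqrt x).
Proof.
move=> D1 x0; apply: le_trans (sqrt_le_mul D1 (sqrtr_ge0 x)).
by apply: ler_wsqrtr; exact: sqrt_le_mul.
Qed.

(** The estimates belong to the pairs of weights [(w / T4, w)], [(w, w)] and [(w, T4 w)]. The kernel
    being symmetric, the two conditions of Schur's test for the third pair are those for the first,
    exchanged; for the second pair [kernel_V1] with [tau <= A T a] serves for both. *)
Lemma vallee_poussin_bounds B : 1 <= B -> exists2 C : R, 0 < C & forall n a, mrs Q B n a ->
  forall p P f, (1 <= p)%E -> orthonormal_polys w P -> finite_moments Q f ->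
  let v := vallee_poussin w P f n in
  [/\ (normLp p (fun x => ((f x - v.[x]) * (w x / T4 x))%R) <= C%:E * best_approx p n w f)%E,
      (normLp p (fun x => ((f x - v.[x]) * w x)%R) <= (C * T4 a)%:E * best_approx p n w f)%E &
      (normLp p (fun x => ((f x - v.[x]) * w x)%R)
        <= C%:E * best_approx p n (fun x => (T4 x * w x)%R) f)%E].
Proof.
move=> B1; have [C1 C10 V1] := kernel_V1 hQ B1; have [C3 C30 V3] := kernel_V3 hQ B1.
have A1 := reg_A hQ; have A0 : 0 < A := lt_le_trans ltr01 A1.
pose D := C1 * A + C3; have C1A : 0 < C1 * A by rewrite mulr_gt0.
have D0 : 0 < D by rewrite addr_gt0.
have D1 : C1 * A <= D by rewrite lerDl ltW.
have D3 : C3 <= D by rewrite lerDr ltW.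
exists (1 + D); first by rewrite addr_gt0.
move=> n a hm p P f p1 oP hf v; have n0 := mrs_n hm; have a0 := mrs_a hm.
have mw := measurable_weight hQ; have mT := measurable_growthT4 hQ.
have w0 x : 0 < w x := weight_gt0 Q x.
have wge x : 0 <= w x := ltW (w0 x).
have W1 t : w t ^+ 2 / w t = w t by rewrite expr2 mulfK// gt_eqF.
have T40 x : 0 <= T4 x := growthT4_ge0 hQ x.
have T41 x : x != 0 -> 1 <= T4 x by exact: (growthT4_ge1 hQ).
have T4p x : x != 0 -> 0 < T4 x by move=> x0; rewrite (lt_le_trans ltr01)// T41.
have T400 : T4 0 = 0 by rewrite (growthT4E hQ) /growthT !mul0r sqrtr0 sqrtr0.
have tauT x : x != 0 -> Num.sqrt (Num.sqrt (tau Q a x)) <= A * T4 x.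
  move=> x0; rewrite (growthT4E hQ); apply: le_trans (sqrt_sqrt_le A1 (T_ge0 hQ x)).
  by do 2 apply: ler_wsqrtr; exact: (tau_le_T hQ).
have V1' x : (\int[mu]_t ((T4 x)^-1 * (w x * `|(vpker P n x).[t]| * w t))%:E <= D%:E)%E.
  under eq_integral do rewrite EFinM.
  rewrite ge0_integralZl//; last 3 first.
  - apply/measurable_EFinP; apply: measurable_funM => //; apply: measurable_funM => //.
    by apply: measurableT_comp => //; exact: measurable_poly.
  - by move=> t _; rewrite lee_fin !mulr_ge0.
  - by rewrite lee_fin invr_ge0.
  have [->|x0] := eqVneq x 0; first by rewrite T400 invr0 mul0e lee_fin ltW.
  apply: (le_trans (lee_wpmul2l _ (V1 _ _ hm P oP x))); first by rewrite lee_fin invr_ge0.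
  rewrite -EFinM lee_fin; apply: le_trans D1.
  rewrite ler_pdivrMl ?T4p// [leRHS]mulrC -mulrA ler_wpM2l ?(ltW C10)//; exact: tauT.
have V3' x : (\int[mu]_t (w x * `|(vpker P n x).[t]| * w t / T4 t)%:E <= D%:E)%E.
  by apply: (le_trans (V3 _ _ hm P oP x)); rewrite lee_fin.
have mi : measurable_fun setT (fun x => w x / T4 x).
  by apply: measurable_funM => //; apply: measurableT_comp => //; exact: measurable_invr.
have mTw : measurable_fun setT (fun x => T4 x * w x) by exact: measurable_funM.
split.
- apply: (vallee_poussin_best hQ p1 D0 oP n0 mi mw _ wge (fun x _ => w0 x)) => //.
  + by move=> x; rewrite divr_ge0.
  + by move=> x x0; rewrite ler_piMr// invf_le1 ?T41// T4p.
  + move=> x; apply: le_trans (V1' x); rewrite le_eqVlt; apply/orP; left; apply/eqP.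
    by apply: eq_integral => t _; rewrite W1; congr EFin; ring.
  + move=> t; apply: le_trans (V3' t); rewrite le_eqVlt; apply/orP; left; apply/eqP.
    by apply: eq_integral => x _; rewrite W1 vpkerC; congr EFin; ring.
- have Ta := T4p _ (lt0r_neq0 a0); have Da : 0 < D * T4 a by rewrite mulr_gt0.
  have V1a x : (\int[mu]_t (w x * `|(vpker P n x).[t]| * w t)%:E <= (D * T4 a)%:E)%E.
    apply: (le_trans (V1 _ _ hm P oP x)); rewrite lee_fin.
    apply: (@le_trans _ _ (C1 * (A * T4 a))); last by rewrite mulrA ler_wpM2r.
    rewrite ler_wpM2l ?(ltW C10)// (growthT4E hQ).
    apply: le_trans (sqrt_sqrt_le A1 (T_ge0 hQ a)).
    by do 2 apply: ler_wsqrtr; exact: (tau_le hQ x hm).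
  apply: (@le_trans _ _ ((1 + D * T4 a)%:E * best_approx p n w f)%E); last first.
    apply: lee_wpmul2r; first exact: best_approx_ge0.
    by rewrite lee_fin (mulrDl 1) mul1r lerD2r T41// lt0r_neq0.
  apply: (vallee_poussin_best hQ p1 Da oP n0 mw mw wge wge (fun x _ => w0 x)) => //.
  + move=> x; apply: le_trans (V1a x); rewrite le_eqVlt; apply/orP; left; apply/eqP.
    by apply: eq_integral => t _; rewrite W1.
  + move=> t; apply: le_trans (V1a t); rewrite le_eqVlt; apply/orP; left; apply/eqP.
    by apply: eq_integral => x _; rewrite W1 vpkerC; congr EFin; ring.
- have W4 t : w t ^+ 2 / (T4 t * w t) = w t / T4 t.
    by rewrite invfM [_^-1 / _]mulrC mulrA W1.
  apply: (vallee_poussin_best hQ p1 D0 oP n0 mw mTw wge) => //.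
  + by move=> x; rewrite mulr_ge0.
  + by move=> x x0; rewrite mulr_gt0// T4p.
  + by move=> x x0; rewrite ler_peMl// T41.
  + move=> x; apply: le_trans (V3' x); rewrite le_eqVlt; apply/orP; left; apply/eqP.
    by apply: eq_integral => t _; rewrite W4; congr EFin; ring.
  + move=> t; apply: le_trans (V1' t); rewrite le_eqVlt; apply/orP; left; apply/eqP.
    by apply: eq_integral => x _; rewrite W4 vpkerC; congr EFin; ring.
Qed.

End ValleePoussinBounds.

(** * Absolutely continuous functions *)

Section AbsolutelyContinuous.
Context {R : realType}.
Implicit Types (f F : R -> R) (a b e d x y : R).
Local Notation TV := total_variation.

Lemma ac_finType f a b e : abs_continuous f -> a < b -> 0 < e -> exists2 d, 0 < d &
  forall (I : finType) (s t : I -> R),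
    (forall i, [/\ a <= s i, s i <= t i & t i <= b]) ->
    trivIset setT (fun i => `]s i, t i[%classic) ->
    \sum_i (t i - s i) < d -> \sum_i `|f (t i) - f (s i)| < e.
Proof.
move=> hf ab e0; have [d d0 H] := hf a b e ab e0; exists d => // I s t st tr sd.
have E (F : I -> R) : \sum_i F i = \sum_(k < #|{: I}|) F (enum_val k).
  by rewrite -big_enum_val; apply: eq_bigl => i.
rewrite E; apply: (H _ (s \o enum_val) (t \o enum_val)).
- by move=> i; exact: st.
- by move=> i j _ _ h; apply/enum_val_inj/(tr (enum_val i) (enum_val j)).
- by move: sd; rewrite E.
Qed.

Lemma itv_partition_nth a b (l : seq R) i j : itv_partition a b l -> (i <= j <= size l)%N ->
  nth b (a :: l) i <= nth b (a :: l) j.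
Proof.
move=> [pl _] /andP[ij jl].
have so : sorted <=%O (a :: l) by rewrite /= (sub_path _ pl)// => x y; exact: ltW.
by apply: (sorted_leq_nth le_trans lexx) => //; rewrite inE/= ltnS// (leq_trans ij).
Qed.

Lemma itv_partition_last a b (l : seq R) : itv_partition a b l -> nth b (a :: l) (size l) = b.
Proof. by move=> [_ /eqP E]; have := nth_last b (a :: l); rewrite /= E. Qed.

(** The pieces of all the partitions form one finite disjoint family of the same total length,
    indexed by pairs. *)
Lemma ac_variation f a b e : abs_continuous f -> a < b -> 0 < e -> exists2 d, 0 < d &
  forall (m : nat) (s t : 'I_m -> R) (l : 'I_m -> seq R),
    (forall i, [/\ a <= s i, s i <= t i & t i <= b]) ->
    (forall i, itv_partition (s i) (t i) (l i)) ->
    trivIset setT (fun i => `]s i, t i[%classic) ->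
    \sum_i (t i - s i) < d -> \sum_i variation (s i) (t i) f (l i) < e.
Proof.
move=> hf ab e0; have [d d0 H] := ac_finType hf ab e0; exists d => // m s t l st pl tr sd.
pose N (i : 'I_m) j := nth (t i) (s i :: l i) j.
have N0 i : N i 0%N = s i by [].
have Nl i : N i (size (l i)) = t i by exact: itv_partition_last.
have Nm i j k : (j <= k <= size (l i))%N -> N i j <= N i k by exact: itv_partition_nth.
pose I := {i : 'I_m & 'I_(size (l i))}.
pose S (p : I) := N (tag p) (tagged p); pose T (p : I) := N (tag p) (tagged p).+1.
have sS p : s (tag p) <= S p by rewrite -N0; apply: Nm; rewrite leq0n ltnW// ltn_ord.
have Tt p : T p <= t (tag p) by rewrite -Nl; apply: Nm; rewrite ltn_ord leqnn.
have sumE (G : forall i : 'I_m, nat -> R) : \sum_(p : I) G (tag p) (tagged p) =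
    \sum_i \sum_(0 <= j < size (l i)) G i j.
  rewrite (eq_bigr (fun i => \sum_(j < size (l i)) G i j)); last by move=> i _; rewrite big_mkord.
  by rewrite sig_big_dep.
have := H I S T; rewrite [X in _ -> _ -> X < d -> _](sumE (fun i j => N i j.+1 - N i j)).
rewrite [X in _ -> _ -> _ -> X < e](sumE (fun i j => `|f (N i j.+1) - f (N i j)|)); apply.
- move=> p; have [h1 h2 h3] := st (tag p); split.
  + exact: le_trans (sS p).
  + by apply: Nm; rewrite leqnSn ltn_ord.
  + exact: le_trans h3.
- move=> [i j] [i' j'] _ _ /= [x []]; rewrite /= !in_itv/= => /andP[h1 h2] /andP[h3 h4].
  have ii' : i = i'.
    apply: (tr i i') => //; exists x; split; rewrite /= in_itv/=.
    + by rewrite (le_lt_trans (sS (existT _ i j)) h1) (lt_le_trans h2 (Tt (existT _ i j))).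
    + by rewrite (le_lt_trans (sS (existT _ i' j')) h3) (lt_le_trans h4 (Tt (existT _ i' j'))).
  subst i'; congr Tagged; apply/val_inj/eqP; rewrite /= eqn_leq; apply/andP; split; rewrite leqNgt; apply/negP => jj.
  + have := lt_trans h1 h4; rewrite /S /T/= ltNge => /negP; apply.
    by apply: Nm; rewrite jj ltnW// ltn_ord.
  + have := lt_trans h3 h2; rewrite /S /T/= ltNge => /negP; apply.
    by apply: Nm; rewrite jj ltnW// ltn_ord.
- rewrite (eq_bigr (fun i => t i - s i))// => i _.
  by rewrite telescope_sumr// -Nl -N0.
Qed.

Lemma ac_total_variation_fin f a b : abs_continuous f -> a < b -> TV a b f \is a fin_num.
Proof.
move=> hf ab; have [d d0 H] := ac_variation hf ab ltr01.
have small x y : a <= x -> x <= y -> y <= b -> y - x < d -> (TV x y f <= 1%:E)%E.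
  move=> ax xy yb yx; apply: ge_ereal_sup => _ [_ [l pl <-] <-]; rewrite lee_fin ltW//.
  have := H 1%N (fun=> x) (fun=> y) (fun=> l); rewrite !big_ord1; apply=> //.
  by move=> i j _ _ _; rewrite !ord1.
pose N := (Num.bound ((b - a) / d)).+1; pose h := (b - a) / N%:R.
have ba0 : 0 < b - a by rewrite subr_gt0.
have N0 : 0 < (N%:R : R) by rewrite ltr0n.
have h0 : 0 < h by rewrite divr_gt0.
have hd : h < d.
  rewrite ltr_pdivrMr// mulrC -ltr_pdivrMr//.
  have := archi_boundP (divr_ge0 (ltW ba0) (ltW d0)) => /lt_le_trans; apply.
  by rewrite ler_nat.
have Nh : a + N%:R * h = b by rewrite /h mulrCA mulfV ?gt_eqF// mulr1 subrKC.
have H' k : (k <= N)%N -> (TV a (a + k%:R * h) f <= k%:R%:E)%E.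
  elim: k => [_|k ih kN]; first by rewrite mul0r addr0 total_variationxx.
  have e : a + k.+1%:R * h = a + k%:R * h + h by rewrite -natr1 mulrDl mul1r addrA.
  have ak : a <= a + k%:R * h by rewrite lerDl mulr_ge0// ltW.
  have kk : a + k%:R * h <= a + k.+1%:R * h by rewrite e lerDl ltW.
  rewrite (total_variationD f ak kk) [in leRHS]mulrS addrC EFinD; apply: leeD; first exact: ih (ltnW kN).
  apply: small => //; last by rewrite e addrAC subrr add0r.
  by rewrite -[leRHS]Nh lerD2l ler_wpM2r ?(ltW h0)// ler_nat.
rewrite ge0_fin_numE ?total_variation_ge0 ?(ltW ab)//.
by rewrite (le_lt_trans _ (ltry N%:R))// -{1}Nh H'.
Qed.

Lemma ac_total_variation_sub f a b x y : abs_continuous f -> a < b -> a <= x -> x <= y -> y <= b ->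
  TV x y f \is a fin_num.
Proof.
move=> hf ab ax xy yb; rewrite ge0_fin_numE ?total_variation_ge0//.
have xb := le_trans xy yb.
apply: le_lt_trans (_ : TV a b f < +oo)%E; last by rewrite ltey_eq ac_total_variation_fin.
rewrite (total_variationD f ax xb) (total_variationD f xy yb).
apply: le_trans (leeDr _ (total_variation_ge0 f ax)); exact: leeDl (total_variation_ge0 f yb).
Qed.

(** Each variation is reached by some partition up to its share of [e / 2], and [ac_variation]
    bounds the sum over these partitions by the other half. *)
Lemma ac_total_variation f a b e : abs_continuous f -> a < b -> 0 < e -> exists2 d, 0 < d &
  forall (m : nat) (s t : 'I_m -> R),
    (forall i, [/\ a <= s i, s i <= t i & t i <= b]) ->
    trivIset setT (fun i => `]s i, t i[%classic) ->
    \sum_i (t i - s i) < d -> \sum_i fine (TV (s i) (t i) f) <= e.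
Proof.
move=> hf ab e0; have e20 : 0 < e / 2 by rewrite divr_gt0.
have [d d0 H] := ac_variation hf ab e20; exists d => // m s t st tr sd.
have n0 : 0 < e / 2 / m.+1%:R by rewrite divr_gt0.
have fin i : TV (s i) (t i) f \is a fin_num.
  by have [h1 h2 h3] := st i; exact: (ac_total_variation_sub hf ab).
have /choice[l Hl] : forall i : 'I_m, exists l, itv_partition (s i) (t i) l /\
    fine (TV (s i) (t i) f) <= variation (s i) (t i) f l + e / 2 / m.+1%:R.
  move=> i; have [_ [_ [l pl <-] <-] h] := ub_ereal_sup_adherent n0 (fin i).
  exists l; split=> //; move: h; rewrite -[ereal_sup _]/(TV (s i) (t i) f) -(fineK (fin i)).
  by rewrite -EFinB lte_fin ltrBlDr => /ltW.
apply: (@le_trans _ _ (\sum_i (variation (s i) (t i) f (l i) + e / 2 / m.+1%:R))).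
  by apply: ler_sum => i _; exact: (Hl i).2.
rewrite big_split/= sumr_const card_ord [leRHS]splitr lerD//.
  by apply/ltW/H => // i; exact: (Hl i).1.
have -> : e / 2 / m.+1%:R *+ m = e / 2 * (m%:R / m.+1%:R) by rewrite -mulr_natr -(mulrA (e / 2)) [_^-1 * _]mulrC.
by rewrite ler_piMr ?(ltW e20)// ler_pdivrMr ?ltr0n// mul1r ler_nat.
Qed.

Lemma open_itv_bounded (I : set R) : open I -> is_interval I -> (lebesgue_measure I < +oo)%E ->
  exists s t : R, [/\ s <= t, I `<=` `]s, t]%classic, `]s, t[%classic `<=` I &
    lebesgue_measure I = (t - s)%:E].
Proof.
move=> oI iI; have IE := (is_intervalP I).1 iI.
have [I0|/set0P[x Ix]] := eqVneq I set0.
  rewrite I0 => _; exists 0, 0; rewrite subrr measure0; split=> //= x.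
  by rewrite /= in_itv/= => /andP[h1 h2]; have := lt_trans h1 h2; rewrite ltxx.
move: oI Ix; rewrite {iI}IE => oI Ix Ioo.
have [bs [s [bt [t iE]]]] : exists bs s bt t, Rhull I = Interval (BSide bs s) (BSide bt t).
  move: Ix Ioo; case: (Rhull I) => [[bs s|[]] [bt t|[]]] /=; rewrite in_itv/= ?andbF// lebesgue_measure_itv/=.
  - by move=> _ _; exists bs, s, bt, t.
  - by rewrite ltry.
  - by rewrite ltNyr.
  - by [].
rewrite {}iE in oI Ix Ioo *; rewrite lebesgue_measure_itv/= lte_fin.
case: bs oI Ix {Ioo} => oI Ix; last first.
  have st : s < t.
    by move: Ix; case: (bt); rewrite /= in_itv/= => /andP[h1 h2]; [exact: lt_trans h2|exact: lt_le_trans h2].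
  exists s, t; rewrite st ltW// EFinB; split=> // z; case: (bt); rewrite /= !in_itv/= => /andP[-> h] //.
  - by rewrite ltW.
  - by rewrite ltW.
exfalso; have Is : [set` Interval (BLeft s) (BSide bt t)] s.
  by move: Ix; rewrite /= !in_itv/= lexx/=; case: (bt) => /andP[h1 h2]; [exact: le_lt_trans h2|exact: le_trans h2].
have [e /= e0 He] := open_nbhs_nbhs (conj oI Is).
have := He (s - e / 2); rewrite /= opprB addrC subrK ger0_norm ?divr_ge0 ?ltW// => /(_ _).
rewrite in_itv/= => H.
have : (s <= s - e / 2) && (if bt then s - e / 2 < t else s - e / 2 <= t).
  by move: H; case: (bt); apply; rewrite gtr_pMr// invf_lt1// ltr1n.
by move=> /andP[]; rewrite leNgt gtrBl divr_gt0.
Qed.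

End AbsolutelyContinuous.

(** * Density of a monotone absolutely continuous function *)

Section AbsolutelyContinuousMeasure.
Context {R : realType} (F : R -> R).
Local Notation mu := (@lebesgue_measure R).
Hypothesis F_homo : {homo F : x y / x <= y}.
Hypothesis F_ac : forall e : R, 0 < e -> exists2 d : R, 0 < d &
  forall (m : nat) (s t : 'I_m -> R), (forall i, s i <= t i) ->
    trivIset setT (fun i => `]s i, t i[%classic) ->
    \sum_i (t i - s i) < d -> \sum_i (F (t i) - F (s i)) <= e.

Lemma ac_homo_continuous : continuous F.
Proof.
move=> x; apply/cvgrPdist_le => e e0; have [d d0 H] := F_ac e0.
have H1 y z : y <= z -> z - y < d -> F z - F y <= e.
  move=> yz zy; have := H 1%N (fun=> y) (fun=> z); rewrite !big_ord1; apply=> //.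
  by move=> i j _ _ _; rewrite !ord1.
near=> y; have yd : `|x - y| < d by near: y; exact: cvgr_dist_lt.
have [xy|/ltW yx] := leP x y.
  rewrite ler0_norm ?subr_le0 ?F_homo// opprB H1//.
  by rewrite (le_lt_trans _ yd)// -normrN opprB ler_norm.
by rewrite ger0_norm ?subr_ge0 ?F_homo// H1// (le_lt_trans _ yd)// ler_norm.
Unshelve. all: by end_near. Qed.

Let F_rc : right_continuous F.
Proof. by apply: right_continuousW; exact: ac_homo_continuous. Qed.

HB.instance Definition _ := isCumulative.Build R _ R F F_homo F_rc.

Let nu := lebesgue_stieltjes_measure F.

Lemma stieltjes_itv x y : x <= y -> nu `]x, y]%classic = (F y - F x)%:E.
Proof.
move=> xy; rewrite /nu /lebesgue_stieltjes_measure /measure_extension measurable_mu_extE/=; last exact: is_ocitv.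
by rewrite wlength_itv_bnd.
Qed.

(** [U] is a countable disjoint union of intervals. Absolute continuity bounds every finite partial
    sum with the same [d], and the bound passes to the limit. *)
Lemma stieltjes_open (e : R) : 0 < e -> exists2 d : R, 0 < d &
  forall U : set R, open U -> (mu U < d%:E)%E -> (nu U <= e%:E)%E.
Proof.
move=> e0; have [d d0 H] := F_ac e0; exists d => // U oU Ud.
set I := open_disjoint_itv oU.
have oI k : open (I k) by exact: open_disjoint_itv_open.
have mI k : measurable (I k) by exact: open_measurable.
have mU : measurable U by exact: open_measurable.
have IU k : I k `<=` U by move=> x Ix; rewrite (open_disjoint_itv_bigcup oU); exists k.
have Ioo k : (mu (I k) < +oo)%E.
  apply: le_lt_trans (lt_trans Ud (ltry _)); by apply: le_measure; [rewrite inE; exact: mI|rewrite inE; exact: mU|exact: IU].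
have /choice[st Hst] : forall k, exists st : R * R, [/\ st.1 <= st.2,
    I k `<=` `]st.1, st.2]%classic, `]st.1, st.2[%classic `<=` I k & mu (I k) = (st.2 - st.1)%:E].
  move=> k; have [s [t h]] := open_itv_bounded (oI k) (@open_disjoint_itv_is_interval R U oU k) (Ioo k).
  by exists (s, t).
have tI := @open_disjoint_itv_trivIset R U oU.
have UE : U = \bigcup_k I k by exact: open_disjoint_itv_bigcup.
have -> : nu U = (\sum_(k <oo) nu (I k))%E.
  by rewrite {1}UE; apply: (@measure_semi_bigcup _ _ _ (lebesgue_stieltjes_measure F)) => //; rewrite -UE.
apply: lime_le; first by apply: is_cvg_nneseries => *; exact: measure_ge0.
apply: nearW => m; rewrite big_mkord.
apply: (@le_trans _ _ (\sum_(i < m) (F (st i).2 - F (st i).1)%:E)%E).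
  apply: lee_sum => i _; have [h1 h2 _ _] := Hst i.
  rewrite -(stieltjes_itv h1); apply: (@le_measure _ _ _ (lebesgue_stieltjes_measure F)) => //; rewrite inE; [exact: mI|exact: measurable_itv].
rewrite sumEFin lee_fin; apply: (H m (fun i => (st i).1) (fun i => (st i).2)).
- by move=> i; have [] := Hst i.
- move=> i j _ _ [x [hi hj]]; apply/val_inj/(tI i j) => //; exists x; split.
  + by have [_ _ h _] := Hst i; exact: h.
  + by have [_ _ h _] := Hst j; exact: h.
- rewrite -lte_fin -sumEFin (eq_bigr (fun i : 'I_m => mu (I i))); last by move=> i _; have [] := Hst i.
  apply: le_lt_trans Ud; rewrite UE measure_semi_bigcup//; last by rewrite -UE.
  by rewrite -(big_mkord xpredT (fun i => mu (I i))); apply: nneseries_lim_ge => *; exact: measure_ge0.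
Qed.

Lemma stieltjes_null (A : set R) : measurable A -> mu A = 0%E -> nu A = 0%E.
Proof.
move=> mA A0; apply/eqP; rewrite eq_le measure_ge0 andbT.
apply/lee_addgt0Pr => e e0; rewrite add0e; have [d d0 H] := stieltjes_open e0.
have Aoo : (mu A < +oo)%E by rewrite A0 ltry.
have [U [oU AU Ud]] := lebesgue_regularity_outer mA Aoo d0.
have mU : measurable U by exact: open_measurable.
apply: (@le_trans _ _ (nu U)); first by rewrite le_measure ?inE.
apply: H => //; apply: le_lt_trans Ud; rewrite -[X in mu X](setDUK AU).
apply: (le_trans (measureU2 _ _ _)) => //; first exact: measurableD.
by rewrite [X in (X + _ <= _)%E](A0 : _ = _) add0e.
Qed.

(** By [stieltjes_null] the Stieltjes measure is dominated by Lebesgue measure. Restricting it to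
    []a, b]] makes it finite, and Radon-Nikodym applies. *)
Lemma ac_homo_density a b : a < b -> exists2 g : R -> R, mu.-integrable setT (EFin \o g) &
  forall x y, a <= x -> x <= y -> y <= b -> F y - F x = \int[mu]_(t in `]x, y]) g t.
Proof.
move=> ab; have mD : measurable (`]a, b]%classic : set (measurableTypeR R)) by exact: measurable_itv.
have Doo : (nu `]a, b]%classic < +oo)%E by rewrite stieltjes_itv ?ltry// ltW.
pose nu' : {finite_measure set _ -> \bar R} := mfrestr mD Doo.
have dom : nu' `<< (mu : {measure set _ -> \bar R}).
  apply/null_content_dominatesP => S mS S0; apply/eqP; rewrite eq_le measure_ge0 andbT.
  rewrite -(stieltjes_null mS S0) /nu' /= /mfrestr /mrestr.
  by apply: le_measure; rewrite ?inE//; exact: measurableI.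
have [g [g0 gf ig gE]] := radon_nikodym_sigma_finite dom.
exists (fine \o g).
  by apply: eq_integrable (ig) => // x _ /=; rewrite fineK.
move=> x y ax xy yb; apply: EFin_inj.
rewrite -stieltjes_itv// /Rintegral fineK; last first.
  apply: integrable_fin_num => //; apply: integrableS (_ : mu.-integrable setT _) => //.
  by apply: eq_integrable (ig) => // z _ /=; rewrite fineK.
under eq_integral do rewrite /= fineK//.
rewrite -gE// /nu' /= /mfrestr /mrestr; congr (nu _).
apply/seteqP; split=> z; last by case.
rewrite /= !in_itv/= => /andP[xz zy]; split; rewrite ?xz ?zy//.
by rewrite (le_lt_trans ax xz) (le_trans zy yb).
Qed.

End AbsolutelyContinuousMeasure.

(** * Fundamental theorem of calculus for absolutely continuous functions *)

Section IntegralDerive.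
Context {R : realType} (f : R -> R).
Local Notation mu := (@lebesgue_measure R).
Local Notation TV := total_variation.
Hypothesis f_ac : abs_continuous f.

Section Clamp.
Variables a b : R.
Hypothesis ab : a < b.

(** Clamping to [[a, b]] extends the variation function to the whole line, where Stieltjes measures
    live, and lengthens no interval. *)
Let c (x : R) := Num.min (Num.max x a) b.

Let c_itv x : a <= c x <= b.
Proof. by rewrite le_min le_max lexx orbT (ltW ab) ge_min lexx orbT. Qed.

Let c_homo x y : x <= y -> c x <= c y.
Proof. by move=> xy; rewrite le_min2// le_max2. Qed.

Let c_id x : a <= x -> x <= b -> c x = x.
Proof. by move=> ax xb; rewrite /c max_l// min_l. Qed.

Let c_in x y z : c x < z -> z < c y -> x < z /\ z < y.
Proof.
rewrite gt_min lt_min gt_max lt_max => /orP h1 /andP[/orP h2 h3]; split.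
  by case: h1 => [/andP[]//|bz]; have := lt_trans bz h3; rewrite ltxx.
case: h2 => // za; case: h1 => [/andP[_ az]|bz]; first by have := lt_trans az za; rewrite ltxx.
by have := lt_trans bz h3; rewrite ltxx.
Qed.

Let c_lip x y : x <= y -> c y - c x <= y - x.
Proof.
move=> xy; have := c_homo xy; rewrite le_eqVlt => /predU1P[->|cc]; first by rewrite subrr subr_ge0.
have h1 : x <= c x.
  rewrite leNgt; apply/negP => h; move: cc; rewrite /c.
  have : b < x by move: h; rewrite gt_min gt_max ltxx/=.
  move=> bx; rewrite !min_r ?ltxx// le_max ?(ltW bx)// (le_trans (ltW bx) xy)//.
have h2 : c y <= y.
  rewrite leNgt; apply/negP => h; move: cc; rewrite /c.
  have ya : y < a by move: h; rewrite lt_min lt_max ltxx/= => /andP[].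
  by rewrite !max_r ?ltxx// ltW// (le_lt_trans xy).
by rewrite lerB.
Qed.

Let TVE x y : x <= y -> fine (TV a (c y) f) - fine (TV a (c x) f) = fine (TV (c x) (c y) f).
Proof.
move=> xy; have /andP[ax xb] := c_itv x; have /andP[ay yb] := c_itv y.
have cc := c_homo xy.
rewrite (total_variationD f ax cc) fineD ?(ac_total_variation_sub f_ac ab)//.
by rewrite addrC addKr.
Qed.

Let TV_abs x y : x <= y -> `|f (c y) - f (c x)| <= fine (TV (c x) (c y) f).
Proof.
move=> xy; have /andP[ax xb] := c_itv x; have /andP[ay yb] := c_itv y.
have cc := c_homo xy.
by rewrite -lee_fin fineK ?(ac_total_variation_sub f_ac ab)// total_variation_ge.
Qed.

Let clamp_ac (F : R -> R) : (forall s t, s <= t -> F t - F s <= 2 * fine (TV (c s) (c t) f)) ->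
  forall e : R, 0 < e -> exists2 d : R, 0 < d &
  forall (m : nat) (s t : 'I_m -> R), (forall i, s i <= t i) ->
    trivIset setT (fun i => `]s i, t i[%classic) ->
    \sum_i (t i - s i) < d -> \sum_i (F (t i) - F (s i)) <= e.
Proof.
move=> hF e e0; have e2 : 0 < e / 2 by rewrite divr_gt0.
have [d d0 H] := ac_total_variation f_ac ab e2; exists d => // m s t st tr sd.
apply: (@le_trans _ _ (\sum_i 2 * fine (TV (c (s i)) (c (t i)) f))).
  by apply: ler_sum => i _; exact: hF.
rewrite -mulr_sumr -ler_pdivlMl// mulrC; apply: H.
- by move=> i; have /andP[-> _] := c_itv (s i); have /andP[_ ->] := c_itv (t i); rewrite c_homo.
- move=> i j _ _ [z []]; rewrite /= !in_itv/= => /andP[h1 h2] /andP[h3 h4].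
  have [k1 k2] := c_in h1 h2; have [k3 k4] := c_in h3 h4.
  by apply: (tr i j) => //; exists z; split; rewrite /= in_itv/= ?k1 ?k2 ?k3 ?k4.
- by apply: le_lt_trans sd; apply: ler_sum => i _; exact: c_lip.
Qed.

(** Jordan decomposition: on [[a, b]] the function is the difference of the monotone functions [V]
    and [V - f], and each has a density. *)
Lemma ac_density : exists2 g : R -> R, mu.-integrable setT (EFin \o g) &
  forall x y, a <= x -> x <= y -> y <= b -> f y - f x = \int[mu]_(t in `]x, y]) g t.
Proof.
pose V x := fine (TV a (c x) f).
have TV0 x y : x <= y -> 0 <= fine (TV (c x) (c y) f).
  by move=> xy; rewrite fine_ge0// total_variation_ge0// c_homo.
have Vh : {homo V : x y / x <= y} by move=> x y xy; rewrite -subr_ge0 TVE// TV0.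
have Fh : {homo (fun x => V x - f (c x)) : x y / x <= y}.
  move=> x y xy; rewrite -subr_ge0; have := TV_abs xy; have := ler_norm (f (c y) - f (c x)).
  by rewrite -TVE// -/(V x) -/(V y); lra.
have VA s t : s <= t -> V t - V s <= 2 * fine (TV (c s) (c t) f).
  by move=> st; rewrite TVE// ler_peMl ?TV0// ler1n.
have FA s t : s <= t -> (V t - f (c t)) - (V s - f (c s)) <= 2 * fine (TV (c s) (c t) f).
  move=> st; have := TV_abs st; have := ler_norm (- (f (c t) - f (c s))).
  by rewrite normrN -TVE// -/(V s) -/(V t); lra.
have [g1 i1 H1] := ac_homo_density Vh (clamp_ac VA) ab.
have [g2 i2 H2] := ac_homo_density Fh (clamp_ac FA) ab.
exists (fun x => g1 x - g2 x); first exact: (integrableB measurableT i1 i2).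
move=> x y ax xy yb.
have mi : measurable (`]x, y]%classic : set (measurableTypeR R)) by exact: measurable_itv.
rewrite RintegralB//; try exact: integrableS (i1); try exact: integrableS (i2).
rewrite -H1// -H2// !c_id//; first by ring.
- exact: le_trans xy yb.
- exact: le_trans ax xy.
Qed.

End Clamp.

(** Lebesgue differentiation identifies the density with [derive1 f] almost everywhere, so the
    values of [derive1 f] at the remaining points do not affect the integral. *)
Lemma ac_integral_derive1 x y : measurable_fun setT (derive1 f) -> x <= y ->
  mu.-integrable `[x, y] (EFin \o derive1 f) /\
  f y - f x = \int[mu]_(t in `[x, y]) derive1 f t.
Proof.
(* The margin of 1 puts [[x, y]] inside an open interval on which [f] agrees with the indefinite
   integral, so derivatives can be compared at the end points too. *)
move=> mf xy; pose a := x - 1; pose b := y + 1.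
have ax : a < x by rewrite gtrBl.
have yb : y < b by rewrite ltrDl.
have ab : a < b by rewrite (lt_trans ax)// (le_lt_trans xy).
have [g ig gE] := ac_density ab.
pose G z := (\int[mu]_(t in [set` Interval (BRight a) (BRight z)]) g t)%R.
have locg : locally_integrable setT g by apply: open_integrable_locally => //; exact: openT.
have ae : {ae mu, forall z, `[x, y]%classic z -> derive1 f z = g z}.
  have igy z : mu.-integrable [set` Interval (BRight a) (BRight z)] (EFin \o g).
    by apply: integrableS (ig) => //; exact: measurable_itv.
  have := @FTC1 R g (BRight a) igy locg.
  apply: filterS; first exact: (ae_filter_ringOfSetsType mu).
  move=> z Hz; rewrite /= in_itv/= => /andP[xz zy].
  have az : a < z := lt_le_trans ax xz.
  have zb : z < b := le_lt_trans zy yb.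
  have haz : (BRight a < BRight z)%O by rewrite bnd_simp.
  have [dG <-] : derivable G z 1 /\ G^`()%classic z = g z := Hz haz.
  have dfG : is_derive z 1 (fun u => f a + G u) (0 + 'D_1 G z).
    by apply: is_deriveD; exact: derivableP.
  have fG : \near z, f a + G z = f z.
    near=> u; have au : a < u by near: u; exact: lt_nbhsr.
    have ub : u < b by near: u; exact: lt_nbhsl.
    have -> : G u = f u - f a by symmetry; apply: gE; [exact: lexx|exact: ltW|exact: ltW].
    by rewrite subrKC.
  by have [_] := near_eq_is_derive fG dfG; rewrite !derive1E add0r.
have mi : measurable (`[x, y]%classic : set (measurableTypeR R)) by exact: measurable_itv.
have igx : mu.-integrable `[x, y] (EFin \o g) by exact: integrableS (ig).
have aeE : ae_eq mu `[x, y]%classic (EFin \o g) (EFin \o derive1 f).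
  apply: filterS ae; first exact: (ae_filter_ringOfSetsType mu).
  by move=> z h /h /= ->.
have mfi : measurable_fun (`[x, y]%classic : set (measurableTypeR R)) (EFin \o derive1 f).
  by apply/measurable_EFinP; exact: measurable_funTS.
split.
  apply/integrableP; split=> //; have /integrableP[mg] := igx.
  apply: le_lt_trans; rewrite le_eqVlt; apply/orP; left; apply/eqP.
  apply: ae_eq_integral => //; try exact: measurableT_comp.
  by apply: filterS aeE => z h /h /= [->].
rewrite (gE x y (ltW ax) xy (ltW yb)) Rintegral_itv_obnd_cbnd; last first.
  by apply: integrableS (ig) => //; exact: measurable_itv.
congr fine; apply: ae_eq_integral => //; exact: measurable_int igx.
Unshelve. all: by end_near. Qed.

End IntegralDerive.

(** * A Favard inequality *)

Section Antiderivative.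
Context {R : realType}.
Implicit Types (p r J : {poly R}) (x y u v s : R).

Definition prim p : {poly R} := \poly_(i < (size p).+1) (p`_i.-1 / i%:R).

Lemma coef_prim p i : (prim p)`_i = p`_i.-1 / i%:R.
Proof.
rewrite coef_poly; case: ltnP => // pi; rewrite nth_default ?mul0r//.
by case: i pi => //= i; rewrite ltnS.
Qed.

Lemma deriv_prim p : (prim p)^`() = p.
Proof. by apply/polyP => i; rewrite coef_deriv coef_prim /= -(mulr_natr (p`_i / i.+1%:R)) divfK// pnatr_eq0. Qed.

Lemma primD p r : prim (p + r) = prim p + prim r.
Proof. by apply/polyP => i; rewrite coefD !coef_prim coefD mulrDl. Qed.

Lemma primZ a p : prim (a *: p) = a *: prim p.
Proof. by apply/polyP => i; rewrite coefZ !coef_prim coefZ mulrA. Qed.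

Lemma size_prim p n : (size p <= n)%N -> (size (prim p) <= n.+1)%N.
Proof. by move=> pn; rewrite (leq_trans (size_poly _ _)). Qed.

(** The integral of a polynomial through its formal primitive: no measurability is involved, and as
    a function of the end point it is again a polynomial. *)
Definition pint p x y : R := (prim p).[y] - (prim p).[x].

Lemma pintD p r x y : pint (p + r) x y = pint p x y + pint r x y.
Proof. by rewrite /pint primD !hornerD; ring. Qed.

Lemma pintZ a p x y : pint (a *: p) x y = a * pint p x y.
Proof. by rewrite /pint primZ !hornerZ; ring. Qed.

Lemma pintN p x y : pint (- p) x y = - pint p x y.
Proof. by rewrite -scaleN1r pintZ mulN1r. Qed.

Lemma pint_cat p x y z : pint p x y + pint p y z = pint p x z.
Proof. by rewrite /pint; ring. Qed.

Lemma pint_le_derive (F f : R -> R) p x y : x <= y -> (forall u, is_derive u 1 F (f u)) ->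
  (forall u, x <= u <= y -> p.[u] <= f u) -> pint p x y <= F y - F x.
Proof.
move=> xy dF pf; have := xy; rewrite le_eqVlt => /predU1P[->|xy']; first by rewrite /pint !subrr.
have dG u : is_derive u 1 (fun v => F v - (prim p).[v]) (f u - p.[u]).
  have := is_deriveB (dF u) (is_derive_poly (prim p) u).
  by rewrite deriv_prim.
have [|c /[!in_itv]/= /andP[xc cy]] := MVT xy' (fun u _ => dG u).
- apply: continuous_subspaceT => u; apply: differentiable_continuous.
  by apply/derivable1_diffP; have [] := dG u.
- rewrite /pint => E; have : 0 <= (f c - p.[c]) * (y - x).
    by rewrite mulr_ge0 ?subr_ge0// pf// !ltW.
  by rewrite -E; lra.
Qed.

Lemma pint_le p r x y : x <= y -> (forall u, x <= u <= y -> p.[u] <= r.[u]) ->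
  pint p x y <= pint r x y.
Proof.
move=> xy; apply: pint_le_derive => // u.
by have := is_derive_poly (prim r) u; rewrite deriv_prim.
Qed.

Lemma pint_ge0 p x y : x <= y -> (forall u, x <= u <= y -> 0 <= p.[u]) -> 0 <= pint p x y.
Proof.
move=> xy p0; have := @pint_le 0 p x y xy; rewrite {1}/pint.
have -> : prim 0 = 0 :> {poly R} by apply/polyP => i; rewrite coef_prim !coef0 mul0r.
by rewrite !horner0 subr0; apply => u /p0; rewrite horner0.
Qed.

Lemma pint_norm_le p r x y : x <= y -> (forall u, x <= u <= y -> `|p.[u]| <= r.[u]) ->
  `|pint p x y| <= pint r x y.
Proof.
move=> xy h; rewrite ler_norml.
have h' u : x <= u <= y -> - r.[u] <= p.[u] <= r.[u] by move=> /h; rewrite ler_norml.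
apply/andP; split.
  rewrite lerNl -pintN; apply: pint_le => // u /h' /andP[h1 _].
  by rewrite hornerN lerNl.
by apply: pint_le => // u /h' /andP[].
Qed.

Lemma pint_odd p L : 0 <= L -> (forall v, p.[- v] = - p.[v]) -> pint p (- L) L = 0.
Proof.
move=> L0 podd.
have h r : (forall v, r.[- v] = - r.[v]) -> pint r 0 L <= - pint r (- L) 0.
  move=> rodd; pose S := prim r \Po (- 'X).
  have SE v : S.[v] = (prim r).[- v] by rewrite horner_comp hornerN hornerX.
  have := @pint_le_derive (horner S) (horner S^`()) r 0 L L0 (is_derive_poly S).
  rewrite !SE /pint oppr0 opprB; apply => u _.
  by rewrite deriv_comp deriv_prim hornerM horner_comp derivN derivX !hornerN hornerX hornerC rodd mulrN1 opprK.
have h1 := h p podd.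
have h2 : pint (- p) 0 L <= - pint (- p) (- L) 0.
  by apply: h => v; rewrite !hornerN podd.
rewrite !pintN in h2; rewrite -(pint_cat p (- L) 0 L); apply/eqP; rewrite eq_le.
by move: h1 h2; clear; lra.
Qed.

Lemma pintC c x y : pint c%:P x y = c * (y - x).
Proof.
have -> : c%:P = c *: (1 : {poly R}) by rewrite -mul_polyC mulr1.
rewrite pintZ /pint; congr (_ * _).
have -> : prim 1 = 'X :> {poly R}.
  apply/polyP => -[|[|i]]; rewrite coef_prim coefX coef1/= ?invr0 ?mulr0 ?mul0r// divr1//.
by rewrite !hornerX.
Qed.

(* The cube of [logQ j] at [(v / L)^2] decays like [(v 2^j / L)^-6], so the
   fourth-order weight is integrable against it. *)
Lemma jackson (j : nat) L : 0 < L -> exists J : {poly R},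
  [/\ (size J <= (6 * (2 ^ j).-1).+1)%N, forall v, J.[- v] = J.[v],
      forall v, - L <= v <= L -> 0 <= J.[v], pint J (- L) L = 1 &
      pint (J * (1 + (2 ^+ j / L) ^+ 2 *: 'X^2) ^+ 2) (- L) L <= 14 * pi].
Proof.
move=> L0; pose m : R := 2 ^+ j; have m1 : 1 <= m by rewrite exprn_ege1// ler1n.
have m0 : 0 < m := lt_le_trans ltr01 m1.
have m2 : 4 ^+ j = m ^+ 2 by rewrite /m exprAC; congr (_ ^+ _); ring.
pose d := L / m; have d0 : 0 < d by rewrite divr_gt0.
have dL : d <= L by rewrite ler_pdivrMr// ler_peMr// ltW.
pose F : {poly R} := logQ j \Po (L ^- 2 *: 'X^2).
have FE v : F.[v] = (logQ j).[(v / L) ^+ 2].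
  by rewrite horner_comp hornerZ hornerXn expr_div_n mulrC.
pose J0 := F ^+ 3; have J0E v : J0.[v] = F.[v] ^+ 3 by rewrite horner_exp.
pose S : {poly R} := 1 + (m / L) ^+ 2 *: 'X^2.
have SE v : S.[v] = 1 + m ^+ 2 * (v / L) ^+ 2.
  by rewrite hornerD hornerC hornerZ hornerXn !expr_div_n; ring.
have SE' v : S.[v] = 1 + (v / d) ^+ 2.
  by rewrite SE /d; congr (_ + _); field; rewrite !gt_eqF.
have unit v : - L <= v <= L -> 0 <= (v / L) ^+ 2 <= 1.
  move=> /andP[v1 v2]; rewrite sqr_ge0 -sqr_norm expr_le1// normrM normfV (gtr0_norm L0).
  by rewrite ler_pdivrMr// mul1r ler_norml v1.
have Fb v : - L <= v <= L -> [/\ 0 <= F.[v], F.[v] <= m ^+ 2, (v / L) ^+ 2 * F.[v] <= 1 &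
    m ^+ 2 * (1 - m ^+ 2 * (v / L) ^+ 2 / 3) <= F.[v]].
  by move=> /unit h; have := logQ_bounds j h; rewrite -FE m2.
have J00 v : - L <= v <= L -> 0 <= J0.[v] by move=> /Fb[h _ _ _]; rewrite J0E exprn_ge0.
(* The bounds [F <= m^2] and [(v / L)^2 F <= 1] give [F (1 + (v / d)^2) <= 2 m^2]. Cubing leaves
   [1 / (1 + (v / d)^2)], the derivative of an arctangent. *)
have up : pint (J0 * S ^+ 2) (- L) L <= 8 * m ^+ 6 * d * pi.
  pose G (v : R) := 8 * m ^+ 6 * d * atan (v / d).
  have dG u : is_derive u 1 G (8 * m ^+ 6 * (1 + (u / d) ^+ 2)^-1).
    have h1 : is_derive u 1 (fun v : R => v / d) (1 / d).
      have := is_derive_poly (d^-1 *: 'X) u; rewrite derivZ derivX hornerZ hornerC mulr1 div1r.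
      by rewrite (_ : horner _ = fun v => v / d)//; apply/funext => v; rewrite hornerZ hornerX mulrC.
    have h3 := @is_derive1_comp R atan (fun v => v / d) u _ _ (is_derive1_atan (u / d)) h1.
    have h2 := is_deriveZ (8 * m ^+ 6 * d) h3.
    have -> : 8 * m ^+ 6 * (1 + (u / d) ^+ 2)^-1 = (8 * m ^+ 6 * d) *: ((1 + (u / d) ^+ 2)^-1 * (1 / d)).
      rewrite /GRing.scale/=; field.
      by rewrite (gt_eqF d0) /= gt_eqF// ltr_pwDl ?exprn_gt0// sqr_ge0.
    exact: h2.
  have LL : - L <= L by rewrite ge0_cp// ltW.
  apply: (le_trans (pint_le_derive LL dG _)).
    move=> v /Fb[h1 h2 h3 _]; rewrite hornerM J0E horner_exp -SE' SE.
    set y := (v / L) ^+ 2 in h3 *; have y0 : 0 <= y by exact: sqr_ge0.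
    have X0 : 0 < 1 + m ^+ 2 * y by rewrite ltr_pwDl// mulr_ge0// sqr_ge0.
    rewrite ler_pdivlMr// -mulrA -exprSr -exprMn.
    have -> : 8 * m ^+ 6 = (2 * m ^+ 2) ^+ 3 by ring.
    rewrite lerXn2r// ?nnegrE ?(mulr_ge0 h1 (ltW X0)) ?(mulr_ge0 _ (sqr_ge0 m))//.
    have := ler_wpM2l (sqr_ge0 m) h3; move: h2; clear; set f := F.[v]; set z := m ^+ 2; nra.
  have c8 : 0 <= 8 * m ^+ 6 * d := mulr_ge0 (mulr_ge0 (ler0n _ 8) (exprn_ge0 6 (ltW m0))) (ltW d0).
  rewrite /G -mulrBr; apply: (ler_wpM2l c8).
  rewrite mulNr atanN opprK; have := atan_ltpi2 (L / d); clear; move: (atan _) => A; lra.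
(* On [|v| <= d] the lower bound of [logQ_bounds] gives [F >= 2/3 m^2]. The quotient of the two
   bounds is [13.5 pi], whence [14 pi]. *)
have low : 16 / 27 * m ^+ 6 * d <= pint J0 (- L) L.
  have e : pint ((8 / 27 * m ^+ 6)%:P) (- d) d = 16 / 27 * m ^+ 6 * d by rewrite pintC; field.
  rewrite -e -(pint_cat J0 (- L) (- d) L) -(pint_cat J0 (- d) d L).
  have h1 : 0 <= pint J0 (- L) (- d).
    apply: pint_ge0; first by rewrite lerN2.
    by move=> u /andP[u1 u2]; rewrite J00// u1 (le_trans u2)// lerNl (le_trans _ (ltW d0))// oppr_le0 ltW.
  have h2 : 0 <= pint J0 d L.
    apply: pint_ge0 => // u /andP[u1 u2]; rewrite J00// u2 andbT (le_trans _ u1)// lerNl.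
    by rewrite (le_trans _ (ltW L0))// oppr_le0 ltW.
  have h3 : pint (8 / 27 * m ^+ 6)%:P (- d) d <= pint J0 (- d) d.
    apply: pint_le; first by rewrite ge0_cp// ltW.
    move=> v /andP[v1 v2]; have vL : - L <= v <= L by rewrite (le_trans _ v1) ?lerN2// (le_trans v2).
    have [f1 f2 f3 f4] := Fb v vL; rewrite hornerC J0E.
    have -> : 8 / 27 * m ^+ 6 = (2 / 3 * m ^+ 2) ^+ 3 by field.
    have z0 : 0 <= 2 / 3 * m ^+ 2 := mulr_ge0 (divr_ge0 (ler0n _ 2) (ler0n _ 3)) (sqr_ge0 m).
    apply: lerXn2r; rewrite ?nnegrE//; apply: le_trans f4.
    rewrite mulrC ler_wpM2l ?sqr_ge0//.
    have : m ^+ 2 * (v / L) ^+ 2 <= 1.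
      have -> : m ^+ 2 * (v / L) ^+ 2 = (v / d) ^+ 2 by rewrite /d; field; rewrite !gt_eqF.
      rewrite -sqr_norm expr_le1// normrM normfV (gtr0_norm d0) ler_pdivrMr// mul1r.
      by rewrite ler_norml v1.
    by clear; lra.
  by clear -h1 h2 h3; lra.
have k0 : (0 : R) < 16 / 27 by rewrite divr_gt0.
have c0 : 0 < pint J0 (- L) L := lt_le_trans (mulr_gt0 (mulr_gt0 k0 (exprn_gt0 6 m0)) d0) low.
set c := pint J0 (- L) L in low c0; exists (c^-1 *: J0); split.
- rewrite (leq_trans (size_scale_leq _ _))// mulnC (_ : 6 = 2 * 3)%N// mulnA.
  apply: size_exp_leq; apply: (leq_trans (size_comp_poly_leq _ _)).
  have h1 : (size (logQ j : {poly R}) <= 2 ^ j)%N := size_logQ j; have p0 : (0 < 2 ^ j)%N by rewrite expn_gt0.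
  have h2 : (size (L ^- 2 *: 'X^2 : {poly R}) <= 3)%N by rewrite (leq_trans (size_scale_leq _ _))// size_polyXn.
  rewrite ltnS leq_mul//; last by move: h2; case: (size _).
  by rewrite -!subn1 leq_sub2r.
- by move=> v; rewrite !hornerZ !J0E !FE mulNr sqrrN.
- by move=> v vL; rewrite hornerZ mulr_ge0 ?J00// invr_ge0 ltW.
- by rewrite pintZ mulVf// gt_eqF.
- rewrite -scalerAl pintZ -/m -/S ler_pdivrMl//; apply: (le_trans up).
  have p0 : (0 : R) <= 14 * pi by rewrite mulr_ge0// pi_ge0.
  have := ler_wpM2r p0 low.
  have hp : 0 <= m ^+ 6 * d * pi by exact: mulr_ge0 (mulr_ge0 (exprn_ge0 6 (ltW m0)) (ltW d0)) (pi_ge0 R).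
  by move: hp; clear; move: (pi : R) => p; set z := m ^+ 6; nra.
Qed.

Lemma expR_quad_nonneg (y : R) : 0 <= y -> expR y - 1 - y <= y ^+ 2 * expR y.
Proof.
move=> y0; have e0 := expR_gt0 y; have h : expR y * (1 - y) <= 1.
  by have := ler_wpM2l (ltW e0) (expR_ge1Dx (- y)); rewrite -expRD subrr expR0.
have := ler_wpM2r (addr_ge0 ler01 y0) h; move: (expR y) e0 => E; clear; nra.
Qed.

Lemma expR_quad_nonpos (y : R) : y <= 0 -> expR y - 1 - y <= y ^+ 2.
Proof.
move=> y0; have := expR_ge1Dx (- y); rewrite expRN.
have e0 := expR_gt0 y; move: (expR y) e0 => E e0 h.
have h1 : E * (1 - y) <= 1.
  by have := ler_wpM2l (ltW e0) h; rewrite mulfV ?gt_eqF.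
have h2 : (1 - y) * (E - 1 - y - y ^+ 2) <= 0 by nra.
by rewrite -subr_le0 -(pmulr_rle0 _ (_ : 0 < 1 - y))//; lra.
Qed.

Lemma sqr_expRN_le (x : R) : 0 <= x -> x ^+ 2 * expR (- x) <= 4.
Proof.
move=> x0; rewrite expRN ler_pdivrMr ?expR_gt0//.
have := expR_ge1Dx (x / 2); have -> : expR x = expR (x / 2) ^+ 2 by rewrite expr2 -expRD -splitr.
by move: (expR (x / 2)) => E; nra.
Qed.

Lemma bernoulli_exp (N : nat) (y : R) : (0 < N)%N -> - N%:R <= y ->
  [/\ 0 <= 1 + y / N%:R, 1 + y <= (1 + y / N%:R) ^+ N & (1 + y / N%:R) ^+ N <= expR y].
Proof.
move=> N0 yN; have NR : 0 < (N%:R : R) by rewrite ltr0n.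
have h0 : -1 <= y / N%:R by rewrite ler_pdivlMr// mulN1r.
have h1 : 0 <= 1 + y / N%:R by lra.
split=> //.
  have E k : 1 + k%:R * (y / N%:R) <= (1 + y / N%:R) ^+ k.
    elim: k => [|k ih]; first by rewrite mul0r addr0 expr0.
    have := ler_wpM2r h1 ih; rewrite -exprSr => /(le_trans _); apply; rewrite -natr1.
    have : 0 <= k%:R * (y / N%:R) ^+ 2 by rewrite mulr_ge0 ?ler0n// sqr_ge0.
    by move: (y / N%:R) (k%:R : R) => z k'; clear; nra.
  by have := E N; rewrite mulrCA mulfV ?gt_eqF// mulr1.
have -> : expR y = expR (y / N%:R) ^+ N by rewrite -expRM_natl mulrC divfK ?gt_eqF.
by rewrite lerXn2r// ?nnegrE ?expR_ge0// expR_ge1Dx.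
Qed.

(** The three claims are the integrands of [step_error] before integration against [J]: for [s >= 0]
    the linear part to the right of [s] and the deviation from it to the left, for [s <= 0] the
    whole integrand. In the variables [v / h], [s / h] and [sg h <= 1] they are scale free. *)
Lemma step_pointwise (h sg s v : R) (N : nat) : 0 < h -> 0 <= sg -> sg * h <= 1 -> (0 < N)%N ->
  `|sg * v| <= N%:R ->
  let K := expR (- (sg * s)) * (1 + (s / h) ^+ 2) in
  let B := 10 * (1 + (v / h) ^+ 2) ^+ 2 in
  [/\ 0 <= s -> s <= v -> K * `|1 + sg * v| <= B,
      0 <= s -> v <= s -> K * `|(1 + sg / N%:R * v) ^+ N - (1 + sg * v)| <= B &
      s <= 0 -> v <= s -> K * `|(1 + sg / N%:R * v) ^+ N| <= B].
Proof.
move=> h0 sg0 sgh N0 vN K B.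
have lv : - N%:R <= sg * v by move: vN; rewrite ler_norml => /andP[].
have [e0 e1 e2] := bernoulli_exp N0 lv.
rewrite (_ : sg / N%:R * v = sg * v / N%:R); last by rewrite mulrAC.
set E := (1 + sg * v / N%:R) ^+ N in e1 e2 *.
pose x := v / h; pose y := s / h.
have vx : v = x * h by rewrite /x divfK// gt_eqF.
have sy : s = y * h by rewrite /y divfK// gt_eqF.
have svx : sg * v = sg * h * x by rewrite vx; ring.
have ssy : sg * s = sg * h * y by rewrite sy; ring.
have g0 : 0 <= sg * h by rewrite mulr_ge0// ltW.
rewrite /K /B -/x -/y svx ssy in e1 e2 *; set g := sg * h in g0 sgh svx ssy e1 e2 *.
have x2 := sqr_ge0 x; have y2 := sqr_ge0 y.
split=> [s0 sv|s0 vs|s0 vs].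
- have y0 : 0 <= y by rewrite divr_ge0// ltW.
  have yx : y <= x by rewrite ler_wpM2r// invr_ge0 ltW.
  have x0 := le_trans y0 yx.
  have gx : g * x <= x by rewrite ler_piMl.
  have gx0 : 0 <= g * x by rewrite mulr_ge0.
  rewrite ger0_norm ?addr_ge0//.
  apply: (@le_trans _ _ (1 * (1 + x ^+ 2) * (1 + x))).
    apply: ler_pM; rewrite ?mulr_ge0 ?expR_ge0 ?addr_ge0 ?ler_wpM2l// ?lerD2l//.
    apply: ler_pM; rewrite ?expR_ge0 ?addr_ge0//.
      by rewrite -[leRHS]expR0 ler_expR oppr_le0 mulr_ge0.
    by rewrite lerD2l lerXn2r// nnegrE.
  by rewrite mul1r; move: x0; clear; move: x => z; nra.
- have y0 : 0 <= y by rewrite divr_ge0// ltW.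
  have xy : x <= y by rewrite ler_wpM2r// invr_ge0 ltW.
  have gy0 : 0 <= g * y by rewrite mulr_ge0.
  rewrite ger0_norm ?subr_ge0//.
  have Z (A D : R) : 0 <= A -> E - (1 + g * x) <= A * D -> E - (1 + g * x) <= A * D by [].
  have Ey1 : expR (- (g * y)) <= 1 by rewrite -[leRHS]expR0 ler_expR oppr_le0.
  have Ey0 := expR_ge0 (- (g * y)).
  have [x0|x0] := leP 0 x.
    (* The exponentials combine to [exp(-g (y - x))], which absorbs [(g (y - x))^2]; then
       [y^2 <= 2 x^2 + 2 (y - x)^2] leaves only powers of [x]. *)
    have hE : E - (1 + g * x) <= (g * x) ^+ 2 * expR (g * x).
      apply: le_trans (expR_quad_nonneg (mulr_ge0 g0 x0)); rewrite opprD addrA !lerD2r; exact: e2.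
    have hz : (g * (y - x)) ^+ 2 * expR (- (g * (y - x))) <= 4.
      by apply: sqr_expRN_le; rewrite mulr_ge0// subr_ge0.
    have hz1 : expR (- (g * (y - x))) <= 1.
      by rewrite -[leRHS]expR0 ler_expR oppr_le0 mulr_ge0// subr_ge0.
    have hz0 := expR_ge0 (- (g * (y - x))).
    have ee : expR (- (g * y)) * expR (g * x) = expR (- (g * (y - x))) by rewrite -expRD; congr expR; ring.
    apply: (@le_trans _ _ (expR (- (g * (y - x))) * ((1 + y ^+ 2) * (g * x) ^+ 2))).
      rewrite -ee; have := ler_wpM2l (mulr_ge0 Ey0 (addr_ge0 ler01 y2)) hE => /le_trans; apply.
      by rewrite le_eqVlt; apply/orP; left; apply/eqP; ring.
    have g2 : g ^+ 2 <= 1 by rewrite expr_le1.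
    have g20 := sqr_ge0 g.
    move: hz hz1 hz0; set e := expR _ => hz hz1 hz0.
    have hy : y ^+ 2 <= 2 * x ^+ 2 + 2 * (y - x) ^+ 2 by have := sqr_ge0 (y - 2 * x); nra.
    have t1 : e * ((1 + y ^+ 2) * (g * x) ^+ 2) <=
        e * g ^+ 2 * x ^+ 2 * (1 + 2 * x ^+ 2) + 2 * x ^+ 2 * ((g * (y - x)) ^+ 2 * e).
      have := ler_wpM2l (mulr_ge0 (mulr_ge0 hz0 g20) x2) hy; lra.
    apply: (le_trans t1).
    have t2 : 2 * x ^+ 2 * ((g * (y - x)) ^+ 2 * e) <= 2 * x ^+ 2 * 4 by rewrite ler_wpM2l// mulr_ge0.
    have t3 : e * g ^+ 2 * x ^+ 2 * (1 + 2 * x ^+ 2) <= x ^+ 2 * (1 + 2 * x ^+ 2).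
      have t4 : e * g ^+ 2 <= 1 by rewrite mulr_ile1.
      have t5 : 0 <= 1 + 2 * x ^+ 2 by lra.
      by have := ler_wpM2r (mulr_ge0 x2 t5) t4; lra.
    by move: t2 t3 x2; clear; set z := x ^+ 2; nra.
  have hE : E - (1 + g * x) <= (g * x) ^+ 2.
    have gx0 : g * x <= 0 by rewrite mulr_ge0_le0// ltW.
    apply: le_trans (expR_quad_nonpos gx0); rewrite opprD addrA !lerD2r; exact: e2.
  have hz := sqr_expRN_le gy0.
  have g2 : g ^+ 2 <= 1 by rewrite expr_le1.
  have := ler_wpM2l (mulr_ge0 Ey0 (addr_ge0 ler01 y2)) hE => /le_trans; apply.
  move: hz Ey1 Ey0; set e := expR _ => hz hz1 hz0.
  have t1 : e * (1 + y ^+ 2) * (g * x) ^+ 2 = x ^+ 2 * (e * g ^+ 2 + (g * y) ^+ 2 * e) by ring.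
  rewrite t1; have t2 : e * g ^+ 2 <= 1 by rewrite mulr_ile1// sqr_ge0.
  have t3 : x ^+ 2 * (e * g ^+ 2 + (g * y) ^+ 2 * e) <= x ^+ 2 * 5 by rewrite ler_wpM2l//; lra.
  by move: t3 x2; clear; set z := x ^+ 2; set Y := _ * (_ + _); nra.
- have y0 : y <= 0 by rewrite mulr_le0_ge0// invr_ge0 ltW.
  have xy : x <= y by rewrite ler_wpM2r// invr_ge0 ltW.
  have E0 : 0 <= E by rewrite exprn_ge0.
  rewrite ger0_norm//.
  have t1 : expR (- (g * y)) * E <= 1.
    apply: (le_trans (ler_wpM2l (expR_ge0 _) e2)); rewrite -expRD -[leRHS]expR0 ler_expR.
    by rewrite addrC -mulrBr mulr_ge0_le0// subr_le0.
  have hy : y ^+ 2 <= x ^+ 2 by nra.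
  rewrite mulrAC; have := ler_wpM2r (addr_ge0 ler01 y2) t1; rewrite mul1r => /le_trans; apply.
  by move: hy x2 y2; clear; set z := x ^+ 2; set z' := y ^+ 2; nra.
Qed.

(* [J] being even, the linear term of [(1 + sg v / N)^N - 1] integrates to [0];
   what remains is quadratic in [sg h]. *)
Lemma step_error J L h sg s M (N : nat) : 0 < h -> 0 <= sg -> sg * h <= 1 -> (0 < N)%N ->
  sg * L <= N%:R -> - L <= s <= L ->
  (forall v, J.[- v] = J.[v]) -> (forall v, - L <= v <= L -> 0 <= J.[v]) ->
  pint J (- L) L = 1 -> pint (J * (1 + h ^- 2 *: 'X^2) ^+ 2) (- L) L <= M ->
  `|(0 <= s)%R%:R - pint (J * (1 + (sg / N%:R) *: 'X) ^+ N) (- L) s| *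
    (expR (- (sg * s)) * (1 + (s / h) ^+ 2)) <= 10 * M.
Proof.
move=> h0 sg0 sgh N0 sL /andP[s1 s2] Jeven J0 J1 JM.
have L0 : 0 <= L by have := le_trans s1 s2; lra.
set G := J * _; set JW := J * _ in JM.
set K := expR _ * _; have K0 : 0 <= K by rewrite mulr_ge0 ?expR_ge0// addr_ge0// sqr_ge0.
have GE v : G.[v] = J.[v] * (1 + sg / N%:R * v) ^+ N.
  by rewrite /G hornerM horner_exp hornerD hornerC hornerZ hornerX.
have WE v : JW.[v] = J.[v] * (1 + (v / h) ^+ 2) ^+ 2.
  by rewrite /JW hornerM horner_exp hornerD hornerC hornerZ hornerXn expr_div_n [_ / _ ^+ 2]mulrC.
have JL : pint (J * (1 + sg *: 'X)) (- L) L = 1.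
  rewrite mulrDr mulr1 -scalerAr pintD pintZ J1 (pint_odd L0) ?mulr0 ?addr0// => v.
  by rewrite !hornerM !hornerX Jeven mulrN.
have vN v : - L <= v <= L -> `|sg * v| <= N%:R.
  move=> vL; rewrite normrM (ger0_norm sg0); apply: le_trans sL.
  by rewrite ler_wpM2l// ler_norml.
have W0 v : - L <= v <= L -> 0 <= (10 *: JW).[v].
  by move=> vL; rewrite hornerZ WE; exact: mulr_ge0 (ler0n _ 10) (mulr_ge0 (J0 v vL) (sqr_ge0 _)).
have fin x y (r : {poly R}) : - L <= x -> x <= y -> y <= L ->
    (forall v, x <= v <= y -> K * `|r.[v]| <= 10 * (1 + (v / h) ^+ 2) ^+ 2) ->
    `|pint (J * r) x y| * K <= pint (10 *: JW) x y.
  move=> Lx xy yL hr; rewrite -{1}(ger0_norm K0) -normrM mulrC -pintZ.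
  apply: pint_norm_le => // v /andP[xv vy].
  have vL : - L <= v <= L by rewrite (le_trans Lx xv) (le_trans vy yL).
  rewrite hornerZ normrM (ger0_norm K0) hornerM normrM (ger0_norm (J0 v vL)) hornerZ WE.
  have := ler_wpM2l (J0 v vL) (hr v ltac:(by rewrite xv vy)); lra.
have tot : pint (10 *: JW) (- L) L <= 10 * M by rewrite pintZ ler_wpM2l.
have [s0|s0] := leP 0 s.
(* The integral of [J (1 + sg v)] over [[-L, L]] is 1, so the step itself is written as this
   integral and split at [s]. *)
- have -> : 1%:R - pint G (- L) s = pint (J * (1 + sg *: 'X)) s L -
      pint (J * ((1 + (sg / N%:R) *: 'X) ^+ N - (1 + sg *: 'X))) (- L) s.
    rewrite mulrBr pintD pintN -/G -JL -(pint_cat _ (- L) s L); ring.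
  apply: le_trans tot; rewrite -(pint_cat _ (- L) s L) [leRHS]addrC.
  apply: (@le_trans _ _ ((`|pint (J * (1 + sg *: 'X)) s L| +
      `|pint (J * ((1 + (sg / N%:R) *: 'X) ^+ N - (1 + sg *: 'X))) (- L) s|) * K)).
    by rewrite ler_wpM2r// ler_normB.
  rewrite mulrDl lerD//; apply: fin => // v /andP[v1 v2].
  + have vL : - L <= v <= L by rewrite (le_trans s1 v1).
    have [h1 _ _] := step_pointwise s h0 sg0 sgh N0 (vN v vL).
    by rewrite hornerD hornerC hornerZ hornerX; exact: h1.
  + have vL : - L <= v <= L by rewrite v1 (le_trans v2).
    have [_ h1 _] := step_pointwise s h0 sg0 sgh N0 (vN v vL).
    rewrite hornerD hornerN horner_exp !hornerD !hornerC !hornerZ !hornerX; exact: h1.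
- rewrite sub0r normrN; apply: (@le_trans _ _ (pint (10 *: JW) (- L) s)).
    apply: fin => // v /andP[v1 v2].
    have vL : - L <= v <= L by rewrite v1 (le_trans v2).
    have [_ _ h1] := step_pointwise s h0 sg0 sgh N0 (vN v vL).
    by rewrite horner_exp hornerD hornerC hornerZ hornerX; apply: h1 => //; exact: ltW.
  apply: le_trans tot; rewrite -(pint_cat _ (- L) s L) lerDl; apply: pint_ge0 => // v /andP[v1 v2].
  by apply: W0; rewrite (le_trans s1 v1).
Qed.

End Antiderivative.

(** * Polynomials depending continuously on a parameter *)

Section CoefficientContinuity.
Context {R : realType}.
Implicit Types (F G : R -> {poly R}) (p : {poly R}) (f : R -> R).

(** Continuity of each coefficient in the parameter is what later makes the coefficients of [r_x]
    measurable and bounded, so that [f'(x) r_x] can be integrated coefficient by coefficient. *)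
Definition coef_continuous F := forall i, continuous (fun x => (F x)`_i).

Lemma coef_continuous_cst p : coef_continuous (fun=> p).
Proof. by move=> i x; exact: cvg_cst. Qed.

Lemma coef_continuousD F G : coef_continuous F -> coef_continuous G ->
  coef_continuous (fun x => F x + G x).
Proof.
move=> cF cG i x; under eq_fun do rewrite coefD.
by apply: cvgD; [exact: cF|exact: cG].
Qed.

Lemma coef_continuousZ f F : continuous f -> coef_continuous F ->
  coef_continuous (fun x => f x *: F x).
Proof.
move=> cf cF i x; under eq_fun do rewrite coefZ.
by apply: cvgM; [exact: cf|exact: cF].
Qed.

Lemma coef_continuousN F : coef_continuous F -> coef_continuous (fun x => - F x).
Proof. by move=> cF i x; under eq_fun do rewrite coefN; apply: cvgN; exact: cF. Qed.

Lemma coef_continuous_sum (I : Type) (s : seq I) (F : I -> R -> {poly R}) :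
  (forall i, coef_continuous (F i)) -> coef_continuous (fun x => \sum_(i <- s) F i x).
Proof.
move=> cF; elim: s => [|i s ih].
  by rewrite (_ : (fun x => _) = fun=> 0); [exact: coef_continuous_cst|apply/funext => x; rewrite big_nil].
rewrite (_ : (fun x => _) = fun x => F i x + \sum_(j <- s) F j x).
  exact: coef_continuousD.
by apply/funext => x; rewrite big_cons.
Qed.

Lemma continuous_sum (I : Type) (s : seq I) (f : I -> R -> R) :
  (forall i, continuous (f i)) -> continuous (fun x => \sum_(i <- s) f i x).
Proof.
move=> cf; elim: s => [|i s ih].
  by under eq_fun do rewrite big_nil; move=> x; exact: cvg_cst.
by under eq_fun do rewrite big_cons; move=> x; apply: cvgD; [exact: cf|exact: ih].
Qed.

Lemma coef_continuousM F G : coef_continuous F -> coef_continuous G ->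
  coef_continuous (fun x => F x * G x).
Proof.
move=> cF cG i; under eq_fun do rewrite coefM.
by apply: continuous_sum => j x; apply: cvgM; [exact: cF|exact: cG].
Qed.

Lemma coef_continuousX F n : coef_continuous F -> coef_continuous (fun x => F x ^+ n).
Proof.
move=> cF; elim: n => [|n ih]; first exact: coef_continuous_cst.
by under eq_fun do rewrite exprS; exact: coef_continuousM.
Qed.

Lemma coef_continuous_prim F : coef_continuous F -> coef_continuous (fun x => prim (F x)).
Proof.
by move=> cF i x; under eq_fun do rewrite coef_prim; apply: cvgMl; exact: cF.
Qed.

Lemma coef_continuousC f : continuous f -> coef_continuous (fun x => (f x)%:P).
Proof.
move=> cf i x; under eq_fun do rewrite coefC.
by case: eqP => _; [exact: cf|exact: cvg_cst].
Qed.

Lemma coef_continuous_horner F m y : coef_continuous F -> (forall x, (size (F x) <= m)%N) ->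
  continuous (fun x => (F x).[y]).
Proof.
move=> cF sF; under eq_fun do rewrite (horner_coef_wide _ (sF _)).
by apply: continuous_sum => i x; apply: cvgMl; exact: cF.
Qed.

Lemma coef_continuous_comp F G m : coef_continuous F -> coef_continuous G ->
  (forall x, (size (F x) <= m)%N) -> coef_continuous (fun x => F x \Po G x).
Proof.
move=> cF cG sF.
rewrite (_ : (fun x => _) = fun x => \sum_(i < m) (F x)`_i *: G x ^+ i); last first.
  apply/funext => x; rewrite /comp_poly (@horner_coef_wide _ m); last first.
    by rewrite (leq_trans (size_poly _ _)).
  by apply: eq_bigr => i _; rewrite coef_map mul_polyC.
by apply: coef_continuous_sum => i; apply: coef_continuousZ; [exact: cF|exact: coef_continuousX].
Qed.

Lemma coef_continuous_bounded F m a : 0 <= a -> coef_continuous F -> (forall x, (size (F x) <= m)%N) ->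
  exists M, forall x i, 0 <= x <= a -> `|(F x)`_i| <= M.
Proof.
move=> a0 cF sF.
have /choice[M HM] : forall i, exists M, forall x, 0 <= x <= a -> `|(F x)`_i| <= M.
  move=> i; have [|c _ Hc] := @EVT_max R (fun x => `|(F x)`_i|) 0 a a0.
    by apply: continuous_subspaceT => x; apply: cvg_norm; exact: cF.
  by exists `|(F c)`_i| => x xa; apply: Hc; rewrite in_itv.
exists (\sum_(i < m) `|M i|) => x i xa.
have [im|mi] := ltnP i m; last first.
  by rewrite nth_default ?normr0 ?sumr_ge0// (leq_trans (sF x)).
rewrite (bigD1 (Ordinal im))//= (le_trans (HM i x xa))// (le_trans (ler_norm _))// lerDl.
by rewrite sumr_ge0.
Qed.

End CoefficientContinuity.

(** * Polynomial approximation of a step function in the weighted sense *)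

Section HalfKernel.
Context {R : realType} (Q : R -> R) (K : nat) (A l : R).
Hypothesis hQ : regular Q K A l.
Local Notation q := (derive1 Q : R -> R).
Local Notation T := (growthT Q).
Local Notation w := (weight Q).
Implicit Types (x y t s a B : R).

(** By convexity it suffices to approximate the step in the exponential weight of slope [q x]. *)
Lemma weight_tangent x t : w t <= w x * expR (- (q x * (t - x))).
Proof. by rewrite /weight -expRD ler_expR -opprD lerN2 (tangent_le hQ). Qed.

Lemma mrs_weight_ge B n a x : mrs Q B n a -> 0 <= x -> x <= a -> expR (- (B * n%:R)) <= w x.
Proof.
move=> hm x0 xa; have a0 := mrs_a hm; rewrite /weight ler_expR lerN2.
apply: (le_trans (Q_homo hQ x0 xa)); apply: le_trans (mrs_hi hm).
by rewrite ler_peMr ?(Q_ge0 hQ)// sqrt_ge1// (T_ge1 hQ).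
Qed.

Lemma mrs_derive_large B n a x : 1 <= B -> mrs Q B n a -> a < x -> n%:R / (B * a) <= q x.
Proof.
move=> B1 hm ax; have a0 := mrs_a hm; have B0 : 0 < B := lt_le_trans ltr01 B1.
apply: le_trans (reg_homo hQ (ltW ax)).
rewrite ler_pdivrMr ?mulr_gt0//; apply: (le_trans (mrs_lo hm)).
have T1 := T_ge1 hQ a0; have := growthTE hQ a0.
have hs : Num.sqrt (T a) <= T a.
  by rewrite -[leRHS](sqr_sqrtr (le_trans ler01 T1)) expr2 ler_peMl ?sqrtr_ge0// sqrt_ge1.
move=> E; have := ler_wpM2l (mulr_ge0 (ltW B0) (Q_ge0 hQ a)) hs.
by rewrite mulrA => /le_trans; apply; rewrite -mulrA [Q a * _]mulrC E; lra.
Qed.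

(** The bound on [|t| <= R0 a] makes [r] at most [(1 + M) exp n] there, hence at most
    [(1 + M) exp(n (1 + 2 |t| / a))] outside. The decay rate [B + 4] pays for this growth and for
    [w x >= exp(-B n)], and leaves [exp(-y)] with [y = n |t| / a]; the 17 bounds
    [exp(-y) (1 + 4 y^2)]. *)
Lemma half_kernel_far B n a (r : {poly R}) R0 M x t : 1 <= B -> mrs Q B n a -> 1 <= R0 ->
  1 <= M -> (size r <= n.+1)%N ->
  (forall t, R0 * a <= `|t| -> (B + 4) * n%:R * (`|t| / a) <= Q t) ->
  0 < x -> x <= a -> q x * ((R0 + 1) * a) <= n%:R ->
  (forall t, `|t| <= R0 * a ->
    `|(x <= t)%R%:R - r.[t]| * (expR (- (q x * (t - x))) * (1 + ((t - x) / (a / n%:R)) ^+ 2)) <= M) ->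
  `|(x <= t)%R%:R - r.[t]| * w t <= 17 * (2 + M) * (w x * cauchy x (a / n%:R) t).
Proof.
move=> B1 hm R1 M1 sr hfar x0 xa qL near.
have n0 := mrs_n hm; have a0 := mrs_a hm; have nR : 0 < (n%:R : R) by rewrite ltr0n.
have h0 : 0 < a / n%:R by rewrite divr_gt0.
have w0 := weight_gt0 Q x; have c0 := cauchy_gt0 x (a / n%:R) t.
have M0 : 0 <= M := le_trans ler01 M1.
have q0 := dQ_ge0 hQ (ltW x0).
have Ra0 : 0 < R0 * a by rewrite mulr_gt0// (lt_le_trans ltr01).
have cst0 : 0 <= M * (w x * cauchy x (a / n%:R) t) by rewrite mulr_ge0// mulr_ge0 ?ltW.
have [tR|/ltW tR] := leP `|t| (R0 * a).
  apply: (@le_trans _ _ (M * (w x * cauchy x (a / n%:R) t))); last first.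
    by rewrite ler_wpM2r ?mulr_ge0 ?ltW//; lra.
  apply: (le_trans (ler_wpM2l (normr_ge0 _) (weight_tangent x t))).
  have := ler_wpM2r (mulr_ge0 (ltW w0) (ltW c0)) (near t tR); rewrite /cauchy.
  set e := expR _; set y := (_ / _) ^+ 2; set d := `|_| => h.
  have y0 : 0 <= y by exact: sqr_ge0.
  apply: le_trans h; rewrite le_eqVlt; apply/orP; left; apply/eqP; field.
  by rewrite gt_eqF// ltr_pwDl.
pose z := `|t| / a.
have z1 : 1 <= z by rewrite ler_pdivlMr// mul1r (le_trans _ tR)// ler_peMl// ltW.
have z0 : 0 <= z := le_trans ler01 z1.
have rb u : `|u| <= R0 * a -> `|r.[u]| <= (1 + M) * expR n%:R.
  move=> uR; have e1 : 1 <= expR n%:R :> R by rewrite -[leLHS]expR0 ler_expR ltW.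
  have hu : q x * (u - x) <= n%:R.
    apply: le_trans qL; rewrite ler_wpM2l//.
    have : u <= R0 * a by apply: le_trans uR; exact: ler_norm.
    by move: x0 a0; clear -hQ; lra.
  have D1 : `|(x <= u)%R%:R - r.[u]| <= M * expR n%:R.
    have := near u uR; set d := `|_|; set y := (_ / _) ^+ 2 => h.
    have y0 : 0 <= y by exact: sqr_ge0.
    have d0 : 0 <= d by exact: normr_ge0.
    have h' : d * expR (- (q x * (u - x))) <= M.
      by apply: le_trans h; rewrite mulrA ler_peMr ?mulr_ge0 ?expR_ge0// lerDl.
    have := ler_wpM2r (expR_ge0 (q x * (u - x))) h'.
    rewrite -mulrA -expRD addNr expR0 mulr1 => /le_trans; apply.
    by rewrite ler_wpM2l// ler_expR.
  have -> : r.[u] = (x <= u)%R%:R - ((x <= u)%R%:R - r.[u]) by ring.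
  apply: (le_trans (ler_normB _ _)); rewrite mulrDl mul1r lerD//.
  by apply: le_trans e1; case: (x <= u); rewrite ?normr1 ?normr0.
have M20 : 0 <= (1 + M) * expR n%:R by rewrite mulr_ge0 ?expR_ge0// addr_ge0.
have rt := poly_far Ra0 sr M20 rb tR.
have ez1 : 1 <= expR (n%:R * (1 + 2 * z)).
  by rewrite -[leLHS]expR0 ler_expR mulr_ge0 ?ltW//; move: z0; clear -hQ; lra.
have rt' : `|r.[t]| <= (1 + M) * expR (n%:R * (1 + 2 * z)).
  apply: (le_trans rt); rewrite -mulrA -expRD ler_wpM2l ?addr_ge0// ler_expR mulrDr mulr1 lerD2l.
  have hz : `|t| / (R0 * a) <= z.
    by rewrite /z ler_wpM2l// lef_pV2 ?posrE// ler_peMl// ltW.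
  by have := ler_wpM2l (ltW nR) hz; lra.
have dt : `|(x <= t)%R%:R - r.[t]| <= (2 + M) * expR (n%:R * (1 + 2 * z)).
  apply: (le_trans (ler_normB _ _)).
  have b1 : `|(x <= t)%R%:R| <= 1 :> R by case: (x <= t); rewrite ?normr1 ?normr0.
  by move: b1 rt' ez1; clear -hQ; set e := expR _; lra.
have wt : w t <= expR (- ((B + 4) * n%:R * z)) by rewrite /weight ler_expR lerN2; exact: hfar.
apply: (le_trans (ler_pM (normr_ge0 _) (weight_ge0 Q t) dt wt)).
rewrite -(mulrA (2 + M)) -expRD -(mulrA 17) [leRHS]mulrCA ler_wpM2l ?addr_ge0//.
have wx := mrs_weight_ge hm (ltW x0) xa.
pose y := n%:R * z; have y0 : 0 <= y by rewrite mulr_ge0// ltW.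
have cy : expR (- y) <= 17 * cauchy x (a / n%:R) t.
  rewrite /cauchy ler_pdivlMr; last by rewrite ltr_pwDl// sqr_ge0.
  have hy : ((t - x) / (a / n%:R)) ^+ 2 <= 4 * y ^+ 2.
    have -> : 4 * y ^+ 2 = (2 * y) ^+ 2 by ring.
    have y20 : 0 <= 2 * y := mulr_ge0 (ler0n _ 2) y0.
    rewrite -(sqr_norm (_ / _)); apply: lerXn2r; rewrite ?nnegrE//.
    rewrite normrM normfV (gtr0_norm h0) ler_pdivrMr//.
    have -> : 2 * y * (a / n%:R) = 2 * `|t|.
      by rewrite /y /z; field; rewrite !gt_eqF.
    apply: (le_trans (ler_normB _ _)); rewrite (gtr0_norm x0).
    have : a <= `|t| by apply: le_trans tR; rewrite ler_peMl// ltW.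
    by move: xa; clear -hQ; lra.
  have e0 := expR_ge0 (- y).
  have e1 : expR (- y) <= 1 by rewrite -[leRHS]expR0 ler_expR oppr_le0.
  have := sqr_expRN_le y0; have := ler_wpM2l e0 (_ : 1 + ((t - x) / (a / n%:R)) ^+ 2 <= 1 + 4 * y ^+ 2).
  by rewrite lerD2l => /(_ hy); move: e1; clear -hQ; move: (expR _) => e; lra.
have -> : 17 * (w x * cauchy x (a / n%:R) t) = w x * (17 * cauchy x (a / n%:R) t) by ring.
apply: le_trans (ler_pM (expR_ge0 _) (expR_ge0 _) wx cy); rewrite -expRD ler_expR /y.
have nz := ler_wpM2l (ltW nR) z1; have := ler_wpM2l (le_trans ler01 B1) nz.
by move: nz; clear -hQ; lra.
Qed.

(* The approximant of the step at [x] is the primitive of the Jackson kernel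
   tilted by [(1 + q x v / N)^N], which mimics [w x / w (x + v)]. *)
Lemma half_kernel_near n a R0 : (0 < n)%N -> 0 < a -> 1 <= R0 -> exists F : R -> {poly R},
  [/\ coef_continuous F, forall x, (size (F x) <= n.+1)%N &
   forall x t, 0 < x -> x <= a -> q x * (4 * ((R0 + 1) * a)) <= n%:R -> `|t| <= R0 * a ->
    `|(x <= t)%R%:R - (F x).[t]| * (expR (- (q x * (t - x))) * (1 + ((t - x) / (a / n%:R)) ^+ 2))
    <= 1 + (R0 + 1) ^+ 2 + 10 * ((24 * (R0 + 1)) ^+ 4 * (14 * pi))].
Proof.
move=> n0 a0 R1; pose kap := 24 * (R0 + 1); have kap0 : 0 <= kap by rewrite mulr_ge0 ?addr_ge0 ?(le_trans ler01).
have M0 : 0 <= kap ^+ 4 * (14 * pi) by exact: mulr_ge0 (exprn_ge0 4 kap0) (mulr_ge0 (ler0n _ 14) (pi_ge0 R)).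
(* For [n = 1] no degree is left for the tilt, but the zero polynomial works, since [h = a] and
   [t - x] is [O(a)]. *)
have [n1|n2] := leqP n 1.
  have -> : n = 1%N by apply/eqP; rewrite eqn_leq n1.
  exists (fun=> 0); split; [exact: coef_continuous_cst|by move=> x; rewrite size_poly0|].
  move=> x t x0 xa _ tR; rewrite horner0 subr0 divr1.
  have [xt|xt] := leP x t; last first.
    rewrite /= normr0 mul0r; exact: addr_ge0 (addr_ge0 ler01 (sqr_ge0 _)) (mulr_ge0 (ler0n _ 10) M0).
  rewrite /= normr1 mul1r; apply: (@le_trans _ _ (1 + (R0 + 1) ^+ 2)); last by rewrite lerDl; exact: mulr_ge0 (ler0n _ 10) M0.
  have y0 : 0 <= ((t - x) / a) ^+ 2 := sqr_ge0 _.
  have e1 : expR (- (q x * (t - x))) <= 1.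
    by rewrite -[leRHS]expR0 ler_expR oppr_le0 mulr_ge0 ?subr_ge0// (dQ_ge0 hQ)// ltW.
  apply: (@le_trans _ _ (1 + ((t - x) / a) ^+ 2)).
    by rewrite ler_piMl// addr_ge0.
  rewrite lerD2l lerXn2r// ?nnegrE ?divr_ge0 ?subr_ge0 ?(ltW a0)//; first by rewrite addr_ge0// (le_trans ler01).
  rewrite ler_pdivrMr//; have : t <= R0 * a := le_trans (ler_norm t) tR.
  by move: x0 a0; clear -hQ; lra.
(* About half of the degree goes to the tilting factor, the rest to the Jackson kernel, whose
   parameter must be a power of 2. All roundings together cost [n <= 24 2^j], the origin of the 24
   in [kap]. *)
pose N := n./2; pose m := (n - n./2).-1; pose k := (m %/ 6).+1; pose j := trunc_log 2 k.
have /andP[jk kj] : (2 ^ j <= k < 2 ^ j.+1)%N by exact: trunc_log_bounds.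
have N0 : (0 < N)%N by rewrite /N; lia.
have nN : (n <= 4 * N)%N by rewrite /N; lia.
have mk : (m < 6 * k)%N by rewrite /k; lia.
have km : (6 * k <= m + 6)%N by rewrite /k; lia.
have p0 : (0 < 2 ^ j)%N by rewrite expn_gt0.
have szn : (6 * (2 ^ j).-1 + N < n)%N by move: jk km p0; rewrite /m /N; lia.
have nj : (n <= 24 * 2 ^ j)%N by move: kj mk; rewrite expnS /m; lia.
pose L := (R0 + 1) * a; have R01 : 0 < R0 + 1 by rewrite addr_gt0// (lt_le_trans ltr01).
have L0 : 0 < L by rewrite mulr_gt0.
have [J [sJ Je J0 J1 JM]] := @jackson R j L L0.
have nR : 0 < (n%:R : R) by rewrite ltr0n.
pose h := a / n%:R; have h0 : 0 < h by rewrite divr_gt0.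
pose G x : {poly R} := J * (1 + (q x / N%:R) *: 'X) ^+ N.
pose F x := (prim (G x) - ((prim (G x)).[- L])%:P) \Po ('X - x%:P).
have sG x : (size (G x) <= (6 * (2 ^ j).-1 + N).+1)%N.
  apply: (leq_trans (size_polyMleq _ _)).
  have h1 : (size ((1 + (q x / N%:R) *: 'X) ^+ N : {poly R}) <= (1 * N).+1)%N.
    apply: size_exp_leq; rewrite (leq_trans (size_polyD _ _))// geq_max size_poly1/=.
    by rewrite (leq_trans (size_scale_leq _ _))// size_polyX.
  rewrite mul1n in h1; rewrite -ltnS -addnS; move: (leq_add sJ h1).
  by rewrite addSn addnS; case: (_ + _)%N.
have sH x : (size (prim (G x) - ((prim (G x)).[- L])%:P)%R <= n.+1)%N.
  rewrite (leq_trans (size_polyD _ _))// geq_max size_polyN; apply/andP; split.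
    by apply: size_prim; rewrite (leq_trans (sG x)).
  by rewrite (leq_trans (size_polyC_leq1 _)).
have cG : coef_continuous G.
  apply: coef_continuousM; first exact: coef_continuous_cst.
  apply: coef_continuousX; apply: coef_continuousD; first exact: coef_continuous_cst.
  apply: coef_continuousZ; last exact: coef_continuous_cst.
  by move=> x; apply: cvgMl; exact: (reg_cont hQ).
have cpG := coef_continuous_prim cG.
have FE x t : (F x).[t] = pint (G x) (- L) (t - x).
  by rewrite /F horner_comp hornerXsubC hornerD hornerN hornerC /pint.
exists F; split.
- apply: (@coef_continuous_comp _ _ _ n.+1) => //.
    apply: coef_continuousD => //; apply: coef_continuousN; apply: coef_continuousC.
    by apply: (@coef_continuous_horner _ _ n.+1) => // x; apply: size_prim; rewrite (leq_trans (sG x)).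
  apply: coef_continuousD; first exact: coef_continuous_cst.
  by apply: coef_continuousN; apply: coef_continuousC => x; exact: cvg_id.
- move=> x; apply: (leq_trans (size_comp_poly_leq _ _)).
  by rewrite size_XsubC/= muln1 ltnS; move: (sH x); case: (size _).
- move=> x t x0 xa qL tR; rewrite FE -/h -/kap.
  apply: (@le_trans _ _ (10 * (kap ^+ 4 * (14 * pi)))); last first.
    by rewrite lerDr addr_ge0// sqr_ge0.
  have q0 := dQ_ge0 hQ (ltW x0).
  have -> : (x <= t)%R = (0 <= t - x)%R by rewrite subr_ge0.
  apply: (@step_error _ J L) => //.
  + rewrite /h mulrA ler_pdivrMr// mul1r; apply: le_trans qL; rewrite ler_wpM2l// mulrA ler_peMl ?(ltW a0)//.
    by move: R1; clear -hQ; lra.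
  + rewrite /L; have : (n%:R : R) <= 4 * N%:R by rewrite -natrM ler_nat.
    by move: qL; clear -hQ; lra.
  + rewrite /L; move: tR; rewrite ler_norml => /andP[t1 t2]; apply/andP; split; move: x0 xa t1 t2 a0; clear -hQ; lra.
  + apply: (@le_trans _ _ (kap ^+ 4 * pint (J * (1 + (2 ^+ j / L) ^+ 2 *: 'X^2) ^+ 2) (- L) L)); last first.
      by rewrite ler_wpM2l ?exprn_ge0.
    rewrite -pintZ; apply: pint_le; first by rewrite ge0_cp// ltW.
    have GE (c v : R) : (J * (1 + c *: 'X^2) ^+ 2).[v] = J.[v] * (1 + c * v ^+ 2) ^+ 2.
      by rewrite hornerM horner_exp hornerD hornerZ hornerXn -polyC1 hornerC.
    move=> v vL; rewrite hornerZ !GE.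
    rewrite [leRHS]mulrCA; apply: (ler_wpM2l (J0 v vL)).
    have kk : 1 <= kap ^+ 2.
      by rewrite exprn_ege1// /kap; move: R1; clear -hQ; lra.
    have -> : kap ^+ 4 * (1 + (2 ^+ j / L) ^+ 2 * v ^+ 2) ^+ 2 =
      (kap ^+ 2 * (1 + (2 ^+ j / L) ^+ 2 * v ^+ 2)) ^+ 2 by ring.
    have v2 := sqr_ge0 v.
    have h2 : 0 <= h ^- 2 by rewrite invr_ge0 sqr_ge0.
    apply: lerXn2r; rewrite ?nnegrE.
    * exact: addr_ge0 ler01 (mulr_ge0 h2 v2).
    * exact: mulr_ge0 (sqr_ge0 _) (addr_ge0 ler01 (mulr_ge0 (sqr_ge0 _) v2)).
    rewrite mulrDr mulr1; apply: lerD => //; rewrite [leRHS]mulrA; apply: (ler_wpM2r v2).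
    rewrite -exprMn -exprVn; apply: lerXn2r; rewrite ?nnegrE ?invr_ge0 ?(ltW h0)//.
      by rewrite mulr_ge0// divr_ge0 ?exprn_ge0// ltW.
    rewrite /h invf_div mulrA ler_pdivlMr// mulrAC ler_pdivrMr// /L.
    have -> : n%:R * ((R0 + 1) * a) = (R0 + 1) * n%:R * a by ring.
    rewrite ler_wpM2r ?(ltW a0)//.
    have -> : kap * 2 ^+ j = (R0 + 1) * (24 * 2 ^+ j) by rewrite /kap; ring.
    by rewrite ler_wpM2l ?(ltW R01)// -natrX -natrM ler_nat.
Qed.

(** When [q x] is large compared with [1 / h], the weight to the right of [x] decays like
    [exp(-c (t - x) / h)] by itself and the zero polynomial suffices. Otherwise [q x] is small
    enough for the tilted Jackson kernel. *)
Lemma half_kernel B : 1 <= B -> exists2 C, 0 < C & forall n a, mrs Q B n a ->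
  exists r : R -> {poly R},
  [/\ forall x, (size (r x) <= n.+1)%N, forall i, measurable_fun setT (fun x => (r x)`_i),
      exists M, forall x i, `|(r x)`_i| <= M,
      forall x, ~~ (0 < x <= a) -> r x = 0 &
      forall x t, 0 < x ->
        `|(x <= t)%R%:R - (r x).[t]| * w t <= C * (w x * cauchy x (a / n%:R) t)].
Proof.
move=> B1; have B0 : 0 < B := lt_le_trans ltr01 B1.
have D0 : 0 < B + 4 by rewrite addr_gt0.
have [R0 R1 hfar] := Q_far hQ B1 D0.
have R01 : 0 < R0 + 1 by rewrite addr_gt0// (lt_le_trans ltr01).
(* Small enough that [q x <= c / h] forces both [x <= a], by [mrs_derive_large], and
   [4 q x (R0 + 1) a <= n]. *)
pose c := (8 * B * (R0 + 1))^-1; have c0 : 0 < c by rewrite invr_gt0 !mulr_gt0.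
pose M := 1 + (R0 + 1) ^+ 2 + 10 * ((24 * (R0 + 1)) ^+ 4 * (14 * pi)).
have M1 : 1 <= M.
  by rewrite /M -addrA lerDl addr_ge0 ?sqr_ge0// !mulr_ge0 ?exprn_ge0 ?mulr_ge0 ?pi_ge0// ltW.
exists (1 + 4 / c ^+ 2 + 17 * (2 + M)).
  have : 0 <= 4 / c ^+ 2 by rewrite divr_ge0// sqr_ge0.
  by move: M1; clear -hQ; lra.
move=> n a hm; have n0 := mrs_n hm; have a0 := mrs_a hm.
have nR : 0 < (n%:R : R) by rewrite ltr0n.
pose h := a / n%:R; have h0 : 0 < h by rewrite divr_gt0.
have [F [cF sF HF]] := half_kernel_near n0 a0 R1; rewrite -/M in HF.
pose P x := (0 < x) && (q x <= c / h).
have cB : c < B^-1.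
  rewrite ltf_pV2 ?posrE ?mulr_gt0//; have := ler_wpM2l (ltW B0) R1; move: B0; clear -hQ; lra.
have Pa x : P x -> x <= a.
  move=> /andP[x0 qx]; rewrite leNgt; apply/negP => ax.
  have := le_trans (mrs_derive_large B1 hm ax) qx; rewrite /h invf_div invfM mulrA.
  rewrite mulrA ler_pM2r ?invr_gt0// [_ / B]mulrC ler_pM2r// => /(lt_le_trans cB).
  by rewrite ltxx.
have Pq x : P x -> q x * (4 * ((R0 + 1) * a)) <= n%:R.
  move=> /andP[x0 qx]; have q0 := dQ_ge0 hQ (ltW x0).
  have := ler_wpM2r (mulr_ge0 (ler0n R 4) (mulr_ge0 (ltW R01) (ltW a0))) qx => /le_trans; apply.
  have -> : c / h * (4 * ((R0 + 1) * a)) = n%:R * (2 * B)^-1.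
    by rewrite /c /h; field; rewrite !gt_eqF.
  have B2 : (2 * B)^-1 <= 1.
    by rewrite -[leRHS]invr1 lef_pV2 ?posrE ?ltr01 ?mulr_gt0//; move: B1; clear -hQ; lra.
  by rewrite ler_piMr ?(ltW nR).
exists (fun x => if P x then F x else 0); split.
- by move=> x; case: ifP => // _; rewrite size_poly0.
- move=> i; rewrite (_ : (fun x => _) = fun x => if P x then (F x)`_i else 0); last first.
    by apply/funext => x; case: ifP => // _; rewrite coef0.
  apply: measurable_fun_ifT => //; last by apply: continuous_measurable_fun; exact: cF.
  apply: measurable_and; first by apply: measurable_fun_ltr => //; exact: measurable_id.
  apply: measurable_fun_ler => //; apply: continuous_measurable_fun; exact: (reg_cont hQ).
- have [M' HM'] := coef_continuous_bounded (ltW a0) cF sF; exists `|M'| => x i.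
  case: ifP => [Px|_]; last by rewrite coef0 normr0.
  apply: le_trans (ler_norm M'); apply: HM'; rewrite Pa// andbT.
  by case/andP: Px => /ltW.
- move=> x; case: ifP => // Px /negP[]; rewrite Pa// andbT; by case/andP: Px.
- move=> x t x0; have w0 := weight_gt0 Q x; have k0 := cauchy_gt0 x h t.
  have wk0 : 0 <= w x * cauchy x h t by rewrite mulr_ge0// ltW.
  have c40 : 0 <= 4 / c ^+ 2 by rewrite divr_ge0// sqr_ge0.
  rewrite (mulrDl (1 + 4 / c ^+ 2)); case: ifP => [Px|nP].
    apply: (@le_trans _ _ (17 * (2 + M) * (w x * cauchy x h t))); last first.
      by rewrite lerDr mulr_ge0// addr_ge0.
    have q1 : q x * ((R0 + 1) * a) <= n%:R.
      apply: le_trans (Pq x Px); rewrite ler_wpM2l ?(dQ_ge0 hQ) ?(ltW x0)// ler_peMl ?mulr_ge0 ?ltW//.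
      by rewrite ltr1n.
    have nearx u : `|u| <= R0 * a ->
        `|(x <= u)%R%:R - (F x).[u]| * (expR (- (q x * (u - x))) * (1 + ((u - x) / (a / n%:R)) ^+ 2)) <= M.
      by move=> uR; apply: HF => //; [exact: Pa|exact: Pq].
    exact: (half_kernel_far t B1 hm R1 M1 (sF x) (hfar n a hm) x0 (Pa x Px) q1 nearx).
  apply: (@le_trans _ _ ((1 + 4 / c ^+ 2) * (w x * cauchy x h t))); last first.
    rewrite lerDl mulr_ge0//; move: M1; clear -hQ; lra.
  rewrite horner0 subr0; have [xt|xt] := leP x t; last first.
    by rewrite normr0 mul0r mulr_ge0// addr_ge0.
  rewrite normr1 mul1r; move: nP; rewrite /P x0/= => /negbT; rewrite -ltNge => qx.
  apply: (le_trans (weight_tangent x t)); rewrite mulrCA ler_wpM2l ?(ltW w0)//.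
  pose y := (t - x) / h; have y0 : 0 <= y by rewrite divr_ge0 ?subr_ge0// ltW.
  have -> : t - x = y * h by rewrite /y divfK// gt_eqF.
  rewrite /cauchy -/y ler_pdivlMr; last by rewrite ltr_pwDl// sqr_ge0.
  have cy0 : 0 <= c * y by rewrite mulr_ge0// ltW.
  have e1 : expR (- (q x * (y * h))) <= expR (- (c * y)).
    rewrite ler_expR lerN2; have := ler_wpM2r (mulr_ge0 y0 (ltW h0)) (ltW qx).
    have -> // : c / h * (y * h) = c * y by field; rewrite gt_eqF.
  have e2 : expR (- (c * y)) <= 1 by rewrite -[leRHS]expR0 ler_expR oppr_le0.
  apply: (@le_trans _ _ (expR (- (c * y)) * (1 + y ^+ 2))).
    by rewrite ler_wpM2r// addr_ge0// sqr_ge0.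
  rewrite mulrDr mulr1 lerD//.
  have := sqr_expRN_le cy0; rewrite exprMn => e3.
  by rewrite ler_pdivlMr ?exprn_gt0// mulrC mulrA mulrAC.
Qed.

End HalfKernel.

(** * Integration of the step approximants against the derivative *)

Section Favard.
Context {R : realType} (Q : R -> R) (K : nat) (A l : R).
Hypothesis hQ : regular Q K A l.
Local Notation mu := (@lebesgue_measure R).
Local Notation w := (weight Q).

(** The signed step for which [f t - f 0] is the integral of [f'(x)] against it; anchoring at 0
    makes it vanish for [x] outside the segment from 0 to [t]. *)
Definition favard_kernel (x t : R) : R := (0 < x <= t)%R%:R - (t <= x < 0)%R%:R.

Lemma favard_kernelN x t : favard_kernel (- x) (- t) = - favard_kernel x t.
Proof. by rewrite /favard_kernel oppr_gt0 oppr_lt0 !lerN2 (andbC (x < 0)) (andbC (x <= t)); ring. Qed.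

(** Negative [x] are obtained by reflection. The two families do not interfere, since each [r x]
    vanishes off []0, a]]. *)
Lemma full_kernel B : 1 <= B -> exists2 C, 0 < C & forall n a, mrs Q B n a ->
  exists r : R -> {poly R},
  [/\ forall x, (size (r x) <= n.+1)%N, forall i, measurable_fun setT (fun x => (r x)`_i),
      exists M, forall x i, `|(r x)`_i| <= M,
      forall x, a < `|x| -> r x = 0 &
      forall x t, `|favard_kernel x t - (r x).[t]| * w t <= C * (w x * cauchy x (a / n%:R) t)].
Proof.
move=> B1; have [C C0 H] := half_kernel hQ B1; exists C => // n a hm.
have [r [sr mr [M HM] r0 Hr]] := H n a hm; have a0 := mrs_a hm.
pose r1 x : {poly R} := \poly_(i < n.+1) ((-1) ^+ i * (r (- x))`_i).
have r1E x t : (r1 x).[t] = (r (- x)).[- t].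
  rewrite horner_poly (horner_coef_wide _ (sr (- x))); apply: eq_bigr => i _.
  by rewrite [in RHS]exprNn; ring.
have M0 : 0 <= M := le_trans (normr_ge0 _) (HM 0 0%N).
exists (fun x => r x - r1 x); split.
- move=> x; rewrite (leq_trans (size_polyD _ _))// geq_max sr size_polyN; exact: size_poly.
- move=> i; under eq_fun do rewrite coefB coef_poly; apply: measurable_funB; first exact: mr.
  case: (i < n.+1)%N; last exact: measurable_cst.
  apply: measurable_funM; first exact: measurable_cst.
  apply: (measurableT_comp (mr i)); exact: oppr_measurable.
- exists (M + M) => x i; rewrite coefB; apply: (le_trans (ler_normB _ _)); apply: lerD => //.
  rewrite coef_poly; case: ifP => _; last by rewrite normr0.
  by rewrite normrM normrX normrN1 expr1n mul1r.
- move=> x ax; rewrite r0; last first.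
    by apply/negP => /andP[x0 xa]; move: ax; rewrite gtr0_norm// ltNge xa.
  suff -> : r1 x = 0 by rewrite subr0.
  apply/polyP => i; rewrite coef_poly coef0; case: ifP => // _; rewrite r0 ?coef0 ?mulr0//.
  apply/negP => /andP[]; rewrite oppr_gt0 => x0 xa; move: ax; rewrite ltr0_norm// ltNge.
  by rewrite xa.
- have wN u : w (- u) = w u by rewrite /weight (reg_even hQ).
  have pos x t : 0 < x -> `|favard_kernel x t - (r x - r1 x).[t]| * w t <= C * (w x * cauchy x (a / n%:R) t).
    move=> x0; rewrite hornerD hornerN r1E (r0 (- x)); last by rewrite oppr_gt0 ltNge (ltW x0).
    rewrite horner0 subr0; apply: le_trans (Hr x t x0).
    by rewrite /favard_kernel x0 [x < 0]ltNge (ltW x0) andbF subr0.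
  have sym x t : favard_kernel x t - (r x - r1 x).[t] =
    - (favard_kernel (- x) (- t) - (r (- x) - r1 (- x)).[- t]).
    by rewrite favard_kernelN !hornerD !hornerN !r1E !opprK; ring.
  move=> x t; have [x0|x0|x0] := ltgtP x 0; last 1 first.
  + have -> : favard_kernel x t = 0 by rewrite x0 /favard_kernel ltxx andbF subrr.
    rewrite x0 hornerD hornerN r1E oppr0 r0 ?ltxx// !horner0 !subr0 normr0 mul0r.
    exact: mulr_ge0 (ltW C0) (mulr_ge0 (weight_ge0 Q 0) (ltW (cauchy_gt0 _ _ _))).
  + rewrite sym normrN -(wN t) -(wN x).
    have -> : cauchy x (a / n%:R) t = cauchy (- x) (a / n%:R) (- t).
      by rewrite /cauchy -opprD mulNr sqrrN.
    by apply: pos; rewrite oppr_gt0.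
  + exact: pos.
Qed.

Lemma integrable_restrict_itv (i : interval R) g : mu.-integrable [set` i] (EFin \o g) ->
  mu.-integrable setT (EFin \o (g \_ [set` i])).
Proof.
move=> h; rewrite -restrict_EFin.
by apply: (integrable_mkcond _ _).1 => //; exact: measurable_itv.
Qed.

Lemma ac_continuous (f : R -> R) : abs_continuous f -> continuous f.
Proof.
move=> fac x; apply/cvgrPdist_lt => e e0; have x11 : x - 1 < x + 1 by lra.
have [d d0 H] := fac _ _ e x11 e0.
have H1 y z : x - 1 <= y -> y <= z -> z <= x + 1 -> z - y < d -> `|f z - f y| < e.
  move=> xy yz zx zy; have := H 1%N (fun=> y) (fun=> z); rewrite !big_ord1; apply=> //.
  by move=> i j _ _ _; rewrite !ord1.
near=> y; have yd : `|x - y| < d by near: y; exact: cvgr_dist_lt.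
have : `|x - y| < 1 by near: y; exact: cvgr_dist_lt.
move: yd; have [xy|/ltW yx] := leP x y.
  rewrite ler0_norm ?subr_le0// opprB => yd y1; rewrite distrC; apply: H1 => //.
    by rewrite gerBl.
  by rewrite -lerBlDl ltW.
rewrite ger0_norm ?subr_ge0// => yd y1; apply: H1 => //; last by rewrite lerDl.
by rewrite lerBlDl -lerBlDr ltW.
Unshelve. all: by end_near. Qed.

Lemma favard_formula f t : abs_continuous f -> measurable_fun setT (derive1 f) ->
  mu.-integrable setT (EFin \o (fun x => derive1 f x * favard_kernel x t)) /\
  f t - f 0 = \int[mu]_x (derive1 f x * favard_kernel x t).
Proof.
move=> fac mf; have [t0|/ltW t0] := leP 0 t.
  have E : (fun x => derive1 f x * favard_kernel x t) = derive1 f \_ `]0, t]%classic.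
    apply/funext => x; rewrite patchE /favard_kernel.
    have -> : (t <= x < 0) = false by apply/negP => /andP[tx x0]; move: (lt_le_trans x0 (le_trans t0 tx)); rewrite ltxx.
    rewrite subr0 mem_setE in_itv/=; by case: ifP => _; rewrite ?mulr1 ?mulr0.
  have [I ->] := ac_integral_derive1 fac mf t0.
  have I' : mu.-integrable `]0, t]%classic (EFin \o derive1 f).
    by apply: integrableS I => //; exact: subset_itv_oc_cc.
  rewrite E; split; last by rewrite -Rintegral_mkcond Rintegral_itv_obnd_cbnd.
  exact: integrable_restrict_itv.
have E : (fun x => derive1 f x * favard_kernel x t) = (fun x => - derive1 f x) \_ `[t, 0[%classic.
  apply/funext => x; rewrite patchE /favard_kernel.
  have -> : (0 < x <= t) = false by apply/negP => /andP[x0 tx]; move: (lt_le_trans x0 (le_trans tx t0)); rewrite ltxx.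
  rewrite sub0r mem_setE in_itv/=; by case: ifP => _; rewrite ?mulrN1 ?oppr0 ?mulr0.
have [I e] := ac_integral_derive1 fac mf t0.
have I' : mu.-integrable `[t, 0[%classic (EFin \o derive1 f).
  by apply: integrableS I => //; exact: subset_itv_co_cc.
have IN : mu.-integrable `[t, 0[%classic (EFin \o (fun x => - derive1 f x)).
  exact: integrableN I'.
rewrite E; split; last first.
  rewrite -Rintegral_mkcond -opprB e -Rintegral_itv_bndo_bndc//.
  rewrite -mulN1r -RintegralZl//; apply: eq_Rintegral => x _; by rewrite mulN1r.
exact: integrable_restrict_itv.
Qed.

(** The approximant is [f 0] plus the integral of [f'(x) r_x]. Since [r_x] vanishes for [|x| > a]
    and has bounded coefficients, local integrability of [f'] suffices for it to exist. The error
    kernel is a multiple of a Cauchy kernel of integral [pi a / n] in either variable. *)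
Lemma favard B : 1 <= B -> exists2 C, 0 < C & forall n a, mrs Q B n a ->
  forall p f, (1 <= p)%E -> abs_continuous f -> memLp p (fun x => derive1 f x * w x) ->
  finite_moments Q f /\
  (best_approx p n w f <= (C * (a / n%:R))%:E * normLp p (fun x => (derive1 f x * w x)%R))%E.
Proof.
move=> B1; have [C C0 H] := full_kernel B1; exists (C * pi); first by rewrite mulr_gt0 ?pi_gt0.
move=> n a hm p f p1 fac fp; have [r [sr mr [M HM] r0 Hr]] := H n a hm.
have a0 := mrs_a hm; have n0 := mrs_n hm.
pose h := a / n%:R; have h0 : 0 < h by rewrite divr_gt0 ?ltr0n.
have mw := measurable_weight hQ; have w0 x : 0 < w x := weight_gt0 Q x.
have mgw := memLp_measurable fp.
have mg : measurable_fun setT (derive1 f).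
  rewrite (_ : derive1 f = fun x => (derive1 f x * w x) * (w x)^-1).
    by apply: measurable_funM => //; apply: measurableT_comp => //; exact: measurable_invr.
  by apply/funext => x; rewrite mulfK// gt_eqF.
have Ir i : mu.-integrable setT (EFin \o (fun x => derive1 f x * (r x)`_i)).
  have aa : - a <= a by rewrite ge0_cp// ltW.
  have [I _] := ac_integral_derive1 fac mg aa.
  have I' : mu.-integrable `[- a, a]%classic (EFin \o (fun x => M * derive1 f x)).
    exact: integrableZl I.
  have := integrable_restrict_itv I'; apply: le_integrable => //.
    by apply/measurable_EFinP; exact: measurable_funM mg (mr i).
  move=> x _; rewrite /= patchE mem_setE in_itv/= -ler_norml; case: ifP => xa.
    by rewrite lee_fin normrM [leRHS]normrM mulrC ler_wpM2r// (le_trans (HM x i))// ler_norm.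
  rewrite r0 ?coef0 ?mulr0// ltNge; exact: negbT xa.
pose P : {poly R} := (f 0)%:P + \poly_(i < n.+1) \int[mu]_x (derive1 f x * (r x)`_i).
have sP : (size P <= n.+1)%N.
  rewrite (leq_trans (size_polyD _ _))// geq_max size_poly andbT.
  by rewrite (leq_trans (size_polyC_leq1 _)).
have IS t : mu.-integrable setT (EFin \o (fun x => derive1 f x * (r x).[t])) /\
    \int[mu]_x (derive1 f x * (r x).[t]) = \sum_(i < n.+1) (\int[mu]_x (derive1 f x * (r x)`_i)) * t ^+ i.
  have E x : derive1 f x * (r x).[t] = \sum_(i < n.+1) (derive1 f x * (r x)`_i) * t ^+ i.
    by rewrite (horner_coef_wide _ (sr x)) mulr_sumr; apply: eq_bigr => i _; rewrite mulrA.
  have Ii (i : 'I_n.+1) : mu.-integrable setT (EFin \o (fun x => (derive1 f x * (r x)`_i) * t ^+ i)).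
    exact: integrableZr (Ir i).
  rewrite (_ : (fun x => derive1 f x * (r x).[t]) =
    fun x => \sum_(i < n.+1) (derive1 f x * (r x)`_i) * t ^+ i); last exact/funext.
  elim: (index_enum _) => [|i s [I1 E1]].
    split; last by under eq_Rintegral do rewrite big_nil; rewrite big_nil /Rintegral integral0.
    under eq_fun do rewrite big_nil; exact: integrable0.
  split.
    under eq_fun do rewrite big_cons; exact: integrableD (Ii i) I1.
  under eq_Rintegral do rewrite big_cons; rewrite RintegralD// big_cons E1; congr (_ + _).
  by rewrite RintegralZr.
have DE t : f t - P.[t] = \int[mu]_x (derive1 f x * (favard_kernel x t - (r x).[t])).
  have [I1 E1] := favard_formula t fac mg; have [I2 E2] := IS t.
  rewrite hornerD hornerC horner_poly opprD addrA E1 -E2 -RintegralB//.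
  by apply: eq_Rintegral => x _; rewrite [RHS]mulrBr.
have ID t : mu.-integrable setT (EFin \o (fun x => derive1 f x * (favard_kernel x t - (r x).[t]))).
  have [I1 _] := favard_formula t fac mg; have [I2 _] := IS t.
  by apply: eq_integrable (integrableB measurableT I1 I2) => // x _ /=; rewrite -EFinB; congr EFin; ring.
have key t : (`|w t * (f t - P.[t])|%:E <= \int[mu]_x (C * cauchy t h x * `|derive1 f x * w x|)%:E)%E.
  rewrite DE -RintegralZl// .
  have I' : mu.-integrable setT (EFin \o (fun x => w t * (derive1 f x * (favard_kernel x t - (r x).[t])))).
    exact: integrableZl (ID t).
  have mI := measurable_int _ I'.
  have -> : (`|\int[mu]_x (w t * (derive1 f x * (favard_kernel x t - (r x).[t])))|%:E =
    `|\int[mu]_x (w t * (derive1 f x * (favard_kernel x t - (r x).[t])))%:E|)%E.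
    by rewrite /Rintegral EFin_normr_Rintegral.
  apply: (le_trans (le_abse_integral mu measurableT mI)); apply: ge0_le_integral => //.
  - exact: measurableT_comp.
  - apply/measurable_EFinP; apply: measurable_funM; last exact: measurableT_comp.
    apply: measurable_funM => //; apply: continuous_measurable_fun; exact: continuous_cauchy.
  - move=> x _; rewrite /= lee_fin !normrM (gtr0_norm (w0 t)) (gtr0_norm (w0 x)).
    rewrite mulrCA (mulrC (w t)); have := ler_wpM2l (normr_ge0 (derive1 f x)) (Hr x t).
    rewrite -/h (cauchyC) => /le_trans; apply.
    by rewrite le_eqVlt; apply/orP; left; apply/eqP; ring.
have Ch : 0 < C * (h * pi) by rewrite mulr_gt0// mulr_gt0// pi_gt0.
have mk : measurable_fun setT (fun z : measurableTypeR R * measurableTypeR R => C * cauchy z.1 h z.2).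
  apply: measurable_funM => //; rewrite /cauchy; apply: measurableT_comp; first exact: measurable_invr.
  apply: measurable_funD => //; apply: measurable_funX; apply: measurable_funM => //.
  by apply: measurable_funB; [exact: measurable_snd|exact: measurable_fst].
have k0 x t : 0 <= C * cauchy x h t by rewrite mulr_ge0 ?(ltW C0)//; exact: ltW (cauchy_gt0 _ _ _).
have k1 x : (\int[mu]_t (C * cauchy x h t)%:E <= (C * (h * pi))%:E)%E.
  by rewrite integral_cauchyZ// ?ltW.
have k2 t : (\int[mu]_x (C * cauchy x h t)%:E <= (C * (h * pi))%:E)%E.
  by under eq_integral do rewrite cauchyC; exact: k1.
have mf : measurable_fun setT f.
  exact: continuous_measurable_fun (ac_continuous fac).
have mF : measurable_fun setT (fun t => w t * (f t - P.[t])).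
  by apply: measurable_funM => //; apply: measurable_funB => //; exact: measurable_poly.
have N := schur_test Ch mk k0 k1 k2 p1 mgw mF key.
have FP : memLp p (fun t => w t * (f t - P.[t])).
  rewrite /memLp inE; apply/andP; split; first by rewrite inE.
  rewrite inE /= /finite_norm; apply: (le_lt_trans N); rewrite lte_mul_pinfty// ?lee_fin ?ltW//.
  by have := set_mem (sub_Lfun_finLfun fp).
split.
  (* [f] is recovered from [f - P], whose product with [w] has just been shown to lie in [L^p], by
     adding the polynomial [P]. *)
  have := finite_momentsB hQ (- P) (memLp_finite_moments hQ p1 FP).
  by rewrite (_ : (fun x => _) = f)//; apply/funext => x; rewrite hornerN; ring.
apply: (@le_trans _ _ (normLp p (fun t => (w t * (f t - P.[t]))%R))).
  by apply: ereal_inf_lbound; exists P.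
apply: (le_trans N); rewrite le_eqVlt; apply/orP; left; apply/eqP.
by congr (_%:E * _)%E; rewrite /h; ring.
Qed.

End Favard.

Theorem corollary6p3 (R : realType) (p : \bar R) (hp : (1 <= p)%E)
    (Q : R -> R) (hQ : classFC2plus Q)
    (a : nat -> R) (ha : forall n, (0 < n)%N -> is_MRS Q n (a n))
    (hT : exists2 c : R, 0 < c &
       forall n, (0 < n)%N -> growthT Q (a n) <= c * (n%:R / a n) `^ (2 / 3)) :
  exists2 C : R, 0 < C &
    forall P : nat -> {poly R}, orthonormal_polys (weight Q) P ->
    forall n : nat, (0 < n)%N ->
    forall f : R -> R,
      let v := vallee_poussin (weight Q) P f n in
      (memLp p (fun x => weight Q x * f x) ->
       [/\ (normLp p (fun x => ((f x - v.[x]) * (weight Q x / growthT4 Q x))%R)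
            <= C%:E * best_approx p n (weight Q) f)%E,
           (normLp p (fun x => ((f x - v.[x]) * weight Q x)%R)
            <= (C * growthT4 Q (a n))%:E * best_approx p n (weight Q) f)%E &
           memLp p (fun x => growthT4 Q x * weight Q x * f x) ->
           (normLp p (fun x => ((f x - v.[x]) * weight Q x)%R)
            <= C%:E * best_approx p n
                        (fun x => (growthT4 Q x * weight Q x)%R) f)%E])
      /\
      (abs_continuous f -> memLp p (fun x => derive1 f x * weight Q x) ->
       (normLp p (fun x => ((f x - v.[x]) * (weight Q x / growthT4 Q x))%R)
        <= (C * (a n / n%:R))%:E *
           normLp p (fun x => (derive1 f x * weight Q x)%R))%E).
Proof.
have [K [A [l rQ]]] := regularP hQ; have [B B1 hB] := mrsP rQ ha hT.
have [C1 C10 V] := vallee_poussin_bounds rQ B1; have [C2 C20 F] := favard rQ B1.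
have C120 : 0 < C1 * C2 by rewrite mulr_gt0.
have T40 x : 0 <= growthT4 Q x := growthT4_ge0 rQ x.
have le1 : C1 <= C1 + C1 * C2 by rewrite lerDl ltW.
have le2 : C1 * C2 <= C1 + C1 * C2 by rewrite lerDr ltW.
(* [C1] serves the first three estimates, and [C1 C2] the last, where the first estimate is followed
   by the Favard inequality. *)
exists (C1 + C1 * C2); first by rewrite addr_gt0.
move=> P oP n n0 f v; have hm := hB n n0; split.
  move=> fp; have [b1 b2 b3] := V n (a n) hm p P f hp oP (memLp_finite_moments rQ hp fp).
  split; [apply: (le_trans b1)|apply: (le_trans b2)|move=> _; apply: (le_trans b3)];
    apply: lee_wpmul2r; rewrite ?best_approx_ge0 ?lee_fin//.
  exact: ler_wpM2r.
move=> fac fp; have [hf b4] := F n (a n) hm p f hp fac fp.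
have [b1 _ _] := V n (a n) hm p P f hp oP hf.
apply: (le_trans b1); apply: (le_trans (lee_wpmul2l _ b4)); first by rewrite lee_fin ltW.
rewrite muleA -EFinM (mulrA C1); apply: lee_wpmul2r; first exact: Lnorm_ge0.
by rewrite lee_fin; apply: ler_wpM2r => //; rewrite divr_ge0// ltW// (mrs_a hm).
Qed.
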